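(* Let $1<p<\infty$. Suppose $\varphi$ and $\psi$ are non-zero functions, each analytic on some neighborhood of the closed unit disc $\overline{\mathbb{D}}$, such that $|\varphi(z)\psi(w)|=1$ for some $z,w\in\mathbb{D}$, with at least one of $\varphi$ and $\psi$ non-constant. Then $C_{\varphi(B),\psi(F)}$ is frequently hypercyclic on $(\mathcal{N}(\ell^p),\|\cdot\|_{nu})$, $(\mathcal{K}(\ell^p),\|\cdot\|_{op})$ and $(\mathcal{L}(\ell^p),\mathrm{COT})$.
   Context: $\mathbb{D}$ is the open unit disc in $\mathbb{C}$; $\ell^p$ is the complex sequence space indexed by $n\ge0$ with standard basis $\{e_n\}_{n\ge0}$. $B$ and $F$ are the unweighted backward and forward shifts: $Be_0=0$, $Be_n=e_{n-1}$ ($n\ge1$), $Fe_n=e_{n+1}$ ($n\ge0$). If $\varphi(z)=\sum_{n\ge0}a_nz^n$ is analytic on a neighborhood of $\overline{\mathbb{D}}$, then $\varphi(B)=\sum_na_nB^n$ and $\varphi(F)=\sum_na_nF^n$, which are bounded operators on $\ell^p$. $C_{R,T}$ is the map $C_{R,T}(S)=RST$. $\mathcal{N}(\ell^p)$ is the space of nuclear operators on $\ell^p$ with the nuclear norm $\|\cdot\|_{nu}$; $\mathcal{K}(\ell^p)$ and $\mathcal{L}(\ell^p)$ are the compact and the bounded operators; $\|\cdot\|_{op}$ is the operator norm; COT is the topology of uniform convergence on compact sets. A continuous linear operator $A$ on a topological vector space $E$ is frequently hypercyclic if there is $x\in E$ such that for every non-empty open $V\subset E$ the set $M=\{n\in\mathbb{N}:A^nx\in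 V\}$ satisfies $\liminf_{N\to\infty}\frac{\mathrm{card}\{n\in M:\ n\le N\}}{N}>0$. *)

(* Defs.v *)
From Stdlib Require Import Reals Lra Lia List.
From Stdlib Require Import ClassicalEpsilon ProofIrrelevance FunctionalExtensionality.
From Coquelicot Require Import Coquelicot.

Open Scope R_scope.

Section NormedModuleOfNorm.

Variables (V : ModuleSpace C_AbsRing) (N : V -> R).
Hypothesis N_triangle : forall x y : V, N (plus x y) <= N x + N y.
Hypothesis N_scal : forall (l : C) (x : V), N (scal l x) <= Cmod l * N x.
Hypothesis N_eq_0 : forall x : V, N x = 0 -> x = zero.

Lemma N_zero_le : N zero <= 0.
Proof.
  rewrite <- (scal_zero_l (zero : V)).
  eapply Rle_trans; [apply (N_scal (RtoC 0))|]. rewrite Cmod_0. lra.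
Qed.

Lemma N_opp_le (x : V) : N (opp x) <= N x.
Proof.
  rewrite <- scal_opp_one.
  eapply Rle_trans; [apply (N_scal (Copp (RtoC 1)))|].
  rewrite Cmod_opp, Cmod_1. lra.
Qed.

Definition norm_ball (x : V) (eps : R) (y : V) : Prop := N (minus y x) < eps.

Lemma norm_ball_center (x : V) (e : posreal) : norm_ball x e x.
Proof.
  unfold norm_ball. rewrite minus_eq_zero.
  apply Rle_lt_trans with 0; [exact N_zero_le | apply cond_pos].
Qed.

Lemma norm_ball_sym (x y : V) (e : R) : norm_ball x e y -> norm_ball y e x.
Proof.
  unfold norm_ball. intros H. rewrite <- opp_minus.
  eapply Rle_lt_trans; [apply N_opp_le | exact H].
Qed.

Lemma norm_ball_triangle (x y z : V) (e1 e2 : R) :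
  norm_ball x e1 y -> norm_ball y e2 z -> norm_ball x (e1 + e2) z.
Proof.
  unfold norm_ball. intros H1 H2. rewrite (minus_trans y z x).
  eapply Rle_lt_trans; [apply N_triangle | lra].
Qed.

Definition norm_UniformSpace_mixin : UniformSpace.mixin_of V :=
  UniformSpace.Mixin V zero norm_ball
    norm_ball_center norm_ball_sym norm_ball_triangle.

Definition norm_NormedModuleAux : NormedModuleAux C_AbsRing :=
  NormedModuleAux.Pack C_AbsRing V
    (NormedModuleAux.Class C_AbsRing V
       (ModuleSpace.class C_AbsRing V) norm_UniformSpace_mixin) V.

Lemma norm_compat2 (x y : V) (eps : posreal) :
  norm_ball x eps y -> N (minus y x) < 1 * eps.
Proof. rewrite Rmult_1_l. exact (fun H => H). Qed.

Definition norm_NormedModule_mixin :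
    NormedModule.mixin_of C_AbsRing norm_NormedModuleAux :=
  NormedModule.Mixin C_AbsRing norm_NormedModuleAux N 1
    N_triangle N_scal (fun x y eps (H : N (minus y x) < eps) => H)
    norm_compat2 N_eq_0.

End NormedModuleOfNorm.

(* [Rpower 0 p = 1] in the standard library, hence the case distinction. *)
Definition rpow (t p : R) : R := if Rle_dec t 0 then 0 else Rpower t p.

Lemma rpow_pos t p : 0 < t -> rpow t p = Rpower t p.
Proof. intros H. unfold rpow. destruct (Rle_dec t 0); [lra | reflexivity]. Qed.

Lemma rpow_0 p : rpow 0 p = 0.
Proof. unfold rpow. destruct (Rle_dec 0 0); lra. Qed.

Lemma rpow_ge0 t p : 0 <= rpow t p.
Proof.
  unfold rpow. destruct (Rle_dec t 0); [lra|].
  left; apply exp_pos.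
Qed.

Lemma rpow_gt0 t p : 0 < t -> 0 < rpow t p.
Proof. intros H. rewrite rpow_pos by exact H. apply exp_pos. Qed.

Lemma rpow_eq_0 t p : 0 <= t -> rpow t p = 0 -> t = 0.
Proof.
  intros Ht H. destruct Ht as [Ht | Ht]; [|now symmetry].
  generalize (rpow_gt0 t p Ht). lra.
Qed.

Lemma rpow_le s t p : 0 < p -> 0 <= s <= t -> rpow s p <= rpow t p.
Proof.
  intros Hp [[Hs | Hs] Hst].
  - rewrite !rpow_pos by lra. apply Rle_Rpower_l; lra.
  - subst s. rewrite rpow_0. apply rpow_ge0.
Qed.

Lemma rpow_mult s t p : 0 <= s -> 0 <= t -> rpow (s * t) p = rpow s p * rpow t p.
Proof.
  intros [Hs | Hs] [Ht | Ht]; subst; rewrite ?Rmult_0_l, ?Rmult_0_r, ?rpow_0; try ring.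
  rewrite !rpow_pos by (try apply Rmult_lt_0_compat; assumption).
  symmetry; apply Rpower_mult_distr; assumption.
Qed.

Lemma rpow_inv_r t p : 0 < p -> 0 <= t -> rpow (rpow t p) (/ p) = t.
Proof.
  intros Hp [Ht | Ht].
  - rewrite (rpow_pos (rpow t p)) by (apply rpow_gt0; exact Ht).
    rewrite rpow_pos by exact Ht.
    rewrite Rpower_mult, Rinv_r, Rpower_1; lra.
  - subst t. now rewrite !rpow_0.
Qed.

Lemma rpow_inv_l t p : 0 < p -> 0 <= t -> rpow (rpow t (/ p)) p = t.
Proof.
  intros Hp Ht. rewrite <- (Rinv_inv p) at 2.
  apply rpow_inv_r; [apply Rinv_0_lt_compat|]; assumption.
Qed.

Lemma rpow_bernoulli y p : 1 < p -> 0 <= y -> 1 + p * (y - 1) <= rpow y p.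
Proof.
  intros Hp [Hy | Hy]; [| subst y; rewrite rpow_0; lra].
  rewrite rpow_pos by exact Hy.
  assert (E1 : Rpower 1 p = 1) by (unfold Rpower; rewrite ln_1, Rmult_0_r; apply exp_0).
  destruct (Rtotal_order y 1) as [H | [H | H]].
  - destruct (MVT_cor2 (fun x => Rpower x p) (fun x => p * Rpower x (p - 1)) y 1 H)
      as [c [Hc Hc']].
    { intros c Hc. apply derivable_pt_lim_power. lra. }
    assert (Hle : Rpower c (p - 1) <= 1).
    { replace 1 with (Rpower 1 (p - 1)) at 2
        by (unfold Rpower; rewrite ln_1, Rmult_0_r; apply exp_0).
      apply Rle_Rpower_l; lra. }
    assert (p * Rpower c (p - 1) * (1 - y) <= p * 1 * (1 - y)).
    { apply Rmult_le_compat_r; [lra|]. apply Rmult_le_compat_l; lra. }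
    lra.
  - subst y. lra.
  - destruct (MVT_cor2 (fun x => Rpower x p) (fun x => p * Rpower x (p - 1)) 1 y H)
      as [c [Hc Hc']].
    { intros c Hc. apply derivable_pt_lim_power. lra. }
    assert (Hle : 1 <= Rpower c (p - 1)).
    { replace 1 with (Rpower 1 (p - 1)) at 1
        by (unfold Rpower; rewrite ln_1, Rmult_0_r; apply exp_0).
      apply Rle_Rpower_l; lra. }
    assert (p * 1 * (y - 1) <= p * Rpower c (p - 1) * (y - 1)).
    { apply Rmult_le_compat_r; [lra|]. apply Rmult_le_compat_l; lra. }
    lra.
Qed.

Lemma rpow_convex p l s t : 1 < p -> 0 <= l <= 1 -> 0 <= s -> 0 <= t ->
  rpow (l * s + (1 - l) * t) p <= l * rpow s p + (1 - l) * rpow t p.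
Proof.
  intros Hp Hl Hs Ht.
  set (m := l * s + (1 - l) * t).
  assert (Hm : 0 <= m).
  { unfold m. apply Rplus_le_le_0_compat; apply Rmult_le_pos; lra. }
  destruct Hm as [Hm | Hm].
  - assert (K : forall x, 0 <= x ->
      rpow m p * (1 + p * (x / m - 1)) <= rpow x p).
    { intros x Hx. replace x with (m * (x / m)) at 2 by (field; lra).
      assert (0 <= x / m) by (apply Rdiv_le_0_compat; lra).
      rewrite rpow_mult by lra.
      apply Rmult_le_compat_l; [apply rpow_ge0 | apply rpow_bernoulli; assumption]. }
    generalize (Rmult_le_compat_l l _ _ (proj1 Hl) (K s Hs)).
    assert (H1l : 0 <= 1 - l) by lra.
    generalize (Rmult_le_compat_l (1 - l) _ _ H1l (K t Ht)).
    intros H1 H2.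
    replace (rpow m p) with
      (l * (rpow m p * (1 + p * (s / m - 1)))
       + (1 - l) * (rpow m p * (1 + p * (t / m - 1)))); [lra|].
    transitivity (rpow m p * (1 + p * ((l * s + (1 - l) * t) / m - 1))).
    { field. lra. }
    fold m. field. lra.
  - rewrite <- Hm, rpow_0.
    apply Rplus_le_le_0_compat; apply Rmult_le_pos; try apply rpow_ge0; lra.
Qed.

Section PSummable.

Variables (p : R) (Hp : 1 < p).

Definition p_summable (u : nat -> C) : Prop :=
  ex_series (fun n => rpow (Cmod (u n)) p).

Definition lp_norm (u : nat -> C) : R :=
  rpow (Series (fun n => rpow (Cmod (u n)) p)) (/ p).

Let Hp0 : 0 < p. Proof. lra. Qed.

Lemma Series_ge0 (a : nat -> R) : (forall n, 0 <= a n) -> ex_series a -> 0 <= Series a.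
Proof.
  intros Ha Ea. rewrite <- (Rmult_0_l (Series a)), <- Series_scal_l.
  apply Series_le; [|exact Ea]. intros n. rewrite Rmult_0_l. split; [lra | apply Ha].
Qed.

Lemma Series_term_le (a : nat -> R) n :
  (forall k, 0 <= a k) -> ex_series a -> a n <= Series a.
Proof.
  intros Ha Ea.
  rewrite (Series_incr_n a (S n)) by (lia || assumption).
  change (pred (S n)) with n.
  assert (H0 : 0 <= Series (fun k => a (S n + k)%nat)).
  { apply Series_ge0; [intros; apply Ha|]. now apply (ex_series_incr_n a (S n)). }
  assert (H1 : a n <= sum_f_R0 a n).
  { destruct n as [|n]; simpl; [lra|].
    generalize (cond_pos_sum a n Ha). lra. }
  lra.
Qed.

Lemma lp_norm_ge0 u : 0 <= lp_norm u.
Proof. apply rpow_ge0. Qed.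

Lemma lp_norm_pow u : p_summable u ->
  rpow (lp_norm u) p = Series (fun n => rpow (Cmod (u n)) p).
Proof.
  intros Hu. apply rpow_inv_l; [exact Hp0|].
  apply Series_ge0; [intros; apply rpow_ge0 | exact Hu].
Qed.

Lemma lp_norm_coord u n : p_summable u -> Cmod (u n) <= lp_norm u.
Proof.
  intros Hu. rewrite <- (rpow_inv_r (Cmod (u n)) p Hp0) by apply Cmod_ge_0.
  apply rpow_le; [now apply Rinv_0_lt_compat|]. split; [apply rpow_ge0|].
  apply (Series_term_le (fun n => rpow (Cmod (u n)) p)); [intros; apply rpow_ge0 | exact Hu].
Qed.

Lemma lp_norm_eq_0 u : p_summable u -> lp_norm u = 0 -> forall n, u n = RtoC 0.
Proof.
  intros Hu H n. apply Cmod_eq_0. generalize (lp_norm_coord u n Hu) (Cmod_ge_0 (u n)). lra.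
Qed.

Lemma lp_norm_le_of u M : 0 <= M ->
  Series (fun n => rpow (Cmod (u n)) p) <= rpow M p -> p_summable u -> lp_norm u <= M.
Proof.
  intros HM H Hu. rewrite <- (rpow_inv_r M p Hp0 HM).
  apply rpow_le; [now apply Rinv_0_lt_compat|]. split; [|exact H].
  apply Series_ge0; [intros; apply rpow_ge0 | exact Hu].
Qed.

Lemma p_summable_0 : p_summable (fun _ => RtoC 0).
Proof.
  apply ex_series_ext with (fun n : nat => scal 0 ((/ 2) ^ n)).
  - intros n. rewrite Cmod_0, rpow_0. apply Rmult_0_l.
  - apply (@ex_series_scal R_AbsRing R_NormedModule 0 (fun n => (/ 2) ^ n)).
    apply (ex_series_geom (/ 2)). rewrite Rabs_pos_eq; lra.
Qed.

Lemma p_summable_plus_aux u v a b :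
  p_summable u -> p_summable v ->
  lp_norm u <= a -> lp_norm v <= b -> 0 < a -> 0 < b ->
  p_summable (fun n => Cplus (u n) (v n)) /\
  Series (fun n => rpow (Cmod (Cplus (u n) (v n))) p) <= rpow (a + b) p.
Proof.
  intros Hu Hv Hua Hvb Ha Hb.
  set (l := a / (a + b)).
  assert (Hl : 0 <= l <= 1).
  { unfold l. split; [apply Rdiv_le_0_compat; lra|].
    apply Rmult_le_reg_r with (a + b); [lra|].
    unfold Rdiv. rewrite Rmult_assoc, Rinv_l; lra. }
  set (w := fun n => rpow (a + b) p *
    (l * (rpow (/ a) p * rpow (Cmod (u n)) p)
     + (1 - l) * (rpow (/ b) p * rpow (Cmod (v n)) p))).
  assert (Hia : 0 < / a) by now apply Rinv_0_lt_compat.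
  assert (Hib : 0 < / b) by now apply Rinv_0_lt_compat.
  assert (Hw : forall n, 0 <= rpow (Cmod (Cplus (u n) (v n))) p <= w n).
  { intros n. split; [apply rpow_ge0|]. unfold w.
    assert (Hx := Cmod_ge_0 (u n)). assert (Hy := Cmod_ge_0 (v n)).
    rewrite <- !rpow_mult by lra.
    apply Rle_trans with
      (rpow ((a + b) * (l * (/ a * Cmod (u n)) + (1 - l) * (/ b * Cmod (v n)))) p).
    - apply rpow_le; [exact Hp0|]. split; [apply Cmod_ge_0|].
      eapply Rle_trans; [apply Cmod_triangle|].
      right. unfold l. field. lra.
    - assert (0 <= / a * Cmod (u n)) by (apply Rmult_le_pos; lra).
      assert (0 <= / b * Cmod (v n)) by (apply Rmult_le_pos; lra).
      rewrite rpow_mult; [| lra |].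
      2:{ apply Rplus_le_le_0_compat; apply Rmult_le_pos; lra. }
      apply Rmult_le_compat_l; [apply rpow_ge0|].
      apply rpow_convex; assumption. }
  assert (Hsw : is_series w (rpow (a + b) p *
    (l * (rpow (/ a) p * Series (fun n => rpow (Cmod (u n)) p))
     + (1 - l) * (rpow (/ b) p * Series (fun n => rpow (Cmod (v n)) p))))).
  { apply (is_series_scal (V := R_NormedModule)).
    apply (is_series_plus (V := R_NormedModule));
      do 2 apply (is_series_scal (V := R_NormedModule)); now apply Series_correct. }
  split.
  - apply (ex_series_le (V := R_CompleteNormedModule)) with w; [|now eexists; exact Hsw].
    intros n. destruct (Hw n) as [H0 H1].
    change (Rabs (rpow (Cmod (Cplus (u n) (v n))) p) <= w n).
    rewrite Rabs_pos_eq; assumption.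
  - eapply Rle_trans; [apply Series_le; [exact Hw | now eexists; exact Hsw]|].
    rewrite (is_series_unique _ _ Hsw).
    rewrite <- (lp_norm_pow u Hu), <- (lp_norm_pow v Hv).
    assert (Hu0 := lp_norm_ge0 u). assert (Hv0 := lp_norm_ge0 v).
    rewrite <- !rpow_mult by lra.
    assert (K : forall x c, 0 <= x <= c -> 0 < c -> rpow (/ c * x) p <= 1).
    { intros x c Hx Hc.
      assert (Hic : 0 < / c) by now apply Rinv_0_lt_compat.
      apply Rle_trans with (rpow 1 p).
      - apply rpow_le; [exact Hp0|]. split; [apply Rmult_le_pos; lra|].
        rewrite <- (Rinv_l c) by lra. apply Rmult_le_compat_l; lra.
      - rewrite rpow_pos by lra. unfold Rpower. rewrite ln_1, Rmult_0_r, exp_0. lra. }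
    rewrite <- (Rmult_1_r (rpow (a + b) p)) at 2.
    apply Rmult_le_compat_l; [apply rpow_ge0|].
    generalize (Rmult_le_compat_l l _ _ (proj1 Hl) (K (lp_norm u) a (conj Hu0 Hua) Ha)).
    assert (H1l : 0 <= 1 - l) by lra.
    generalize (Rmult_le_compat_l (1 - l) _ _ H1l (K (lp_norm v) b (conj Hv0 Hvb) Hb)).
    lra.
Qed.

Lemma p_summable_plus u v : p_summable u -> p_summable v ->
  p_summable (fun n => Cplus (u n) (v n)).
Proof.
  intros Hu Hv. assert (Hu0 := lp_norm_ge0 u). assert (Hv0 := lp_norm_ge0 v).
  apply (p_summable_plus_aux u v (lp_norm u + 1) (lp_norm v + 1)); try assumption; lra.
Qed.

Lemma lp_norm_triangle u v : p_summable u -> p_summable v ->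
  lp_norm (fun n => Cplus (u n) (v n)) <= lp_norm u + lp_norm v.
Proof.
  intros Hu Hv. assert (Hu0 := lp_norm_ge0 u). assert (Hv0 := lp_norm_ge0 v).
  apply le_epsilon. intros eps Heps.
  destruct (p_summable_plus_aux u v (lp_norm u + eps / 2) (lp_norm v + eps / 2))
    as [H1 H2]; try assumption; try lra.
  apply Rle_trans with ((lp_norm u + eps / 2) + (lp_norm v + eps / 2)); [|lra].
  apply lp_norm_le_of; [lra | exact H2 | exact H1].
Qed.

Lemma p_summable_scal c u : p_summable u -> p_summable (fun n => Cmult c (u n)).
Proof.
  intros Hu.
  apply ex_series_ext with (fun n => scal (rpow (Cmod c) p) (rpow (Cmod (u n)) p)).
  - intros n. rewrite Cmod_mult, rpow_mult by apply Cmod_ge_0. reflexivity.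
  - now apply (ex_series_scal (V := R_NormedModule)).
Qed.

Lemma lp_norm_scal_le c u : p_summable u ->
  lp_norm (fun n => Cmult c (u n)) <= Cmod c * lp_norm u.
Proof.
  intros Hu. assert (Hu0 := lp_norm_ge0 u). assert (Hc := Cmod_ge_0 c).
  apply lp_norm_le_of; [now apply Rmult_le_pos | | now apply p_summable_scal].
  rewrite rpow_mult, lp_norm_pow, <- Series_scal_l by assumption.
  right. apply Series_ext. intros n. now rewrite Cmod_mult, rpow_mult by apply Cmod_ge_0.
Qed.

Lemma p_summable_opp u : p_summable u -> p_summable (fun n => Copp (u n)).
Proof.
  apply ex_series_ext. intros n. now rewrite Cmod_opp.
Qed.

End PSummable.

(* The proof of [1 < p] is a parameter of the type only so that the canonical
   structures below can be inferred from the type. *)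
Record lp (p : R) (Hp : 1 < p) : Type :=
  mk_lp { lp_seq :> nat -> C; lp_summable : p_summable p lp_seq }.

Arguments mk_lp {p Hp} _ _.
Arguments lp_seq {p Hp} _ _.
Arguments lp_summable {p Hp} _.

Section Lp.

Variables (p : R) (Hp : 1 < p).

Notation lp := (lp p Hp).
Notation p_summable_0 := (p_summable_0 p).
Notation p_summable_plus := (p_summable_plus p Hp).
Notation p_summable_opp := (p_summable_opp p).
Notation p_summable_scal := (p_summable_scal p).
Notation lp_norm := (lp_norm p).

Lemma lp_ext (x y : lp) : (forall n, x n = y n) -> x = y.
Proof.
  destruct x as [x Hx], y as [y Hy]; simpl. intros H.
  assert (E : x = y) by (apply functional_extensionality; exact H).
  subst y. f_equal. apply proof_irrelevance.
Qed.

Definition lp_plus (x y : lp) : lp :=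
  mk_lp _ (p_summable_plus x y (lp_summable x) (lp_summable y)).
Definition lp_opp (x : lp) : lp := mk_lp _ (p_summable_opp x (lp_summable x)).
Definition lp_scal (c : C) (x : lp) : lp :=
  mk_lp _ (p_summable_scal c x (lp_summable x)).
Definition lp_zero : lp := mk_lp _ p_summable_0.

Lemma lp_plus_comm x y : lp_plus x y = lp_plus y x.
Proof. apply lp_ext; intros n; apply Cplus_comm. Qed.
Lemma lp_plus_assoc x y z : lp_plus x (lp_plus y z) = lp_plus (lp_plus x y) z.
Proof. apply lp_ext; intros n; apply Cplus_assoc. Qed.
Lemma lp_plus_zero x : lp_plus x lp_zero = x.
Proof. apply lp_ext; intros n; apply Cplus_0_r. Qed.
Lemma lp_plus_opp x : lp_plus x (lp_opp x) = lp_zero.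
Proof. apply lp_ext; intros n; apply Cplus_opp_r. Qed.
Lemma lp_scal_assoc c d x : lp_scal c (lp_scal d x) = lp_scal (Cmult c d) x.
Proof. apply lp_ext; intros n; apply Cmult_assoc. Qed.
Lemma lp_scal_one x : lp_scal (RtoC 1) x = x.
Proof. apply lp_ext; intros n; apply Cmult_1_l. Qed.
Lemma lp_scal_distr_l c x y : lp_scal c (lp_plus x y) = lp_plus (lp_scal c x) (lp_scal c y).
Proof. apply lp_ext; intros n; apply Cmult_plus_distr_l. Qed.
Lemma lp_scal_distr_r c d x : lp_scal (Cplus c d) x = lp_plus (lp_scal c x) (lp_scal d x).
Proof. apply lp_ext; intros n; apply Cmult_plus_distr_r. Qed.

Definition lp_AbelianMonoid_mixin :=
  AbelianMonoid.Mixin lp lp_plus lp_zero lp_plus_comm lp_plus_assoc lp_plus_zero.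
Canonical lp_AbelianMonoid := AbelianMonoid.Pack lp lp_AbelianMonoid_mixin lp.
Definition lp_AbelianGroup_mixin :=
  AbelianGroup.Mixin lp_AbelianMonoid lp_opp lp_plus_opp.
Canonical lp_AbelianGroup := AbelianGroup.Pack lp
  (AbelianGroup.Class lp lp_AbelianMonoid_mixin lp_AbelianGroup_mixin) lp.
Definition lp_ModuleSpace_mixin :=
  ModuleSpace.Mixin C_AbsRing lp_AbelianGroup lp_scal
    lp_scal_assoc lp_scal_one lp_scal_distr_l lp_scal_distr_r.
Canonical lp_ModuleSpace := ModuleSpace.Pack C_AbsRing lp
  (ModuleSpace.Class C_AbsRing lp (AbelianGroup.class lp_AbelianGroup)
     lp_ModuleSpace_mixin) lp.

Lemma lp_triangle (x y : lp) : lp_norm (plus x y) <= lp_norm x + lp_norm y.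
Proof. apply (lp_norm_triangle p Hp); apply lp_summable. Qed.
Lemma lp_scal_le (c : C) (x : lp) : lp_norm (scal c x) <= Cmod c * lp_norm x.
Proof. apply (lp_norm_scal_le p Hp); apply lp_summable. Qed.
Lemma lp_eq_zero (x : lp) : lp_norm x = 0 -> x = zero.
Proof.
  intros H. apply lp_ext. intros n.
  exact (lp_norm_eq_0 p Hp x (lp_summable x) H n).
Qed.

Canonical lp_UniformSpace := UniformSpace.Pack lp
  (norm_UniformSpace_mixin lp_ModuleSpace lp_norm lp_triangle lp_scal_le) lp.
Canonical lp_NormedModuleAux := NormedModuleAux.Pack C_AbsRing lp
  (NormedModuleAux.Class C_AbsRing lp (ModuleSpace.class C_AbsRing lp_ModuleSpace)
     (UniformSpace.class lp_UniformSpace)) lp.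
Canonical lp_NormedModule := NormedModule.Pack C_AbsRing lp
  (NormedModule.Class C_AbsRing lp
     (NormedModuleAux.class C_AbsRing lp_NormedModuleAux)
     (norm_NormedModule_mixin lp_ModuleSpace lp_norm
        lp_triangle lp_scal_le lp_eq_zero)) lp.

End Lp.

Record bounded_op (U V : NormedModule C_AbsRing) : Type :=
  mk_op { op_fun :> U -> V; op_linear : is_linear op_fun }.

Arguments mk_op {U V} _ _.
Arguments op_fun {U V} _ _.
Arguments op_linear {U V} _.

Section BoundedOp.

Variables (U V : NormedModule C_AbsRing).

Notation op := (bounded_op U V).

Lemma op_ext (S T : op) : (forall x, S x = T x) -> S = T.
Proof.
  destruct S as [S HS], T as [T HT]; simpl. intros H.
  assert (E : S = T) by (apply functional_extensionality; exact H).
  subst T. f_equal. apply proof_irrelevance.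
Qed.

Lemma is_linear_plus (S T : op) : is_linear (fun x : U => plus (S x) (T x)).
Proof.
  destruct (op_linear S) as [Sp Ss [M [HM SM]]], (op_linear T) as [Tp Ts [M' [HM' TM]]].
  split.
  - intros x y. rewrite Sp, Tp, <- !plus_assoc. f_equal.
    rewrite (plus_comm (S y)), <- plus_assoc. f_equal. apply plus_comm.
  - intros c x. rewrite Ss, Ts. symmetry. exact (scal_distr_l (V := V) c (S x) (T x)).
  - exists (M + M'). split; [lra|]. intros x.
    eapply Rle_trans; [apply (norm_triangle (K := C_AbsRing))|].
    generalize (SM x) (TM x). lra.
Qed.

Lemma is_linear_scal (c : C) (T : op) :
  is_linear (fun x : U => (scal (c : C_AbsRing) (T x) : V)).
Proof.
  destruct (op_linear T) as [Tp Ts [M [HM TM]]].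
  assert (Hc := Cmod_ge_0 c).
  split.
  - intros x y. rewrite Tp. exact (scal_distr_l (V := V) (c : C_AbsRing) (T x) (T y)).
  - intros d x. rewrite Ts, !scal_assoc. f_equal. apply Cmult_comm.
  - exists (Cmod c * M + 1).
    split; [generalize (Rmult_le_pos _ _ Hc (Rlt_le _ _ HM)); lra|]. intros x.
    eapply Rle_trans; [apply (norm_scal (K := C_AbsRing))|].
    generalize (Rmult_le_compat_l _ _ _ Hc (TM x)) (norm_ge_0 x).
    change (abs (c : C_AbsRing)) with (Cmod c). lra.
Qed.

Lemma is_linear_zero : is_linear (fun _ : U => (zero : V)).
Proof.
  split.
  - intros _ _. symmetry. apply plus_zero_r.
  - intros c _. symmetry. exact (scal_zero_r (V := V) c).
  - exists 1. split; [lra|]. intros x. rewrite norm_zero.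
    generalize (norm_ge_0 x). lra.
Qed.

Definition op_plus (S T : op) : op := mk_op _ (is_linear_plus S T).
Definition op_scal (c : C) (T : op) : op := mk_op _ (is_linear_scal c T).
Definition op_opp (T : op) : op := op_scal (Copp (RtoC 1)) T.
Definition op_zero : op := mk_op _ is_linear_zero.

Lemma op_plus_comm S T : op_plus S T = op_plus T S.
Proof. apply op_ext; intros x; apply plus_comm. Qed.
Lemma op_plus_assoc S T W : op_plus S (op_plus T W) = op_plus (op_plus S T) W.
Proof. apply op_ext; intros x; apply plus_assoc. Qed.
Lemma op_plus_zero T : op_plus T op_zero = T.
Proof. apply op_ext; intros x; apply plus_zero_r. Qed.
Lemma op_plus_opp T : op_plus T (op_opp T) = op_zero.
Proof.
  apply op_ext; intros x. simpl.
  etransitivity; [apply f_equal, (scal_opp_one (T x)) | exact (plus_opp_r (G := V) (T x))].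
Qed.
Lemma op_scal_assoc c d T : op_scal c (op_scal d T) = op_scal (Cmult c d) T.
Proof. apply op_ext; intros x; exact (scal_assoc (V := V) (c : C_AbsRing) (d : C_AbsRing) (T x)). Qed.
Lemma op_scal_one T : op_scal (RtoC 1) T = T.
Proof. apply op_ext; intros x; exact (scal_one (V := V) (T x)). Qed.
Lemma op_scal_distr_l c S T : op_scal c (op_plus S T) = op_plus (op_scal c S) (op_scal c T).
Proof. apply op_ext; intros x; exact (scal_distr_l (V := V) (c : C_AbsRing) (S x) (T x)). Qed.
Lemma op_scal_distr_r c d T : op_scal (Cplus c d) T = op_plus (op_scal c T) (op_scal d T).
Proof. apply op_ext; intros x; exact (scal_distr_r (V := V) (c : C_AbsRing) (d : C_AbsRing) (T x)). Qed.

Definition op_AbelianMonoid_mixin :=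
  AbelianMonoid.Mixin op op_plus op_zero op_plus_comm op_plus_assoc op_plus_zero.
Canonical op_AbelianMonoid := AbelianMonoid.Pack op op_AbelianMonoid_mixin op.
Definition op_AbelianGroup_mixin :=
  AbelianGroup.Mixin op_AbelianMonoid op_opp op_plus_opp.
Canonical op_AbelianGroup := AbelianGroup.Pack op
  (AbelianGroup.Class op op_AbelianMonoid_mixin op_AbelianGroup_mixin) op.
Definition op_ModuleSpace_mixin :=
  ModuleSpace.Mixin C_AbsRing op_AbelianGroup op_scal
    op_scal_assoc op_scal_one op_scal_distr_l op_scal_distr_r.
Canonical op_ModuleSpace := ModuleSpace.Pack C_AbsRing op
  (ModuleSpace.Class C_AbsRing op (AbelianGroup.class op_AbelianGroup)
     op_ModuleSpace_mixin) op.

Definition op_norm (T : op) : R :=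
  real (Lub_Rbar (fun r => exists x : U, norm x <= 1 /\ r = norm (T x))).

Lemma op_norm_is_lub (T : op) :
  is_lub_Rbar (fun r => exists x : U, norm x <= 1 /\ r = norm (T x)) (Finite (op_norm T)).
Proof.
  set (E := fun r => exists x : U, norm x <= 1 /\ r = norm (T x)).
  assert (HL := Lub_Rbar_correct E). unfold op_norm. fold E.
  destruct (op_linear T) as [_ _ [M [HM TM]]].
  assert (H0 : Rbar_le 0 (Lub_Rbar E)).
  { apply Rbar_le_trans with (Finite (norm (T zero))); [apply norm_ge_0|].
    apply HL. exists zero. split; [rewrite norm_zero; lra | reflexivity]. }
  assert (HM' : Rbar_le (Lub_Rbar E) M).
  { apply HL. intros r [x [Hx ->]]. simpl.
    eapply Rle_trans; [apply TM|].
    rewrite <- (Rmult_1_r M) at 2. apply Rmult_le_compat_l; lra. }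
  destruct (Lub_Rbar E); [exact HL | destruct HM' | destruct H0].
Qed.

Lemma op_norm_ge0 (T : op) : 0 <= op_norm T.
Proof.
  apply Rle_trans with (norm (T zero)); [apply norm_ge_0|].
  apply (op_norm_is_lub T). exists zero. split; [rewrite norm_zero; lra | reflexivity].
Qed.

Lemma op_norm_le_of (T : op) (M : R) :
  (forall x, norm x <= 1 -> norm (T x) <= M) -> op_norm T <= M.
Proof.
  intros H. apply (proj2 (op_norm_is_lub T) (Finite M)).
  intros r [x [Hx ->]]. now apply H.
Qed.

Lemma op_norm_bound1 (T : op) (x : U) : norm x <= 1 -> norm (T x) <= op_norm T.
Proof.
  intros Hx. apply (op_norm_is_lub T). now exists x.
Qed.

Lemma op_norm_bound (T : op) (x : U) : norm (T x) <= op_norm T * norm x.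
Proof.
  destruct (norm_ge_0 x) as [Hx | Hx].
  - set (y := scal (RtoC (/ norm x) : C_AbsRing) x).
    assert (Hi : 0 < / norm x) by now apply Rinv_0_lt_compat.
    assert (Hy : norm y <= 1).
    { eapply Rle_trans; [apply norm_scal|].
      change (Cmod (RtoC (/ norm x)) * norm x <= 1).
      rewrite Cmod_R, Rabs_pos_eq, Rinv_l; lra. }
    assert (Ex : x = scal (RtoC (norm x) : C_AbsRing) y).
    { unfold y. rewrite scal_assoc.
      replace (mult (RtoC (norm x) : C_AbsRing) (RtoC (/ norm x) : C_AbsRing))
        with (one : C_AbsRing); [symmetry; apply scal_one|].
      change (RtoC 1 = Cmult (RtoC (norm x)) (RtoC (/ norm x))).
      rewrite <- RtoC_mult, Rinv_r; [reflexivity | lra]. }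
    rewrite Ex at 1. rewrite (linear_scal _ (op_linear T)).
    eapply Rle_trans; [apply norm_scal|].
    change (Cmod (RtoC (norm x)) * norm (T y) <= op_norm T * norm x).
    rewrite Cmod_R, Rabs_pos_eq, Rmult_comm by lra.
    apply Rmult_le_compat_r; [lra | now apply op_norm_bound1].
  - assert (Ex : x = zero) by (now apply norm_eq_zero; symmetry).
    rewrite Ex, norm_zero, Rmult_0_r.
    destruct (op_linear T) as [_ _ [M [HM TM]]].
    generalize (TM zero). rewrite norm_zero. lra.
Qed.

Lemma op_norm_triangle (S T : op) : op_norm (plus S T) <= op_norm S + op_norm T.
Proof.
  apply op_norm_le_of. intros x Hx.
  eapply Rle_trans; [apply (norm_triangle (S x) (T x))|].
  generalize (op_norm_bound1 S x Hx) (op_norm_bound1 T x Hx). lra.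
Qed.

Lemma op_norm_scal (c : C) (T : op) : op_norm (scal c T) <= Cmod c * op_norm T.
Proof.
  apply op_norm_le_of. intros x Hx.
  eapply Rle_trans; [apply (norm_scal (c : C_AbsRing) (T x))|].
  apply Rmult_le_compat_l; [apply Cmod_ge_0 | now apply op_norm_bound1].
Qed.

Lemma op_norm_eq_0 (T : op) : op_norm T = 0 -> T = zero.
Proof.
  intros H. apply op_ext. intros x. apply (norm_eq_zero (T x)).
  generalize (op_norm_bound T x) (norm_ge_0 (T x)). rewrite H. lra.
Qed.

Canonical op_UniformSpace := UniformSpace.Pack op
  (norm_UniformSpace_mixin op_ModuleSpace op_norm op_norm_triangle op_norm_scal) op.
Canonical op_NormedModuleAux := NormedModuleAux.Pack C_AbsRing op
  (NormedModuleAux.Class C_AbsRing op (ModuleSpace.class C_AbsRing op_ModuleSpace)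
     (UniformSpace.class op_UniformSpace)) op.
Canonical op_NormedModule := NormedModule.Pack C_AbsRing op
  (NormedModule.Class C_AbsRing op
     (NormedModuleAux.class C_AbsRing op_NormedModuleAux)
     (norm_NormedModule_mixin op_ModuleSpace op_norm
        op_norm_triangle op_norm_scal op_norm_eq_0)) op.

End BoundedOp.

Arguments op_norm {U V} _.

Lemma is_linear_comp_op {U V W : NormedModule C_AbsRing}
    (S : bounded_op V W) (T : bounded_op U V) : is_linear (fun x => S (T x)).
Proof. apply is_linear_comp; apply op_linear. Qed.

Definition op_comp {U V W : NormedModule C_AbsRing}
    (S : bounded_op V W) (T : bounded_op U V) : bounded_op U W :=
  mk_op _ (is_linear_comp_op S T).

Lemma is_linear_id {U : NormedModule C_AbsRing} : is_linear (fun x : U => x).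
Proof.
  split; [reflexivity | reflexivity |].
  exists 1. split; [lra|]. intros x. lra.
Qed.

Definition op_id (U : NormedModule C_AbsRing) : bounded_op U U := mk_op _ is_linear_id.

Definition op_pow {U : NormedModule C_AbsRing} (T : bounded_op U U) (n : nat) :
    bounded_op U U := Nat.iter n (op_comp T) (op_id U).

Definition conj_op {U : NormedModule C_AbsRing} (A B S : bounded_op U U) :
    bounded_op U U := op_comp A (op_comp S B).

Section Shifts.

Variables (p : R) (Hp : 1 < p).

Lemma p_summable_bshift (u : nat -> C) :
  p_summable p u -> p_summable p (fun n => u (S n)).
Proof. intros Hu. exact (proj1 (ex_series_incr_1 _) Hu). Qed.

Definition fshift_seq (u : nat -> C) (n : nat) : C :=
  match n with O => RtoC 0 | S m => u m end.

Lemma p_summable_fshift (u : nat -> C) :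
  p_summable p u -> p_summable p (fshift_seq u).
Proof. intros Hu. exact (proj2 (ex_series_incr_1 _) Hu). Qed.

Definition bshift_fun (x : lp p Hp) : lp p Hp :=
  mk_lp _ (p_summable_bshift x (lp_summable x)).
Definition fshift_fun (x : lp p Hp) : lp p Hp :=
  mk_lp _ (p_summable_fshift x (lp_summable x)).

Lemma bshift_is_linear : is_linear bshift_fun.
Proof.
  split; [intros x y; now apply lp_ext | intros c x; now apply lp_ext |].
  exists 1. split; [lra|]. intros x. rewrite Rmult_1_l.
  apply (lp_norm_le_of p Hp); [apply lp_norm_ge0 | | exact (lp_summable (bshift_fun x))].
  change (norm x) with (lp_norm p x).
  rewrite (lp_norm_pow p Hp x (lp_summable x)).
  rewrite (Series_incr_1 (fun n => rpow (Cmod (x n)) p)) by exact (lp_summable x).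
  generalize (rpow_ge0 (Cmod (x O)) p). simpl. lra.
Qed.

Lemma fshift_is_linear : is_linear fshift_fun.
Proof.
  split.
  - intros x y. apply lp_ext. intros [|n]; [symmetry; apply Cplus_0_r | reflexivity].
  - intros c x. apply lp_ext. intros [|n]; [symmetry; apply Cmult_0_r | reflexivity].
  - exists 1. split; [lra|]. intros x. rewrite Rmult_1_l.
    apply (lp_norm_le_of p Hp); [apply lp_norm_ge0 | | exact (lp_summable (fshift_fun x))].
    change (norm x) with (lp_norm p x).
    rewrite (lp_norm_pow p Hp x (lp_summable x)).
    rewrite Series_incr_1 by exact (lp_summable (fshift_fun x)).
    simpl. rewrite Cmod_0, rpow_0. lra.
Qed.

(* The bounded operators with [B e_0 = 0], [B e_(n+1) = e_n] and [F e_n = e_(n+1)],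
   given by their action on coordinates. *)
Definition backward_shift : bounded_op (lp_NormedModule p Hp) (lp_NormedModule p Hp) :=
  mk_op _ bshift_is_linear.
Definition forward_shift : bounded_op (lp_NormedModule p Hp) (lp_NormedModule p Hp) :=
  mk_op _ fshift_is_linear.

End Shifts.

Definition analytic_at (f : C -> C) (z0 : C) : Prop :=
  exists (b : nat -> C) (r : R), 0 < r /\
    forall z : C, Cmod (Cminus z z0) < r ->
      is_pseries (K := C_AbsRing) (V := C_NormedModule) b (Cminus z z0) (f z).

Definition analytic_near_closed_disc (f : C -> C) : Prop :=
  exists O : C -> Prop, open O /\ (forall z, Cmod z <= 1 -> O z) /\
    forall z, O z -> analytic_at f z.

(* [f(T)]: the sum in operator norm of the series [a_n T^n], where
   [f(z) = sum a_n z^n] on the open unit disc. Such a sum is unique; when there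
   is none, the value is arbitrary. *)
Definition fun_of_op {U : NormedModule C_AbsRing} (f : C -> C) (T : bounded_op U U) :
    bounded_op U U :=
  epsilon (inhabits zero) (fun S : bounded_op U U =>
    exists a : nat -> C,
      (forall z : C, Cmod z < 1 ->
         is_pseries (K := C_AbsRing) (V := C_NormedModule) a z (f z)) /\
      is_series (K := C_AbsRing) (V := op_NormedModule U U)
        (fun n => scal (a n : C_AbsRing) (op_pow T n)) S).

Definition nuclear_representation {U : NormedModule C_AbsRing} (T : bounded_op U U)
    (f : nat -> bounded_op U C_NormedModule) (y : nat -> U) (s : R) : Prop :=
  is_series (fun n => op_norm (f n) * norm (y n)) s /\
  forall x : U, is_series (fun n => scal (f n x : C_AbsRing) (y n)) (T x).

Definition is_nuclear {U : NormedModule C_AbsRing} (T : bounded_op U U) : Prop :=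
  exists f y s, nuclear_representation T f y s.

Definition nuclear_norm {U : NormedModule C_AbsRing} (T : bounded_op U U) : R :=
  real (Glb_Rbar (fun s => exists f y, nuclear_representation T f y s)).

Definition compact_set {X : UniformSpace} (K : X -> Prop) : Prop :=
  forall (I : Type) (O : I -> X -> Prop),
    (forall i, open (O i)) -> (forall x, K x -> exists i, O i x) ->
    exists l : list I, forall x, K x -> exists i, In i l /\ O i x.

Definition closure {X : UniformSpace} (A : X -> Prop) (x : X) : Prop :=
  forall W : X -> Prop, locally x W -> exists y, A y /\ W y.

Definition is_compact_op {U : NormedModule C_AbsRing} (T : bounded_op U U) : Prop :=
  compact_set (closure (fun y : U => exists x : U, norm x <= 1 /\ y = T x)).

(* A linear subspace of [X] with a vector topology, given by a base of
   neighbourhoods of zero: [W] in the base stands for the neighbourhood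
   [carrier /\ W] of zero in the subspace. *)
Record top_subspace (X : ModuleSpace C_AbsRing) : Type := mk_top_subspace {
  carrier :> X -> Prop;
  base0 : (X -> Prop) -> Prop
}.

Arguments mk_top_subspace {X} _ _.
Arguments carrier {X} _ _.
Arguments base0 {X} _ _.

Definition open_in {X : ModuleSpace C_AbsRing} (E : top_subspace X) (V : X -> Prop) : Prop :=
  (forall x, V x -> E x) /\
  forall x, V x -> exists W, base0 E W /\ forall y, E y -> W (minus y x) -> V y.

Definition card_upto (M : nat -> Prop) (N : nat) : nat :=
  length (filter (fun n => if excluded_middle_informative (M n) then true else false)
            (seq 0 (S N))).

Definition lower_density (M : nat -> Prop) : Rbar :=
  LimInf_seq (fun N => INR (card_upto M N) / INR N).

Record continuous_linear_on {X : ModuleSpace C_AbsRing} (E : top_subspace X)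
    (A : X -> X) : Prop := {
  clo_stable : forall x, E x -> E (A x);
  clo_plus : forall x y, E x -> E y -> A (plus x y) = plus (A x) (A y);
  clo_scal : forall (c : C) x, E x -> A (scal (c : C_AbsRing) x) = scal (c : C_AbsRing) (A x);
  clo_continuous : forall V, open_in E V -> open_in E (fun x => E x /\ V (A x))
}.

Definition frequently_hypercyclic {X : ModuleSpace C_AbsRing} (E : top_subspace X)
    (A : X -> X) : Prop :=
  continuous_linear_on E A /\
  exists x, E x /\
    forall V, open_in E V -> (exists y, V y) ->
      Rbar_lt 0 (lower_density (fun n => V (Nat.iter n A x))).

Section OperatorSpaces.

Variable U : NormedModule C_AbsRing.

Definition nuclear_ops : top_subspace (op_ModuleSpace U U) :=
  mk_top_subspace is_nuclear
    (fun W => exists eps : posreal, W = (fun T => nuclear_norm T < eps)).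

Definition compact_ops : top_subspace (op_ModuleSpace U U) :=
  mk_top_subspace is_compact_op
    (fun W => exists eps : posreal, W = (fun T => op_norm T < eps)).

Definition bounded_ops_COT : top_subspace (op_ModuleSpace U U) :=
  mk_top_subspace (fun _ => True)
    (fun W => exists (K : U -> Prop) (eps : posreal), compact_set K /\
       W = (fun T : bounded_op U U => forall x, K x -> norm (T x) < eps)).

End OperatorSpaces.

(* Main.v *)
Require Import Defs.
From Stdlib Require Import Reals Lra Lia List ClassicalEpsilon ZArith Cantor FinFun.
From Coquelicot Require Import Coquelicot.

Open Scope R_scope.

(** Write [E_ij] for the matrix unit that sends [e_j] to [e_i]. Since
    [B E_ij = E_(i-1)j] and [E_ij F = E_i(j-1)], the map [S -> phi(B) S psi(F)] acts
    on the operators with absolutely summable matrix as the operator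
    [T = phi(B) (x) psi(B)] on the absolutely summable double sequences. The map
    from such a sequence to the operator with that matrix is continuous with dense
    image for the nuclear norm, for the operator norm on the compact operators and
    for the topology of uniform convergence on compact sets. So a vector whose
    [T]-orbit visits every ball frequently has an image which is a frequently
    hypercyclic vector in each of the three spaces ([comparison_principle],
    [compression], and [double_shift_visits] for [T]). Density in the nuclear and
    compact operators rests on the fact that functionals on [l^p] have small tails
    for [1 < p] ([functional_tail]).

    For [Cmod z < 1] the sequence [k_z = (z^i)_i] is an eigenvector of [B] for the
    eigenvalue [z], so [k_z (x) k_w] is an eigenvector of [T] for
    [phi(z) psi(w)]. When this number is unimodular, the Taylor coefficients at [z]
    of the analytic family [l -> k_l (x) k_w] yield, by Lagrange inversion, a Jordan
    chain of [T] that starts at the eigenvector ([eigen_expansion_start]), and with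
    it a family of eigenvectors for the eigenvalues near [phi(z) psi(w)]. Averaging
    this family over an arc of the unit circle against a smooth weight produces a
    two-sided orbit of [T] which starts near the eigenvector and decays like
    [1 / |n|^3] in both directions, by partial integration ([flat_moments],
    [chain_orbit_start]).

    The limits of starting points of such orbits form a closed subspace. It contains
    [k_z (x) k_w] whenever [|phi(z) psi(w)| = 1]. If [phi] is not constant, [|phi|]
    takes all values close to a given one on small circles ([modulus_values]); so
    such [z] accumulate, and exist for every [w] near the given one. Applying the
    identity theorem to a power series with coefficients in the quotient by that
    subspace, in [z] and then in [w], puts all the basis vectors [e_i (x) e_j] into
    it ([identity_theorem], [double_shift_starts]). It is therefore the whole space.

    Finally, let [y_v] run through decaying orbits that start near the points of a
    countable dense set. The vector [sum_k y_(v k) (- p k)] is at time [p k] close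
    to [y_(v k) 0], if the constants of the orbits grow slowly and the times are
    separated according to the indices. With [v k] the exponent of [2] in [k + 1]
    every index recurs with positive density, while the separated times still grow
    linearly ([frequently_visiting_vector]).

    An analytic function near the closed disc is a single power series of radius
    larger than [1]: by compactness its local expansions have a common radius and
    bound, and Cauchy's estimate for all of them enlarges the disc of convergence in
    steps of fixed size ([analytic_near_closed_disc_series]). *)

Set Bullet Behavior "Strict Subproofs".

(** * Linear identities in modules *)

Section ModuleReflection.

Variable X : ModuleSpace C_AbsRing.

(** Reflected linear combinations of a list of vectors. *)
Inductive lin_expr : Type :=
  | LZero | LVar (n : nat) | LPlus (a b : lin_expr) | LOpp (a : lin_expr)
  | LScal (c : C) (a : lin_expr).

Fixpoint lin_eval (env : list X) (e : lin_expr) : X :=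
  match e with
  | LZero => zero
  | LVar n => nth n env zero
  | LPlus a b => plus (lin_eval env a) (lin_eval env b)
  | LOpp a => opp (lin_eval env a)
  | LScal c a => scal (c : C_AbsRing) (lin_eval env a)
  end.

Fixpoint lin_coef (e : lin_expr) (k : nat) : C :=
  match e with
  | LZero => RtoC 0
  | LVar n => if Nat.eqb n k then RtoC 1 else RtoC 0
  | LPlus a b => Cplus (lin_coef a k) (lin_coef b k)
  | LOpp a => Copp (lin_coef a k)
  | LScal c a => Cmult c (lin_coef a k)
  end.

Fixpoint lin_comb (env : list X) (f : nat -> C) : X :=
  match env with
  | nil => zero
  | cons x l => plus (scal (f O : C_AbsRing) x) (lin_comb l (fun n => f (S n)))
  end.

Lemma lin_comb_ext env f g : (forall n, (n < length env)%nat -> f n = g n) ->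
  lin_comb env f = lin_comb env g.
Proof.
  revert f g. induction env as [|x l IH]; simpl; intros f g H; [reflexivity|].
  rewrite (H O) by lia. f_equal. apply IH. intros n Hn. apply H. lia.
Qed.

Lemma lin_comb_zero env : lin_comb env (fun _ => RtoC 0) = zero.
Proof.
  induction env as [|x l IH]; simpl; [reflexivity|].
  rewrite IH, plus_zero_r. exact (scal_zero_l x).
Qed.

Lemma lin_comb_plus env f g :
  lin_comb env (fun n => Cplus (f n) (g n)) = plus (lin_comb env f) (lin_comb env g).
Proof.
  revert f g. induction env as [|x l IH]; simpl; intros f g; [now rewrite plus_zero_l|].
  rewrite (IH (fun n => f (S n)) (fun n => g (S n))).
  transitivity (plus (plus (scal (f O : C_AbsRing) x) (scal (g O : C_AbsRing) x))
     (plus (lin_comb l (fun n => f (S n))) (lin_comb l (fun n => g (S n))))).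
  - f_equal. exact (scal_distr_r (f O : C_AbsRing) (g O) x).
  - rewrite <- !plus_assoc. f_equal. rewrite !plus_assoc. f_equal. apply plus_comm.
Qed.

Lemma lin_comb_scal env c f :
  lin_comb env (fun n => Cmult c (f n)) = scal (c : C_AbsRing) (lin_comb env f).
Proof.
  revert f. induction env as [|x l IH]; simpl; intros f.
  - symmetry. exact (scal_zero_r (c : C_AbsRing)).
  - rewrite (IH (fun n => f (S n))), scal_distr_l. f_equal.
    symmetry. exact (scal_assoc (c : C_AbsRing) (f O) x).
Qed.

Lemma lin_comb_opp env f : lin_comb env (fun n => Copp (f n)) = opp (lin_comb env f).
Proof.
  transitivity (lin_comb env (fun n => Cmult (Copp (RtoC 1)) (f n))).
  - apply lin_comb_ext. intros n _. ring.
  - rewrite lin_comb_scal. exact (scal_opp_one (lin_comb env f)).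
Qed.

Lemma lin_comb_var env n :
  lin_comb env (fun k => if Nat.eqb n k then RtoC 1 else RtoC 0) = nth n env zero.
Proof.
  revert n. induction env as [|x l IH]; simpl; intros n; [now destruct n|].
  destruct n as [|n]; simpl.
  - rewrite lin_comb_zero, plus_zero_r. exact (scal_one x).
  - rewrite IH. transitivity (plus zero (nth n l zero)); [|apply plus_zero_l].
    f_equal. exact (scal_zero_l x).
Qed.

Lemma lin_eval_comb env e : lin_eval env e = lin_comb env (lin_coef e).
Proof.
  induction e; simpl.
  - symmetry. apply lin_comb_zero.
  - symmetry. apply lin_comb_var.
  - rewrite IHe1, IHe2. symmetry. apply lin_comb_plus.
  - rewrite IHe. symmetry. apply lin_comb_opp.
  - rewrite IHe. symmetry. apply lin_comb_scal.
Qed.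

Fixpoint same_coefs (n : nat) (a b : lin_expr) : Prop :=
  match n with
  | O => True
  | S m => lin_coef a m = lin_coef b m /\ same_coefs m a b
  end.

Lemma lin_eval_eq env a b : same_coefs (length env) a b -> lin_eval env a = lin_eval env b.
Proof.
  intros H. rewrite !lin_eval_comb. apply lin_comb_ext.
  revert H. generalize (length env). intros N. induction N as [|N IH]; simpl; [lia|].
  intros [H1 H2] n Hn. destruct (Nat.eq_dec n N) as [->|Hne]; [exact H1|].
  apply IH; [exact H2 | lia].
Qed.

End ModuleReflection.

Arguments lin_eval {X} _ _.

Ltac in_list x l :=
  match l with
  | nil => constr:(false)
  | cons x _ => constr:(true)
  | cons _ ?l' => in_list x l'
  end.
Ltac collect_atoms t l :=
  lazymatch t with
  | zero => l
  | plus ?a ?b => let l := collect_atoms a l in collect_atoms b l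
  | minus ?a ?b => let l := collect_atoms a l in collect_atoms b l
  | opp ?a => collect_atoms a l
  | scal _ ?a => collect_atoms a l
  | ?x => match in_list x l with true => l | false => constr:(cons x l) end
  end.
Ltac atom_index x l :=
  match l with
  | cons x _ => constr:(O)
  | cons _ ?l' => let n := atom_index x l' in constr:(S n)
  end.
Ltac reify_lin t l :=
  lazymatch t with
  | zero => constr:(LZero)
  | plus ?a ?b => let a := reify_lin a l in let b := reify_lin b l in constr:(LPlus a b)
  | minus ?a ?b =>
      let a := reify_lin a l in let b := reify_lin b l in constr:(LPlus a (LOpp b))
  | opp ?a => let a := reify_lin a l in constr:(LOpp a)
  | scal ?c ?a => let a := reify_lin a l in constr:(LScal c a)
  | ?x => let n := atom_index x l in constr:(LVar n)
  end.

(** Proves linear identities in a complex module by comparing the coefficients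
    of each atom; [module_eq_pre] leaves the equations between coefficients. *)
Ltac module_eq_pre :=
  lazymatch goal with
  | |- @eq ?T ?a ?b =>
    let l0 := constr:(@nil T) in
    let l := collect_atoms a l0 in
    let l := collect_atoms b l in
    let ea := reify_lin a l in
    let eb := reify_lin b l in
    refine (lin_eval_eq _ l ea eb _); simpl; repeat split
  end.
Ltac module_eq := module_eq_pre; try ring.

Notation "c *: x" := (scal (c : C_AbsRing) x) (at level 40, left associativity).

(** * Series in normed modules *)

(** Half-open partial sums [u 0 + ... + u (n - 1)]: they make the shift
    identities free of special cases, unlike [sum_n]. *)
Fixpoint psum {G : AbelianMonoid} (u : nat -> G) (n : nat) : G :=
  match n with O => zero | S m => plus (psum u m) (u m) end.

Lemma psum_sum_n {G : AbelianMonoid} (u : nat -> G) n : psum u (S n) = sum_n u n.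
Proof.
  induction n as [|n IH].
  - rewrite sum_O. apply plus_zero_l.
  - rewrite sum_Sn, <- IH. reflexivity.
Qed.

Lemma psum_ext {G : AbelianMonoid} (u v : nat -> G) n :
  (forall k, (k < n)%nat -> u k = v k) -> psum u n = psum v n.
Proof.
  induction n as [|n IH]; simpl; intros H; [reflexivity|].
  rewrite IH, (H n) by (intros; try apply H; lia). reflexivity.
Qed.

Lemma psum_split {G : AbelianMonoid} (u : nat -> G) n m :
  psum u (n + m) = plus (psum u n) (psum (fun k => u (n + k)%nat) m).
Proof.
  induction m as [|m IH]; simpl.
  - rewrite Nat.add_0_r. symmetry. apply plus_zero_r.
  - rewrite Nat.add_succ_r. simpl. rewrite IH. symmetry. apply plus_assoc.
Qed.

Lemma psum_S_l {G : AbelianMonoid} (u : nat -> G) n :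
  psum u (S n) = plus (u O) (psum (fun k => u (S k)) n).
Proof.
  change (S n) with (1 + n)%nat. rewrite psum_split. simpl. now rewrite plus_zero_l.
Qed.

Lemma psum_zero {G : AbelianMonoid} (u : nat -> G) n :
  (forall k, (k < n)%nat -> u k = zero) -> psum u n = zero.
Proof.
  induction n as [|n IH]; simpl; intros H; [reflexivity|].
  rewrite IH, (H n) by (intros; try apply H; lia). apply plus_zero_r.
Qed.

Lemma psum_single {G : AbelianMonoid} (u : nat -> G) n i : (i < n)%nat ->
  (forall k, (k < n)%nat -> k <> i -> u k = zero) -> psum u n = u i.
Proof.
  induction n as [|n IH]; simpl; intros Hi H; [lia|].
  destruct (Nat.eq_dec i n) as [->|Hne].
  - rewrite psum_zero, plus_zero_l; [reflexivity|]. intros k Hk. apply H; lia.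
  - rewrite IH, (H n), plus_zero_r; try lia; [reflexivity|]. intros k Hk. apply H; lia.
Qed.

(* Coercions through the algebraic structures hide the type [R] from [ring]. *)
Ltac Rring := match goal with |- @eq _ ?a ?b => change (@eq R a b) end; ring.
Ltac Cring := match goal with |- @eq _ ?a ?b => change (@eq C a b) end; ring.

Lemma psum_R_S (a : nat -> R) n : psum a (S n) = psum a n + a n.
Proof. reflexivity. Qed.

Lemma psum_R_split (a : nat -> R) n m :
  psum a (n + m) = psum a n + psum (fun k => a (n + k)%nat) m.
Proof. exact (psum_split (G := R_AbelianMonoid) a n m). Qed.

Lemma psum_R_le (a b : nat -> R) n : (forall k, (k < n)%nat -> a k <= b k) ->
  psum a n <= psum b n.
Proof.
  induction n as [|n IH]; intros H; [apply Rle_refl|].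
  rewrite !psum_R_S. apply Rplus_le_compat; [apply IH; intros; apply H; lia | apply H; lia].
Qed.

Lemma psum_R_ge0 (a : nat -> R) n : (forall k, 0 <= a k) -> 0 <= psum a n.
Proof.
  intros H. induction n as [|n IH]; [apply Rle_refl|].
  rewrite psum_R_S. generalize (H n). lra.
Qed.

Lemma psum_R_mono (a : nat -> R) n m : (forall k, 0 <= a k) -> (n <= m)%nat ->
  psum a n <= psum a m.
Proof.
  intros H Hnm. replace m with (n + (m - n))%nat by lia. rewrite psum_R_split.
  generalize (psum_R_ge0 (fun k => a (n + k)%nat) (m - n) (fun k => H _)). lra.
Qed.

Lemma psum_R_scal (a : nat -> R) c n : psum (fun k => c * a k) n = c * psum a n.
Proof.
  induction n as [|n IH]; [symmetry; apply Rmult_0_r|].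
  rewrite !psum_R_S, IH. Rring.
Qed.

Lemma psum_R_plus (a b : nat -> R) n : psum (fun k => a k + b k) n = psum a n + psum b n.
Proof.
  induction n as [|n IH]; [symmetry; apply Rplus_0_l|].
  rewrite !psum_R_S, IH. Rring.
Qed.

Lemma psum_R_const c n : psum (fun _ => c) n = INR n * c.
Proof.
  induction n as [|n IH]; [symmetry; apply Rmult_0_l|].
  rewrite psum_R_S, IH, S_INR. Rring.
Qed.

Lemma psum_R_term (a : nat -> R) n k : (forall k, 0 <= a k) -> (k < n)%nat ->
  a k <= psum a n.
Proof.
  intros H Hk. apply Rle_trans with (psum a (S k)); [|now apply psum_R_mono].
  rewrite psum_R_S. generalize (psum_R_ge0 a k H). lra.
Qed.

Lemma psum_geom_le q n : 0 <= q < 1 -> psum (fun k => q ^ k) n <= / (1 - q).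
Proof.
  intros Hq.
  assert (E : (1 - q) * psum (fun k => q ^ k) n = 1 - q ^ n).
  { induction n as [|n IH]; [simpl; change (@zero R_AbelianMonoid) with 0; ring|].
    rewrite psum_R_S, Rmult_plus_distr_l, IH. simpl. ring. }
  apply Rmult_le_reg_l with (1 - q); [lra|]. rewrite E, Rinv_r by lra.
  generalize (pow_le q n (proj1 Hq)). lra.
Qed.

Section NormedSeries.

Variable X : NormedModule C_AbsRing.

Implicit Types (x y z : X) (u v : nat -> X) (c : C).

Lemma norm_scalC c x : norm (c *: x) = Cmod c * norm x.
Proof.
  apply Rle_antisym; [exact (norm_scal (c : C_AbsRing) x)|].
  destruct (Ceq_dec c (RtoC 0)) as [->|Hc].
  - rewrite Cmod_0, Rmult_0_l. apply norm_ge_0.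
  - assert (H0 : 0 < Cmod c) by now apply Cmod_gt_0.
    replace (norm x) with (norm (Cinv c *: (c *: x))).
    + apply Rmult_le_reg_l with (/ Cmod c); [now apply Rinv_0_lt_compat|].
      rewrite <- Rmult_assoc, Rinv_l, Rmult_1_l by lra.
      rewrite <- Cmod_inv by exact Hc. exact (norm_scal (Cinv c : C_AbsRing) (c *: x)).
    + f_equal. module_eq_pre. field. exact Hc.
Qed.

Lemma norm_oppC x : norm (opp x) = norm x.
Proof. apply norm_opp. Qed.

Lemma norm_minus_sym x y : norm (minus x y) = norm (minus y x).
Proof. rewrite <- norm_oppC. f_equal. module_eq. Qed.

Lemma norm_minus_le x y : norm (minus x y) <= norm x + norm y.
Proof.
  unfold minus. eapply Rle_trans; [apply (norm_triangle x (opp y))|].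
  rewrite norm_oppC. apply Rle_refl.
Qed.

Lemma norm_dist_triangle x y z :
  norm (minus x z) <= norm (minus x y) + norm (minus y z).
Proof.
  replace (minus x z) with (plus (minus x y) (minus y z)) by module_eq.
  apply (norm_triangle (minus x y) (minus y z)).
Qed.

Lemma norm_plus_minus x y : norm x <= norm y + norm (minus x y).
Proof.
  replace x with (plus y (minus x y)) at 1 by module_eq.
  apply (norm_triangle y (minus x y)).
Qed.

Lemma psum_scal c u n : psum (fun k => c *: u k) n = c *: psum u n.
Proof.
  induction n as [|n IH]; simpl; [module_eq|]. rewrite IH. module_eq.
Qed.

Lemma psum_norm u n : norm (psum u n) <= psum (fun k => norm (u k)) n.
Proof.
  induction n as [|n IH]; simpl; [rewrite norm_zero; apply Rle_refl|].
  eapply Rle_trans; [apply (norm_triangle (psum u n) (u n))|].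
  apply Rplus_le_compat_r. exact IH.
Qed.

Lemma is_series_psum u l : is_series u l <->
  forall eps, 0 < eps -> exists N, forall n, (N <= n)%nat -> norm (minus (psum u n) l) < eps.
Proof.
  split.
  - intros H0 eps Heps. assert (H := proj1 (filterlim_locally_ball_norm _ _) H0).
    destruct (H (mkposreal eps Heps)) as [N HN].
    exists (S N). intros [|n] Hn; [lia|]. rewrite psum_sum_n. apply HN. lia.
  - intros H. apply filterlim_locally_ball_norm. intros eps.
    destruct (H eps (cond_pos eps)) as [N HN].
    exists N. intros n Hn. unfold ball_norm. rewrite <- psum_sum_n. apply HN. lia.
Qed.

Lemma is_series_unique_C u l l' : is_series u l -> is_series u l' -> l = l'.
Proof. apply filterlim_locally_unique. Qed.

Lemma is_series_eq u v l l' : is_series u l -> (forall n, u n = v n) -> l = l' ->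
  is_series v l'.
Proof. intros H E <-. exact (is_series_ext u v l E H). Qed.

Lemma is_series_shift u n l :
  is_series u l <-> is_series (fun k => u (n + k)%nat) (minus l (psum u n)).
Proof.
  rewrite !is_series_psum. split; intros H eps Heps; destruct (H eps Heps) as [N HN].
  - exists N. intros m Hm. specialize (HN (n + m)%nat ltac:(lia)).
    rewrite psum_split in HN.
    replace (minus (psum (fun k => u (n + k)%nat) m) (minus l (psum u n)))
      with (minus (plus (psum u n) (psum (fun k => u (n + k)%nat) m)) l) by module_eq.
    exact HN.
  - exists (n + N)%nat. intros m Hm. specialize (HN (m - n)%nat ltac:(lia)).
    replace m with (n + (m - n))%nat by lia. rewrite psum_split.
    replace (minus (plus (psum u n) (psum (fun k => u (n + k)%nat) (m - n))) l)
      with (minus (psum (fun k => u (n + k)%nat) (m - n)) (minus l (psum u n)))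
      by module_eq.
    exact HN.
Qed.

Lemma is_series_cons u l :
  is_series u l <-> is_series (fun k => u (S k)) (minus l (u O)).
Proof.
  rewrite (is_series_shift u 1 l). simpl. now rewrite plus_zero_l.
Qed.

Lemma is_series_finite u n : (forall k, (n <= k)%nat -> u k = zero) -> is_series u (psum u n).
Proof.
  intros H. apply is_series_psum. intros eps Heps. exists n. intros m Hm.
  replace m with (n + (m - n))%nat by lia. rewrite psum_split.
  rewrite (psum_zero (fun k => u (n + k)%nat)) by (intros; apply H; lia).
  replace (minus (plus (psum u n) zero) (psum u n)) with (zero : X) by module_eq.
  now rewrite norm_zero.
Qed.

Lemma is_series_norm_le u l M : is_series u l ->
  (forall n, psum (fun k => norm (u k)) n <= M) -> norm l <= M.
Proof.
  intros H HM. apply le_epsilon. intros eps Heps.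
  destruct (proj1 (is_series_psum u l) H eps Heps) as [N HN].
  specialize (HN N (Nat.le_refl _)). rewrite norm_minus_sym in HN.
  generalize (norm_plus_minus l (psum u N)) (psum_norm u N) (HM N). lra.
Qed.

Lemma is_series_term_small u l : is_series u l ->
  forall eps, 0 < eps -> exists N, forall n, (N <= n)%nat -> norm (u n) < eps.
Proof.
  intros H eps Heps.
  destruct (proj1 (is_series_psum u l) H (eps / 2) ltac:(lra)) as [N HN].
  exists N. intros n Hn.
  assert (H1 := HN n Hn). assert (H2 := HN (S n) ltac:(lia)).
  replace (u n) with (minus (minus (psum u (S n)) l) (minus (psum u n) l))
    by (simpl; module_eq).
  eapply Rle_lt_trans; [apply norm_minus_le|]. lra.
Qed.

Definition abs_summable u : Prop :=
  exists M, forall n, psum (fun k => norm (u k)) n <= M.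

(** For normed spaces, the same as completeness. *)
Definition abs_complete : Prop := forall u, abs_summable u -> exists l, is_series u l.

(** The sum of a series, arbitrary when it diverges. *)
Definition vsum u : X := epsilon (inhabits zero) (fun l => is_series u l).

Lemma vsum_correct u l : is_series u l -> is_series u (vsum u).
Proof. intros H. apply (epsilon_spec (inhabits zero) (fun l => is_series u l)). now exists l. Qed.

Lemma vsum_unique u l : is_series u l -> vsum u = l.
Proof. intros H. eapply is_series_unique_C; [eapply vsum_correct; exact H | exact H]. Qed.

Lemma abs_summable_le u (b : nat -> R) M :
  (forall n, norm (u n) <= b n) -> (forall n, psum b n <= M) -> abs_summable u.
Proof.
  intros H HM. exists M. intros n. eapply Rle_trans; [|apply (HM n)].
  apply psum_R_le. intros; apply H.
Qed.

Lemma abs_summable_geom u A q : 0 <= q < 1 -> 0 <= A ->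
  (forall n, norm (u n) <= A * q ^ n) -> abs_summable u.
Proof.
  intros Hq HA H. apply abs_summable_le with (fun n => A * q ^ n) (A * / (1 - q)); [exact H|].
  intros n. rewrite psum_R_scal. apply Rmult_le_compat_l; [exact HA | now apply psum_geom_le].
Qed.

Lemma is_series_norm_le_geom u l A q : 0 <= q < 1 -> 0 <= A ->
  (forall n, norm (u n) <= A * q ^ n) -> is_series u l -> norm l <= A / (1 - q).
Proof.
  intros Hq HA H Hs. apply is_series_norm_le with u; [exact Hs|].
  intros n. apply Rle_trans with (psum (fun n => A * q ^ n) n).
  - apply psum_R_le. intros; apply H.
  - rewrite psum_R_scal. apply Rmult_le_compat_l; [exact HA | now apply psum_geom_le].
Qed.

Lemma abs_summable_tail u : abs_summable u -> forall eps, 0 < eps -> exists N, forall n m,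
  (N <= n)%nat -> psum (fun k => norm (u (n + k)%nat)) m <= eps.
Proof.
  intros [M HM] eps Heps.
  pose (a := (fun n => psum (fun k => norm (u k)) n) : nat -> R).
  assert (Ha : Un_growing a).
  { intros n. unfold a. rewrite psum_R_S. generalize (norm_ge_0 (u n)). lra. }
  assert (Hb : has_ub a).
  { exists M. intros r [n ->]. apply HM. }
  destruct (Un_cv_crit a Ha Hb) as [l Hl].
  destruct (Hl eps Heps) as [N HN].
  exists N. intros n m Hn.
  assert (Hbnd : forall k, a k <= l) by (intros k; now apply growing_ineq).
  assert (H1 := HN n Hn). unfold Rdist in H1.
  assert (H2 : a (n + m)%nat = a n + psum (fun k => norm (u (n + k)%nat)) m).
  { unfold a. apply psum_R_split. }
  generalize (Hbnd (n + m)%nat) (Hbnd n). rewrite H2.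
  rewrite Rabs_minus_sym, Rabs_pos_eq in H1 by (generalize (Hbnd n); lra). lra.
Qed.

Lemma abs_summable_ex (HX : abs_complete) u : abs_summable u -> is_series u (vsum u).
Proof. intros H. destruct (HX u H) as [l Hl]. now apply vsum_correct with l. Qed.

End NormedSeries.

Arguments norm_scalC {X} _ _.
Arguments vsum {X} _.
Arguments abs_summable {X} _.
Arguments is_series_psum {X} _ _.
Arguments is_series_shift {X} _ _ _.
Arguments is_series_eq {X} _ _ _ _ _ _ _.
Arguments is_series_cons {X} _ _.
Arguments norm_dist_triangle {X} _ _ _.
Arguments norm_plus_minus {X} _ _.
Arguments norm_minus_sym {X} _ _.
Arguments norm_minus_le {X} _ _.
Arguments norm_oppC {X} _.
Arguments psum_norm {X} _ _.
Arguments psum_scal {X} _ _ _.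

Arguments abs_summable_ex {X} _ _ _.
Arguments vsum_unique {X} _ _ _.
Arguments is_series_unique_C {X} _ _ _ _ _.

(** * Bounded operators and their series *)

Section BoundedOpFacts.

Variables U V : NormedModule C_AbsRing.

Implicit Types (T : bounded_op U V) (u : nat -> U).

Lemma bop_plus T x y : T (plus x y) = plus (T x) (T y).
Proof. apply (linear_plus _ (op_linear T)). Qed.

Lemma bop_scal T (c : C) x : T (c *: x) = c *: T x.
Proof. apply (linear_scal _ (op_linear T)). Qed.

Lemma bop_zero T : T zero = zero.
Proof.
  transitivity (T (RtoC 0 *: zero)); [f_equal; module_eq|]. rewrite bop_scal. module_eq.
Qed.

Lemma bop_opp T x : T (opp x) = opp (T x).
Proof.
  transitivity (T (Copp (RtoC 1) *: x)); [f_equal; module_eq|]. rewrite bop_scal. module_eq.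
Qed.

Lemma bop_minus T x y : T (minus x y) = minus (T x) (T y).
Proof. unfold minus. now rewrite bop_plus, bop_opp. Qed.

Lemma bop_psum T u n : T (psum u n) = psum (fun k => T (u k)) n.
Proof.
  induction n as [|n IH]; simpl; [apply bop_zero|]. now rewrite bop_plus, IH.
Qed.

Lemma bop_is_series T u l : is_series u l -> is_series (fun k => T (u k)) (T l).
Proof.
  rewrite !is_series_psum. intros H eps Heps.
  assert (H0 := op_norm_ge0 U V T).
  destruct (H (eps / (op_norm T + 1))) as [N HN]; [apply Rdiv_lt_0_compat; lra|].
  exists N. intros n Hn. rewrite <- bop_psum, <- bop_minus.
  eapply Rle_lt_trans; [apply op_norm_bound|].
  apply Rle_lt_trans with ((op_norm T + 1) * norm (minus (psum u n) l)).
  - apply Rmult_le_compat_r; [apply norm_ge_0 | lra].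
  - apply Rlt_le_trans with ((op_norm T + 1) * (eps / (op_norm T + 1))).
    + apply Rmult_lt_compat_l; [lra | now apply HN].
    + right. field. lra.
Qed.

Lemma bop_psum_apply (T : nat -> bounded_op U V) n x :
  (psum T n : bounded_op U V) x = psum (fun k => T k x) n.
Proof. induction n as [|n IH]; simpl; [reflexivity|]. now rewrite <- IH. Qed.

Lemma bop_minus_apply (S T : bounded_op U V) x :
  (minus S T : bounded_op U V) x = minus (S x) (T x).
Proof.
  change (plus (S x) (Copp (RtoC 1) *: T x) = minus (S x) (T x)). module_eq.
Qed.

Lemma bop_is_series_apply (T : nat -> bounded_op U V) (S : bounded_op U V) x :
  is_series (V := op_NormedModule U V) T S -> is_series (fun k => T k x) (S x).
Proof.
  rewrite !is_series_psum. intros H eps Heps.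
  assert (H0 := norm_ge_0 x).
  destruct (H (eps / (norm x + 1))) as [N HN]; [apply Rdiv_lt_0_compat; lra|].
  exists N. intros n Hn. rewrite <- bop_psum_apply, <- bop_minus_apply.
  eapply Rle_lt_trans; [apply op_norm_bound|].
  apply Rle_lt_trans with (op_norm (minus (psum T n) S) * (norm x + 1)).
  - apply Rmult_le_compat_l; [apply op_norm_ge0 | lra].
  - apply Rlt_le_trans with (eps / (norm x + 1) * (norm x + 1)).
    + apply Rmult_lt_compat_r; [lra | now apply HN].
    + right. field. lra.
Qed.

Lemma op_norm_le_mult T M : 0 <= M -> (forall x, norm (T x) <= M * norm x) -> op_norm T <= M.
Proof.
  intros HM H. apply op_norm_le_of. intros x Hx.
  eapply Rle_trans; [apply H|]. rewrite <- (Rmult_1_r M) at 2.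
  now apply Rmult_le_compat_l.
Qed.

(** The pointwise sums form an operator, and the bound on the tails of the series of
    norms makes the convergence uniform on the unit ball. *)
Lemma bounded_op_abs_complete : abs_complete V -> abs_complete (op_NormedModule U V).
Proof.
  intros HV T HT. destruct HT as [M HM].
  change (forall n, psum (fun k => op_norm (T k)) n <= M) in HM.
  assert (HM0 : 0 <= M) by (exact (HM O)).
  assert (Hb : forall x n m, psum (fun k => norm (T (n + k)%nat x)) m
     <= psum (fun k => op_norm (T (n + k)%nat)) m * norm x).
  { intros x n m. rewrite Rmult_comm, <- psum_R_scal. apply psum_R_le.
    intros k _. rewrite Rmult_comm. apply op_norm_bound. }
  assert (HS : forall x, is_series (fun k => T k x) (vsum (fun k => T k x))).
  { intros x. apply (abs_summable_ex HV). exists (M * norm x). intros n.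
    eapply Rle_trans; [apply (Hb x O n)|].
    apply Rmult_le_compat_r; [apply norm_ge_0 | apply HM]. }
  assert (HL : is_linear (fun x : U => (vsum (fun k => T k x) : V))).
  { split.
    - intros x y. apply vsum_unique.
      apply is_series_ext with (fun k => plus (T k x) (T k y)).
      + intros k. symmetry. apply bop_plus.
      + now apply is_series_plus.
    - intros c x. apply vsum_unique.
      apply is_series_ext with (fun k => c *: T k x).
      + intros k. symmetry. apply (bop_scal (T k)).
      + now apply (is_series_scal (c : C_AbsRing)).
    - exists (M + 1). split; [lra|]. intros x.
      apply is_series_norm_le with (fun k => T k x); [apply HS|].
      intros n. eapply Rle_trans; [apply (Hb x O n)|].
      apply Rmult_le_compat_r; [apply norm_ge_0|]. generalize (HM n). simpl. lra. }
  exists (mk_op _ HL : bounded_op U V).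
  apply is_series_psum. intros eps Heps.
  destruct (abs_summable_tail (op_NormedModule U V) T (ex_intro _ M HM) (eps / 2))
    as [N HN]; [lra|].
  exists N. intros n Hn. apply Rle_lt_trans with (eps / 2); [|lra].
  apply op_norm_le_mult; [lra|]. intros x. rewrite bop_minus_apply, bop_psum_apply.
  simpl. rewrite norm_minus_sym.
  apply is_series_norm_le with (fun k => T (n + k)%nat x).
  - apply (proj1 (is_series_shift (fun k => T k x) n _) (HS x)).
  - intros m. eapply Rle_trans; [apply (Hb x n m)|].
    apply Rmult_le_compat_r; [apply norm_ge_0 | now apply HN].
Qed.

End BoundedOpFacts.

Arguments bop_plus {U V} _ _ _.
Arguments bop_scal {U V} _ _ _.
Arguments bop_zero {U V} _.
Arguments bop_opp {U V} _ _.
Arguments bop_minus {U V} _ _ _.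
Arguments bop_psum {U V} _ _ _.
Arguments bop_is_series {U V} _ _ _ _.
Arguments bop_minus_apply {U V} _ _ _.
Arguments bop_psum_apply {U V} _ _ _.
Arguments op_norm_le_mult {U V} _ _ _ _.

Lemma is_series_C_pair (u : nat -> C) (a b : R) :
  is_series (fun n => Re (u n)) a -> is_series (fun n => Im (u n)) b ->
  is_series (V := C_NormedModule) u (a, b).
Proof.
  intros Ha Hb. apply is_series_psum. intros eps Heps.
  assert (HH : forall (v : nat -> R) l, is_series v l -> exists N, forall n, (N <= n)%nat ->
    Rabs (psum v n - l) < eps / 2).
  { intros v l H. assert (H0 := proj1 (filterlim_locally_ball_norm _ _) H).
    destruct (H0 (mkposreal (eps / 2) ltac:(lra))) as [N HN].
    exists (S N). intros [|n] Hn; [lia|]. rewrite psum_sum_n. apply HN. lia. }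
  destruct (HH _ _ Ha) as [N1 H1]. destruct (HH _ _ Hb) as [N2 H2].
  exists (Nat.max N1 N2). intros n Hn.
  specialize (H1 n ltac:(lia)). specialize (H2 n ltac:(lia)).
  assert (E : forall m, (psum u m : C) = (psum (fun n => Re (u n)) m, psum (fun n => Im (u n)) m)).
  { induction m as [|m IH]; [reflexivity|]. simpl. rewrite IH. reflexivity. }
  change (Cmod (Cminus (psum u n) (a, b)) < eps).
  rewrite E.
  set (A := psum (fun n => Re (u n)) n : R) in *. set (B := psum (fun n => Im (u n)) n : R) in *.
  assert (E2 : Cminus (A, B) (a, b) = Cplus (RtoC (A - a)) (Cmult Ci (RtoC (B - b)))).
  { unfold Cminus, Cplus, Cmult, Ci, RtoC, Copp; simpl. f_equal; ring. }
  change (Cmod (Cminus ((A, B) : C) (a, b)) < eps).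
  rewrite E2. eapply Rle_lt_trans; [apply Cmod_triangle|].
  rewrite Cmod_mult, Cmod_Ci, !Cmod_R. lra.
Qed.

Lemma C_abs_complete : abs_complete C_NormedModule.
Proof.
  intros u [M HM].
  change (forall n, psum (fun k => Cmod (u k)) n <= M) in HM.
  assert (HE : ex_series (fun k => Cmod (u k))).
  { destruct (Un_cv_crit (psum (fun k => Cmod (u k)))) as [l Hl].
    - intros n. rewrite psum_R_S. generalize (Cmod_ge_0 (u n)). lra.
    - exists M. intros r [n ->]. apply HM.
    - exists l. apply is_series_Reals. intros eps Heps. destruct (Hl eps Heps) as [N HN].
      exists N. intros n Hn. rewrite <- sum_n_Reals, <- psum_sum_n. apply HN. lia. }
  assert (H1 : ex_series (fun n => Re (u n))).
  { apply (ex_series_le (V := R_CompleteNormedModule)) with (fun k => Cmod (u k)); [|exact HE].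
    intros n. apply re_le_Cmod. }
  assert (H2 : ex_series (fun n => Im (u n))).
  { apply (ex_series_le (V := R_CompleteNormedModule)) with (fun k => Cmod (u k)); [|exact HE].
    intros n. eapply Rle_trans; [|apply Rmax_Cmod]. apply Rmax_r. }
  destruct H1 as [a Ha]. destruct H2 as [b Hb]. exists (a, b). now apply is_series_C_pair.
Qed.

(** * Vector-valued power series *)

Section PowerFamilies.

Variables (X : NormedModule C_AbsRing) (HX : abs_complete X).

Definition geom_bounded (f : nat -> X) (A rho : R) : Prop :=
  0 <= A /\ 0 <= rho /\ forall i, norm (f i) <= A * rho ^ i.

Definition ksum (f : nat -> X) (l : C) : X := vsum (fun i => Cpow l i *: f i).

(** The coefficients of the quotient [(K l - K z) / (l - z)], where [K = ksum f].
    Iterating this division gives the Taylor coefficients of [K] at [z] with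
    their bounds, and no double series has to be rearranged. *)
Definition quot (f : nat -> X) (z : C) (i : nat) : X := ksum (fun k => f (S i + k)%nat) z.

Definition quotn (m : nat) (f : nat -> X) (z : C) : nat -> X :=
  Nat.iter m (fun h => quot h z) f.

Definition taylor (f : nat -> X) (z : C) (m : nat) : X := ksum (quotn m f z) z.

Lemma minus_plus_r (x y : X) : minus x (plus x y) = opp y.
Proof. module_eq. Qed.

Lemma geom_term f A rho l i : geom_bounded f A rho ->
  norm (Cpow l i *: f i) <= A * (rho * Cmod l) ^ i.
Proof.
  intros [HA [Hr H]]. rewrite norm_scalC, Cmod_pow, Rpow_mult_distr.
  replace (A * (rho ^ i * Cmod l ^ i)) with (Cmod l ^ i * (A * rho ^ i)) by ring.
  apply Rmult_le_compat_l; [apply pow_le, Cmod_ge_0 | apply H].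
Qed.

Lemma ksum_correct f A rho l : geom_bounded f A rho -> rho * Cmod l < 1 ->
  is_series (fun i => Cpow l i *: f i) (ksum f l).
Proof.
  intros Hf Hl. apply (abs_summable_ex HX).
  assert (Hf' := Hf). destruct Hf' as [HA [Hr _]].
  apply abs_summable_geom with A (rho * Cmod l); [|exact HA|].
  - split; [apply Rmult_le_pos; [exact Hr | apply Cmod_ge_0] | exact Hl].
  - intros i. now apply geom_term.
Qed.

Lemma ksum_norm f A rho l : geom_bounded f A rho -> rho * Cmod l < 1 ->
  norm (ksum f l) <= A / (1 - rho * Cmod l).
Proof.
  intros Hf Hl. assert (Hf' := Hf). destruct Hf' as [HA [Hr _]].
  apply is_series_norm_le_geom with (fun i => Cpow l i *: f i);
    [split| exact HA | intros; now apply geom_term | now apply ksum_correct with A rho].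
  - apply Rmult_le_pos; [exact Hr | apply Cmod_ge_0].
  - exact Hl.
Qed.

Lemma geom_bounded_shift f A rho n : geom_bounded f A rho ->
  geom_bounded (fun k => f (n + k)%nat) (A * rho ^ n) rho.
Proof.
  intros [HA [Hr H]]. repeat split; [|exact Hr|].
  - apply Rmult_le_pos; [exact HA | now apply pow_le].
  - intros i. rewrite Rmult_assoc, <- pow_add. apply H.
Qed.

Lemma ksum_unfold f A rho z : geom_bounded f A rho -> rho * Cmod z < 1 ->
  ksum f z = plus (f O) (z *: ksum (fun k => f (S k)) z).
Proof.
  intros Hf Hz. apply vsum_unique. apply is_series_cons.
  replace (minus (plus (f O) (z *: ksum (fun k => f (S k)) z)) (Cpow z 0 *: f O))
    with (z *: ksum (fun k => f (S k)) z) by (simpl; module_eq).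
  apply is_series_ext with (fun k => z *: (Cpow z k *: f (S k))).
  - intros k. rewrite Cpow_S. module_eq.
  - apply (is_series_scal (z : C_AbsRing)).
    apply ksum_correct with (A * rho ^ 1) rho; [|exact Hz].
    exact (geom_bounded_shift f A rho 1 Hf).
Qed.

Lemma quot_bounded f A rho z : geom_bounded f A rho -> rho * Cmod z < 1 ->
  geom_bounded (quot f z) (A * (rho / (1 - rho * Cmod z))) rho.
Proof.
  intros Hf Hz. assert (Hf' := Hf). destruct Hf' as [HA [Hr _]].
  repeat split; [|exact Hr|].
  - apply Rmult_le_pos; [exact HA|]. apply Rdiv_le_0_compat; lra.
  - intros i. eapply Rle_trans.
    + apply (ksum_norm _ _ rho z (geom_bounded_shift f A rho (S i) Hf) Hz).
    + right. simpl. field. lra.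
Qed.

Lemma quot_rec f A rho z i : geom_bounded f A rho -> rho * Cmod z < 1 ->
  f (S i) = minus (quot f z i) (z *: quot f z (S i)).
Proof.
  intros Hf Hz. unfold quot at 1.
  rewrite (ksum_unfold _ _ rho z (geom_bounded_shift f A rho (S i) Hf) Hz).
  replace (ksum (fun k => f (S i + S k)%nat) z) with (quot f z (S i)).
  - rewrite Nat.add_0_r. module_eq.
  - unfold quot. f_equal. apply FunctionalExtensionality.functional_extensionality.
    intros k. f_equal. lia.
Qed.

Lemma quot_rec0 f A rho z : geom_bounded f A rho -> rho * Cmod z < 1 ->
  f O = minus (ksum f z) (z *: quot f z O).
Proof.
  intros Hf Hz. rewrite (ksum_unfold f A rho z Hf Hz).
  change (quot f z O) with (ksum (fun k => f (S k)) z). module_eq.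
Qed.

Lemma ksum_quot f A rho z l : geom_bounded f A rho ->
  rho * Cmod z < 1 -> rho * Cmod l < 1 ->
  ksum f l = plus (ksum f z) (Cminus l z *: ksum (quot f z) l).
Proof.
  intros Hf Hz Hl. assert (Hq := quot_bounded f A rho z Hf Hz).
  rewrite (ksum_unfold f A rho l Hf Hl).
  assert (E : ksum (fun k => f (S k)) l =
     minus (ksum (quot f z) l) (z *: ksum (fun k => quot f z (S k)) l)).
  { apply vsum_unique.
    apply is_series_ext with
      (fun k => plus (Cpow l k *: quot f z k) (opp (z *: (Cpow l k *: quot f z (S k))))).
    - intros k. rewrite (quot_rec f A rho z k Hf Hz). module_eq.
    - apply is_series_minus; [now apply ksum_correct with (2 := Hl) (1 := Hq)|].
      apply (is_series_scal (z : C_AbsRing)).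
      refine (ksum_correct _ _ rho l (geom_bounded_shift _ _ _ 1 Hq) Hl). }
  rewrite E, (quot_rec0 f A rho z Hf Hz), (ksum_unfold (quot f z) _ rho l Hq Hl).
  module_eq.
Qed.

Lemma quotn_bounded f A rho z m : geom_bounded f A rho -> rho * Cmod z < 1 ->
  geom_bounded (quotn m f z) (A * (rho / (1 - rho * Cmod z)) ^ m) rho.
Proof.
  intros Hf Hz. induction m as [|m IH].
  - simpl. rewrite Rmult_1_r. exact Hf.
  - change (quotn (S m) f z) with (quot (quotn m f z) z).
    replace (A * (rho / (1 - rho * Cmod z)) ^ S m)
      with (A * (rho / (1 - rho * Cmod z)) ^ m * (rho / (1 - rho * Cmod z)))
      by (simpl; ring).
    now apply quot_bounded.
Qed.

Lemma taylor_norm f A rho z m : geom_bounded f A rho -> rho * Cmod z < 1 ->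
  norm (taylor f z m) <= A / (1 - rho * Cmod z) * (rho / (1 - rho * Cmod z)) ^ m.
Proof.
  intros Hf Hz. eapply Rle_trans; [apply (ksum_norm _ _ rho z (quotn_bounded f A rho z m Hf Hz) Hz)|].
  right. set (q := (rho / (1 - rho * Cmod z)) ^ m). unfold Rdiv. ring.
Qed.

Lemma taylor_partial f A rho z l m : geom_bounded f A rho ->
  rho * Cmod z < 1 -> rho * Cmod l < 1 ->
  ksum f l = plus (psum (fun k => Cpow (Cminus l z) k *: taylor f z k) m)
                  (Cpow (Cminus l z) m *: ksum (quotn m f z) l).
Proof.
  intros Hf Hz Hl. induction m as [|m IH].
  - simpl. module_eq.
  - rewrite IH, (ksum_quot (quotn m f z) _ rho z l (quotn_bounded f A rho z m Hf Hz) Hz Hl).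
    change (quotn (S m) f z) with (quot (quotn m f z) z).
    unfold taylor at 2. simpl. unfold taylor. module_eq.
Qed.

(** The remainder after [m] divisions is [u^m] times the sum of the [m]-th quotient,
    and this decays geometrically. *)
Lemma taylor_series f A rho z u : geom_bounded f A rho ->
  rho * (Cmod z + Cmod u) < 1 ->
  is_series (fun m => Cpow u m *: taylor f z m) (ksum f (Cplus z u)).
Proof.
  intros Hf Hzu. assert (Hf' := Hf). destruct Hf' as [HA [Hr _]].
  assert (Hz : rho * Cmod z < 1).
  { eapply Rle_lt_trans; [|exact Hzu]. apply Rmult_le_compat_l; [exact Hr|].
    generalize (Cmod_ge_0 u). lra. }
  assert (Hl : rho * Cmod (Cplus z u) < 1).
  { eapply Rle_lt_trans; [|exact Hzu]. apply Rmult_le_compat_l; [exact Hr|].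
    apply Cmod_triangle. }
  set (q := Cmod u * (rho / (1 - rho * Cmod z))).
  assert (Hq : 0 <= q < 1).
  { unfold q. split.
    - apply Rmult_le_pos; [apply Cmod_ge_0 | apply Rdiv_le_0_compat; lra].
    - apply Rmult_lt_reg_r with (1 - rho * Cmod z); [lra|].
      replace (Cmod u * (rho / (1 - rho * Cmod z)) * (1 - rho * Cmod z))
        with (Cmod u * rho) by (field; lra). lra. }
  set (B := A / (1 - rho * Cmod (Cplus z u))).
  assert (HB : 0 <= B) by (apply Rdiv_le_0_compat; lra).
  apply is_series_psum. intros eps Heps.
  destruct (pow_lt_1_zero q) with (y := eps / (B + 1)) as [N HN].
  { rewrite Rabs_pos_eq; lra. }
  { apply Rdiv_lt_0_compat; lra. }
  exists N. intros n Hn. specialize (HN n Hn).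
  rewrite Rabs_pos_eq in HN by (apply pow_le; lra).
  rewrite (taylor_partial f A rho z (Cplus z u) n Hf Hz Hl).
  replace (Cminus (Cplus z u) z) with u by ring.
  rewrite minus_plus_r, norm_oppC, norm_scalC, Cmod_pow.
  eapply Rle_lt_trans.
  { apply Rmult_le_compat_l; [apply pow_le, Cmod_ge_0|].
    apply (ksum_norm _ _ rho _ (quotn_bounded f A rho z n Hf Hz) Hl). }
  replace (Cmod u ^ n * (A * (rho / (1 - rho * Cmod z)) ^ n / (1 - rho * Cmod (Cplus z u))))
    with (B * q ^ n).
  2:{ unfold B, q. rewrite Rpow_mult_distr. unfold Rdiv. ring. }
  apply Rle_lt_trans with ((B + 1) * q ^ n).
  - apply Rmult_le_compat_r; [apply pow_le; lra | lra].
  - apply Rlt_le_trans with ((B + 1) * (eps / (B + 1))).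
    + apply Rmult_lt_compat_l; lra.
    + right. field. lra.
Qed.

(** By [ksum_quot] the increment is [l - z] times a sum that is bounded near [z]. *)
Lemma ksum_continuous f A rho z :
  geom_bounded f A rho -> rho * Cmod z < 1 ->
  forall eps, 0 < eps -> exists delta, 0 < delta /\
    forall l, Cmod (Cminus l z) < delta -> norm (minus (ksum f l) (ksum f z)) < eps.
Proof.
  intros Hf Hz eps Heps. assert (Hf' := Hf). destruct Hf' as [HA [Hr _]].
  set (d := 1 - rho * Cmod z). assert (Hd : 0 < d) by (unfold d; lra).
  assert (Hq := quot_bounded f A rho z Hf Hz).
  set (B := A * (rho / (1 - rho * Cmod z))) in *.
  assert (HB : 0 <= B) by apply Hq.
  set (b := 2 * (B + 1) / d). assert (Hb : 0 < b) by (apply Rdiv_lt_0_compat; lra).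
  exists (Rmin (d / (2 * (rho + 1))) (eps / b)). split.
  { apply Rmin_case; apply Rdiv_lt_0_compat; lra. }
  intros l Hl.
  assert (H1 := Rlt_le_trans _ _ _ Hl (Rmin_l _ _)).
  assert (H2 := Rlt_le_trans _ _ _ Hl (Rmin_r _ _)).
  assert (H0 := Cmod_ge_0 (Cminus l z)).
  assert (H3 : rho * Cmod (Cminus l z) <= d / 2).
  { apply Rle_trans with ((rho + 1) * (d / (2 * (rho + 1)))).
    - apply Rmult_le_compat; lra.
    - right. field. lra. }
  assert (H4 : Cmod l <= Cmod z + Cmod (Cminus l z)).
  { replace l with (Cplus z (Cminus l z)) at 1 by ring. apply Cmod_triangle. }
  assert (H5 : rho * Cmod l <= 1 - d / 2).
  { apply Rle_trans with (rho * (Cmod z + Cmod (Cminus l z))).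
    - now apply Rmult_le_compat_l.
    - unfold d in *. lra. }
  rewrite (ksum_quot f A rho z l Hf Hz) by lra.
  rewrite norm_minus_sym, minus_plus_r, norm_oppC, norm_scalC.
  apply Rle_lt_trans with (Cmod (Cminus l z) * b).
  - apply Rmult_le_compat_l; [exact H0|].
    eapply Rle_trans; [apply (ksum_norm _ B rho l Hq); lra|].
    unfold b, Rdiv. replace (2 * (B + 1) * / d) with ((B + 1) * / (d / 2)) by (field; lra).
    apply Rmult_le_compat; try lra.
    + left. apply Rinv_0_lt_compat. lra.
    + apply Rinv_le_contravar; lra.
  - apply Rlt_le_trans with (eps / b * b).
    + apply Rmult_lt_compat_r; assumption.
    + right. field. lra.
Qed.

(** * The identity theorem *)

Record closed_subspace (Z : X -> Prop) : Prop := {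
  cs_zero : Z zero;
  cs_plus : forall x y, Z x -> Z y -> Z (plus x y);
  cs_scal : forall (c : C) x, Z x -> Z (c *: x);
  cs_closed : forall x, (forall eps, 0 < eps -> exists y, Z y /\ norm (minus x y) < eps) -> Z x
}.

Section Identity.

Variables (Z : X -> Prop) (HZ : closed_subspace Z).

Lemma cs_minus x y : Z x -> Z y -> Z (minus x y).
Proof.
  intros Hx Hy. replace (minus x y) with (plus x (Copp (RtoC 1) *: y)) by module_eq.
  apply (cs_plus Z HZ); [exact Hx | now apply (cs_scal Z HZ)].
Qed.

Lemma cs_psum u n : (forall k, (k < n)%nat -> Z (u k)) -> Z (psum u n).
Proof.
  induction n as [|n IH]; simpl; intros H; [apply (cs_zero Z HZ)|].
  apply (cs_plus Z HZ); [apply IH; intros; apply H; lia | apply H; lia].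
Qed.

Lemma cs_series u l : is_series u l -> (forall k, Z (u k)) -> Z l.
Proof.
  intros H Hu. apply (cs_closed Z HZ). intros eps Heps.
  destruct (proj1 (is_series_psum u l) H eps Heps) as [N HN].
  exists (psum u N). split; [apply cs_psum; intros; apply Hu|].
  rewrite norm_minus_sym. now apply HN.
Qed.

Definition meets_near (f : nat -> X) (z : C) : Prop :=
  forall eps, 0 < eps -> exists l, l <> z /\ Cmod (Cminus l z) < eps /\ Z (ksum f l).

Lemma ksum_limit_in f A rho z : geom_bounded f A rho -> rho * Cmod z < 1 ->
  meets_near f z -> Z (ksum f z).
Proof.
  intros Hf Hz Hm. apply (cs_closed Z HZ). intros eps Heps.
  destruct (ksum_continuous f A rho z Hf Hz eps Heps) as [delta [Hd H]].
  destruct (Hm delta Hd) as [l [_ [Hl HZl]]].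
  exists (ksum f l). split; [exact HZl|]. rewrite norm_minus_sym. now apply H.
Qed.

(** The quotient takes at the same points the values of the difference quotients,
    which lie in the subspace because the value at [z] does by continuity. *)
Lemma meets_near_quot f A rho z : geom_bounded f A rho -> rho * Cmod z < 1 ->
  meets_near f z -> meets_near (quot f z) z.
Proof.
  intros Hf Hz Hm eps Heps. assert (Hf' := Hf). destruct Hf' as [HA [Hr _]].
  set (d := 1 - rho * Cmod z). assert (Hd : 0 < d) by (unfold d; lra).
  destruct (Hm (Rmin eps (d / (2 * (rho + 1))))) as [l [Hne [Hl HZl]]].
  { apply Rmin_case; [exact Heps|]. apply Rdiv_lt_0_compat; lra. }
  assert (H1 := Rlt_le_trans _ _ _ Hl (Rmin_l _ _)).
  assert (H2 := Rlt_le_trans _ _ _ Hl (Rmin_r _ _)).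
  assert (H0 := Cmod_ge_0 (Cminus l z)).
  assert (H3 : rho * Cmod (Cminus l z) <= d / 2).
  { apply Rle_trans with ((rho + 1) * (d / (2 * (rho + 1)))).
    - apply Rmult_le_compat; lra.
    - right. field. lra. }
  assert (H4 : Cmod l <= Cmod z + Cmod (Cminus l z)).
  { replace l with (Cplus z (Cminus l z)) at 1 by ring. apply Cmod_triangle. }
  assert (H5 : rho * Cmod l <= 1 - d / 2).
  { apply Rle_trans with (rho * (Cmod z + Cmod (Cminus l z))).
    - now apply Rmult_le_compat_l.
    - unfold d in *. lra. }
  exists l. split; [exact Hne|]. split; [exact H1|].
  assert (Hnz : Cminus l z <> RtoC 0).
  { intros E. apply Hne. replace l with (Cplus (Cminus l z) z) by ring. rewrite E. ring. }
  replace (ksum (quot f z) l) with (Cinv (Cminus l z) *: minus (ksum f l) (ksum f z)).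
  - apply (cs_scal Z HZ), cs_minus; [exact HZl|]. now apply ksum_limit_in with A rho.
  - rewrite (ksum_quot f A rho z l Hf Hz) by lra. module_eq_pre; field; exact Hnz.
Qed.

Lemma taylor_in f A rho z m : geom_bounded f A rho -> rho * Cmod z < 1 ->
  meets_near f z -> Z (taylor f z m).
Proof.
  intros Hf Hz Hm.
  assert (H : meets_near (quotn m f z) z).
  { induction m as [|m IH]; [exact Hm|].
    apply meets_near_quot with (2 := Hz) (1 := quotn_bounded f A rho z m Hf Hz). exact IH. }
  exact (ksum_limit_in _ _ rho z (quotn_bounded f A rho z m Hf Hz) Hz H).
Qed.

Lemma ksum_in_disc f A rho z u : geom_bounded f A rho -> rho * (Cmod z + Cmod u) < 1 ->
  (forall m, Z (taylor f z m)) -> Z (ksum f (Cplus z u)).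
Proof.
  intros Hf Hu H. apply cs_series with (1 := taylor_series f A rho z u Hf Hu).
  intros k. apply (cs_scal Z HZ), H.
Qed.

Lemma taylor_0 f A rho m : geom_bounded f A rho -> taylor f (RtoC 0) m = f m.
Proof.
  intros Hf.
  assert (K0 : forall h B, geom_bounded h B rho -> ksum h (RtoC 0) = h O).
  { intros h B Hh. rewrite (ksum_unfold h B rho) by (rewrite ?Cmod_0; auto; lra). module_eq. }
  assert (E : forall i, quotn m f (RtoC 0) i = f (m + i)%nat).
  { induction m as [|m IH]; intros i; [reflexivity|].
    change (quotn (S m) f (RtoC 0)) with (quot (quotn m f (RtoC 0)) (RtoC 0)).
    unfold quot. rewrite (K0 _ (A * (rho / (1 - rho * Cmod (RtoC 0))) ^ m * rho ^ (S i))).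
    - rewrite IH. f_equal. lia.
    - refine (geom_bounded_shift _ _ _ (S i) (quotn_bounded f A rho _ m Hf _)).
      rewrite Cmod_0. lra. }
  unfold taylor. rewrite (K0 _ (A * (rho / (1 - rho * Cmod (RtoC 0))) ^ m)).
  - rewrite E. f_equal. lia.
  - apply quotn_bounded; [exact Hf|]. rewrite Cmod_0. lra.
Qed.

(** A power series whose values near [z] meet a closed subspace in points
    accumulating at [z] has all its Taylor coefficients at [z] there, hence all
    its values on a disc around [z]; finitely many discs lead from [z] to [0]. *)
Theorem identity_theorem f A rho z : geom_bounded f A rho -> rho * Cmod z < 1 ->
  meets_near f z -> forall i, Z (f i).
Proof.
  intros Hf Hz Hm i. assert (Hf' := Hf). destruct Hf' as [HA [Hr _]].
  set (d := 1 - rho * Cmod z). assert (Hd : 0 < d) by (unfold d; lra).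
  (* From [z] to [0] in [N] steps that are short against the distance to the boundary
     of the disc of convergence. *)
  destruct (archimed_cor1 (d / (2 * (rho * Cmod z + 1)))) as [N [HN HN0]].
  { apply Rdiv_lt_0_compat; [lra|].
    generalize (Rmult_le_pos _ _ Hr (Cmod_ge_0 z)). lra. }
  assert (HNR : 0 < INR N) by (apply lt_0_INR; lia).
  set (w := fun k : nat => Cmult (RtoC (1 - INR k / INR N)) z).
  assert (Hw : forall k, (k <= N)%nat -> Cmod (w k) <= Cmod z).
  { intros k Hk. unfold w. rewrite Cmod_mult, Cmod_R.
    assert (0 <= INR k / INR N) by (apply Rdiv_le_0_compat; [apply pos_INR | exact HNR]).
    assert (INR k / INR N <= 1).
    { apply Rmult_le_reg_r with (INR N); [exact HNR|].
      unfold Rdiv. rewrite Rmult_assoc, Rinv_l, Rmult_1_r, Rmult_1_l by lra. now apply le_INR. }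
    rewrite Rabs_pos_eq by lra.
    rewrite <- (Rmult_1_l (Cmod z)) at 2. apply Rmult_le_compat_r; [apply Cmod_ge_0 | lra]. }
  assert (Hrw : forall k, (k <= N)%nat -> rho * Cmod (w k) <= rho * Cmod z).
  { intros k Hk. apply Rmult_le_compat_l; [exact Hr | now apply Hw]. }
  assert (H : forall k, (k <= N)%nat -> forall m, Z (taylor f (w k) m)).
  { induction k as [|k IH]; intros Hk m.
    - replace (w O) with z; [now apply taylor_in with A rho|].
      unfold w. simpl. unfold Rdiv. rewrite Rmult_0_l, Rminus_0_r. ring.
    - apply taylor_in with A rho; [exact Hf | generalize (Hrw (S k) Hk); lra |].
      intros eps Heps.
      set (e := Rmin (eps / 2) (d / (4 * (rho + 1)))).
      assert (He : 0 < e) by (apply Rmin_case; apply Rdiv_lt_0_compat; lra).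
      assert (He1 : e <= eps / 2) by apply Rmin_l.
      assert (He2 : e <= d / (4 * (rho + 1))) by apply Rmin_r.
      (* Points close to [w (S k)] still lie in the disc around [w k]. *)
      exists (Cplus (w (S k)) (RtoC e)). split; [|split].
      + intros E. assert (E2 : RtoC e = RtoC 0).
        { replace (RtoC e) with (Cminus (Cplus (w (S k)) (RtoC e)) (w (S k))) by ring.
          rewrite E. ring. }
        apply RtoC_inj in E2. lra.
      + replace (Cminus (Cplus (w (S k)) (RtoC e)) (w (S k))) with (RtoC e) by ring.
        rewrite Cmod_R, Rabs_pos_eq; lra.
      + replace (Cplus (w (S k)) (RtoC e))
          with (Cplus (w k) (Cplus (Cminus (w (S k)) (w k)) (RtoC e))) by ring.
        apply ksum_in_disc with A rho; [exact Hf | | apply IH; lia].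
        assert (Hs : Cmod (Cplus (Cminus (w (S k)) (w k)) (RtoC e)) <= / INR N * Cmod z + e).
        { eapply Rle_trans; [apply Cmod_triangle|].
          rewrite (Cmod_R e), (Rabs_pos_eq e) by lra. apply Rplus_le_compat_r.
          replace (Cminus (w (S k)) (w k)) with (Cmult (RtoC (- / INR N)) z).
          - rewrite Cmod_mult, Cmod_R, Rabs_Ropp, Rabs_pos_eq; [lra|].
            left. now apply Rinv_0_lt_compat.
          - unfold w. rewrite S_INR.
            replace (- / INR N) with ((1 - (INR k + 1) / INR N) - (1 - INR k / INR N))
              by (field; lra).
            rewrite RtoC_minus. ring. }
        apply Rle_lt_trans with (rho * (Cmod z + (/ INR N * Cmod z + e))).
        { apply Rmult_le_compat_l; [exact Hr|]. generalize (Hw k ltac:(lia)). lra. }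
        assert (Ha : rho * Cmod z * / INR N < d / 2).
        { apply Rle_lt_trans with ((rho * Cmod z + 1) * / INR N).
          - apply Rmult_le_compat_r; [left; now apply Rinv_0_lt_compat | lra].
          - assert (Hc : 0 < rho * Cmod z + 1)
              by (generalize (Rmult_le_pos _ _ Hr (Cmod_ge_0 z)); lra).
            apply Rlt_le_trans with ((rho * Cmod z + 1) * (d / (2 * (rho * Cmod z + 1)))).
            + now apply Rmult_lt_compat_l.
            + right. field. lra. }
        assert (Hb : rho * e <= d / 4).
        { apply Rle_trans with ((rho + 1) * (d / (4 * (rho + 1)))).
          - apply Rmult_le_compat; lra.
          - right. field. lra. }
        unfold d in *. lra. }
  assert (E : w N = RtoC 0).
  { unfold w. unfold Rdiv. rewrite Rinv_r, Rminus_diag by lra. ring. }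
  rewrite <- (taylor_0 f A rho i Hf), <- E. now apply H.
Qed.

End Identity.

End PowerFamilies.

Arguments geom_bounded {X} _ _ _.
Arguments ksum {X} _ _.
Arguments quot {X} _ _ _.
Arguments quotn {X} _ _ _ _.
Arguments taylor {X} _ _ _.
Arguments closed_subspace {X} _.

(** * Functions analytic near the closed disc *)

Lemma is_pseries_C (a : nat -> C) (z l : C) :
  is_pseries (K := C_AbsRing) (V := C_NormedModule) a z l <->
  is_series (V := C_NormedModule) (fun i => Cpow z i *: (a i : C_NormedModule)) l.
Proof.
  split; exact (fun H => H).
Qed.

Notation geom_bounded_C := (geom_bounded (X := C_NormedModule)).
Notation ksum_C := (ksum (X := C_NormedModule)).
Notation taylor_C := (taylor (X := C_NormedModule)).

Lemma ksum_C_correct (a : nat -> C) A rho l : geom_bounded_C a A rho -> rho * Cmod l < 1 ->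
  is_series (V := C_NormedModule) (fun i => Cpow l i *: (a i : C_NormedModule)) (ksum_C a l).
Proof. apply ksum_correct, C_abs_complete. Qed.

Lemma geom_bounded_weaken {X : NormedModule C_AbsRing} (f : nat -> X) A B r s :
  geom_bounded f A r -> A <= B -> r <= s -> geom_bounded f B s.
Proof.
  intros [HA [Hr H]] HAB Hrs. repeat split; try lra. intros i.
  eapply Rle_trans; [apply H|]. apply Rmult_le_compat; try lra.
  - now apply pow_le.
  - now apply pow_incr.
Qed.

(** The terms of a convergent series are bounded. *)
Lemma geom_bounded_of_series (a : nat -> C) (s : R) (l : C) : 0 < s ->
  is_series (V := C_NormedModule) (fun i => Cpow (RtoC s) i *: (a i : C_NormedModule)) l ->
  exists A, geom_bounded_C a A (/ s).
Proof.
  intros Hs H.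
  destruct (is_series_term_small C_NormedModule _ _ H 1 ltac:(lra)) as [N HN].
  set (b := fun i => Cmod (a i) * s ^ i).
  assert (Hb : forall i, 0 <= b i).
  { intros i. apply Rmult_le_pos; [apply Cmod_ge_0 | apply pow_le; lra]. }
  exists (psum b N + 1). assert (H0 := psum_R_ge0 b N Hb).
  repeat split; [lra | left; now apply Rinv_0_lt_compat |].
  intros i. rewrite pow_inv.
  assert (Hi : b i <= psum b N + 1).
  { destruct (Nat.lt_ge_cases i N) as [Hi|Hi].
    - generalize (psum_R_term b N i Hb Hi). lra.
    - specialize (HN i Hi). rewrite norm_scalC, Cmod_pow, Cmod_R, Rabs_pos_eq in HN by lra.
      change (norm (a i : C_NormedModule)) with (Cmod (a i)) in HN.
      unfold b at 1. lra. }
  change (Cmod (a i) <= (psum b N + 1) * / s ^ i).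
  assert (Hp : 0 < s ^ i) by now apply pow_lt.
  apply Rmult_le_reg_r with (s ^ i); [exact Hp|].
  rewrite Rmult_assoc, Rinv_l, Rmult_1_r by lra. exact Hi.
Qed.

Lemma closed_subspace_zero (X : NormedModule C_AbsRing) :
  closed_subspace (fun x : X => x = zero).
Proof.
  split.
  - reflexivity.
  - intros x y -> ->. apply plus_zero_r.
  - intros c x ->. module_eq.
  - intros x H. apply (norm_eq_zero (V := X)). apply Rle_antisym; [|apply norm_ge_0].
    apply le_epsilon. intros eps Heps. destruct (H eps Heps) as [y [Hy0 Hy]].
    eapply Rle_trans; [apply (norm_plus_minus x y)|].
    apply Rplus_le_compat; [|left; exact Hy].
    rewrite Hy0. right. apply (norm_zero (V := X)).
Qed.

(** The identity theorem for the difference, with the zero subspace. *)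
Lemma coefs_unique (a b : nat -> C) A B r s eta (f : C -> C) : 0 < eta ->
  geom_bounded_C a A r -> geom_bounded_C b B s ->
  (forall u, Cmod u < eta ->
     is_series (V := C_NormedModule) (fun i => Cpow u i *: (a i : C_NormedModule)) (f u)) ->
  (forall u, Cmod u < eta ->
     is_series (V := C_NormedModule) (fun i => Cpow u i *: (b i : C_NormedModule)) (f u)) ->
  forall i, a i = b i.
Proof.
  intros Heta Ha Hb Hfa Hfb i.
  set (q := Rmax r s).
  assert (Ha' := geom_bounded_weaken _ _ _ _ q Ha (Rle_refl _) (Rmax_l _ _)).
  assert (Hb' := geom_bounded_weaken _ _ _ _ q Hb (Rle_refl _) (Rmax_r _ _)).
  pose (d := (fun i => minus (a i : C_NormedModule) (b i)) : nat -> C_NormedModule).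
  assert (Hd : geom_bounded_C d (A + B) q).
  { destruct Ha' as [HA [Hq HA']], Hb' as [HB [_ HB']]. repeat split; [lra | exact Hq |].
    intros k. eapply Rle_trans; [apply norm_minus_le|].
    rewrite Rmult_plus_distr_r. apply Rplus_le_compat; [apply HA' | apply HB']. }
  assert (E : d i = zero).
  { apply (identity_theorem C_NormedModule C_abs_complete _
      (closed_subspace_zero C_NormedModule) d (A + B) q (RtoC 0) Hd).
    - rewrite Cmod_0. lra.
    - intros eps Heps.
      set (e := Rmin eps eta / 2).
      assert (He : 0 < Rmin eps eta) by now apply Rmin_case.
      assert (H1 := Rmin_l eps eta). assert (H2 := Rmin_r eps eta).
      exists (RtoC e). split; [|split].
      + intros E. apply RtoC_inj in E. unfold e in E. lra.
      + replace (Cminus (RtoC e) (RtoC 0)) with (RtoC e) by ring.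
        rewrite Cmod_R, Rabs_pos_eq; unfold e; lra.
      + assert (Hu : Cmod (RtoC e) < eta).
        { rewrite Cmod_R, Rabs_pos_eq; unfold e; lra. }
        apply vsum_unique.
        change (is_series (fun i => Cpow (RtoC e) i *: d i) (zero : C_NormedModule)).
        refine (eq_ind _ (fun x : C_NormedModule => is_series _ x) _ _
          (minus_eq_zero (f (RtoC e) : C_NormedModule))).
        apply is_series_ext with (fun k => plus (Cpow (RtoC e) k *: (a k : C_NormedModule))
           (opp (Cpow (RtoC e) k *: (b k : C_NormedModule)))).
        * intros k. unfold d. module_eq.
        * apply (is_series_minus (V := C_NormedModule)); [now apply Hfa | now apply Hfb]. }
  replace (a i) with (plus (minus (a i : C_NormedModule) (b i)) (b i)) by module_eq.
  change (minus (a i : C_NormedModule) (b i)) with (d i). rewrite E. apply plus_zero_l.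
Qed.

Definition nonconstant (a : nat -> C) : Prop := exists i, (1 <= i)%nat /\ a i <> RtoC 0.

Lemma nonconstant_least a : nonconstant a -> exists L, (1 <= L)%nat /\ a L <> RtoC 0 /\
  forall l, (1 <= l < L)%nat -> a l = RtoC 0.
Proof.
  intros [l0 [Hl1 Hl2]]. revert Hl1 Hl2.
  induction l0 as [l0 IH] using lt_wf_ind. intros H1 H2.
  destruct (classic (exists l, (1 <= l < l0)%nat /\ a l <> RtoC 0)) as [[l [Hl Hl']]|Hno].
  - apply (IH l); [lia | lia | exact Hl'].
  - exists l0. split; [exact H1|]. split; [exact H2|]. intros l Hl.
    apply NNPP. intros Hne. apply Hno. now exists l.
Qed.

(** ** Cauchy's estimate *)

Definition cis (x : R) : C := (cos x, sin x).

Lemma cis_plus x y : cis (x + y) = Cmult (cis x) (cis y).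
Proof. unfold cis, Cmult; simpl. rewrite cos_plus, sin_plus. f_equal; ring. Qed.

Lemma cis_0 : cis 0 = RtoC 1.
Proof. unfold cis. now rewrite cos_0, sin_0. Qed.

Lemma Cmod_cis x : Cmod (cis x) = 1.
Proof.
  unfold cis, Cmod; simpl. rewrite !Rmult_1_r.
  generalize (sin2_cos2 x). unfold Rsqr. intros H.
  replace (cos x * cos x + sin x * sin x) with 1 by lra. apply sqrt_1.
Qed.

Lemma cis_pow x n : Cpow (cis x) n = cis (INR n * x).
Proof.
  induction n as [|n IH].
  - simpl. now rewrite Rmult_0_l, cis_0.
  - rewrite Cpow_S, IH, <- cis_plus, S_INR. f_equal. ring.
Qed.

Lemma cis_opp_l x : Cmult (cis (- x)) (cis x) = RtoC 1.
Proof. rewrite <- cis_plus, Rplus_opp_l. apply cis_0. Qed.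

Lemma cis_2PI_mult k : cis (INR k * (2 * PI)) = RtoC 1.
Proof.
  rewrite <- cis_pow. replace (cis (2 * PI)) with (RtoC 1).
  - apply Cpow_1_l.
  - unfold cis. now rewrite cos_2PI, sin_2PI.
Qed.

Lemma cis_neq_1 x : 0 < x < 2 * PI -> cis x <> RtoC 1.
Proof.
  intros Hx E. assert (E1 : cos x = 1) by (now injection E).
  replace x with (2 * (x / 2)) in E1 by field. rewrite cos_2a_sin in E1.
  assert (H := sin_gt_0 (x / 2) ltac:(lra) ltac:(lra)). nra.
Qed.

Lemma geom_sum_root (r : C) n : r <> RtoC 1 -> Cpow r n = RtoC 1 ->
  psum (G := C_AbelianMonoid) (fun s => Cpow r s) n = RtoC 0.
Proof.
  intros Hr Hn.
  assert (E : Cmult (Cminus r (RtoC 1)) (psum (G := C_AbelianMonoid) (fun s => Cpow r s) n)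
     = Cminus (Cpow r n) (RtoC 1)).
  { clear Hn. induction n as [|n IH].
    - simpl. change (@zero C_AbelianMonoid) with (RtoC 0). Cring.
    - simpl psum. change (@plus C_AbelianMonoid) with Cplus.
      rewrite Cmult_plus_distr_l, IH, Cpow_S. ring. }
  rewrite Hn in E.
  assert (Hnz : Cminus r (RtoC 1) <> RtoC 0).
  { intros E0. apply Hr. replace r with (Cplus (Cminus r (RtoC 1)) (RtoC 1)) by ring.
    rewrite E0. ring. }
  destruct (Ceq_dec (psum (G := C_AbelianMonoid) (fun s => Cpow r s) n) (RtoC 0)) as [H|H];
    [exact H|].
  exfalso. apply (Cmult_neq_0 _ _ Hnz H). rewrite E. ring.
Qed.

Lemma psum_switch {G : AbelianMonoid} (u : nat -> nat -> G) m n :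
  psum (fun i => psum (u i) n) m = psum (fun j => psum (fun i => u i j) m) n.
Proof.
  induction m as [|m IH]; simpl.
  - symmetry. apply psum_zero. reflexivity.
  - rewrite IH. clear IH. induction n as [|n IHn]; simpl; [apply plus_zero_l|].
    rewrite <- IHn, <- !plus_assoc. f_equal. rewrite !plus_assoc. f_equal. apply plus_comm.
Qed.

Lemma psum_C_const (c : C) n : psum (G := C_AbelianMonoid) (fun _ => c) n = Cmult (RtoC (INR n)) c.
Proof.
  induction n as [|n IH]; [symmetry; apply Cmult_0_l|].
  simpl psum. rewrite IH, S_INR, RtoC_plus. change (@plus C_AbelianMonoid) with Cplus. Cring.
Qed.

Lemma psum_C_mult_l (c : C) u n : psum (G := C_AbelianMonoid) (fun k => Cmult c (u k)) n
  = Cmult c (psum (G := C_AbelianMonoid) u n).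
Proof.
  induction n as [|n IH]; [symmetry; apply Cmult_0_r|].
  simpl psum. rewrite IH. change (@plus C_AbelianMonoid) with Cplus. Cring.
Qed.

(** The powers of a non-trivial [N]-th root of unity add up to zero. *)
Lemma root_orthogonality N i k : (i < N)%nat -> (k < N)%nat ->
  psum (G := C_AbelianMonoid) (fun s => Cmult (cis (- (INR k * (INR s * (2 * PI / INR N)))))
    (cis (INR i * (INR s * (2 * PI / INR N))))) N
  = if Nat.eqb i k then RtoC (INR N) else RtoC 0.
Proof.
  intros Hi Hk. assert (HN : 0 < INR N) by (apply lt_0_INR; lia).
  set (al := 2 * PI / INR N).
  assert (Hal : forall d, (0 < d < N)%nat -> 0 < INR d * al < 2 * PI).
  { intros d Hd. assert (0 < INR d) by (apply lt_0_INR; lia).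
    assert (INR d < INR N) by (apply lt_INR; lia). generalize PI_RGT_0. intros HPI.
    unfold al. split.
    - apply Rmult_lt_0_compat; [assumption | apply Rdiv_lt_0_compat; lra].
    - apply Rmult_lt_reg_r with (INR N); [exact HN|].
      replace (INR d * (2 * PI / INR N) * INR N) with (INR d * (2 * PI)) by (field; lra).
      rewrite (Rmult_comm (2 * PI)). apply Rmult_lt_compat_r; lra. }
  assert (HalN : forall d, INR N * (INR d * al) = INR d * (2 * PI)).
  { intros d. unfold al. field. lra. }
  destruct (Nat.eqb_spec i k) as [->|Hne].
  - rewrite (psum_ext _ (fun _ => RtoC 1)), psum_C_const; [Cring|].
    intros s _. apply cis_opp_l.
  - destruct (Nat.lt_ge_cases k i) as [Hlt|Hge].
    + rewrite (psum_ext _ (fun s => Cpow (cis (INR (i - k) * al)) s)).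
      * apply geom_sum_root; [apply cis_neq_1, Hal; lia|].
        rewrite cis_pow, HalN. apply cis_2PI_mult.
      * intros s _. rewrite cis_pow, <- cis_plus. f_equal. rewrite minus_INR by lia. ring.
    + rewrite (psum_ext _ (fun s => Cpow (cis (- (INR (k - i) * al))) s)).
      * apply geom_sum_root.
        -- intros E. apply (cis_neq_1 (INR (k - i) * al)); [apply Hal; lia|].
           rewrite <- (cis_opp_l (INR (k - i) * al)), E. ring.
        -- rewrite cis_pow. replace (INR N * - (INR (k - i) * al))
             with (- (INR (k - i) * (2 * PI))) by (rewrite <- HalN; ring).
           rewrite <- (cis_opp_l (INR (k - i) * (2 * PI))), cis_2PI_mult. Cring.
      * intros s _. rewrite cis_pow, <- cis_plus. f_equal. rewrite minus_INR by lia. ring.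
Qed.

(** Averaging over the [N]-th roots of unity isolates the coefficient of index
    [k] among those below [N]; the remaining tail is small for large [N]. *)
Lemma cauchy_estimate (a : nat -> C) A rho t M k : geom_bounded_C a A rho ->
  0 <= t -> rho * t < 1 ->
  (forall l, Cmod l = t -> Cmod (ksum_C a l) <= M) -> Cmod (a k) * t ^ k <= M.
Proof.
  intros Ha Ht Hrt HM. assert (Ha' := Ha). destruct Ha' as [HA [Hr Hai]].
  set (q := rho * t). assert (Hq : 0 <= q < 1).
  { unfold q. split; [now apply Rmult_le_pos | exact Hrt]. }
  apply le_epsilon. intros eps Heps.
  set (B := A / (1 - q)). assert (HB : 0 <= B) by (apply Rdiv_le_0_compat; lra).
  destruct (pow_lt_1_zero q) with (y := eps / (B + 1)) as [N0 HN0].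
  { rewrite Rabs_pos_eq; lra. }
  { apply Rdiv_lt_0_compat; lra. }
  set (N := (N0 + k + 1)%nat).
  specialize (HN0 N ltac:(unfold N; lia)). rewrite Rabs_pos_eq in HN0 by (apply pow_le; lra).
  assert (HN : 0 < INR N) by (apply lt_0_INR; unfold N; lia).
  set (al := 2 * PI / INR N).
  set (pt := fun s => Cmult (RtoC t) (cis (INR s * al))).
  assert (Hpt : forall s, Cmod (pt s) = t).
  { intros s. unfold pt. rewrite Cmod_mult, Cmod_cis, Cmod_R, Rabs_pos_eq; lra. }
  set (P := fun l => psum (G := C_AbelianMonoid) (fun i => Cmult (Cpow l i) (a i)) N : C).
  assert (Htail : forall s, Cmod (P (pt s)) <= M + eps).
  { intros s.
    assert (HS := ksum_C_correct a A rho (pt s) Ha ltac:(rewrite Hpt; exact Hrt)).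
    assert (HT := proj1 (is_series_shift _ N _) HS).
    assert (H1 : norm (minus (ksum_C a (pt s)) (psum (fun i => Cpow (pt s) i *: (a i : C_NormedModule)) N))
       <= A * q ^ N / (1 - q)).
    { refine (is_series_norm_le_geom C_NormedModule _ _ (A * q ^ N) q Hq _ _ HT).
      - apply Rmult_le_pos; [exact HA | apply pow_le; lra].
      - intros n. rewrite Rmult_assoc, <- pow_add. unfold q.
        rewrite <- (Hpt s) at 1.
        apply (geom_term C_NormedModule a A rho (pt s) (N + n) Ha). }
    rewrite norm_minus_sym in H1.
    assert (H2 := norm_plus_minus (P (pt s) : C_NormedModule) (ksum_C a (pt s))).
    change (norm (P (pt s) : C_NormedModule)) with (Cmod (P (pt s))) in H2.
    assert (H3 := HM (pt s) (Hpt s)).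
    change (norm (ksum_C a (pt s))) with (Cmod (ksum_C a (pt s))) in H2.
    assert (H4 : A * q ^ N / (1 - q) <= eps).
    { replace (A * q ^ N / (1 - q)) with (B * q ^ N) by (unfold B, Rdiv; ring).
      apply Rle_trans with ((B + 1) * (eps / (B + 1))).
      - apply Rmult_le_compat; try lra. apply pow_le; lra.
      - right. field. lra. }
    eapply Rle_trans; [apply H2|].
    apply Rplus_le_compat; [exact H3|]. eapply Rle_trans; [|exact H4]. exact H1. }
  set (avg := psum (G := C_AbelianMonoid)
     (fun s => Cmult (cis (- (INR k * (INR s * al)))) (P (pt s))) N : C).
  assert (E : avg = Cmult (RtoC (INR N)) (Cmult (RtoC (t ^ k)) (a k))).
  { unfold avg, P.
    rewrite (psum_ext _ (fun s => psum (G := C_AbelianMonoid) (fun i =>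
       Cmult (Cmult (RtoC (t ^ i)) (a i))
         (Cmult (cis (- (INR k * (INR s * al)))) (cis (INR i * (INR s * al))))) N)).
    - rewrite psum_switch.
      rewrite (psum_single _ N k).
      + rewrite psum_C_mult_l. unfold al.
        rewrite (root_orthogonality N k k) by (unfold N; lia). rewrite Nat.eqb_refl. Cring.
      + unfold N; lia.
      + intros i Hi Hne. rewrite psum_C_mult_l. unfold al.
        rewrite (root_orthogonality N i k) by (unfold N in *; lia).
        destruct (Nat.eqb_spec i k); [contradiction|]. apply Cmult_0_r.
    - intros s _. rewrite <- psum_C_mult_l. apply psum_ext. intros i _.
      unfold pt. rewrite Cpow_mult_l, cis_pow, RtoC_pow. Cring. }
  assert (Hav : Cmod avg <= INR N * (M + eps)).
  { eapply Rle_trans; [apply (psum_norm (X := C_NormedModule))|].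
    rewrite <- psum_R_const. apply psum_R_le. intros s _.
    change (Cmod (Cmult (cis (- (INR k * (INR s * al)))) (P (pt s))) <= M + eps).
    rewrite Cmod_mult, Cmod_cis, Rmult_1_l. apply Htail. }
  rewrite E, !Cmod_mult, !Cmod_R, (Rabs_pos_eq (INR N)), (Rabs_pos_eq (t ^ k)) in Hav
    by (try apply pow_le; lra).
  apply Rmult_le_reg_l with (INR N); [exact HN|].
  rewrite (Rmult_comm (Cmod (a k))). exact Hav.
Qed.

(** ** Taylor coefficients as functions of the centre *)

(** [multichoose m k] is the binomial coefficient of [m + k - 1] over [k], the
    coefficient of [X ^ k] in [(1 - X) ^ (- m)]. *)
Fixpoint multichoose (m : nat) : nat -> R :=
  match m with
  | O => fun k => match k with O => 1 | S _ => 0 end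
  | S m' => fix row k := match k with
                         | O => multichoose m' O
                         | S k' => row k' + multichoose m' (S k')
                         end
  end.

Lemma multichoose_0_r m : multichoose m 0 = 1.
Proof. induction m as [|m IH]; [reflexivity | exact IH]. Qed.

Lemma multichoose_S m k :
  multichoose (S m) (S k) = multichoose (S m) k + multichoose m (S k).
Proof. reflexivity. Qed.

Lemma multichoose_ge0 m k : 0 <= multichoose m k.
Proof.
  revert k. induction m as [|m IHm]; intros k.
  - destruct k; simpl; lra.
  - induction k as [|k IHk]; [apply IHm|]. rewrite multichoose_S.
    generalize (IHm (S k)). lra.
Qed.

Lemma multichoose_le_S m k : multichoose m k <= multichoose (S m) k.
Proof.
  destruct k as [|k]; [rewrite !multichoose_0_r; lra|].
  rewrite multichoose_S. generalize (multichoose_ge0 (S m) k). lra.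
Qed.

(** The binomial theorem, as [multichoose (m + 1) (k - m)] is [k] over [m]. *)
Lemma multichoose_binomial t x k :
  psum (fun m => multichoose (S m) (k - m) * t ^ (k - m) * x ^ m) (S k) = (t + x) ^ k.
Proof.
  induction k as [|k IH].
  - rewrite psum_R_S. simpl. change (@zero R_AbelianMonoid) with 0. Rring.
  - rewrite psum_R_S, Nat.sub_diag, multichoose_0_r.
    rewrite (psum_ext _ (fun m => t * (multichoose (S m) (k - m) * t ^ (k - m) * x ^ m)
        + multichoose m (S (k - m)) * t ^ (S (k - m)) * x ^ m)).
    2:{ intros m Hm. rewrite Nat.sub_succ_l by lia. rewrite multichoose_S. simpl pow. Rring. }
    rewrite psum_R_plus, psum_R_scal, IH.
    assert (E : psum (fun m => multichoose m (S (k - m)) * t ^ S (k - m) * x ^ m) (S k)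
      = x * psum (fun m => multichoose (S m) (k - m) * t ^ (k - m) * x ^ m) k :> R).
    { rewrite psum_S_l, <- psum_R_scal.
      change (@plus R_AbelianMonoid) with Rplus.
      replace (multichoose 0 (S (k - 0)) * t ^ S (k - 0) * x ^ 0) with 0 by (simpl; ring).
      rewrite Rplus_0_l. apply psum_ext. intros m Hm.
      replace (S (k - S m)) with (k - m)%nat by lia. simpl pow. Rring. }
    rewrite psum_R_S, Nat.sub_diag, multichoose_0_r in IH.
    rewrite E. simpl pow.
    replace (psum (fun m => multichoose (S m) (k - m) * t ^ (k - m) * x ^ m) k : R)
      with ((t + x) ^ k - 1 * t ^ 0 * x ^ k) by (rewrite <- IH; Rring).
    simpl pow. Rring.
Qed.

(** A single term in the expansion of [(1 + x) ^ (m + k)]. *)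
Lemma multichoose_le m k x : 0 < x -> multichoose (S m) k <= (1 + x) ^ (m + k) / x ^ m.
Proof.
  intros Hx. assert (Hp : 0 < x ^ m) by now apply pow_lt.
  apply Rmult_le_reg_r with (x ^ m); [exact Hp|].
  unfold Rdiv. rewrite Rmult_assoc, Rinv_l, Rmult_1_r by lra.
  rewrite <- (multichoose_binomial 1 x (m + k)).
  eapply Rle_trans; [|apply (psum_R_term _ _ m)].
  - cbv beta. replace (m + k - m)%nat with k by lia. rewrite pow1. lra.
  - intros j. apply Rmult_le_pos; [apply Rmult_le_pos|]; try apply multichoose_ge0;
      apply pow_le; lra.
  - lia.
Qed.

Section TaylorFamily.

Variables (X : NormedModule C_AbsRing) (HX : abs_complete X).
Variables (f : nat -> X) (A rho : R) (Hf : geom_bounded f A rho).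

(** The terms, up to the powers of [z], of [sum_k multichoose m k z^k f (n + k)]; for
    [n = i + m] this sum is the [i]-th entry of the [m]-th iterated quotient at [z]. *)
Definition binomial_family (m n k : nat) : X := RtoC (multichoose m k) *: f (n + k)%nat.

Lemma binomial_family_bounded m n x : 0 < x ->
  geom_bounded (binomial_family m n) (A * ((1 + x) ^ m / x ^ m) * rho ^ n) (rho * (1 + x)).
Proof.
  intros Hx. destruct Hf as [HA [Hr H]].
  assert (Hp : 0 < x ^ m) by now apply pow_lt.
  assert (Hq : 0 <= (1 + x) ^ m / x ^ m).
  { apply Rdiv_le_0_compat; [apply pow_le; lra | exact Hp]. }
  repeat split.
  - apply Rmult_le_pos; [now apply Rmult_le_pos | now apply pow_le].
  - apply Rmult_le_pos; lra.
  - intros k. unfold binomial_family.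
    rewrite norm_scalC, Cmod_R, Rabs_pos_eq by apply multichoose_ge0.
    replace (A * ((1 + x) ^ m / x ^ m) * rho ^ n * (rho * (1 + x)) ^ k)
      with ((1 + x) ^ (m + k) / x ^ m * (A * rho ^ (n + k))).
    + apply Rmult_le_compat; [apply multichoose_ge0 | apply norm_ge_0 | | apply H].
      eapply Rle_trans; [apply multichoose_le_S | now apply multichoose_le].
    + rewrite Rpow_mult_distr, !pow_add. unfold Rdiv. ring.
Qed.

Lemma ksum_plus g h B r l C0 : geom_bounded g B r -> geom_bounded h C0 r -> r * Cmod l < 1 ->
  ksum (fun k => plus (g k) (h k)) l = plus (ksum g l) (ksum h l) :> X.
Proof.
  intros Hg Hh Hl. apply vsum_unique.
  apply is_series_ext with (fun i => plus (Cpow l i *: g i) (Cpow l i *: h i)).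
  - intros i. module_eq.
  - apply (is_series_plus (V := X)); eapply ksum_correct; eassumption.
Qed.

Lemma small_enlargement z : rho * Cmod z < 1 -> exists x, 0 < x /\ rho * (1 + x) * Cmod z < 1.
Proof.
  intros Hz. destruct Hf as [_ [Hr _]].
  exists ((1 - rho * Cmod z) / 2). split; [lra|].
  assert (0 <= rho * Cmod z) by (apply Rmult_le_pos; [exact Hr | apply Cmod_ge_0]).
  replace (rho * (1 + (1 - rho * Cmod z) / 2) * Cmod z)
    with (rho * Cmod z * (1 + (1 - rho * Cmod z) / 2)) by ring.
  nra.
Qed.

Lemma binomial_family_rec z m n : rho * Cmod z < 1 ->
  ksum (binomial_family (S m) n) z =
  plus (ksum (binomial_family m n) z) (z *: ksum (binomial_family (S m) (S n)) z).
Proof.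
  intros Hz. destruct (small_enlargement z Hz) as [x [Hx Hxz]].
  assert (H0 := binomial_family_bounded m n x Hx).
  assert (H1 := binomial_family_bounded (S m) n x Hx).
  assert (H2 := binomial_family_bounded (S m) (S n) x Hx).
  rewrite (ksum_unfold X HX _ _ _ z H1 Hxz), (ksum_unfold X HX _ _ _ z H0 Hxz).
  replace (ksum (fun k => binomial_family (S m) n (S k)) z)
    with (plus (ksum (binomial_family (S m) (S n)) z)
               (ksum (fun k => binomial_family m n (S k)) z)).
  - unfold binomial_family at 1 4. rewrite !multichoose_0_r. module_eq.
  - etransitivity; [symmetry; exact (ksum_plus _ _ _ _ z _ H2
      (geom_bounded_shift X _ _ _ 1 H0) Hxz)|].
    f_equal. apply FunctionalExtensionality.functional_extensionality. intros k.
    unfold binomial_family. change (1 + k)%nat with (S k).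
    replace (S n + k)%nat with (n + S k)%nat by lia.
    rewrite multichoose_S, RtoC_plus. module_eq.
Qed.

(** Iterating gives [d i = z^n d (i + n)], which tends to zero. *)
Lemma bounded_recursion_zero (d : nat -> X) B r z : geom_bounded d B r -> r * Cmod z < 1 ->
  (forall i, d i = z *: d (S i)) -> forall i, d i = zero.
Proof.
  intros [HB [Hr Hd]] Hz Hrec i. apply (norm_eq_zero (V := X)).
  apply Rle_antisym; [|apply norm_ge_0]. apply le_epsilon. intros eps Heps.
  assert (E : forall n, d i = Cpow z n *: d (n + i)%nat).
  { induction n as [|n IH]; [simpl; module_eq|].
    rewrite IH, (Hrec (n + i)%nat), Cpow_S. simpl Nat.add. module_eq. }
  assert (Hq : 0 <= r * Cmod z) by (apply Rmult_le_pos; [exact Hr | apply Cmod_ge_0]).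
  set (c := B * r ^ i). assert (Hc : 0 <= c) by (apply Rmult_le_pos; [exact HB | now apply pow_le]).
  destruct (pow_lt_1_zero (r * Cmod z)) with (y := eps / (c + 1)) as [N HN].
  { rewrite Rabs_pos_eq; lra. }
  { apply Rdiv_lt_0_compat; lra. }
  specialize (HN N (Nat.le_refl _)). rewrite Rabs_pos_eq in HN by now apply pow_le.
  rewrite (E N), norm_scalC, Cmod_pow, Rplus_0_l.
  apply Rle_trans with (c * (r * Cmod z) ^ N).
  - replace (c * (r * Cmod z) ^ N) with (Cmod z ^ N * (B * r ^ (N + i)))
      by (unfold c; rewrite Rpow_mult_distr, pow_add; ring).
    apply Rmult_le_compat_l; [apply pow_le, Cmod_ge_0 | apply Hd].
  - apply Rle_trans with ((c + 1) * (eps / (c + 1))).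
    + apply Rmult_le_compat; try lra. now apply pow_le.
    + right. field. lra.
Qed.

(** A geometrically bounded solution [q] of [f (S i) = q i - z q (S i)] is unique, and
    both sides solve this recursion for the quotient of order [m - 1]. *)
Lemma quotn_binomial z m i : rho * Cmod z < 1 ->
  quotn m f z i = ksum (binomial_family m (i + m)) z.
Proof.
  intros Hz. destruct (small_enlargement z Hz) as [x [Hx Hxz]].
  assert (Hf' := Hf). destruct Hf' as [HA [Hr _]].
  revert i. induction m as [|m IH]; intros i.
  - rewrite (ksum_unfold X HX _ _ _ z (binomial_family_bounded 0 (i + 0) x Hx) Hxz).
    replace (ksum (fun k => binomial_family 0 (i + 0) (S k)) z) with (zero : X).
    + simpl quotn. unfold binomial_family. simpl. rewrite !Nat.add_0_r. module_eq.
    + symmetry. apply vsum_unique. change (zero : X) with (psum (G := X) (fun _ => zero) 0).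
      apply is_series_ext with (fun _ : nat => (zero : X)).
      * intros k. unfold binomial_family. simpl. module_eq.
      * apply (is_series_finite X (fun _ => zero) 0). reflexivity.
  - set (h := quotn (S m) f z).
    set (H := fun i => ksum (binomial_family (S m) (i + S m)) z).
    set (c := A * ((1 + x) ^ S m / x ^ S m) * rho ^ (S m) / (1 - rho * (1 + x) * Cmod z)).
    assert (Hh := quotn_bounded X HX f A rho z (S m) Hf Hz). fold h in Hh.
    assert (HH : geom_bounded H c rho).
    { repeat split; [|exact Hr|].
      - unfold c. apply Rdiv_le_0_compat; [|lra].
        apply (binomial_family_bounded (S m) (S m) x Hx).
      - intros j. eapply Rle_trans.
        + apply (ksum_norm X HX _ _ _ z (binomial_family_bounded (S m) (j + S m) x Hx) Hxz).
        + right. unfold c. rewrite pow_add. unfold Rdiv. ring. }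
    assert (Hd : geom_bounded (fun j => minus (h j) (H j))
       (A * (rho / (1 - rho * Cmod z)) ^ S m + c) rho).
    { destruct Hh as [Hh0 [_ Hh1]], HH as [HH0 [_ HH1]].
      split; [lra|]. split; [exact Hr|]. intros j.
      eapply Rle_trans; [apply norm_minus_le|]. rewrite Rmult_plus_distr_r.
      apply Rplus_le_compat; [apply Hh1 | apply HH1]. }
    assert (E : minus (h i) (H i) = zero).
    { apply (bounded_recursion_zero (fun j => minus (h j) (H j)) _ rho z Hd Hz).
      intros j.
      assert (E1 := quot_rec X HX (quotn m f z) _ rho z j (quotn_bounded X HX f A rho z m Hf Hz) Hz).
      change (quot (quotn m f z) z) with h in E1. rewrite IH in E1.
      assert (E2 := binomial_family_rec z m (j + S m) Hz).
      fold (H j) in E2.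
      replace (S (j + S m)) with (S j + S m)%nat in E2 by lia. fold (H (S j)) in E2.
      replace (S j + m)%nat with (j + S m)%nat in E1 by lia.
      rewrite E2, E1. module_eq. }
    fold (H i). replace (h i) with (plus (minus (h i) (H i)) (H i)) by module_eq.
    rewrite E. apply plus_zero_l.
Qed.

Lemma taylor_binomial z m : rho * Cmod z < 1 ->
  taylor f z m = ksum (binomial_family (S m) m) z.
Proof.
  intros Hz. assert (Hq := quotn_bounded X HX f A rho z m Hf Hz).
  assert (E0 := quot_rec0 X HX _ _ rho z Hq Hz).
  change (quot (quotn m f z) z O) with (quotn (S m) f z O) in E0.
  change (ksum (quotn m f z) z) with (taylor f z m) in E0.
  rewrite !quotn_binomial in E0 by exact Hz. simpl Nat.add in E0.
  rewrite (binomial_family_rec z m m Hz), E0. module_eq.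
Qed.

End TaylorFamily.

(** ** A single power series beyond the unit disc *)

Definition sums_on_disc (a : nat -> C) (f : C -> C) (r : R) : Prop :=
  forall z, Cmod z < r ->
    is_series (V := C_NormedModule) (fun i => Cpow z i *: (a i : C_NormedModule)) (f z).

Definition local_series (f : C -> C) (z : C) (b : nat -> C) (M delta : R) : Prop :=
  geom_bounded_C b M (/ delta) /\ sums_on_disc b (fun u => f (Cplus z u)) delta.

Lemma sums_on_disc_bounded a f r s : sums_on_disc a f r -> 0 < s < r ->
  exists A, geom_bounded_C a A (/ s).
Proof.
  intros H Hs. apply (geom_bounded_of_series a s (f (RtoC s))); [lra|].
  apply H. rewrite Cmod_R, Rabs_pos_eq; lra.
Qed.

Lemma sums_on_disc_ksum a f r A s z : sums_on_disc a f r -> geom_bounded_C a A (/ s) ->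
  0 < s -> Cmod z < s -> Cmod z < r -> f z = ksum_C a z.
Proof.
  intros H Ha Hs Hz Hzr. symmetry. apply vsum_unique. now apply H.
Qed.

Lemma inv_mult_lt_1 s x : 0 < s -> x < s -> / s * x < 1.
Proof.
  intros Hs Hx. rewrite <- (Rinv_l s) by lra. apply Rmult_lt_compat_l; [|exact Hx].
  now apply Rinv_0_lt_compat.
Qed.

(** Uniqueness of coefficients, applied to the expansion of the series [a] around [z]. *)
Lemma local_series_coefs a f r z b M delta A s : sums_on_disc a f r ->
  geom_bounded_C a A (/ s) -> 0 < s <= r -> Cmod z < s -> 0 < delta ->
  local_series f z b M delta -> forall m, b m = taylor_C a z m.
Proof.
  intros H Ha Hs Hz Hd [Hb Hbf].
  assert (Hz' : / s * Cmod z < 1) by (apply inv_mult_lt_1; lra).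
  assert (Ht : geom_bounded_C (taylor_C a z) (A / (1 - / s * Cmod z)) (/ s / (1 - / s * Cmod z))).
  { assert (0 < / s) by (apply Rinv_0_lt_compat; lra). assert (HA : 0 <= A) by apply Ha.
    repeat split.
    - apply Rdiv_le_0_compat; lra.
    - apply Rdiv_le_0_compat; lra.
    - intros m. exact (taylor_norm C_NormedModule C_abs_complete a A (/ s) z m Ha Hz'). }
  apply (coefs_unique b (taylor_C a z) M (A / (1 - / s * Cmod z)) (/ delta)
    (/ s / (1 - / s * Cmod z)) (Rmin delta (s - Cmod z))
    (fun u => f (Cplus z u))); [apply Rmin_case; lra | exact Hb | exact Ht | |].
  - intros u Hu. apply Hbf. eapply Rlt_le_trans; [exact Hu | apply Rmin_l].
  - intros u Hu. assert (Hu' := Rlt_le_trans _ _ _ Hu (Rmin_r _ _)).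
    assert (Hzu : Cmod (Cplus z u) < s).
    { eapply Rle_lt_trans; [apply Cmod_triangle|]. lra. }
    rewrite (sums_on_disc_ksum a f r A s (Cplus z u) H Ha) by lra.
    apply (taylor_series C_NormedModule C_abs_complete a A (/ s) z u Ha).
    apply inv_mult_lt_1; lra.
Qed.

(** Expand [(t + delta / 2) ^ k] by the binomial theorem; the [m]-th term contributes at
    most [M 2^-m]. *)
Lemma coef_growth (c : R) (k : nat) t delta M : 0 <= c -> 0 <= t -> 0 < delta -> 0 <= M ->
  (forall m, (m <= k)%nat -> multichoose (S m) (k - m) * c * t ^ (k - m) <= M * (/ delta) ^ m) ->
  c * (t + delta / 2) ^ k <= 2 * M.
Proof.
  intros Hc Ht Hd HM H. rewrite <- multichoose_binomial, <- psum_R_scal.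
  apply Rle_trans with (psum (fun m => M * (/ 2) ^ m) (S k)).
  - apply psum_R_le. intros m Hm.
    replace (c * (multichoose (S m) (k - m) * t ^ (k - m) * (delta / 2) ^ m))
      with (multichoose (S m) (k - m) * c * t ^ (k - m) * (delta / 2) ^ m) by ring.
    apply Rle_trans with (M * (/ delta) ^ m * (delta / 2) ^ m).
    + apply Rmult_le_compat_r; [apply pow_le; lra | apply H; lia].
    + right. rewrite Rmult_assoc, <- Rpow_mult_distr. do 2 f_equal. field. lra.
  - rewrite psum_R_scal. rewrite (Rmult_comm 2). apply Rmult_le_compat_l; [exact HM|].
    eapply Rle_trans; [apply psum_geom_le; lra|]. lra.
Qed.

(** If the local series at all points of the disc converge on discs of a common
    radius with a common bound, Cauchy's estimate for the [m]-th Taylor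
    coefficient, summed over [m], enlarges the disc of convergence at [0] by a
    fixed amount. *)
Lemma extend_disc a f r delta M : sums_on_disc a f r -> 0 < delta <= r -> r <= 1 -> 0 <= M ->
  (forall z, Cmod z <= 1 -> exists b, local_series f z b M delta) ->
  sums_on_disc a f (r + delta / 8) /\ geom_bounded_C a (2 * M) (/ (r + delta / 4)).
Proof.
  intros H Hd Hr1 HM Hloc.
  set (t := r - delta / 4). assert (Ht : 0 < t < r) by (unfold t; lra).
  set (s := r - delta / 16). assert (Hs : t < s < r) by (unfold t, s; lra).
  assert (Hs0 : 0 < s < r) by lra.
  destruct (sums_on_disc_bounded a f r s H Hs0) as [A Ha].
  assert (Hrt : / s * t < 1) by (apply inv_mult_lt_1; lra).
  (* Cauchy's estimate, on the circle of radius [t], for the [m]-th Taylor coefficient as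
     a function of the centre. *)
  assert (Hgr : forall m k, multichoose (S m) k * Cmod (a (m + k)%nat) * t ^ k <= M * (/ delta) ^ m).
  { intros m k.
    destruct (small_enlargement C_NormedModule a A (/ s) Ha (RtoC t)) as [x [Hx Hxt]].
    { rewrite Cmod_R, Rabs_pos_eq; lra. }
    assert (HB := binomial_family_bounded C_NormedModule a A (/ s) Ha (S m) m x Hx).
    rewrite Cmod_R, (Rabs_pos_eq t) in Hxt by lra.
    assert (HC := cauchy_estimate _ _ _ t (M * (/ delta) ^ m) k HB ltac:(lra) Hxt).
    unfold binomial_family in HC.
    assert (HC2 : Cmod (Cmult (RtoC (multichoose (S m) k)) (a (m + k)%nat)) * t ^ k
      <= M * (/ delta) ^ m).
    { apply HC. intros l Hl.
      assert (Hl' : / s * Cmod l < 1) by (rewrite Hl; exact Hrt).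
      destruct (Hloc l ltac:(lra)) as [b Hb].
      assert (E := taylor_binomial C_NormedModule C_abs_complete a A (/ s) Ha l m Hl').
      unfold binomial_family in E. rewrite <- E.
      rewrite <- (local_series_coefs a f r l b M delta A s H Ha ltac:(lra) ltac:(lra) ltac:(lra) Hb m).
      apply Hb. }
    rewrite Cmod_mult, Cmod_R, Rabs_pos_eq in HC2 by apply multichoose_ge0. exact HC2. }
  assert (Hg : geom_bounded_C a (2 * M) (/ (r + delta / 4))).
  { assert (Hp : 0 < r + delta / 4) by lra.
    repeat split; [lra | left; now apply Rinv_0_lt_compat |].
    intros k. change (Cmod (a k) <= 2 * M * (/ (r + delta / 4)) ^ k).
    assert (Hpk : 0 < (r + delta / 4) ^ k) by now apply pow_lt.
    rewrite pow_inv. apply Rmult_le_reg_r with ((r + delta / 4) ^ k); [exact Hpk|].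
    rewrite Rmult_assoc, Rinv_l, Rmult_1_r by lra.
    replace (r + delta / 4) with (t + delta / 2) by (unfold t; field).
    apply coef_growth; try lra; [apply Cmod_ge_0|].
    intros m Hm. specialize (Hgr m (k - m)%nat).
    replace (m + (k - m))%nat with k in Hgr by lia. exact Hgr. }
  split; [|exact Hg].
  intros z Hz. destruct (Rlt_le_dec (Cmod z) r) as [Hzr|Hzr]; [now apply H|].
  assert (Hz0 : 0 < Cmod z) by lra.
  (* Beyond radius [r] the enlarged series is compared with the local series at a point
     [z0] inside the old disc at distance less than [delta]. *)
  set (z0 := Cmult (RtoC ((r - delta / 8) / Cmod z)) z).
  assert (Hz0m : Cmod z0 = r - delta / 8).
  { unfold z0. rewrite Cmod_mult, Cmod_R, Rabs_pos_eq.
    - field. lra.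
    - apply Rdiv_le_0_compat; lra. }
  set (u := Cminus z z0).
  assert (Hum : Cmod u = Cmod z - (r - delta / 8)).
  { unfold u, z0.
    replace (Cminus z (Cmult (RtoC ((r - delta / 8) / Cmod z)) z))
      with (Cmult (RtoC (1 - (r - delta / 8) / Cmod z)) z) by (rewrite RtoC_minus; ring).
    assert (Hq : (r - delta / 8) / Cmod z <= 1).
    { apply Rmult_le_reg_r with (Cmod z); [exact Hz0|]. unfold Rdiv.
      rewrite Rmult_assoc, Rinv_l by lra. lra. }
    rewrite Cmod_mult, Cmod_R, Rabs_pos_eq by lra. field. lra. }
  assert (Ezu : z = Cplus z0 u) by (unfold u; ring).
  assert (Hp : 0 < r + delta / 4) by lra.
  assert (Hk := ksum_C_correct a (2 * M) _ z Hg ltac:(apply inv_mult_lt_1; lra)).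
  destruct (Hloc z0 ltac:(lra)) as [b Hb].
  assert (Eb := local_series_coefs a f r z0 b M delta A s H Ha ltac:(lra)
    ltac:(unfold s; lra) ltac:(lra) Hb).
  replace (f z) with (ksum_C a z); [exact Hk|].
  assert (H1 := taylor_series C_NormedModule C_abs_complete a (2 * M) _ z0 u Hg
    ltac:(apply inv_mult_lt_1; lra)).
  rewrite <- Ezu in H1.
  assert (H2 := proj2 Hb u ltac:(lra)). simpl in H2. rewrite <- Ezu in H2.
  apply (is_series_unique_C _ _ _ H1).
  refine (is_series_ext _ _ _ _ H2). intros i. now rewrite Eb.
Qed.

Lemma analytic_at_local f z : analytic_at f z ->
  exists b A s, 0 < s /\ local_series f z b A s.
Proof.
  intros [b [r [Hr H]]].
  set (s := r / 2).
  assert (Hs : sums_on_disc b (fun u => f (Cplus z u)) r).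
  { intros u Hu.
    assert (E : Cminus (Cplus z u) z = u) by ring.
    assert (Hzu := H (Cplus z u)). rewrite E in Hzu. exact (Hzu Hu). }
  destruct (sums_on_disc_bounded b _ r s Hs) as [A HA]; [unfold s; lra|].
  exists b, A, s. split; [unfold s; lra|]. split; [exact HA|].
  intros u Hu. apply Hs. unfold s in Hu. lra.
Qed.

(** As long as the centre moves by at most half the radius, the bounds only change by a
    factor. *)
Lemma local_series_move f c b A s w d : local_series f c b A s -> 0 < d ->
  A <= / d -> 4 * d <= s -> Cmod w < 2 * d ->
  local_series f (Cplus c w) (taylor_C b w) (2 * / d) d.
Proof.
  intros [Hb Hbf] Hd HAd Hds Hw.
  assert (Hs : 0 < s) by lra.
  assert (H0 := Cmod_ge_0 w).
  assert (Hw' : / s * Cmod w <= 1 / 2).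
  { apply Rmult_le_reg_l with s; [exact Hs|].
    rewrite <- Rmult_assoc, Rinv_r, Rmult_1_l by lra. lra. }
  assert (His : 0 < / s) by now apply Rinv_0_lt_compat.
  assert (Hid : 0 < / d) by now apply Rinv_0_lt_compat.
  assert (HA : 0 <= A) by apply Hb.
  split.
  - split; [lra|]. split; [lra|]. intros m.
    eapply Rle_trans; [apply (taylor_norm C_NormedModule C_abs_complete b A (/ s) w m Hb); lra|].
    apply Rmult_le_compat.
    + apply Rdiv_le_0_compat; lra.
    + apply pow_le. apply Rdiv_le_0_compat; lra.
    + apply Rle_trans with (A * 2); [|lra].
      apply Rmult_le_compat_l; [exact HA|].
      rewrite <- (Rinv_inv 2). apply Rinv_le_contravar; lra.
    + apply pow_incr. split; [apply Rdiv_le_0_compat; lra|].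
      apply Rle_trans with (/ s * 2).
      * apply Rmult_le_compat_l; [lra|].
        rewrite <- (Rinv_inv 2). apply Rinv_le_contravar; lra.
      * apply Rmult_le_reg_l with s; [exact Hs|].
        rewrite <- Rmult_assoc, Rinv_r, Rmult_1_l by lra.
        apply Rmult_le_reg_r with d; [exact Hd|]. rewrite Rmult_assoc, Rinv_l by lra. lra.
  - intros u Hu.
    replace (Cplus (Cplus c w) u) with (Cplus c (Cplus w u)) by ring.
    assert (Hwu : Cmod (Cplus w u) < s).
    { eapply Rle_lt_trans; [apply Cmod_triangle|]. lra. }
    rewrite (sums_on_disc_ksum b (fun u => f (Cplus c u)) s A s (Cplus w u) Hbf Hb) by lra.
    apply (taylor_series C_NormedModule C_abs_complete b A (/ s) w u Hb).
    apply inv_mult_lt_1; lra.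
Qed.

Lemma Cmod_le_Rabs (x y : R) : Cmod (x, y) <= Rabs x + Rabs y.
Proof.
  replace ((x, y) : C) with (Cplus (RtoC x) (Cmult Ci (RtoC y))).
  - eapply Rle_trans; [apply Cmod_triangle|]. rewrite Cmod_mult, Cmod_Ci, !Cmod_R. lra.
  - unfold Cplus, Cmult, Ci, RtoC; simpl. f_equal; ring.
Qed.

(** A gauge on the square assigns to the points of the closed disc a radius and a bound
    for their series and keeps all other points away from it; by compactness of the
    square the gauge can be bounded below. *)
Lemma uniform_local_series f : (forall z, Cmod z <= 1 -> analytic_at f z) ->
  exists delta M, 0 < delta /\ 0 <= M /\
    forall z, Cmod z <= 1 -> exists b, local_series f z b M delta.
Proof.
  intros Hf.
  assert (Hex : forall x y : R, exists d : posreal,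
    (Cmod (x, y) <= 1 -> exists b A s, local_series f (x, y) b A s /\ A <= / d /\ 4 * d <= s) /\
    (1 < Cmod (x, y) -> 2 * d <= Cmod (x, y) - 1)).
  { intros x y. destruct (Rle_lt_dec (Cmod (x, y)) 1) as [H|H].
    - destruct (analytic_at_local f (x, y) (Hf _ H)) as [b [A [s [Hs Hb]]]].
      assert (HA : 0 <= A) by apply Hb.
      assert (Hd : 0 < Rmin (s / 4) (/ (A + 1))).
      { apply Rmin_case; [lra | apply Rinv_0_lt_compat; lra]. }
      exists (mkposreal _ Hd). simpl. split; [intros _ | lra].
      exists b, A, s. split; [exact Hb|]. split.
      + apply Rle_trans with (/ / (A + 1)); [rewrite Rinv_inv; lra|].
        apply Rinv_le_contravar; [exact Hd | apply Rmin_r].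
      + generalize (Rmin_l (s / 4) (/ (A + 1))). lra.
    - assert (Hd : 0 < (Cmod (x, y) - 1) / 2) by lra.
      exists (mkposreal _ Hd). simpl. split; lra. }
  set (D := fun x y => proj1_sig (constructive_indefinite_description _ (Hex x y))).
  assert (HD : forall x y,
    (Cmod (x, y) <= 1 -> exists b A s, local_series f (x, y) b A s /\ A <= / D x y /\ 4 * D x y <= s) /\
    (1 < Cmod (x, y) -> 2 * D x y <= Cmod (x, y) - 1)).
  { intros x y. exact (proj2_sig (constructive_indefinite_description _ (Hex x y))). }
  destruct (compactness_value_2d (-1) 1 (-1) 1 D) as [d Hd].
  assert (Hd0 := cond_pos d).
  exists d, (2 * / d). split; [exact Hd0|]. split.
  { generalize (Rinv_0_lt_compat _ Hd0). lra. }
  intros [x y] Hz.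
  assert (Hm := Rmax_Cmod (x, y)). simpl in Hm.
  assert (Hx : Rabs x <= 1) by (generalize (Rmax_l (Rabs x) (Rabs y)); lra).
  assert (Hy : Rabs y <= 1) by (generalize (Rmax_r (Rabs x) (Rabs y)); lra).
  apply Rabs_le_between in Hx. apply Rabs_le_between in Hy.
  apply NNPP. intros Hno. apply (Hd x y Hx Hy). intros [u [v [_ [_ [Hu [Hv Hdd]]]]]].
  apply Hno. clear Hno.
  assert (Huv : Cmod (Cminus (x, y) (u, v)) < 2 * D u v).
  { eapply Rle_lt_trans; [apply (Cmod_le_Rabs (x - u) (y - v))|]. lra. }
  destruct (Rle_lt_dec (Cmod (u, v)) 1) as [H|H].
  - destruct (proj1 (HD u v) H) as [b [A [s [Hb [HA Hs]]]]].
    assert (HL := local_series_move f (u, v) b A s (Cminus (x, y) (u, v)) (D u v) Hb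
      (cond_pos _) HA Hs Huv).
    assert (E : Cplus (u, v) (Cminus (x, y) (u, v)) = (x, y)) by Cring.
    rewrite E in HL.
    exists (taylor_C b (Cminus (x, y) (u, v))). destruct HL as [HL1 HL2]. split.
    + assert (/ D u v <= / d) by (apply Rinv_le_contravar; assumption).
      apply geom_bounded_weaken with (1 := HL1); lra.
    + intros w Hw. apply HL2. lra.
  - exfalso. assert (H2 := proj2 (HD u v) H).
    assert (Cmod (u, v) <= Cmod (x, y) + Cmod (Cminus (x, y) (u, v))); [|lra].
    assert (E : Cplus (x, y) (Copp (Cminus (x, y) (u, v))) = (u, v)) by Cring.
    rewrite <- E at 1. eapply Rle_trans; [apply Cmod_triangle|]. rewrite Cmod_opp. lra.
Qed.

(** From [0] on, each step enlarges the disc of convergence by [delta / 8], until its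
    radius exceeds [1]. *)
Theorem analytic_near_closed_disc_series f : analytic_near_closed_disc f ->
  exists a A rho, 0 <= rho < 1 /\ geom_bounded_C a A rho /\
    forall z, Cmod z <= 1 -> f z = ksum_C a z.
Proof.
  intros [O [_ [HO Han]]].
  assert (Hf : forall z, Cmod z <= 1 -> analytic_at f z) by (intros z Hz; apply Han, HO, Hz).
  destruct (uniform_local_series f Hf) as [delta0 [M0 [Hd0 [HM0 Hloc0]]]].
  set (delta := Rmin delta0 1).
  assert (Hd : 0 < delta) by (apply Rmin_case; lra).
  assert (Hd1 : delta <= 1) by apply Rmin_r.
  assert (Hdd : delta <= delta0) by apply Rmin_l.
  assert (Hloc : forall z, Cmod z <= 1 -> exists b, local_series f z b M0 delta).
  { intros z Hz. destruct (Hloc0 z Hz) as [b [Hb1 Hb2]]. exists b. split.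
    - apply geom_bounded_weaken with (1 := Hb1); [lra|]. now apply Rinv_le_contravar.
    - intros u Hu. apply Hb2. lra. }
  destruct (Hloc (RtoC 0)) as [a [_ Ha]]; [rewrite Cmod_0; lra|].
  assert (Ha0 : sums_on_disc a f delta).
  { intros z Hz. generalize (Ha z Hz). simpl. now replace (Cplus (RtoC 0) z) with z by ring. }
  assert (Hit : forall n, (exists r, 1 < r /\ sums_on_disc a f r) \/
     (sums_on_disc a f (delta + INR n * (delta / 8)))).
  { induction n as [|n IH].
    - right. simpl. rewrite Rmult_0_l, Rplus_0_r. exact Ha0.
    - destruct IH as [IH|IH]; [now left|].
      assert (Hn := pos_INR n).
      assert (0 <= INR n * (delta / 8)) by (apply Rmult_le_pos; lra).
      destruct (Rlt_le_dec 1 (delta + INR n * (delta / 8))) as [H1|H1]; [left; eauto|].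
      right. rewrite S_INR.
      replace (delta + (INR n + 1) * (delta / 8)) with (delta + INR n * (delta / 8) + delta / 8)
        by field.
      apply (extend_disc a f _ delta M0 IH); auto; lra. }
  assert (Hr : exists r, 1 < r /\ sums_on_disc a f r).
  { destruct (INR_unbounded (8 / delta)) as [n Hn].
    destruct (Hit n) as [H|H]; [exact H|].
    exists (delta + INR n * (delta / 8)). split; [|exact H].
    apply Rlt_le_trans with (INR n * (delta / 8)); [|lra].
    replace 1 with (8 / delta * (delta / 8)) by (field; lra).
    apply Rmult_lt_compat_r; lra. }
  destruct Hr as [r [Hr1 Hr]].
  set (s := (1 + r) / 2).
  destruct (sums_on_disc_bounded a f r s Hr) as [A HA]; [unfold s; lra|].
  exists a, A, (/ s). split.
  - split; [left; apply Rinv_0_lt_compat; unfold s; lra|].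
    rewrite <- Rinv_1. apply Rinv_lt_contravar; unfold s; lra.
  - split; [exact HA|]. intros z Hz.
    apply (sums_on_disc_ksum a f r A s z Hr HA); unfold s; lra.
Qed.

(** * Sets of positive lower density *)

Definition linearly_recurrent (M : nat -> Prop) : Prop :=
  exists (sigma : nat -> nat) (D : nat), (forall i, (sigma i < sigma (S i))%nat) /\
    (forall i, M (sigma i)) /\ forall i, (sigma i <= D * (i + 1))%nat.

Lemma linearly_recurrent_incl (M M' : nat -> Prop) : (forall n, M n -> M' n) ->
  linearly_recurrent M -> linearly_recurrent M'.
Proof. intros H [s [D [H1 [H2 H3]]]]. exists s, D. repeat split; auto. Qed.

Lemma card_upto_ge (M : nat -> Prop) (sigma : nat -> nat) N k :
  (forall i j, sigma i = sigma j -> i = j) -> (forall i, M (sigma i)) ->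
  (forall i, (i < k)%nat -> (sigma i <= N)%nat) -> (k <= card_upto M N)%nat.
Proof.
  intros Hinj HM Hle. unfold card_upto.
  rewrite <- (length_seq k 0) at 1. rewrite <- (length_map sigma (seq 0 k)).
  apply NoDup_incl_length.
  - apply Injective_map_NoDup; [exact Hinj | apply seq_NoDup].
  - intros n Hn. apply in_map_iff in Hn. destruct Hn as [i [<- Hi]].
    apply in_seq in Hi. apply filter_In. split.
    + apply in_seq. specialize (Hle i). lia.
    + destruct (excluded_middle_informative (M (sigma i))) as [_|Hno]; [reflexivity|].
      destruct (Hno (HM i)).
Qed.

(** At least about [N / D] of the times up to [N] belong to the set. *)
Lemma lower_density_pos (M : nat -> Prop) :
  linearly_recurrent M -> Rbar_lt 0 (lower_density M).
Proof.
  intros [sigma [D [Hs [HM HD]]]].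
  assert (Hmono : forall i j, (i < j)%nat -> (sigma i < sigma j)%nat).
  { intros i j Hij. induction Hij as [|j Hij IH]; [apply Hs|]. generalize (Hs j). lia. }
  assert (Hinj : forall i j, sigma i = sigma j -> i = j).
  { intros i j E. destruct (Nat.lt_trichotomy i j) as [H|[H|H]]; [|exact H|];
      apply Hmono in H; lia. }
  assert (HD0 : (0 < D)%nat).
  { destruct D; [|lia]. generalize (HD 1%nat) (Hs O). lia. }
  apply Rbar_lt_le_trans with (Finite (/ (2 * INR D))).
  { simpl. apply Rinv_0_lt_compat. generalize (lt_0_INR D HD0). lra. }
  unfold lower_density.
  rewrite <- (LimInf_seq_const (/ (2 * INR D))). apply LimInf_le.
  exists (2 * D)%nat. intros N HN.
  assert (Hk : (N / D <= card_upto M N)%nat).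
  { apply card_upto_ge with sigma; [exact Hinj | exact HM |].
    intros i Hi. eapply Nat.le_trans; [apply HD|].
    apply Nat.le_trans with (D * (N / D))%nat; [apply Nat.mul_le_mono_l; lia|].
    apply Nat.Div0.mul_div_le. }
  assert (H2 : (N <= 2 * (D * card_upto M N))%nat).
  { assert (Hd := Nat.div_mod_eq N D). assert (Hm := Nat.mod_upper_bound N D ltac:(lia)).
    assert (1 <= N / D)%nat by (apply Nat.div_le_lower_bound; lia).
    nia. }
  apply le_INR in H2. rewrite !mult_INR in H2. simpl (INR 2) in H2.
  assert (HDR := lt_0_INR D HD0). assert (HNR : 0 < INR N) by (apply lt_0_INR; lia).
  apply Rmult_le_reg_r with (INR N * (2 * INR D)); [apply Rmult_lt_0_compat; lra|].
  replace (/ (2 * INR D) * (INR N * (2 * INR D))) with (INR N) by (field; lra).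
  replace (INR (card_upto M N) / INR N * (INR N * (2 * INR D)))
    with (2 * (INR D * INR (card_upto M N))) by (field; lra).
  lra.
Qed.

(** * The ruler sequence *)

Fixpoint two_adic_val (q : positive) : nat :=
  match q with xO r => S (two_adic_val r) | _ => O end.

Fixpoint digit_sum (q : positive) : nat :=
  match q with xO r => digit_sum r | xI r => S (digit_sum r) | xH => 1%nat end.

(** Adding [1] turns the trailing ones into zeros and the next zero into a one. *)
Lemma digit_sum_succ q :
  (digit_sum q + 1 = digit_sum (Pos.succ q) + two_adic_val (Pos.succ q))%nat.
Proof. induction q; simpl; lia. Qed.

Definition ruler (k : nat) : nat := two_adic_val (Pos.of_succ_nat k).

Fixpoint ruler_sum (k : nat) : nat :=
  match k with O => O | S j => ruler_sum j + ruler j end.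

(** Legendre's formula for the exponent of [2] in a factorial. *)
Lemma ruler_sum_digits k : (ruler_sum (S k) + digit_sum (Pos.of_succ_nat k) = S k)%nat.
Proof.
  induction k as [|k IH]; [reflexivity|].
  change (ruler_sum (S (S k))) with (ruler_sum (S k) + ruler (S k))%nat.
  unfold ruler. simpl Pos.of_succ_nat. generalize (digit_sum_succ (Pos.of_succ_nat k)). lia.
Qed.

Lemma ruler_sum_le k : (ruler_sum k <= k)%nat.
Proof. destruct k; [simpl; lia|]. generalize (ruler_sum_digits k). lia. Qed.

Lemma ruler_spec l i : ruler (2 ^ l * (2 * i + 1) - 1) = l.
Proof.
  unfold ruler. set (n := (2 ^ l * (2 * i + 1))%nat).
  assert (H2 : (0 < 2 ^ l)%nat) by (generalize (Nat.pow_nonzero 2 l); lia).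
  assert (Hn : (0 < n)%nat) by (unfold n; nia).
  rewrite Pos.of_nat_succ. replace (S (n - 1)) with n by lia. unfold n.
  clear n Hn H2. induction l as [|l IH].
  - rewrite Nat.pow_0_r, Nat.mul_1_l. destruct i as [|i]; [reflexivity|].
    rewrite Nat2Pos.inj_add, Nat2Pos.inj_mul by lia.
    generalize (Pos.of_nat (S i)). intros q. simpl Pos.of_nat.
    rewrite Pos.add_1_r. reflexivity.
  - replace (2 ^ S l * (2 * i + 1))%nat with (2 * (2 ^ l * (2 * i + 1)))%nat by (simpl; lia).
    assert (H2 : (2 ^ l <> 0)%nat) by (apply Nat.pow_nonzero; lia).
    rewrite Nat2Pos.inj_mul by nia. simpl (Pos.of_nat 2).
    change (two_adic_val (2 * Pos.of_nat (2 ^ l * (2 * i + 1))))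
      with (S (two_adic_val (Pos.of_nat (2 ^ l * (2 * i + 1))))).
    now rewrite IH.
Qed.

(** Times growing linearly, in which two indices [k < m] are separated by at
    least [(m - k) + ruler k + ruler m]. *)
Definition ruler_time (k : nat) : nat := (k + 2 * ruler_sum k + ruler k)%nat.

Lemma ruler_time_gap k m : (k < m)%nat ->
  (ruler_time k + (m - k) + ruler k + ruler m <= ruler_time m)%nat.
Proof.
  intros H. unfold ruler_time.
  assert (Hs : (ruler_sum k + ruler k <= ruler_sum m)%nat).
  { induction H as [|m H IH]; simpl; [lia|]. simpl in IH. lia. }
  lia.
Qed.

Lemma ruler_time_le k : (ruler_time k <= 4 * k + 1)%nat.
Proof.
  unfold ruler_time. generalize (ruler_sum_le (S k)) (ruler_sum_le k). simpl. lia.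
Qed.

(** The numbers [k + 1] with exactly [l] factors [2] form an arithmetic progression. *)
Lemma ruler_time_class l (P : nat -> Prop) :
  (forall k, ruler k = l -> P (ruler_time k)) -> linearly_recurrent P.
Proof.
  intros H. exists (fun i => ruler_time (2 ^ l * (2 * i + 1) - 1)), (8 * 2 ^ l)%nat.
  assert (H2 : (2 ^ l <> 0)%nat) by (apply Nat.pow_nonzero; lia).
  repeat split.
  - intros i.
    assert (Hlt : (2 ^ l * (2 * i + 1) - 1 < 2 ^ l * (2 * S i + 1) - 1)%nat) by nia.
    generalize (ruler_time_gap _ _ Hlt). lia.
  - intros i. apply H, ruler_spec.
  - intros i. generalize (ruler_time_le (2 ^ l * (2 * i + 1) - 1)). nia.
Qed.

(** * Frequently visiting vectors from decaying orbits *)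

Section DecayingOrbits.

Variables (X : NormedModule C_AbsRing) (HX : abs_complete X) (T : bounded_op X X).

(** The exponent leaves one power for constants [c] that grow with the index of an
    orbit, and summable inverse squares after that. *)
Definition decaying_orbit (y : Z -> X) (c : R) : Prop :=
  (forall n, T (y n) = y (n + 1)%Z) /\
  forall n, norm (y n) <= c / (IZR (Z.abs n) + 1) ^ 3.

Lemma decay_denominator n : 0 < (IZR (Z.abs n) + 1) ^ 3.
Proof. apply pow_lt. generalize (IZR_le 0 _ (Z.abs_nonneg n)). lra. Qed.

Lemma decaying_orbit_mono y c c' : decaying_orbit y c -> c <= c' -> decaying_orbit y c'.
Proof.
  intros [H1 H2] Hc. split; [exact H1|]. intros n. eapply Rle_trans; [apply H2|].
  apply Rmult_le_compat_r; [left; apply Rinv_0_lt_compat, decay_denominator | exact Hc].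
Qed.

Lemma decaying_orbit_zero c : 0 <= c -> decaying_orbit (fun _ => zero) c.
Proof.
  intros Hc. split; [intros; apply bop_zero|]. intros n.
  eapply Rle_trans; [right; apply (norm_zero (V := X))|].
  apply Rdiv_le_0_compat; [exact Hc | apply decay_denominator].
Qed.

Lemma decaying_orbit_plus y z c d : decaying_orbit y c -> decaying_orbit z d ->
  decaying_orbit (fun n => plus (y n) (z n)) (c + d).
Proof.
  intros [H1 H2] [H3 H4]. split.
  - intros n. now rewrite bop_plus, H1, H3.
  - intros n. eapply Rle_trans; [apply (norm_triangle (y n) (z n))|].
    unfold Rdiv. rewrite Rmult_plus_distr_r. apply Rplus_le_compat; [apply H2 | apply H4].
Qed.

Lemma decaying_orbit_scal (a : C) y c : decaying_orbit y c ->
  decaying_orbit (fun n => a *: y n) (Cmod a * c).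
Proof.
  intros [H1 H2]. split.
  - intros n. now rewrite bop_scal, H1.
  - intros n. eapply Rle_trans; [right; apply (norm_scalC a (y n))|]. unfold Rdiv. rewrite Rmult_assoc.
    apply Rmult_le_compat_l; [apply Cmod_ge_0 | apply H2].
Qed.

Lemma orbit_iter y c n m : decaying_orbit y c -> Nat.iter n T (y m) = y (m + Z.of_nat n)%Z.
Proof.
  intros [H _]. induction n as [|n IH]; simpl Nat.iter.
  - f_equal. lia.
  - rewrite IH, H. f_equal. lia.
Qed.

Definition orbit_starts (x : X) : Prop :=
  forall eps, 0 < eps -> exists y c, decaying_orbit y c /\ norm (minus x (y 0%Z)) < eps.

Lemma orbit_starts_subspace : closed_subspace orbit_starts.
Proof.
  split.
  - intros eps Heps. exists (fun _ => zero), 0. split; [now apply decaying_orbit_zero; lra|].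
    eapply Rle_lt_trans; [|exact Heps]. right.
    rewrite minus_eq_zero. apply (norm_zero (V := X)).
  - intros x y Hx Hy eps Heps.
    destruct (Hx (eps / 2) ltac:(lra)) as [u [c [Hu Hu1]]].
    destruct (Hy (eps / 2) ltac:(lra)) as [v [d [Hv Hv1]]].
    exists (fun n => plus (u n) (v n)), (c + d).
    split; [now apply decaying_orbit_plus|].
    assert (E : minus (plus x y) (plus (u 0%Z) (v 0%Z))
      = plus (minus x (u 0%Z)) (minus y (v 0%Z))) by module_eq.
    eapply Rle_lt_trans; [right; exact (f_equal _ E)|].
    eapply Rle_lt_trans; [apply (norm_triangle (minus x (u 0%Z)) (minus y (v 0%Z)))|]. lra.
  - intros a x Hx eps Heps. assert (Ha := Cmod_ge_0 a).
    destruct (Hx (eps / (Cmod a + 1))) as [u [c [Hu Hu1]]]; [apply Rdiv_lt_0_compat; lra|].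
    exists (fun n => a *: u n), (Cmod a * c). split; [now apply decaying_orbit_scal|].
    assert (E : minus (a *: x) (a *: u 0%Z) = a *: minus x (u 0%Z)) by module_eq.
    apply Rle_lt_trans with (norm (a *: minus x (u 0%Z))); [right; exact (f_equal _ E)|].
    rewrite norm_scalC.
    apply Rle_lt_trans with ((Cmod a + 1) * norm (minus x (u 0%Z))).
    + apply Rmult_le_compat_r; [apply norm_ge_0 | lra].
    + apply Rlt_le_trans with ((Cmod a + 1) * (eps / (Cmod a + 1))).
      * apply Rmult_lt_compat_l; lra.
      * right. field. lra.
  - intros x H eps Heps.
    destruct (H (eps / 2) ltac:(lra)) as [z [Hz Hxz]].
    destruct (Hz (eps / 2) ltac:(lra)) as [u [c [Hu Hu1]]].
    exists u, c. split; [exact Hu|].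
    eapply Rle_lt_trans; [apply (norm_dist_triangle x z)|]. lra.
Qed.

(** Telescoping, with [1 / a^2 <= 1 / (a - 1) - 1 / a]. *)
Lemma sum_inv_squares (K v n : nat) : (1 <= v)%nat ->
  psum (fun M => if Nat.eqb M K then 0 else / (Rabs (INR K - INR M) + INR v) ^ 2) n
    <= 2 / INR v.
Proof.
  intros Hv. assert (Hv1 : 1 <= INR v) by (apply (le_INR 1); exact Hv).
  set (w := fun M => if Nat.eqb M K then 0 else / (Rabs (INR K - INR M) + INR v) ^ 2).
  assert (Hstep : forall a, 1 < a -> / a ^ 2 <= / (a - 1) - / a).
  { intros a Ha. replace (/ (a - 1) - / a) with (/ (a * (a - 1))) by (field; lra).
    apply Rinv_le_contravar; nra. }
  assert (H1 : forall n, (n <= K)%nat -> psum w n <= / (INR K - INR n + INR v)).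
  { clear n. induction n as [|n IH]; intros Hn.
    - simpl. left. apply Rinv_0_lt_compat. generalize (pos_INR K). lra.
    - rewrite psum_R_S. specialize (IH ltac:(lia)).
      assert (HK : INR n + 1 <= INR K) by (rewrite <- S_INR; apply le_INR; lia).
      unfold w at 2. destruct (Nat.eqb_spec n K); [lia|].
      rewrite Rabs_pos_eq by lra. rewrite S_INR.
      generalize (Hstep (INR K - INR n + INR v) ltac:(lra)).
      replace (INR K - (INR n + 1) + INR v) with (INR K - INR n + INR v - 1) by ring. lra. }
  assert (H2 : forall j, psum w (K + 1 + j) <= 2 / INR v - / (INR j + INR v)).
  { induction j as [|j IH].
    - rewrite Nat.add_0_r, Nat.add_1_r, psum_R_S. specialize (H1 K (Nat.le_refl K)).
      unfold w at 2. rewrite Nat.eqb_refl. simpl (INR 0).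
      replace (INR K - INR K + INR v) with (INR v) in H1 by ring.
      replace (2 / INR v - / (0 + INR v)) with (/ INR v) by (field; lra). lra.
    - rewrite Nat.add_succ_r, psum_R_S. unfold w at 2.
      destruct (Nat.eqb_spec (K + 1 + j) K); [lia|].
      assert (Hj := pos_INR j). rewrite !plus_INR. simpl (INR 1).
      replace (INR K - (INR K + 1 + INR j)) with (- (INR j + 1)) by ring.
      rewrite Rabs_Ropp, Rabs_pos_eq by lra.
      generalize (Hstep (INR j + 1 + INR v) ltac:(lra)). rewrite S_INR.
      replace (INR j + 1 + INR v - 1) with (INR j + INR v) by ring. lra. }
  assert (Hw : forall k, 0 <= w k).
  { intros k. unfold w. destruct (Nat.eqb k K); [lra|]. left. apply Rinv_0_lt_compat.
    apply pow_lt. generalize (Rabs_pos (INR K - INR k)). lra. }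
  apply Rle_trans with (psum w (K + 1 + n)); [apply psum_R_mono; [exact Hw | lia]|].
  eapply Rle_trans; [apply H2|].
  assert (0 < / (INR n + INR v)) by (apply Rinv_0_lt_compat; generalize (pos_INR n); lra).
  lra.
Qed.

Lemma is_series_remove (u : nat -> X) l K : is_series u l ->
  is_series (fun k => if Nat.eqb k K then zero else u k) (minus l (u K)).
Proof.
  intros H.
  assert (H1 : is_series (fun k => if Nat.eqb k K then u k else zero) (u K)).
  { replace (u K) with (psum (fun k => if Nat.eqb k K then u k else zero) (S K)).
    - apply is_series_finite. intros k Hk. destruct (Nat.eqb_spec k K); [lia | reflexivity].
    - rewrite (psum_single _ _ K); [now rewrite Nat.eqb_refl | lia |].
      intros k _ Hne. destruct (Nat.eqb_spec k K); [contradiction | reflexivity]. }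
  refine (is_series_ext _ _ _ _ (is_series_minus _ _ _ _ H H1)).
  intros k. simpl. destruct (Nat.eqb k K); module_eq.
Qed.

Lemma iter_is_series n (u : nat -> X) l : is_series u l ->
  is_series (fun k => Nat.iter n T (u k)) (Nat.iter n T l).
Proof.
  intros H. induction n as [|n IH]; [exact H|].
  exact (bop_is_series T (fun k => Nat.iter n T (u k)) _ IH).
Qed.

(** The vector is [sum_k y_(v k) (- p k)] for the ruler sequence [v], the ruler
    times [p] and a sequence of decaying orbits [y_v] whose constants grow so
    slowly that at time [p k] all terms but the [k]-th add up to at most [2 / v k]. *)
Theorem frequently_visiting_vector (D : nat -> X) :
  (forall d eps, 0 < eps -> exists k, norm (minus (D k) d) < eps) ->
  (forall d, orbit_starts d) ->
  exists x, forall d eps, 0 < eps ->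
    linearly_recurrent (fun n => norm (minus (Nat.iter n T x) d) < eps).
Proof.
  intros HD Hstart.
  assert (Hex : forall s : nat, exists yc : (Z -> X) * R, decaying_orbit (fst yc) (snd yc) /\
    norm (minus (D (fst (of_nat s))) (fst yc 0%Z)) < / (INR (snd (of_nat s)) + 1)).
  { intros s. destruct (Hstart (D (fst (of_nat s))) (/ (INR (snd (of_nat s)) + 1)))
      as [y [c Hy]].
    - apply Rinv_0_lt_compat. generalize (pos_INR (snd (of_nat s))). lra.
    - now exists (y, c). }
  set (Y := fun s => proj1_sig (constructive_indefinite_description _ (Hex s))).
  assert (HY : forall s, decaying_orbit (fst (Y s)) (snd (Y s)) /\
    norm (minus (D (fst (of_nat s))) (fst (Y s) 0%Z)) < / (INR (snd (of_nat s)) + 1)).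
  { intros s. exact (proj2_sig (constructive_indefinite_description _ (Hex s))). }
  (* Every orbit [Y s] occurs as [y v] for infinitely many [v]; it is replaced by zero
     until [v] has caught up with its constant. *)
  set (y := fun v : nat => if Rle_dec (snd (Y (fst (of_nat v)))) (INR v + 1)
                     then fst (Y (fst (of_nat v))) else fun _ => zero).
  assert (Hy : forall v, decaying_orbit (y v) (INR v + 1)).
  { intros v. unfold y. destruct (Rle_dec _ _) as [H|H].
    - eapply decaying_orbit_mono; [apply HY | exact H].
    - apply decaying_orbit_zero. generalize (pos_INR v). lra. }
  set (p := ruler_time).
  set (u := fun k => y (ruler k) (- Z.of_nat (p k))%Z).
  assert (Hu : abs_summable u).
  { apply abs_summable_le with (fun k => / (Rabs (INR 0 - INR k) + INR 1) ^ 2) (1 + 2 / INR 1).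
    - intros k. unfold u. eapply Rle_trans; [apply (proj2 (Hy (ruler k)))|].
      rewrite Z.abs_opp, (Z.abs_eq (Z.of_nat (p k))) by lia. rewrite <- INR_IZR_INZ.
      assert (H1 : INR k <= INR (p k)) by (apply le_INR; unfold p, ruler_time; lia).
      assert (H2 : INR (ruler k) <= INR (p k)) by (apply le_INR; unfold p, ruler_time; lia).
      assert (H3 := pos_INR k). assert (H4 := pos_INR (ruler k)).
      simpl (INR 0). simpl (INR 1). rewrite Rminus_0_l, Rabs_Ropp, Rabs_pos_eq by lra.
      set (P := INR (p k)) in *.
      apply Rle_trans with ((P + 1) / (P + 1) ^ 3).
      + apply Rmult_le_compat_r; [left; apply Rinv_0_lt_compat, pow_lt; lra | lra].
      + replace ((P + 1) / (P + 1) ^ 3) with (/ (P + 1) ^ 2) by (field; lra).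
        apply Rinv_le_contravar; [apply pow_lt; lra | apply pow_incr; lra].
    - intros n. destruct n as [|n]; [simpl; change (@zero R_AbelianMonoid) with 0; lra|].
      rewrite psum_S_l. change (@plus R_AbelianMonoid) with Rplus.
      apply Rplus_le_compat.
      + simpl (INR 0). simpl (INR 1). rewrite Rminus_0_r, Rabs_R0. right. field.
      + generalize (sum_inv_squares 0 1 (S n) (Nat.le_refl _)).
        rewrite psum_S_l. change (@plus R_AbelianMonoid) with Rplus. simpl Nat.eqb.
        rewrite Rplus_0_l. exact (fun h => h). }
  set (x := vsum u). assert (Hx := abs_summable_ex HX u Hu). fold x in Hx.
  exists x.
  (* At time [p K] the [k]-th term stands at index [p K - p k], which is at least
     [|K - k| + ruler K + ruler k] in absolute value. *)
  assert (Hmain : forall K, (1 <= ruler K)%nat ->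
    norm (minus (Nat.iter (p K) T x) (y (ruler K) 0%Z)) <= 2 / INR (ruler K)).
  { intros K HK.
    set (t := fun k => Nat.iter (p K) T (u k)).
    assert (Ht : is_series t (Nat.iter (p K) T x)) by now apply iter_is_series.
    assert (Et : forall k, t k = y (ruler k) (Z.of_nat (p K) - Z.of_nat (p k))%Z).
    { intros k. unfold t, u. rewrite (orbit_iter _ _ _ _ (Hy (ruler k))). f_equal. lia. }
    replace (y (ruler K) 0%Z) with (t K) by (rewrite Et; f_equal; lia).
    apply is_series_norm_le with (1 := is_series_remove t _ K Ht).
    intros n. eapply Rle_trans; [|apply (sum_inv_squares K (ruler K) n HK)].
    apply psum_R_le. intros k _.
    destruct (Nat.eqb_spec k K) as [->|Hne];
      [right; apply (norm_zero (V := X))|].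
    rewrite Et. eapply Rle_trans; [apply (proj2 (Hy (ruler k)))|].
    set (g := IZR (Z.abs (Z.of_nat (p K) - Z.of_nat (p k)))).
    assert (Hg : Rabs (INR K - INR k) + INR (ruler K) + INR (ruler k) <= g).
    { unfold g. rewrite !INR_IZR_INZ, <- minus_IZR, <- abs_IZR, <- !plus_IZR.
      apply IZR_le.
      destruct (Nat.lt_trichotomy k K) as [H|[H|H]]; [|contradiction|];
        assert (Hgap := ruler_time_gap _ _ H); fold p in Hgap; lia. }
    assert (H0 := Rabs_pos (INR K - INR k)).
    assert (H1 : 1 <= INR (ruler K)) by (apply (le_INR 1); exact HK).
    assert (H2 := pos_INR (ruler k)).
    apply Rle_trans with ((g + 1) / (g + 1) ^ 3).
    - apply Rmult_le_compat_r; [left; apply Rinv_0_lt_compat, pow_lt; lra | lra].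
    - replace ((g + 1) / (g + 1) ^ 3) with (/ (g + 1) ^ 2) by (field; lra).
      apply Rinv_le_contravar; [apply pow_lt; lra | apply pow_incr; lra]. }
  intros d eps Heps.
  destruct (HD d (eps / 3) ltac:(lra)) as [k Hk].
  destruct (archimed_cor1 (eps / 3) ltac:(lra)) as [q [Hq Hq0]].
  set (s := to_nat (k, q)).
  destruct (INR_unbounded (snd (Y s))) as [t1 Ht1].
  destruct (INR_unbounded (6 / eps)) as [t2 Ht2].
  set (v := to_nat (s, (t1 + t2 + 1)%nat)).
  assert (Hv : (t1 + t2 + 1 <= v)%nat).
  { generalize (to_nat_non_decreasing s (t1 + t2 + 1)). fold v. lia. }
  assert (HvR : INR t1 + INR t2 + 1 <= INR v).
  { rewrite <- plus_INR. apply (le_INR (t1 + t2 + 1)) in Hv. rewrite plus_INR in Hv. exact Hv. }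
  assert (Ht1' := pos_INR t1). assert (Ht2' := pos_INR t2).
  assert (Eyv : y v = fst (Y s)).
  { unfold y. replace (fst (of_nat v)) with s by (unfold v; now rewrite cancel_of_to).
    destruct (Rle_dec _ _) as [H|H]; [reflexivity | lra]. }
  apply (ruler_time_class v). intros K HK. fold p.
  assert (H1 := Hmain K ltac:(lia)). rewrite HK, Eyv in H1.
  assert (H2 := proj2 (HY s)).
  replace (of_nat s) with (k, q) in H2 by (unfold s; now rewrite cancel_of_to).
  cbn [fst snd] in H2.
  assert (H3 : 2 / INR v < eps / 3).
  { apply Rmult_lt_reg_r with (INR v); [lra|].
    unfold Rdiv at 1. rewrite Rmult_assoc, Rinv_l, Rmult_1_r by lra.
    apply Rle_lt_trans with (6 / eps * (eps / 3)); [right; field; lra|].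
    rewrite (Rmult_comm (eps / 3)). apply Rmult_lt_compat_r; lra. }
  assert (H4 : / (INR q + 1) < eps / 3).
  { eapply Rle_lt_trans; [|exact Hq]. apply Rinv_le_contravar; [|lra].
    apply lt_0_INR. exact Hq0. }
  eapply Rle_lt_trans; [apply (norm_dist_triangle _ (fst (Y s) 0%Z))|].
  assert (H5 := norm_dist_triangle (fst (Y s) 0%Z) (D k) d).
  rewrite (norm_minus_sym (fst (Y s) 0%Z) (D k)) in H5. lra.
Qed.

End DecayingOrbits.

Arguments decaying_orbit {X} _ _ _.
Arguments orbit_starts {X} _ _.

(** * Oscillatory integrals with a flat weight *)

Definition C_continuous (f : R -> C) : Prop :=
  forall x, continuous (fun t => fst (f t)) x /\ continuous (fun t => snd (f t)) x.

Definition is_C_derive (f f' : R -> C) : Prop :=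
  forall x, is_derive (fun t => fst (f t)) x (fst (f' x)) /\
            is_derive (fun t => snd (f t)) x (snd (f' x)).

Definition CInt (f : R -> C) (a b : R) : C :=
  (RInt (fun t => fst (f t)) a b, RInt (fun t => snd (f t)) a b).

Lemma is_C_derive_continuous f f' : is_C_derive f f' -> C_continuous f.
Proof.
  intros H x. split.
  - exact (ex_derive_continuous (V := R_NormedModule) _ x (ex_intro _ _ (proj1 (H x)))).
  - exact (ex_derive_continuous (V := R_NormedModule) _ x (ex_intro _ _ (proj2 (H x)))).
Qed.

Lemma C_continuous_plus f g : C_continuous f -> C_continuous g ->
  C_continuous (fun t => Cplus (f t) (g t)).
Proof.
  intros Hf Hg x. destruct (Hf x) as [H1 H2], (Hg x) as [H3 H4].
  split; simpl; now apply (continuous_plus (V := R_NormedModule)).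
Qed.

Lemma C_continuous_mult f g : C_continuous f -> C_continuous g ->
  C_continuous (fun t => Cmult (f t) (g t)).
Proof.
  intros Hf Hg x. destruct (Hf x) as [H1 H2], (Hg x) as [H3 H4]. split; simpl.
  - apply (continuous_minus (V := R_NormedModule));
      now apply (continuous_mult (K := R_AbsRing)).
  - apply (continuous_plus (V := R_NormedModule));
      now apply (continuous_mult (K := R_AbsRing)).
Qed.

Lemma C_continuous_const c : C_continuous (fun _ => c).
Proof. intros x. split; apply continuous_const. Qed.

Lemma C_continuous_RtoC (f : R -> R) : (forall x, continuous f x) ->
  C_continuous (fun t => RtoC (f t)).
Proof. intros H x. split; [apply H | apply continuous_const]. Qed.

Lemma is_C_derive_mult f f' g g' : is_C_derive f f' -> is_C_derive g g' ->
  is_C_derive (fun t => Cmult (f t) (g t))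
    (fun t => Cplus (Cmult (f' t) (g t)) (Cmult (f t) (g' t))).
Proof.
  intros Hf Hg x. destruct (Hf x) as [H1 H2], (Hg x) as [H3 H4].
  assert (M : forall a a' b b' : R -> R, is_derive a x (a' x) -> is_derive b x (b' x) ->
    is_derive (fun t => a t * b t) x (a' x * b x + a x * b' x)).
  { intros a a' b b' Ha Hb. exact (is_derive_mult a b x _ _ Ha Hb Rmult_comm). }
  split; simpl.
  - evar_last.
    + exact (is_derive_minus (V := R_NormedModule) _ _ x _ _
        (M _ (fun t => fst (f' t)) _ (fun t => fst (g' t)) H1 H3)
        (M _ (fun t => snd (f' t)) _ (fun t => snd (g' t)) H2 H4)).
    + unfold minus, plus, opp; simpl. ring.
  - evar_last.
    + exact (is_derive_plus (V := R_NormedModule) _ _ x _ _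
        (M _ (fun t => fst (f' t)) _ (fun t => snd (g' t)) H1 H4)
        (M _ (fun t => snd (f' t)) _ (fun t => fst (g' t)) H2 H3)).
    + unfold plus; simpl. ring.
Qed.

Lemma is_C_derive_ext f f' g' : (forall t, f' t = g' t) ->
  is_C_derive f f' -> is_C_derive f g'.
Proof. intros E H x. rewrite <- E. apply H. Qed.

Lemma is_C_derive_RtoC (f f' : R -> R) : (forall x, is_derive f x (f' x)) ->
  is_C_derive (fun t => RtoC (f t)) (fun t => RtoC (f' t)).
Proof. intros H x. split; [exact (H x) | exact (is_derive_const (V := R_NormedModule) 0 x)]. Qed.

Lemma ex_RInt_cont (f : R -> R) a b : (forall x, continuous f x) -> ex_RInt f a b.
Proof. intros H. apply (ex_RInt_continuous (V := R_CompleteNormedModule)). intros; apply H. Qed.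

Lemma CInt_plus f g a b : C_continuous f -> C_continuous g ->
  CInt (fun t => Cplus (f t) (g t)) a b = Cplus (CInt f a b) (CInt g a b).
Proof.
  intros Hf Hg. unfold CInt, Cplus; simpl. f_equal.
  - exact (RInt_plus (V := R_CompleteNormedModule) (fun t => fst (f t)) (fun t => fst (g t)) a b
      (ex_RInt_cont _ a b (fun x => proj1 (Hf x))) (ex_RInt_cont _ a b (fun x => proj1 (Hg x)))).
  - exact (RInt_plus (V := R_CompleteNormedModule) (fun t => snd (f t)) (fun t => snd (g t)) a b
      (ex_RInt_cont _ a b (fun x => proj2 (Hf x))) (ex_RInt_cont _ a b (fun x => proj2 (Hg x)))).
Qed.

Lemma RInt_scal_R (f : R -> R) c a b : (forall x, continuous f x) ->
  RInt (fun t => c * f t) a b = c * RInt f a b.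
Proof. intros H. apply (RInt_scal (V := R_CompleteNormedModule)). now apply ex_RInt_cont. Qed.

Lemma continuous_scal_R (f : R -> R) c : (forall x, continuous f x) ->
  forall x, continuous (fun t => c * f t) x.
Proof.
  intros H x. apply (continuous_mult (K := R_AbsRing)); [apply continuous_const | apply H].
Qed.

Lemma CInt_mult_l c f a b : C_continuous f ->
  CInt (fun t => Cmult c (f t)) a b = Cmult c (CInt f a b).
Proof.
  intros Hf. assert (H1 := fun x => proj1 (Hf x)). assert (H2 := fun x => proj2 (Hf x)).
  unfold CInt, Cmult; simpl. f_equal.
  - rewrite <- !RInt_scal_R by assumption.
    apply (RInt_minus (V := R_CompleteNormedModule)); apply ex_RInt_cont;
      now apply continuous_scal_R.
  - rewrite <- !RInt_scal_R by assumption.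
    apply (RInt_plus (V := R_CompleteNormedModule)); apply ex_RInt_cont;
      now apply continuous_scal_R.
Qed.

Lemma CInt_ext f g a b : (forall t, f t = g t) -> CInt f a b = CInt g a b.
Proof. intros H. unfold CInt. f_equal; apply RInt_ext; intros; now rewrite H. Qed.

Lemma CInt_norm_le f (m : R -> R) a b : a <= b -> C_continuous f ->
  (forall x, continuous m x) -> (forall t, a <= t <= b -> Cmod (f t) <= m t) ->
  Cmod (CInt f a b) <= RInt m a b.
Proof.
  intros Hab Hf Hm H. rewrite Cmod_norm.
  apply (norm_RInt_le (V := C_R_NormedModule) f m a b); [exact Hab | | |].
  - intros x Hx. rewrite <- Cmod_norm. now apply H.
  - apply (is_RInt_fct_extend_pair (U := R_NormedModule) (V := R_NormedModule));
      apply (RInt_correct (V := R_CompleteNormedModule)); apply ex_RInt_cont; intros x; apply Hf.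
  - apply (RInt_correct (V := R_CompleteNormedModule)). now apply ex_RInt_cont.
Qed.

Lemma CInt_derive f f' a b : is_C_derive f f' -> C_continuous f' ->
  CInt f' a b = Cminus (f b) (f a).
Proof.
  intros Hf Hc. unfold CInt, Cminus, Cplus, Copp; simpl.
  f_equal; apply (is_RInt_unique (V := R_CompleteNormedModule)).
  - exact (is_RInt_derive (V := R_CompleteNormedModule) (fun t => fst (f t))
      (fun t => fst (f' t)) a b (fun x _ => proj1 (Hf x)) (fun x _ => proj1 (Hc x))).
  - exact (is_RInt_derive (V := R_CompleteNormedModule) (fun t => snd (f t))
      (fun t => snd (f' t)) a b (fun x _ => proj2 (Hf x)) (fun x _ => proj2 (Hc x))).
Qed.

Lemma is_C_derive_cis c al :
  is_C_derive (fun t => cis (c * (t + al)))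
    (fun t => Cmult (Cmult Ci (RtoC c)) (cis (c * (t + al)))).
Proof.
  intros x. unfold cis; simpl. split; auto_derive; auto; ring.
Qed.

(** The chord is [2 |sin (x / 2)|]. *)
Lemma Cmod_cis_minus x y : Cmod (Cminus (cis (x + y)) (cis y)) <= Rabs x.
Proof.
  replace (Cminus (cis (x + y)) (cis y)) with (Cmult (cis y) (Cminus (cis x) (RtoC 1)))
    by (rewrite cis_plus; ring).
  rewrite Cmod_mult, Cmod_cis, Rmult_1_l.
  assert (Hs : Rabs (sin (x / 2)) <= Rabs (x / 2)).
  { destruct (Rtotal_order (x / 2) 0) as [H|[H|H]].
    - rewrite <- (Rabs_Ropp (sin _)), <- sin_neg, (Rabs_left (x / 2)) by lra.
      set (w := - (x / 2)). assert (0 < w) by (unfold w; lra).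
      apply Rabs_le. split; [|left; now apply sin_lt_x].
      destruct (Rle_lt_dec w PI) as [Hw|Hw].
      + generalize (sin_ge_0 w ltac:(lra) Hw). lra.
      + generalize (SIN_bound w) PI2_3_2. unfold PI2 in *. lra.
    - rewrite H, sin_0, Rabs_R0. lra.
    - rewrite (Rabs_pos_eq (x / 2)) by lra.
      apply Rabs_le. split; [|left; now apply sin_lt_x].
      destruct (Rle_lt_dec (x / 2) PI) as [Hw|Hw].
      + generalize (sin_ge_0 (x / 2) ltac:(lra) Hw). lra.
      + generalize (SIN_bound (x / 2)) PI2_3_2. unfold PI2 in *. lra. }
  rewrite <- (sqrt_Rsqr (Rabs x)) by apply Rabs_pos.
  unfold Cmod. apply sqrt_le_1_alt. rewrite <- Rsqr_abs. simpl.
  replace x with (2 * (x / 2)) at 1 2 3 4 by field.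
  replace (cos (2 * (x / 2))) with (1 - 2 * sin (x / 2) * sin (x / 2))
    by (rewrite cos_2a_sin; ring).
  rewrite sin_2a.
  assert (H2 : Rsqr (sin (x / 2)) <= Rsqr (x / 2)) by (now apply Rsqr_le_abs_1).
  assert (H3 := sin2_cos2 (x / 2)). unfold Rsqr in *.
  set (s := sin (x / 2)) in *. set (c := cos (x / 2)) in *.
  replace ((1 - 2 * s * s + - (1)) * ((1 - 2 * s * s + - (1)) * 1)
     + (2 * s * c + - 0) * ((2 * s * c + - 0) * 1)) with (4 * (s * s) * (s * s + c * c)) by ring.
  rewrite H3. nra.
Qed.

Section FlatIntegrals.

Variables (al eps : R) (Heps : 0 < eps).

Definition osc (n : Z) (t : R) : C := cis (IZR n * (t + al)).
Definition chord (t : R) : C := Cminus (cis (t + al)) (cis al).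

Definition flat_integral (chi : R -> R) (n : Z) (m : nat) : C :=
  CInt (fun t => Cmult (RtoC (chi t)) (Cmult (osc n t) (Cpow (chord t) m))) (- eps) eps.

Lemma chord_derive :
  is_C_derive chord (fun t => Cmult Ci (Cplus (chord t) (cis al))).
Proof.
  intros x. unfold chord, cis; simpl. split; auto_derive; auto; ring.
Qed.

Lemma chord_pow_derive m : is_C_derive (fun t => Cpow (chord t) m)
  (fun t => Cmult (Cmult Ci (RtoC (INR m)))
     (Cplus (Cpow (chord t) m) (Cmult (cis al) (Cpow (chord t) (pred m))))).
Proof.
  induction m as [|m IH].
  - intros x. simpl. split.
    + evar_last; [apply (is_derive_const (V := R_NormedModule))|]. simpl.
      unfold zero; simpl. ring.
    + evar_last; [apply (is_derive_const (V := R_NormedModule))|]. simpl.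
      unfold zero; simpl. ring.
  - eapply is_C_derive_ext; [|exact (is_C_derive_mult _ _ _ _ chord_derive IH)].
    intros t. simpl pred. rewrite S_INR, RtoC_plus. destruct m as [|m]; simpl; ring.
Qed.

Lemma osc_derive n : is_C_derive (osc n) (fun t => Cmult (Cmult Ci (RtoC (IZR n))) (osc n t)).
Proof. apply is_C_derive_cis. Qed.

Lemma osc_chord_continuous n m : C_continuous (fun t => Cmult (osc n t) (Cpow (chord t) m)).
Proof.
  apply C_continuous_mult.
  - eapply is_C_derive_continuous, osc_derive.
  - eapply is_C_derive_continuous, chord_pow_derive.
Qed.

Lemma flat_integrand_continuous chi n m : (forall x, continuous chi x) ->
  C_continuous (fun t => Cmult (RtoC (chi t)) (Cmult (osc n t) (Cpow (chord t) m))).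
Proof.
  intros H. apply C_continuous_mult; [now apply C_continuous_RtoC | apply osc_chord_continuous].
Qed.

Lemma flat_integral_rec chi n m : (forall x, continuous chi x) ->
  flat_integral chi (n + 1) m =
  Cplus (Cmult (cis al) (flat_integral chi n m)) (flat_integral chi n (S m)).
Proof.
  intros H. unfold flat_integral.
  rewrite <- CInt_mult_l by now apply flat_integrand_continuous.
  rewrite <- CInt_plus.
  - apply CInt_ext. intros t. unfold osc. rewrite plus_IZR.
    replace ((IZR n + 1) * (t + al)) with (IZR n * (t + al) + (t + al)) by ring.
    rewrite cis_plus. unfold chord at 3. rewrite Cpow_S. unfold chord. ring.
  - apply C_continuous_mult; [apply C_continuous_const | now apply flat_integrand_continuous].
  - now apply flat_integrand_continuous.
Qed.

(** Partial integration of the oscillating factor: the boundary terms vanish, and the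
    derivative of the [m]-th power of the chord involves the powers [m] and [m - 1]. *)
Lemma flat_integral_parts chi chi' n m :
  (forall x, is_derive chi x (chi' x)) -> (forall x, continuous chi' x) ->
  chi eps = 0 -> chi (- eps) = 0 ->
  Rabs (IZR n) * Cmod (flat_integral chi n m) <=
  Cmod (flat_integral chi' n m) +
  INR m * (Cmod (flat_integral chi n m) + Cmod (flat_integral chi n (pred m))).
Proof.
  intros Hd Hc He1 He2.
  assert (Hcc : forall x, continuous chi x).
  { intros x. apply (ex_derive_continuous (V := R_NormedModule)). eexists; apply Hd. }
  set (F := fun t => Cmult (RtoC (chi t)) (Cmult (osc n t) (Cpow (chord t) m))).
  assert (HF := is_C_derive_mult _ _ _ _ (is_C_derive_RtoC chi chi' Hd)
     (is_C_derive_mult _ _ _ _ (osc_derive n) (chord_pow_derive m))).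
  set (A := Cmult Ci (RtoC (IZR n))). set (B := Cmult Ci (RtoC (INR m))).
  assert (HF' : is_C_derive F (fun t =>
     Cplus (Cmult (RtoC (chi' t)) (Cmult (osc n t) (Cpow (chord t) m)))
       (Cplus (Cmult A (F t)) (Cmult B (Cplus (F t)
          (Cmult (cis al) (Cmult (RtoC (chi t)) (Cmult (osc n t) (Cpow (chord t) (pred m))))))))) ).
  { eapply is_C_derive_ext; [|exact HF]. intros t. unfold F, A, B. ring. }
  assert (C1 := flat_integrand_continuous chi' n m Hc).
  assert (C2 := flat_integrand_continuous chi n m Hcc). fold F in C2.
  assert (C3 := flat_integrand_continuous chi n (pred m) Hcc).
  assert (C4 := C_continuous_mult _ _ (C_continuous_const A) C2).
  assert (C5 := C_continuous_mult _ _ (C_continuous_const (cis al)) C3).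
  assert (C6 := C_continuous_plus _ _ C2 C5).
  assert (C7 := C_continuous_mult _ _ (C_continuous_const B) C6).
  assert (E := CInt_derive F _ (- eps) eps HF'
     (C_continuous_plus _ _ C1 (C_continuous_plus _ _ C4 C7))).
  rewrite CInt_plus in E by (auto; now apply C_continuous_plus).
  rewrite CInt_plus, !CInt_mult_l, CInt_plus, CInt_mult_l in E by auto.
  change (CInt F (- eps) eps) with (flat_integral chi n m) in E.
  fold (flat_integral chi' n m) in E. fold (flat_integral chi n (pred m)) in E.
  assert (E0 : Cminus (F eps) (F (- eps)) = RtoC 0).
  { unfold F. rewrite He1, He2. ring. }
  rewrite E0 in E.
  set (I := flat_integral chi n m) in *. set (I' := flat_integral chi' n m) in *.
  set (J := flat_integral chi n (pred m)) in *.
  assert (E1 : Cmult A I = Copp (Cplus I' (Cmult B (Cplus I (Cmult (cis al) J))))).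
  { replace (Cmult A I) with (Cminus (Cplus I' (Cplus (Cmult A I) (Cmult B (Cplus I (Cmult (cis al) J)))))
       (Cplus I' (Cmult B (Cplus I (Cmult (cis al) J))))) by ring.
    rewrite E. ring. }
  assert (E2 : Rabs (IZR n) * Cmod I = Cmod (Cmult A I)).
  { unfold A. rewrite !Cmod_mult, Cmod_Ci, Cmod_R. ring. }
  rewrite E2, E1, Cmod_opp.
  eapply Rle_trans; [apply Cmod_triangle|]. apply Rplus_le_compat_l.
  unfold B. rewrite !Cmod_mult, Cmod_Ci, Cmod_R, Rmult_1_l, Rabs_pos_eq by apply pos_INR.
  apply Rmult_le_compat_l; [apply pos_INR|].
  eapply Rle_trans; [apply Cmod_triangle|].
  rewrite Cmod_mult, Cmod_cis. lra.
Qed.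

(** The factor [(m + 1) ^ k] comes from differentiating the [m]-th power of the chord [k]
    times. *)
Definition decay_order (k : nat) (chi : R -> R) : Prop :=
  exists B, 0 <= B /\ forall n m,
    Rabs (IZR n) ^ k * Cmod (flat_integral chi n m) <= B * (INR m + 1) ^ k * eps ^ m.

Lemma chord_norm t : - eps <= t <= eps -> Cmod (chord t) <= eps.
Proof.
  intros Ht. unfold chord. eapply Rle_trans; [apply Cmod_cis_minus|]. now apply Rabs_le.
Qed.

Lemma flat_integrand_norm chi n m t : - eps <= t <= eps ->
  Cmod (Cmult (RtoC (chi t)) (Cmult (osc n t) (Cpow (chord t) m))) <= eps ^ m * Rabs (chi t).
Proof.
  intros Ht. rewrite !Cmod_mult, Cmod_pow, Cmod_R. unfold osc. rewrite Cmod_cis, Rmult_1_l.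
  rewrite Rmult_comm. apply Rmult_le_compat_r; [apply Rabs_pos|].
  apply pow_incr. split; [apply Cmod_ge_0 | now apply chord_norm].
Qed.

Lemma continuous_Rabs_comp (chi : R -> R) : (forall x, continuous chi x) ->
  forall x, continuous (fun t => Rabs (chi t)) x.
Proof. intros H x. apply (continuous_comp chi Rabs); [apply H | apply continuous_Rabs]. Qed.

Lemma flat_integral_norm chi n m : (forall x, continuous chi x) ->
  Cmod (flat_integral chi n m) <= eps ^ m * RInt (fun t => Rabs (chi t)) (- eps) eps.
Proof.
  intros H. assert (Ha := continuous_Rabs_comp chi H).
  rewrite <- RInt_scal_R by exact Ha.
  apply CInt_norm_le; [lra | now apply flat_integrand_continuous | now apply continuous_scal_R |].
  intros t Ht. now apply flat_integrand_norm.
Qed.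

Lemma decay_order_0 chi : (forall x, continuous chi x) -> decay_order 0 chi.
Proof.
  intros H. exists (RInt (fun t => Rabs (chi t)) (- eps) eps). split.
  - apply RInt_ge_0; [lra | apply ex_RInt_cont; now apply continuous_Rabs_comp |].
    intros; apply Rabs_pos.
  - intros n m. simpl. rewrite Rmult_1_l, Rmult_1_r, Rmult_comm. now apply flat_integral_norm.
Qed.

Lemma decay_order_S k chi chi' :
  (forall x, is_derive chi x (chi' x)) -> (forall x, continuous chi' x) ->
  chi eps = 0 -> chi (- eps) = 0 ->
  decay_order k chi -> decay_order k chi' -> decay_order (S k) chi.
Proof.
  intros Hd Hc He1 He2 [B [HB H]] [B' [HB' H']].
  assert (Hie : 0 < / eps) by now apply Rinv_0_lt_compat.
  exists (B' + B + B * / eps). split.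
  { assert (0 <= B * / eps) by (apply Rmult_le_pos; lra). lra. }
  intros n m.
  assert (Hn : 0 <= Rabs (IZR n) ^ k) by (apply pow_le, Rabs_pos).
  assert (Hm := pos_INR m).
  assert (Hp := flat_integral_parts chi chi' n m Hd Hc He1 He2).
  apply (Rmult_le_compat_l _ _ _ Hn) in Hp.
  simpl (_ ^ S k). set (q := (INR m + 1) ^ k). assert (Hq : 0 <= q) by (apply pow_le; lra).
  assert (Hem : 0 <= eps ^ m) by (apply pow_le; lra).
  assert (H1 := H' n m). assert (H2 := H n m). fold q in H1, H2.
  assert (H3 : INR m * (Rabs (IZR n) ^ k * Cmod (flat_integral chi n (pred m)))
     <= INR m * (B * / eps * q * eps ^ m)).
  { destruct m as [|m]; [simpl; lra|]. simpl pred. apply Rmult_le_compat_l; [exact Hm|].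
    eapply Rle_trans; [apply H|].
    replace (B * / eps * q * eps ^ S m) with (B * q * eps ^ m) by (simpl; field; lra).
    apply Rmult_le_compat_r; [apply pow_le; lra|]. apply Rmult_le_compat_l; [exact HB|].
    apply pow_incr. rewrite S_INR in *. generalize (pos_INR m). lra. }
  assert (H4 := Rmult_le_compat_l _ _ _ Hm H2).
  set (a := Rabs (IZR n)) in *. set (I := Cmod (flat_integral chi n m)) in *.
  set (J := Cmod (flat_integral chi n (pred m))) in *.
  set (I' := Cmod (flat_integral chi' n m)) in *.
  replace (a * a ^ k * I) with (a ^ k * (a * I)) by ring.
  eapply Rle_trans; [exact Hp|].
  replace (a ^ k * (I' + INR m * (I + J)))
    with (a ^ k * I' + (INR m * (a ^ k * I) + INR m * (a ^ k * J))) by ring.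
  assert (Hbq : 0 <= B * q * eps ^ m) by (repeat apply Rmult_le_pos; lra).
  assert (Hbq' : 0 <= B' * q * eps ^ m) by (repeat apply Rmult_le_pos; lra).
  assert (Hbq2 : 0 <= B * / eps * q * eps ^ m) by (repeat apply Rmult_le_pos; lra).
  replace ((B' + B + B * / eps) * ((INR m + 1) * q) * eps ^ m) with
    (B' * q * eps ^ m + INR m * (B' * q * eps ^ m)
     + (B * q * eps ^ m + INR m * (B * q * eps ^ m))
     + (B * / eps * q * eps ^ m + INR m * (B * / eps * q * eps ^ m))) by ring.
  assert (0 <= INR m * (B' * q * eps ^ m)) by now apply Rmult_le_pos.
  lra.
Qed.

(** Vanishes to third order at [- eps] and [eps], so that three partial
    integrations have no boundary terms. *)
Definition flat_weight (t : R) : R := (eps ^ 2 - t ^ 2) ^ 3.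
Definition flat_weight1 (t : R) : R := - 6 * t * (eps ^ 2 - t ^ 2) ^ 2.
Definition flat_weight2 (t : R) : R :=
  - 6 * (eps ^ 2 - t ^ 2) ^ 2 + 24 * t ^ 2 * (eps ^ 2 - t ^ 2).
Definition flat_weight3 (t : R) : R := 72 * t * (eps ^ 2 - t ^ 2) - 48 * t ^ 3.

Lemma flat_weight_derive x : is_derive flat_weight x (flat_weight1 x).
Proof. unfold flat_weight, flat_weight1. auto_derive; auto. ring. Qed.
Lemma flat_weight1_derive x : is_derive flat_weight1 x (flat_weight2 x).
Proof. unfold flat_weight1, flat_weight2. auto_derive; auto. ring. Qed.
Lemma flat_weight2_derive x : is_derive flat_weight2 x (flat_weight3 x).
Proof. unfold flat_weight2, flat_weight3. auto_derive; auto. ring. Qed.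
Lemma flat_weight3_continuous x : continuous flat_weight3 x.
Proof.
  apply (ex_derive_continuous (V := R_NormedModule)). unfold flat_weight3. auto_derive. auto.
Qed.

Lemma flat_weight_continuity :
  (forall x, continuous flat_weight x) /\ (forall x, continuous flat_weight1 x) /\
  (forall x, continuous flat_weight2 x).
Proof.
  repeat split; intros x; apply (ex_derive_continuous (V := R_NormedModule)); eexists.
  - apply flat_weight_derive.
  - apply flat_weight1_derive.
  - apply flat_weight2_derive.
Qed.

Lemma flat_weight_decay : decay_order 3 flat_weight.
Proof.
  destruct flat_weight_continuity as [C0 [C1 C2]].
  assert (C3 := flat_weight3_continuous).
  assert (D03 := decay_order_0 _ C3). assert (D02 := decay_order_0 _ C2).
  assert (D01 := decay_order_0 _ C1). assert (D00 := decay_order_0 _ C0).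
  assert (D12 : decay_order 1 flat_weight2).
  { apply decay_order_S with flat_weight3; auto using flat_weight2_derive;
      unfold flat_weight2; Rring. }
  assert (D11 : decay_order 1 flat_weight1).
  { apply decay_order_S with flat_weight2; auto using flat_weight1_derive;
      unfold flat_weight1; Rring. }
  assert (D10 : decay_order 1 flat_weight).
  { apply decay_order_S with flat_weight1; auto using flat_weight_derive;
      unfold flat_weight; Rring. }
  assert (D21 : decay_order 2 flat_weight1).
  { apply decay_order_S with flat_weight2; auto using flat_weight1_derive;
      unfold flat_weight1; Rring. }
  assert (D20 : decay_order 2 flat_weight).
  { apply decay_order_S with flat_weight1; auto using flat_weight_derive;
      unfold flat_weight; Rring. }
  apply decay_order_S with flat_weight1; auto using flat_weight_derive;
    unfold flat_weight; Rring.
Qed.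

Lemma cube_le_pow2 m : (INR m + 1) ^ 3 <= 8 * 2 ^ m.
Proof.
  assert (H : ((m + 1) ^ 3 <= 8 * 2 ^ m)%nat).
  { destruct (Nat.le_gt_cases m 2) as [Hm|Hm].
    - destruct m as [|[|[|m]]]; simpl; lia.
    - induction Hm as [|m Hm IH]; [simpl; lia|].
      assert (((S m + 1) ^ 3 <= 2 * (m + 1) ^ 3)%nat) by (simpl; nia).
      change (2 ^ S m)%nat with (2 * 2 ^ m)%nat. lia. }
  apply le_INR in H. rewrite mult_INR, !pow_INR, plus_INR in H. simpl INR in H.
  replace (1 + 1 + 1 + 1 + 1 + 1 + 1 + 1) with 8 in H by ring.
  replace (1 + 1) with 2 in H by ring. exact H.
Qed.

(** Moments, against [exp (i n (t + al))], of the powers of the chord of the unit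
    circle from [exp (i al)], with a weight concentrated near [0]: smooth enough
    to decay in [n], and small in [m] because the chord is short. *)
Theorem flat_moments : exists (kappa : Z -> nat -> C) (B : R), 0 <= B /\
  (forall n m, kappa (n + 1)%Z m = Cplus (Cmult (cis al) (kappa n m)) (kappa n (S m))) /\
  (forall n m, Cmod (kappa n m) <= B * (2 * eps) ^ m / (IZR (Z.abs n) + 1) ^ 3) /\
  kappa 0%Z O = RtoC 1 /\ (forall m, Cmod (kappa 0%Z m) <= eps ^ m).
Proof.
  destruct flat_weight_continuity as [C0 _].
  set (c := RInt flat_weight (- eps) eps).
  assert (Hpos : forall t, - eps < t < eps -> 0 < flat_weight t).
  { intros t Ht. unfold flat_weight. apply pow_lt. nra. }
  assert (Hc : 0 < c) by (apply RInt_gt_0; [lra | exact Hpos | intros; apply C0]).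
  assert (Hic : 0 < / c) by now apply Rinv_0_lt_compat.
  assert (E : RInt (fun t => Rabs (flat_weight t)) (- eps) eps = c).
  { apply RInt_ext. intros t Ht. rewrite Rmin_left, Rmax_right in Ht by lra.
    apply Rabs_pos_eq. left. now apply Hpos. }
  destruct (decay_order_0 _ C0) as [B0 [HB0 H0]].
  destruct flat_weight_decay as [B3 [HB3 H3]].
  exists (fun n m => Cmult (RtoC (/ c)) (flat_integral flat_weight n m)).
  exists (/ c * (64 * (B0 + B3))). repeat split.
  - apply Rmult_le_pos; lra.
  - intros n m. rewrite flat_integral_rec by exact C0. ring.
  - intros n m. rewrite Cmod_mult, Cmod_R, Rabs_pos_eq by lra.
    unfold Rdiv. rewrite !Rmult_assoc. apply Rmult_le_compat_l; [lra|].
    set (I := Cmod (flat_integral flat_weight n m)).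
    specialize (H0 n m). specialize (H3 n m). fold I in H0, H3. simpl (_ ^ 0) in H0.
    rewrite abs_IZR. set (a := Rabs (IZR n)) in *. assert (Ha : 0 <= a) by apply Rabs_pos.
    assert (Hem : 0 <= eps ^ m) by (apply pow_le; lra).
    assert (Hm := cube_le_pow2 m). assert (Hm0 := pos_INR m).
    assert (Hm1 : 1 <= (INR m + 1) ^ 3) by (apply pow_R1_Rle; lra).
    assert (Hd : 0 < (a + 1) ^ 3) by (apply pow_lt; lra).
    apply Rmult_le_reg_r with ((a + 1) ^ 3); [exact Hd|].
    replace (64 * ((B0 + B3) * ((2 * eps) ^ m * / (a + 1) ^ 3)) * (a + 1) ^ 3)
      with (64 * (B0 + B3) * (2 ^ m * eps ^ m)) by (rewrite Rpow_mult_distr; field; lra).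
    assert (Hcube : (a + 1) ^ 3 <= 8 * (1 + a ^ 3)).
    { apply Rminus_le_0.
      replace (8 * (1 + a ^ 3) - (a + 1) ^ 3) with ((a + 1) * (7 * (a - 5 / 7) ^ 2 + 24 / 7))
        by field.
      apply Rmult_le_pos; [lra|]. generalize (pow2_ge_0 (a - 5 / 7)). lra. }
    assert (HI : 0 <= I) by apply Cmod_ge_0.
    apply Rle_trans with (I * (8 * (1 + a ^ 3))); [now apply Rmult_le_compat_l|].
    assert (H4 : I * (1 + a ^ 3) <= (B0 + B3) * (INR m + 1) ^ 3 * eps ^ m).
    { assert (B0 * eps ^ m <= B0 * (INR m + 1) ^ 3 * eps ^ m).
      { apply Rmult_le_compat_r; [exact Hem|]. nra. }
      replace (I * (1 + a ^ 3)) with (1 * I + a ^ 3 * I) by ring.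
      replace ((B0 + B3) * (INR m + 1) ^ 3 * eps ^ m)
        with (B0 * (INR m + 1) ^ 3 * eps ^ m + B3 * (INR m + 1) ^ 3 * eps ^ m) by ring.
      lra. }
    assert (H5 : (B0 + B3) * (INR m + 1) ^ 3 * eps ^ m <= (B0 + B3) * (8 * 2 ^ m) * eps ^ m).
    { apply Rmult_le_compat_r; [exact Hem|]. apply Rmult_le_compat_l; lra. }
    lra.
  - unfold flat_integral.
    rewrite (CInt_ext _ (fun t => RtoC (flat_weight t))).
    + unfold CInt. simpl.
      change (RInt (fun t => flat_weight t) (- eps) eps) with c.
      replace (RInt (fun _ => 0) (- eps) eps) with 0.
      * unfold Cmult, RtoC; simpl. f_equal; field; lra.
      * symmetry. rewrite RInt_const. apply Rmult_0_r.
    + intros t. unfold osc. rewrite Rmult_0_l, cis_0. simpl. ring.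
  - intros m. rewrite Cmod_mult, Cmod_R, Rabs_pos_eq by lra.
    apply Rmult_le_reg_l with c; [exact Hc|].
    rewrite <- Rmult_assoc, Rinv_r, Rmult_1_l by lra.
    rewrite (Rmult_comm c), <- E. now apply flat_integral_norm.
Qed.

End FlatIntegrals.

(** * Decaying orbits near unimodular eigenvectors *)

Lemma unimodular_cis (z : C) : Cmod z = 1 -> exists al, z = cis al.
Proof.
  intros H. destruct z as [x y].
  assert (H1 : x * x + y * y = 1).
  { assert (H2 := Cmod2_alt (x, y)). rewrite H in H2. simpl in H2. lra. }
  assert (Hx : -1 <= x <= 1) by nra.
  destruct (Rle_lt_dec 0 y) as [Hy|Hy].
  - exists (acos x). unfold cis. rewrite cos_acos, sin_acos by exact Hx. f_equal.
    replace (1 - Rsqr x) with (Rsqr y) by (unfold Rsqr; lra). now rewrite sqrt_Rsqr.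
  - exists (- acos x). unfold cis. rewrite cos_neg, sin_neg, cos_acos, sin_acos by exact Hx.
    f_equal. replace (1 - Rsqr x) with (Rsqr (- y)) by (unfold Rsqr; lra).
    rewrite sqrt_Rsqr by lra. ring.
Qed.

Section Chains.

Variables (X : NormedModule C_AbsRing) (HX : abs_complete X) (T : bounded_op X X).

(** A Jordan chain [T v_0 = z v_0], [T v_(m+1) = z v_(m+1) + v_m] of geometric
    growth sums to the eigenvectors [sum_m s^m v_m] for the eigenvalues [z + s];
    integrating these over a short arc around [z] against a smooth weight gives
    a decaying orbit that starts near a multiple of [v_0]. *)
Theorem chain_orbit_start (v : nat -> X) (z : C) A D : Cmod z = 1 ->
  geom_bounded v A D -> T (v O) = z *: v O ->
  (forall m, T (v (S m)) = plus (z *: v (S m)) (v m)) -> orbit_starts T (v O).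
Proof.
  intros Hz [HA [HD Hv]] Hv0 HvS eta Heta.
  destruct (unimodular_cis z Hz) as [al Hal].
  (* The arc is so short that the moments beat the growth of the chain, and that the
     terms of positive index stay below [eta] in total. *)
  set (e := Rmin (/ (4 * (D + 1))) (eta / (4 * (A * D + 1)))).
  assert (HAD : 0 <= A * D) by now apply Rmult_le_pos.
  assert (He : 0 < e).
  { apply Rmin_case; [apply Rinv_0_lt_compat; lra | apply Rdiv_lt_0_compat; lra]. }
  assert (He1 : e * D <= / 4).
  { apply Rle_trans with (/ (4 * (D + 1)) * (D + 1)).
    - apply Rmult_le_compat; try lra. apply Rmin_l.
    - right. field. lra. }
  assert (He2 : e * (A * D) <= eta / 4).
  { apply Rle_trans with (eta / (4 * (A * D + 1)) * (A * D + 1)).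
    - apply Rmult_le_compat; try lra. apply Rmin_r.
    - right. field. lra. }
  assert (HeD : 0 <= e * D) by (apply Rmult_le_pos; lra).
  destruct (flat_moments al e He) as [kappa [B [HB [Hrec [Hdec [H00 H0m]]]]]].
  rewrite <- Hal in Hrec.
  set (w := fun n => B / (IZR (Z.abs n) + 1) ^ 3).
  assert (Hw : forall n, 0 <= w n).
  { intros n. apply Rdiv_le_0_compat; [exact HB | apply decay_denominator]. }
  assert (Hq : 0 <= 2 * e * D < 1) by lra.
  assert (Hb : forall n m k, norm (kappa n (k + m)%nat *: v m)
     <= w n * (2 * e) ^ k * A * (2 * e * D) ^ m).
  { intros n m k. rewrite norm_scalC.
    replace (w n * (2 * e) ^ k * A * (2 * e * D) ^ m)
      with (B * (2 * e) ^ (k + m) / (IZR (Z.abs n) + 1) ^ 3 * (A * D ^ m)).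
    - apply Rmult_le_compat; [apply Cmod_ge_0 | apply norm_ge_0 | apply Hdec | apply Hv].
    - unfold w, Rdiv. rewrite pow_add, !Rpow_mult_distr. ring. }
  assert (Hsum : forall n k, is_series (fun m => kappa n (k + m)%nat *: v m)
     (vsum (fun m => kappa n (k + m)%nat *: v m))).
  { intros n k. apply (abs_summable_ex HX).
    apply abs_summable_geom with (w n * (2 * e) ^ k * A) (2 * e * D); [exact Hq | |].
    - apply Rmult_le_pos; [|exact HA]. apply Rmult_le_pos; [apply Hw | apply pow_le; lra].
    - intros m. apply Hb. }
  set (y := fun n => vsum (fun m => kappa n m *: v m)).
  exists y, (B * A * 2). split.
  - split.
    + intros n. symmetry. apply vsum_unique.
      assert (H1 := bop_is_series T _ _ (Hsum n O)). simpl Nat.add in H1.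
      assert (H2 := is_series_scal (z : C_AbsRing) _ _ (Hsum n O)). simpl Nat.add in H2.
      assert (H3 := Hsum n 1%nat). simpl Nat.add in H3.
      fold (y n) in H1, H2.
      replace (T (y n)) with (plus (z *: y n) (vsum (fun m => kappa n (S m) *: v m))).
      * refine (is_series_ext _ _ _ _ (is_series_plus _ _ _ _ H2 H3)).
        intros m. simpl. rewrite Hrec. module_eq.
      * apply (is_series_unique_C (fun m => T (kappa n m *: v m))); [|exact H1].
        apply is_series_cons.
        assert (H2' := proj1 (is_series_cons _ _) H2).
        refine (is_series_eq _ _ _ _ (is_series_plus _ _ _ _ H2' H3) _ _).
        -- intros m. simpl. rewrite bop_scal, HvS. module_eq.
        -- rewrite bop_scal, Hv0. simpl. module_eq.
    + intros n.
      eapply Rle_trans.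
      { apply (is_series_norm_le_geom X (fun m => kappa n m *: v m) _
          (w n * A) (2 * e * D) Hq); [apply Rmult_le_pos; auto | | apply (Hsum n O)].
        intros m. eapply Rle_trans; [apply (Hb n m O)|]. simpl. right. ring. }
      unfold w, Rdiv.
      replace (B * A * 2 * / (IZR (Z.abs n) + 1) ^ 3)
        with (B * / (IZR (Z.abs n) + 1) ^ 3 * A * 2) by ring.
      apply Rmult_le_compat_l; [apply Rmult_le_pos; auto; apply Hw|].
      rewrite <- (Rinv_inv 2). apply Rinv_le_contravar; lra.
  - assert (H1 := proj1 (is_series_cons _ _) (Hsum 0%Z O)).
    cbv beta in H1. simpl Nat.add in H1.
    fold (y 0%Z) in H1. rewrite H00 in H1.
    replace (RtoC 1 *: v O) with (v O) in H1 by module_eq.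
    rewrite norm_minus_sym.
    assert (Hq' : 0 <= e * D < 1) by lra.
    eapply Rle_lt_trans.
    { apply (is_series_norm_le_geom X _ _ (e * (A * D)) (e * D) Hq') with (3 := H1).
      - apply Rmult_le_pos; lra.
      - intros m. rewrite norm_scalC.
        replace (e * (A * D) * (e * D) ^ m) with (e ^ S m * (A * D ^ S m))
          by (rewrite Rpow_mult_distr; simpl; ring).
        apply Rmult_le_compat; [apply Cmod_ge_0 | apply norm_ge_0 | apply H0m | apply Hv]. }
    apply Rle_lt_trans with (eta / 4 * 2); [|lra].
    apply Rmult_le_compat; try lra.
    + apply Rmult_le_pos; lra.
    + left. apply Rinv_0_lt_compat. lra.
    + rewrite <- (Rinv_inv 2). apply Rinv_le_contravar; lra.
Qed.

(** ** Long division *)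

(** The solution [y] of [sum_(k <= j) h_k y_(j - k) = g_j]: the quotient of the
    generating series of [g] by that of [h], one leading term at a time. *)
Fixpoint long_div (h : nat -> C) (g : nat -> X) (j : nat) : X :=
  match j with
  | O => Cinv (h O) *: g O
  | S i => long_div h (fun k => minus (g (S k)) (h (S k) *: (Cinv (h O) *: g O))) i
  end.

Definition convol (h : nat -> C) (y : nat -> X) (j : nat) : X :=
  psum (fun k => h k *: y (j - k)%nat) (S j).

Lemma long_div_spec h g j : h O <> RtoC 0 -> convol h (long_div h g) j = g j.
Proof.
  intros Hh. revert g. induction j as [|j IH]; intros g; unfold convol in *.
  - simpl. module_eq_pre. field. exact Hh.
  - set (g' := fun k => minus (g (S k)) (h (S k) *: (Cinv (h O) *: g O))).
    change (psum (fun k => h k *: long_div h g (S j - k)%nat) (S (S j))) with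
      (plus (psum (fun k => h k *: long_div h g (S j - k)%nat) (S j))
         (h (S j) *: long_div h g (S j - S j)%nat)).
    rewrite (psum_ext _ (fun k => h k *: long_div h g' (j - k)%nat)).
    + rewrite (IH g'), Nat.sub_diag. unfold g'. simpl. module_eq.
    + intros k Hk. replace (S j - k)%nat with (S (j - k)) by lia. reflexivity.
Qed.

Lemma convol_split h y j :
  convol h y j = plus (h O *: y j) (psum (fun k => h (S k) *: y (j - S k)%nat) j).
Proof. unfold convol. rewrite psum_S_l. now rewrite Nat.sub_0_r. Qed.

Lemma convol_solve h y j : h O <> RtoC 0 ->
  y j = Cinv (h O) *: minus (convol h y j) (psum (fun k => h (S k) *: y (j - S k)%nat) j).
Proof.
  intros Hh. rewrite convol_split. module_eq_pre; field; exact Hh.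
Qed.

Lemma pow_third_sum s r j : 0 < s -> 0 <= r -> 3 * r <= s ->
  psum (fun k => r ^ S k * s ^ (j - S k)) j <= s ^ j / 2.
Proof.
  intros Hs Hr Hrs. apply Rle_trans with (psum (fun k => s ^ j / 3 * (/ 3) ^ k) j).
  - apply psum_R_le. intros k Hk.
    replace j with (S k + (j - S k))%nat at 2 by lia. rewrite pow_add.
    replace (s ^ S k * s ^ (j - S k) / 3 * (/ 3) ^ k)
      with ((s * / 3) ^ S k * s ^ (j - S k)) by (rewrite Rpow_mult_distr; simpl; field).
    apply Rmult_le_compat_r; [apply pow_le; lra|]. apply pow_incr. lra.
  - rewrite psum_R_scal. assert (0 <= s ^ j) by (apply pow_le; lra).
    apply Rle_trans with (s ^ j / 3 * / (1 - / 3)); [|lra].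
    apply Rmult_le_compat_l; [lra | apply psum_geom_le; lra].
Qed.

(** In the norm with weights [s^j] the recursion for the quotient contracts by [1 / 2]. *)
Lemma long_div_bounded h g A s r : h O <> RtoC 0 -> 0 < s -> 0 <= r -> 3 * r <= s ->
  (forall k, Cmod (h k) <= Cmod (h O) * r ^ k) ->
  geom_bounded g A s -> geom_bounded (long_div h g) (A * (2 / Cmod (h O))) s.
Proof.
  intros Hh Hs Hr Hrs Hhr [HA [_ Hg]].
  assert (H0 : 0 < Cmod (h O)) by now apply Cmod_gt_0.
  assert (HY : 0 <= A * (2 / Cmod (h O))).
  { apply Rmult_le_pos; [exact HA | apply Rdiv_le_0_compat; lra]. }
  split; [exact HY|]. split; [lra|].
  intros j. induction j as [j IH] using lt_wf_ind.
  rewrite (convol_solve h (long_div h g) j Hh), long_div_spec by exact Hh.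
  rewrite norm_scalC, Cmod_inv by exact Hh.
  assert (Hps : norm (psum (fun k => h (S k) *: long_div h g (j - S k)%nat) j)
     <= Cmod (h O) * (A * (2 / Cmod (h O))) * (s ^ j / 2)).
  { eapply Rle_trans; [apply psum_norm|].
    apply Rle_trans with (psum (fun k => Cmod (h O) * (A * (2 / Cmod (h O))) *
       (r ^ S k * s ^ (j - S k))) j).
    - apply psum_R_le. intros k Hk. rewrite norm_scalC.
      replace (Cmod (h O) * (A * (2 / Cmod (h O))) * (r ^ S k * s ^ (j - S k)))
        with ((Cmod (h O) * r ^ S k) * (A * (2 / Cmod (h O)) * s ^ (j - S k))) by ring.
      apply Rmult_le_compat; [apply Cmod_ge_0 | apply norm_ge_0 | apply Hhr | apply IH; lia].
    - rewrite psum_R_scal. apply Rmult_le_compat_l; [apply Rmult_le_pos; lra|].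
      now apply pow_third_sum. }
  apply Rle_trans with (/ Cmod (h O) * (A * s ^ j + Cmod (h O) * (A * (2 / Cmod (h O))) * (s ^ j / 2))).
  - apply Rmult_le_compat_l; [left; now apply Rinv_0_lt_compat|].
    eapply Rle_trans; [apply norm_minus_le|]. apply Rplus_le_compat; [apply Hg | exact Hps].
  - right. field. lra.
Qed.

(** If [S] shifts [g] by [L] onto [u], it shifts the quotient of [g] by [L] onto
    the quotient of [u]: both satisfy the same triangular system. *)
Lemma convol_shift (S' : bounded_op X X) h (g y u w : nat -> X) L : h O <> RtoC 0 ->
  (forall j, S' (g (j + L)%nat) = u j) -> (forall j, (j < L)%nat -> S' (g j) = zero) ->
  (forall j, convol h y j = g j) -> (forall j, convol h w j = u j) ->
  (forall j, S' (y (j + L)%nat) = w j) /\ (forall j, (j < L)%nat -> S' (y j) = zero).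
Proof.
  intros Hh Hg Hg0 Hy Hw.
  assert (Hsolve : forall j, S' (y j) =
    Cinv (h O) *: minus (S' (g j)) (psum (fun k => h (S k) *: S' (y (j - S k)%nat)) j)).
  { intros j. rewrite (convol_solve h y j Hh) at 1. rewrite bop_scal, bop_minus, Hy.
    do 2 f_equal. etransitivity; [apply bop_psum|].
    apply psum_ext. intros k _. apply bop_scal. }
  assert (H0 : forall j, (j < L)%nat -> S' (y j) = zero).
  { intros j. induction j as [j IH] using lt_wf_ind. intros Hj.
    rewrite Hsolve, Hg0, psum_zero by (try exact Hj; intros k Hk; rewrite IH by lia; module_eq).
    module_eq. }
  split; [|exact H0].
  intros j. induction j as [j IH] using lt_wf_ind.
  rewrite Hsolve, Hg, (convol_solve h w j Hh), Hw, psum_split.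
  rewrite (psum_zero (fun k => h (S (j + k)) *: S' (y (j + L - S (j + k))%nat))).
  - rewrite (psum_ext _ (fun k => h (S k) *: w (j - S k)%nat)); [module_eq|].
    intros k Hk. replace (j + L - S k)%nat with (j - S k + L)%nat by lia.
    now rewrite IH by lia.
  - intros k Hk. rewrite H0 by lia. module_eq.
Qed.

(** With [S = T - gam 0] and [gam = gam 0 + X^L h], the vectors
    [v_m = (h^(-m) g)_(m L)] form a Jordan chain; in the language of power series
    this is Lagrange inversion. *)
Theorem eigen_expansion_start (g : nat -> X) (gam : nat -> C) A s B t :
  Cmod (gam O) = 1 -> geom_bounded g A s -> 0 <= B -> 0 <= t ->
  (forall l, Cmod (gam l) <= B * t ^ l) -> nonconstant gam ->
  (forall j, T (g j) = convol gam g j) -> orbit_starts T (g O).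
Proof.
  intros Hz [HA [Hs Hg]] HB Ht Hgam Hex HT.
  destruct (nonconstant_least gam Hex) as [L [HL1 [HL2 HL0]]].
  set (h := fun k => gam (L + k)%nat).
  assert (Hh : h O <> RtoC 0) by (unfold h; now rewrite Nat.add_0_r).
  assert (Hh0 : 0 < Cmod (h O)) by now apply Cmod_gt_0.
  (* Enlarging the ratio from [t] to [r] absorbs the constant in the bound of [h]. *)
  set (c := B * t ^ L / Cmod (h O)).
  assert (Hc : 0 <= c).
  { apply Rdiv_le_0_compat; [apply Rmult_le_pos; [exact HB | now apply pow_le] | exact Hh0]. }
  set (r := t * (1 + c)). assert (Hr : 0 <= r) by (apply Rmult_le_pos; lra).
  assert (Hhr : forall k, Cmod (h k) <= Cmod (h O) * r ^ k).
  { intros [|k]; [simpl; lra|].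
    unfold h at 1. eapply Rle_trans; [apply Hgam|].
    unfold r. rewrite Rpow_mult_distr, pow_add.
    replace (B * (t ^ L * t ^ S k)) with (Cmod (h O) * (t ^ S k * c))
      by (unfold c; field; lra).
    apply Rmult_le_compat_l; [lra|]. apply Rmult_le_compat_l; [now apply pow_le|].
    simpl. assert (1 <= (1 + c) ^ k) by (apply pow_R1_Rle; lra).
    assert ((1 + c) * 1 <= (1 + c) * (1 + c) ^ k) by (apply Rmult_le_compat_l; lra). lra. }
  set (s' := s + 3 * r + 1).
  assert (Hg' : geom_bounded g A s').
  { repeat split; [exact HA | unfold s'; lra |]. intros j. eapply Rle_trans; [apply Hg|].
    apply Rmult_le_compat_l; [exact HA|]. apply pow_incr. unfold s'. lra. }
  set (S' := minus T (gam O *: op_id X) : bounded_op X X).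
  assert (HS' : forall x, S' x = minus (T x) (gam O *: x)).
  { intros x. unfold S'. rewrite bop_minus_apply. reflexivity. }
  set (Y := fun m => Nat.iter m (long_div h) g).
  assert (HYspec : forall m j, convol h (Y (S m)) j = Y m j).
  { intros m j. apply long_div_spec. exact Hh. }
  set (u := convol h g).
  assert (Hg1 : forall j, S' (g (j + L)%nat) = u j).
  { intros j. rewrite HS', HT. unfold convol.
    replace (S (j + L)) with (1 + (pred L + S j))%nat by lia.
    rewrite !psum_split. simpl psum at 1.
    rewrite (psum_zero (fun k => gam (1 + k)%nat *: g (j + L - (1 + k))%nat)).
    - unfold u, convol.
      rewrite (psum_ext (fun k => gam (1 + (pred L + k))%nat *: g (j + L - (1 + (pred L + k)))%nat)
         (fun k => h k *: g (j - k)%nat)).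
      + rewrite Nat.sub_0_r. module_eq.
      + intros k Hk. unfold h. replace (1 + (pred L + k))%nat with (L + k)%nat by lia.
        replace (j + L - (L + k))%nat with (j - k)%nat by lia. reflexivity.
    - intros k Hk. rewrite HL0 by lia. module_eq. }
  assert (Hg0 : forall j, (j < L)%nat -> S' (g j) = zero).
  { intros j Hj. rewrite HS', HT, convol_split.
    rewrite psum_zero; [module_eq|].
    intros k Hk. rewrite HL0 by lia. module_eq. }
  assert (HY : forall m, (forall j, S' (Y (S m) (j + L)%nat) = Y m j) /\
     (forall j, (j < L)%nat -> S' (Y (S m) j) = zero)).
  { induction m as [|m IH].
    - apply (convol_shift S' h g (Y 1%nat) u g L Hh Hg1 Hg0).
      + apply (HYspec O).
      + reflexivity.
    - apply (convol_shift S' h (Y (S m)) (Y (S (S m))) (Y m) (Y (S m)) L Hh); try apply IH;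
        apply HYspec. }
  set (q := 2 / Cmod (h O)). assert (Hq : 0 <= q) by (apply Rdiv_le_0_compat; lra).
  assert (HYb : forall m, geom_bounded (Y m) (A * q ^ m) s').
  { induction m as [|m IH]; [simpl; rewrite Rmult_1_r; exact Hg'|].
    replace (A * q ^ S m) with (A * q ^ m * q) by (simpl; ring).
    apply long_div_bounded with r; auto; unfold s'; lra. }
  set (v := fun m => Y m (m * L)%nat).
  change (g O) with (v O).
  apply (chain_orbit_start v (gam O) A (q * s' ^ L) Hz).
  - repeat split; [exact HA | apply Rmult_le_pos; [exact Hq | apply pow_le; unfold s'; lra] |].
    intros m. unfold v. destruct (HYb m) as [_ [_ H]]. eapply Rle_trans; [apply H|].
    right. rewrite Rpow_mult_distr, <- pow_mult, (Nat.mul_comm L). ring.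
  - assert (H := Hg0 O ltac:(lia)). rewrite HS' in H. change (v O) with (g O).
    replace (T (g O)) with (plus (minus (T (g O)) (gam O *: g O)) (gam O *: g O)) by module_eq.
    rewrite H. apply plus_zero_l.
  - intros m. assert (H := proj1 (HY m) (m * L)%nat). rewrite HS' in H.
    fold (v m) in H.
    replace (m * L + L)%nat with (S m * L)%nat in H by (simpl; lia). fold (v (S m)) in H.
    rewrite <- H. module_eq.
Qed.

End Chains.

(** * Power series in a contraction *)

Section FunctionalCalculus.

Variables (U : NormedModule C_AbsRing) (HU : abs_complete U).

Lemma op_pow_S (T : bounded_op U U) n x : op_pow T (S n) x = T (op_pow T n x).
Proof. reflexivity. Qed.

Lemma op_pow_S_r (T : bounded_op U U) n x : op_pow T (S n) x = op_pow T n (T x).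
Proof. induction n as [|n IH]; [reflexivity|]. rewrite op_pow_S, IH. reflexivity. Qed.

Lemma op_pow_norm (T : bounded_op U U) n : op_norm T <= 1 -> op_norm (op_pow T n) <= 1.
Proof.
  intros HT. induction n as [|n IH].
  - apply op_norm_le_mult; [lra|]. intros x. simpl. lra.
  - apply op_norm_le_mult; [lra|]. intros x. rewrite op_pow_S.
    eapply Rle_trans; [apply op_norm_bound|].
    apply Rmult_le_compat; try lra; [apply op_norm_ge0 | apply norm_ge_0 |].
    eapply Rle_trans; [apply op_norm_bound|].
    rewrite <- (Rmult_1_l (norm x)) at 2. apply Rmult_le_compat_r; [apply norm_ge_0 | exact IH].
Qed.

Definition fcalc (a : nat -> C) (T : bounded_op U U) : bounded_op U U :=
  vsum (X := op_NormedModule U U) (fun n => a n *: op_pow T n).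

Lemma fcalc_correct a A rho T : geom_bounded_C a A rho -> rho < 1 -> op_norm T <= 1 ->
  is_series (V := op_NormedModule U U) (fun n => a n *: op_pow T n) (fcalc a T).
Proof.
  intros [HA [Hr Ha]] Hr1 HT.
  apply (abs_summable_ex (bounded_op_abs_complete U U HU)).
  apply abs_summable_geom with A rho; [lra | exact HA |].
  intros n. eapply Rle_trans; [right; apply (norm_scalC (X := op_NormedModule U U))|].
  rewrite <- (Rmult_1_r (A * rho ^ n)).
  apply Rmult_le_compat; [apply Cmod_ge_0 | apply norm_ge_0 | apply Ha |].
  now apply op_pow_norm.
Qed.

Lemma fcalc_apply a A rho T x : geom_bounded_C a A rho -> rho < 1 -> op_norm T <= 1 ->
  is_series (fun n => a n *: op_pow T n x) (fcalc a T x).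
Proof.
  intros Ha Hr HT. exact (bop_is_series_apply U U _ _ x (fcalc_correct a A rho T Ha Hr HT)).
Qed.

Lemma fcalc_eigen a A rho T x z : geom_bounded_C a A rho -> rho < 1 -> op_norm T <= 1 ->
  Cmod z <= 1 -> T x = z *: x -> fcalc a T x = ksum_C a z *: x.
Proof.
  intros Ha Hr HT Hz Hx.
  assert (Hrz : rho * Cmod z < 1).
  { destruct Ha as [_ [Hr0 _]]. apply Rle_lt_trans with (rho * 1); [|lra].
    now apply Rmult_le_compat_l. }
  apply (is_series_unique_C _ _ _ (fcalc_apply a A rho T x Ha Hr HT)).
  assert (H1 := ksum_C_correct a A rho z Ha Hrz).
  set (M := op_norm T).
  assert (HL : is_linear (fun c : C => c *: x)).
  { split.
    - intros c d. exact (scal_distr_r (c : C_AbsRing) d x).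
    - intros c d. symmetry. exact (scal_assoc (c : C_AbsRing) d x).
    - exists (norm x + 1). split; [generalize (norm_ge_0 x); lra|].
      intros c. rewrite norm_scalC. rewrite Rmult_comm.
      apply Rmult_le_compat_r; [apply Cmod_ge_0 | lra]. }
  refine (is_series_eq _ _ _ _
    (bop_is_series (mk_op (U := C_NormedModule) (V := U) _ HL) _ _ H1) _ _); [|reflexivity].
  intros n.
  assert (E : op_pow T n x = Cpow z n *: x).
  { clear -Hx. induction n as [|n IH]; [simpl; module_eq|].
    rewrite op_pow_S, IH, bop_scal, Hx, Cpow_S. module_eq. }
  rewrite E. simpl.
  change (scal (Cmult (Cpow z n) (a n) : C_AbsRing) x = a n *: (Cpow z n *: x)). module_eq.
Qed.

(** The factorization [a(T) = a(z) + q(T) (T - z)] with the quotient [q] of [a] at [z]. *)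
Lemma fcalc_quot a A rho T x z : geom_bounded_C a A rho -> rho < 1 -> op_norm T <= 1 ->
  Cmod z < 1 ->
  fcalc a T x = plus (taylor_C a z 0 *: x)
     (fcalc (quot (X := C_NormedModule) a z) T (minus (T x) (z *: x))).
Proof.
  intros Ha Hr HT Hz.
  assert (Hrz : rho * Cmod z < 1).
  { destruct Ha as [_ [Hr0 _]]. apply Rle_lt_trans with (rho * 1); [|lra].
    apply Rmult_le_compat_l; lra. }
  set (q := quot (X := C_NormedModule) a z).
  assert (Hq := quot_bounded C_NormedModule C_abs_complete a A rho z Ha Hrz). fold q in Hq.
  assert (E0 := quot_rec0 C_NormedModule C_abs_complete a A rho z Ha Hrz).
  assert (ES := fun i => quot_rec C_NormedModule C_abs_complete a A rho z i Ha Hrz).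
  fold q in E0, ES.
  apply (is_series_unique_C _ _ _ (fcalc_apply a A rho T x Ha Hr HT)).
  assert (H1 := fcalc_apply q _ rho T (T x) Hq Hr HT).
  assert (H2 := fcalc_apply q _ rho T x Hq Hr HT).
  assert (H2' := proj1 (is_series_cons _ _) H2). cbv beta in H2'.
  apply is_series_cons.
  refine (is_series_eq _ _ _ _
    (is_series_minus _ _ _ _ H1 (is_series_scal (z : C_AbsRing) _ _ H2')) _ _).
  - intros n. simpl.
    assert (E : op_pow T n (T x) = op_pow T (S n) x) by (symmetry; apply op_pow_S_r).
    rewrite E, ES.
    change (minus (q n : C_NormedModule) (scal (z : C_AbsRing) (q (S n) : C_NormedModule)))
      with (Cminus (q n) (Cmult z (q (S n)))).
    change (op_pow T (S n) x) with (T (op_pow T n x)). module_eq.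
  - rewrite bop_minus, bop_scal.
    change (taylor_C a z 0) with (ksum_C a z).
    change (a O = Cminus (ksum_C a z) (Cmult z (q O))) in E0.
    rewrite E0. simpl. module_eq.
Qed.

Lemma op_pow_intertwine (V : NormedModule C_AbsRing) (J : bounded_op U V)
    (T : bounded_op U U) (T' : bounded_op V V) n x :
  (forall x, J (T x) = T' (J x)) -> J (op_pow T n x) = op_pow T' n (J x).
Proof.
  intros H. induction n as [|n IH]; [reflexivity|].
  change (J (T (op_pow T n x)) = T' (op_pow T' n (J x))). now rewrite H, IH.
Qed.

End FunctionalCalculus.

Arguments fcalc {U} _ _.

Lemma fcalc_intertwine (U V : NormedModule C_AbsRing) (HU : abs_complete U)
    (HV : abs_complete V) (J : bounded_op U V) (T : bounded_op U U) (T' : bounded_op V V)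
    a A rho x : geom_bounded_C a A rho -> rho < 1 -> op_norm T <= 1 -> op_norm T' <= 1 ->
  (forall x, J (T x) = T' (J x)) -> J (fcalc a T x) = fcalc a T' (J x).
Proof.
  intros Ha Hr HT HT' H.
  apply (is_series_unique_C (fun n => a n *: op_pow T' n (J x))).
  - refine (is_series_eq _ _ _ _ (bop_is_series J _ _ (fcalc_apply U HU a A rho T x Ha Hr HT)) _ _);
      [|reflexivity].
    intros n. simpl. rewrite bop_scal. f_equal. now apply op_pow_intertwine.
  - exact (fcalc_apply V HV a A rho T' (J x) Ha Hr HT').
Qed.

(** * Backward shifts on power families *)

Section BackwardFamily.

Variables (X : NormedModule C_AbsRing) (HX : abs_complete X) (B : bounded_op X X).
Variables (f : nat -> X) (A rho : R) (Hf : geom_bounded f A rho) (z : C)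
          (Hz : rho * Cmod z < 1).
Hypotheses (HfS : forall i, B (f (S i)) = f i) (Hf0 : B (f O) = zero).

Lemma bop_ksum (h : nat -> X) H : geom_bounded h H rho ->
  B (ksum h z) = ksum (fun i => B (h i)) z.
Proof.
  intros Hh. symmetry. apply vsum_unique.
  refine (is_series_eq _ _ _ _ (bop_is_series B _ _ (ksum_correct X HX h H rho z Hh Hz)) _ _);
    [|reflexivity].
  intros i. simpl. now rewrite bop_scal.
Qed.

Lemma quotn_shift m i : B (quotn m f z (S i)) = quotn m f z i.
Proof.
  revert i. induction m as [|m IH]; intros i; [apply HfS|].
  change (B (ksum (fun k => quotn m f z (S (S i) + k)%nat) z)
          = ksum (fun k => quotn m f z (S i + k)%nat) z).
  rewrite (bop_ksum _ _ (geom_bounded_shift X _ _ _ (S (S i))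
    (quotn_bounded X HX f A rho z m Hf Hz))).
  f_equal. apply FunctionalExtensionality.functional_extensionality.
  intros k. apply IH.
Qed.

Lemma quotn_shift0 m : B (quotn (S m) f z O) = taylor f z m.
Proof.
  change (B (ksum (fun k => quotn m f z (1 + k)%nat) z) = ksum (quotn m f z) z).
  etransitivity; [exact (bop_ksum _ _ (geom_bounded_shift X _ _ _ 1
    (quotn_bounded X HX f A rho z m Hf Hz)))|].
  f_equal. apply FunctionalExtensionality.functional_extensionality.
  intros k. apply quotn_shift.
Qed.

Lemma taylor_shift m :
  B (taylor f z m) = plus (z *: taylor f z m) (B (quotn m f z O)).
Proof.
  assert (Hq := quotn_bounded X HX f A rho z m Hf Hz).
  unfold taylor at 1. rewrite (ksum_unfold X HX _ _ rho z Hq Hz), bop_plus, bop_scal.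
  assert (E : B (ksum (fun k => quotn m f z (S k)) z) = taylor f z m).
  2:{ rewrite E. module_eq. }
  etransitivity; [exact (bop_ksum _ _ (geom_bounded_shift X _ _ _ 1 Hq))|].
  - unfold taylor. f_equal. apply FunctionalExtensionality.functional_extensionality.
    intros k. apply quotn_shift.
Qed.

Lemma taylor_shift_O : minus (B (taylor f z 0)) (z *: taylor f z 0) = zero.
Proof.
  rewrite taylor_shift. change (quotn 0 f z O) with (f O). rewrite Hf0. module_eq.
Qed.

Lemma taylor_shift_S m : minus (B (taylor f z (S m))) (z *: taylor f z (S m)) = taylor f z m.
Proof. rewrite taylor_shift, quotn_shift0. module_eq. Qed.

Lemma quotn_quot {Y : NormedModule C_AbsRing} (a : nat -> Y) m :
  quotn m (quot a z) z = quotn (S m) a z.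
Proof. unfold quotn. rewrite Nat.iter_succ_r. reflexivity. Qed.

(** The Taylor coefficients at [z] of the family of eigenvectors [l -> ksum f l] form a
    Jordan chain of [B] for the eigenvalue [z], and powers of [B - z] shift it. *)
Lemma fcalc_taylor (a : nat -> C) C0 r j : op_norm B <= 1 -> Cmod z < 1 ->
  geom_bounded_C a C0 r -> r < 1 ->
  fcalc a B (taylor f z j) = convol X (taylor_C a z) (taylor f z) j.
Proof.
  intros HB Hz1. revert a C0. induction j as [|j IH]; intros a C0 Ha Hr;
    rewrite (fcalc_quot X HX a C0 r B _ z Ha Hr HB Hz1).
  - rewrite taylor_shift_O. etransitivity; [apply f_equal; apply bop_zero|].
    unfold convol. simpl. module_eq.
  - assert (Hrz : r * Cmod z < 1).
    { destruct Ha as [_ [Hr0 _]]. apply Rle_lt_trans with (r * 1); [|lra].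
      apply Rmult_le_compat_l; lra. }
    rewrite taylor_shift_S.
    rewrite (IH _ _ (quot_bounded C_NormedModule C_abs_complete a C0 r z Ha Hrz) Hr).
    rewrite (convol_split X _ _ (S j)). unfold convol. f_equal. apply psum_ext. intros k Hk.
    unfold taylor at 1. rewrite quotn_quot. reflexivity.
Qed.

End BackwardFamily.

Lemma taylor_in_subspace (X : NormedModule C_AbsRing) (HX : abs_complete X) (Z : X -> Prop)
    (HZ : closed_subspace Z) f A rho z m : geom_bounded f A rho -> rho * Cmod z < 1 ->
  (forall i, Z (f i)) -> Z (taylor f z m).
Proof.
  intros Hf Hz H.
  assert (HK : forall h H0, geom_bounded h H0 rho -> (forall i, Z (h i)) -> Z (ksum h z)).
  { intros h H0 Hh Hhi. apply (cs_series X Z HZ _ _ (ksum_correct X HX h H0 rho z Hh Hz)).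
    intros k. apply (cs_scal X Z HZ), Hhi. }
  assert (HQ : forall i, Z (quotn m f z i)).
  { induction m as [|m IH]; [exact H|]. intros i.
    apply HK with (1 := geom_bounded_shift X _ _ _ (S i) (quotn_bounded X HX f A rho z m Hf Hz)).
    intros k. apply IH. }
  exact (HK _ _ (quotn_bounded X HX f A rho z m Hf Hz) HQ).
Qed.

(** * The modulus of an analytic function on small circles *)


(** Otherwise the sum would be constant near [z], hence everywhere by the identity
    theorem. *)
Lemma nonconstant_taylor a A rho z : geom_bounded_C a A rho -> rho * Cmod z < 1 ->
  nonconstant a -> nonconstant (taylor_C a z).
Proof.
  intros Ha Hz [i0 [Hi0 Hai0]]. apply NNPP. intros Hno. apply Hai0.
  assert (H0 : forall l, (1 <= l)%nat -> taylor_C a z l = RtoC 0).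
  { intros l Hl. apply NNPP. intros Hne. apply Hno. now exists l. }
  set (a' := fun i => match i with O => Cminus (a O) (ksum_C a z) | S _ => a i end).
  assert (Ha' := Ha). destruct Ha' as [HA [Hr Hai]].
  assert (Hb : geom_bounded_C a' (A + Cmod (ksum_C a z)) rho).
  { assert (Hc := Cmod_ge_0 (ksum_C a z)). split; [lra|]. split; [exact Hr|]. intros i.
    destruct i as [|i]; unfold a'.
    - simpl. rewrite Rmult_1_r. change (Cmod (Cminus (a O) (ksum_C a z)) <= A + Cmod (ksum_C a z)).
      eapply Rle_trans; [apply Cmod_triangle|]. rewrite Cmod_opp.
      apply Rplus_le_compat_r. generalize (Hai O). simpl. rewrite Rmult_1_r. exact (fun h => h).
    - eapply Rle_trans; [apply Hai|]. apply Rmult_le_compat_r; [now apply pow_le | lra]. }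
  assert (HK : forall l, rho * Cmod l < 1 -> ksum_C a' l = Cminus (ksum_C a l) (ksum_C a z)).
  { intros l Hl. rewrite (ksum_unfold C_NormedModule C_abs_complete a' _ rho l Hb Hl).
    rewrite (ksum_unfold C_NormedModule C_abs_complete a _ rho l Ha Hl).
    change (Cplus (Cminus (a O) (ksum_C a z)) (Cmult l (ksum_C (fun k => a (S k)) l))
      = Cminus (Cplus (a O) (Cmult l (ksum_C (fun k => a (S k)) l))) (ksum_C a z)).
    ring. }
  assert (E : a' i0 = RtoC 0).
  { refine (identity_theorem C_NormedModule C_abs_complete _
      (closed_subspace_zero C_NormedModule) a' _ rho z Hb Hz _ i0).
    intros eps Heps.
    set (d := 1 - rho * Cmod z). assert (Hd : 0 < d) by (unfold d; lra).
    set (e := Rmin (eps / 2) (d / (2 * (rho + 1)))).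
    assert (He : 0 < e) by (apply Rmin_case; apply Rdiv_lt_0_compat; lra).
    assert (He1 : e <= eps / 2) by apply Rmin_l.
    assert (Hre : rho * e <= d / 2).
    { apply Rle_trans with ((rho + 1) * (d / (2 * (rho + 1)))).
      - apply Rmult_le_compat; try lra. apply Rmin_r.
      - right. field. lra. }
    assert (Hce : Cmod (RtoC e) = e) by (rewrite Cmod_R, Rabs_pos_eq; lra).
    assert (Hze : rho * (Cmod z + Cmod (RtoC e)) < 1) by (rewrite Hce; unfold d in *; lra).
    exists (Cplus z (RtoC e)). split; [|split].
    - intros E. assert (E2 : RtoC e = RtoC 0).
      { replace (RtoC e) with (Cminus (Cplus z (RtoC e)) z) by ring. rewrite E. ring. }
      apply RtoC_inj in E2. lra.
    - replace (Cminus (Cplus z (RtoC e)) z) with (RtoC e) by ring. rewrite Hce. lra.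
    - rewrite HK.
      + assert (HT := taylor_series C_NormedModule C_abs_complete a A rho z (RtoC e) Ha Hze).
        replace (ksum_C a (Cplus z (RtoC e))) with (ksum_C a z);
          [apply Cplus_opp_r|].
        refine (is_series_unique_C (fun m => Cpow (RtoC e) m *: (taylor_C a z m : C_NormedModule))
          _ _ _ HT).
        refine (is_series_eq _ _ _ _ (is_series_finite C_NormedModule
          (fun m => Cpow (RtoC e) m *: (taylor_C a z m : C_NormedModule)) 1 _) _ _).
        * intros m Hm. rewrite H0 by exact Hm. apply Cmult_0_r.
        * reflexivity.
        * simpl. change (Cplus (RtoC 0) (Cmult (RtoC 1) (ksum_C a z)) = ksum_C a z). ring.
      + eapply Rle_lt_trans; [|exact Hze]. apply Rmult_le_compat_l; [exact Hr|].
        apply Cmod_triangle. }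
  destruct i0 as [|i0]; [lia | exact E].
Qed.

Lemma polar_form (b : C) : exists be, b = Cmult (RtoC (Cmod b)) (cis be).
Proof.
  destruct (Ceq_dec b (RtoC 0)) as [->|Hb].
  - exists 0. rewrite Cmod_0. ring.
  - assert (H0 : 0 < Cmod b) by now apply Cmod_gt_0.
    assert (Hnz : RtoC (Cmod b) <> RtoC 0) by (intros E; apply RtoC_inj in E; lra).
    destruct (unimodular_cis (Cdiv b (RtoC (Cmod b)))) as [be Hbe].
    + rewrite Cmod_div by exact Hnz. rewrite Cmod_R, Rabs_pos_eq by lra. field. lra.
    + exists be. rewrite <- Hbe. field. exact Hnz.
Qed.

Lemma circle_modulus_continuous a A rho z t : geom_bounded_C a A rho -> 0 < t ->
  rho * (Cmod z + t) < 1 ->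
  continuity (fun al => Cmod (ksum_C a (Cplus z (Cmult (RtoC t) (cis al))))).
Proof.
  intros Ha Ht Hzt x eps Heps. assert (Ha' := Ha). destruct Ha' as [HA [Hr _]].
  assert (Htc : forall al, Cmod (Cmult (RtoC t) (cis al)) = t).
  { intros al. rewrite Cmod_mult, Cmod_cis, Cmod_R, Rabs_pos_eq; lra. }
  assert (Hp : rho * Cmod (Cplus z (Cmult (RtoC t) (cis x))) < 1).
  { eapply Rle_lt_trans; [|exact Hzt]. apply Rmult_le_compat_l; [exact Hr|].
    eapply Rle_trans; [apply Cmod_triangle|]. rewrite Htc. lra. }
  destruct (ksum_continuous C_NormedModule C_abs_complete a A rho _ Ha Hp eps Heps)
    as [delta [Hd H]].
  exists (delta / t). split; [apply Rdiv_lt_0_compat; lra|].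
  assert (HH : forall y : R, Rabs (y - x) < delta / t ->
    Rabs (Cmod (ksum_C a (Cplus z (Cmult (RtoC t) (cis y)))) -
          Cmod (ksum_C a (Cplus z (Cmult (RtoC t) (cis x))))) < eps);
    [|intros y [_ Hy]; exact (HH y Hy)].
  intros y Hy.
  assert (Hl : Cmod (Cminus (Cplus z (Cmult (RtoC t) (cis y))) (Cplus z (Cmult (RtoC t) (cis x)))) < delta).
  { replace (Cminus (Cplus z (Cmult (RtoC t) (cis y))) (Cplus z (Cmult (RtoC t) (cis x))))
      with (Cmult (RtoC t) (Cminus (cis ((y - x) + x)) (cis x)))
      by (replace (y - x + x) with y by ring; ring).
    rewrite Cmod_mult, Cmod_R, Rabs_pos_eq by lra.
    apply Rle_lt_trans with (t * Rabs (y - x)).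
    - apply Rmult_le_compat_l; [lra | apply Cmod_cis_minus].
    - apply Rlt_le_trans with (t * (delta / t)); [now apply Rmult_lt_compat_l|].
      right. field. lra. }
  eapply Rle_lt_trans; [|exact (H _ Hl)].
  exact (norm_triangle_inv (V := C_NormedModule) _ _).
Qed.

(** On a small circle around [z] the term [c u^L] of lowest order dominates
    [K (z + u) - K z], and its argument takes all values; so [|K|] gets both
    larger and smaller than [|K z|] and takes all values close to [|K z|]. *)
Theorem modulus_values a A rho z : geom_bounded_C a A rho -> rho * Cmod z < 1 ->
  nonconstant a -> ksum_C a z <> RtoC 0 ->
  forall t0, 0 < t0 -> exists t eta, 0 < t < t0 /\ 0 < eta /\
    forall r, Rabs (r - Cmod (ksum_C a z)) < eta ->
      exists l, Cmod (Cminus l z) = t /\ Cmod (ksum_C a l) = r.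
Proof.
  intros Ha Hz Hnc Hne t0 Ht0. assert (Ha' := Ha). destruct Ha' as [HA [Hr _]].
  destruct (nonconstant_least _ (nonconstant_taylor a A rho z Ha Hz Hnc)) as [L [HL1 [HL2 HL0]]].
  set (c0 := ksum_C a z) in *. set (c := taylor_C a z L) in *.
  set (b := Cmult (Cconj c0) c).
  assert (Hc0 : 0 < Cmod c0) by now apply Cmod_gt_0.
  assert (Hc : 0 < Cmod c) by now apply Cmod_gt_0.
  assert (Hb : Cmod b = Cmod c0 * Cmod c) by (unfold b; now rewrite Cmod_mult, Cmod_conj).
  assert (Hb0 : 0 < Cmod b) by (rewrite Hb; now apply Rmult_lt_0_compat).
  set (d := 1 - rho * Cmod z). assert (Hd : 0 < d) by (unfold d; lra).
  assert (Hq := quotn_bounded C_NormedModule C_abs_complete a A rho z (S L) Ha Hz).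
  set (A' := A * (rho / (1 - rho * Cmod z)) ^ S L) in *.
  assert (HA' : 0 <= A') by apply Hq.
  set (M := 2 * A' / d). assert (HM : 0 <= M) by (apply Rdiv_le_0_compat; lra).
  assert (HM1 : 0 < M + 1) by lra.
  set (t := Rmin (Rmin (t0 / 2) (d / (2 * (rho + 1))))
                 (Rmin (Rmin 1 (Cmod c0 ^ 2 / Cmod b)) (Cmod b / (2 * (Cmod c0 * (M + 1)))))).
  assert (Ht : 0 < t).
  { unfold t. repeat apply Rmin_case; try lra; apply Rdiv_lt_0_compat; try lra.
    - now apply pow_lt.
    - apply Rmult_lt_0_compat; [lra|]. now apply Rmult_lt_0_compat. }
  assert (Ht1 : t <= t0 / 2) by (eapply Rle_trans; [apply Rmin_l | apply Rmin_l]).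
  assert (Ht2 : t <= d / (2 * (rho + 1))) by (eapply Rle_trans; [apply Rmin_l | apply Rmin_r]).
  assert (Ht3 : t <= 1).
  { eapply Rle_trans; [apply Rmin_r|]. eapply Rle_trans; [apply Rmin_l | apply Rmin_l]. }
  assert (Ht4 : t <= Cmod c0 ^ 2 / Cmod b).
  { eapply Rle_trans; [apply Rmin_r|]. eapply Rle_trans; [apply Rmin_l | apply Rmin_r]. }
  assert (Ht5 : t <= Cmod b / (2 * (Cmod c0 * (M + 1)))).
  { eapply Rle_trans; [apply Rmin_r | apply Rmin_r]. }
  assert (Hrt : rho * t <= d / 2).
  { apply Rle_trans with ((rho + 1) * (d / (2 * (rho + 1)))).
    - apply Rmult_le_compat; lra.
    - right. field. lra. }
  assert (HtL : 0 < t ^ L) by now apply pow_lt.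
  set (p := fun al => Cplus z (Cmult (RtoC t) (cis al))).
  assert (Htc : forall al, Cmod (Cmult (RtoC t) (cis al)) = t).
  { intros al. rewrite Cmod_mult, Cmod_cis, Cmod_R, Rabs_pos_eq; lra. }
  assert (Hpz : forall al, Cminus (p al) z = Cmult (RtoC t) (cis al)) by (intros; unfold p; ring).
  assert (Hp : forall al, rho * Cmod (p al) <= 1 - d / 2).
  { intros al. apply Rle_trans with (rho * (Cmod z + t)); [|unfold d in *; lra].
    apply Rmult_le_compat_l; [exact Hr|]. rewrite <- (Htc al). apply Cmod_triangle. }
  (* [conj (K z) * K (z + u)] up to an error that is small against [|b| t^L]. *)
  assert (Hexp : forall al, exists w, Cmod w <= Cmod b * t ^ L / 2 /\
    Cmult (Cconj c0) (ksum_C a (p al)) =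
      Cplus (Cplus (RtoC (Cmod c0 ^ 2)) (Cmult b (Cmult (RtoC (t ^ L)) (cis (INR L * al))))) w).
  { intros al. set (u := Cmult (RtoC t) (cis al)).
    set (rem := ksum_C (quotn (X := C_NormedModule) (S L) a z) (p al)).
    exists (Cmult (Cconj c0) (Cmult (Cpow u (S L)) rem)). split.
    - rewrite !Cmod_mult, Cmod_conj, Cmod_pow. unfold u. rewrite Htc.
      assert (Hrem : Cmod rem <= M).
      { eapply Rle_trans; [apply (ksum_norm C_NormedModule C_abs_complete _ A' rho (p al) Hq);
          generalize (Hp al); lra|].
        unfold M. replace (2 * A' / d) with (A' * / (d / 2)) by (field; lra).
        apply Rmult_le_compat_l; [exact HA'|]. apply Rinv_le_contravar; [lra|].
        generalize (Hp al). lra. }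
      assert (H1 : t * (Cmod c0 * (M + 1)) <= Cmod b / 2).
      { assert (Hcm : 0 < Cmod c0 * (M + 1)) by now apply Rmult_lt_0_compat.
        apply Rle_trans with (Cmod b / (2 * (Cmod c0 * (M + 1))) * (Cmod c0 * (M + 1))).
        - apply Rmult_le_compat_r; lra.
        - right. field. lra. }
      apply Rle_trans with (t ^ L * (t * (Cmod c0 * (M + 1)))).
      + simpl (t ^ S L).
        replace (t ^ L * (t * (Cmod c0 * (M + 1)))) with (Cmod c0 * (t * t ^ L * (M + 1))) by ring.
        apply Rmult_le_compat_l; [lra|]. apply Rmult_le_compat_l; [|lra].
        apply Rmult_le_pos; lra.
      + apply Rle_trans with (t ^ L * (Cmod b / 2)); [apply Rmult_le_compat_l; lra | lra].
    - unfold rem.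
      rewrite (taylor_partial C_NormedModule C_abs_complete a A rho z (p al) (S L) Ha Hz)
        by (generalize (Hp al); lra).
      rewrite Hpz. fold u.
      assert (Eps : psum (G := C_AbelianMonoid) (fun k => Cmult (Cpow u k) (taylor_C a z k)) (S L)
         = Cplus c0 (Cmult (Cpow u L) c)).
      { change (psum (G := C_AbelianMonoid) (fun k => Cmult (Cpow u k) (taylor_C a z k)) (S L))
          with (Cplus (psum (G := C_AbelianMonoid) (fun k => Cmult (Cpow u k) (taylor_C a z k)) L)
             (Cmult (Cpow u L) (taylor_C a z L))).
        f_equal. rewrite (psum_single _ L O).
        - simpl. change (taylor_C a z 0) with c0. Cring.
        - lia.
        - intros k Hk Hk0. rewrite HL0 by lia. apply Cmult_0_r. }
      change (Cmult (Cconj c0) (Cplus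
        (psum (G := C_AbelianMonoid) (fun k => Cmult (Cpow u k) (taylor_C a z k)) (S L))
        (Cmult (Cpow u (S L)) (ksum_C (quotn (X := C_NormedModule) (S L) a z) (p al)))) =
        Cplus (Cplus (RtoC (Cmod c0 ^ 2)) (Cmult b (Cmult (RtoC (t ^ L)) (cis (INR L * al)))))
          (Cmult (Cconj c0) (Cmult (Cpow u (S L)) (ksum_C (quotn (X := C_NormedModule) (S L) a z) (p al))))).
      rewrite Eps.
      replace (RtoC (Cmod c0 ^ 2)) with (Cmult c0 (Cconj c0)) by (symmetry; apply Cmod2_conj).
      rewrite <- cis_pow, RtoC_pow. unfold u. rewrite !Cpow_mult_l. unfold b. ring. }
  destruct (polar_form b) as [be Hbe].
  (* The angles for which [b u^L] is a positive and a negative number. *)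
  set (alp := - be / INR L). set (alm := (PI - be) / INR L).
  assert (HLR : 0 < INR L) by (apply lt_0_INR; lia).
  set (F := fun al => Cmod (ksum_C a (p al))).
  set (eta := Cmod b * t ^ L / (2 * Cmod c0)).
  assert (Heta : 0 < eta) by (apply Rdiv_lt_0_compat; [now apply Rmult_lt_0_compat | lra]).
  assert (HF : forall al, Cmod (Cmult (Cconj c0) (ksum_C a (p al))) = Cmod c0 * F al).
  { intros al. now rewrite Cmod_mult, Cmod_conj. }
  assert (HbtL : Cmod b * t ^ L <= Cmod c0 ^ 2).
  { assert (t ^ L <= t).
    { replace L with (S (pred L)) by lia. simpl. rewrite <- (Rmult_1_r t) at 3.
      apply Rmult_le_compat_l; [lra|]. rewrite <- (pow1 (pred L)). apply pow_incr. lra. }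
    apply Rle_trans with (Cmod b * (Cmod c0 ^ 2 / Cmod b)).
    - apply Rmult_le_compat_l; lra.
    - right. field. lra. }
  assert (Hetac : eta * Cmod c0 = Cmod b * t ^ L / 2) by (unfold eta; field; lra).
  assert (HFp : Cmod c0 + eta <= F alp).
  { destruct (Hexp alp) as [w [Hw Ew]].
    assert (E : Cmult b (Cmult (RtoC (t ^ L)) (cis (INR L * alp))) = RtoC (Cmod b * t ^ L)).
    { rewrite Hbe at 1. replace (INR L * alp) with (- be) by (unfold alp; field; lra).
      transitivity (Cmult (RtoC (Cmod b * t ^ L)) (Cmult (cis (- be)) (cis be))).
      - rewrite RtoC_mult. ring.
      - rewrite cis_opp_l. ring. }
    rewrite E, <- RtoC_plus in Ew.
    apply Rmult_le_reg_l with (Cmod c0); [exact Hc0|].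
    rewrite <- HF, Ew, Rmult_plus_distr_l, (Rmult_comm _ eta), Hetac.
    assert (H1 : Cmod c0 ^ 2 + Cmod b * t ^ L <=
       Cmod (Cplus (RtoC (Cmod c0 ^ 2 + Cmod b * t ^ L)) w) + Cmod w).
    { assert (E1 : RtoC (Cmod c0 ^ 2 + Cmod b * t ^ L) =
        Cplus (Cplus (RtoC (Cmod c0 ^ 2 + Cmod b * t ^ L)) w) (Copp w)) by ring.
      assert (E2 : Cmod c0 ^ 2 + Cmod b * t ^ L = Cmod (RtoC (Cmod c0 ^ 2 + Cmod b * t ^ L))).
      { rewrite Cmod_R, Rabs_pos_eq; [reflexivity|].
        apply Rplus_le_le_0_compat; [apply pow_le; lra | apply Rmult_le_pos; lra]. }
      rewrite E2 at 1. rewrite E1 at 1. rewrite <- (Cmod_opp w). apply Cmod_triangle. }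
    simpl (_ ^ 2) in *. lra. }
  assert (HFm : F alm <= Cmod c0 - eta).
  { destruct (Hexp alm) as [w [Hw Ew]].
    assert (E : Cmult b (Cmult (RtoC (t ^ L)) (cis (INR L * alm))) = RtoC (- (Cmod b * t ^ L))).
    { rewrite Hbe at 1. replace (INR L * alm) with (PI + - be) by (unfold alm; field; lra).
      rewrite cis_plus. replace (cis PI) with (RtoC (- 1)).
      - transitivity (Cmult (RtoC (- (Cmod b * t ^ L))) (Cmult (cis (- be)) (cis be))).
        + rewrite !RtoC_opp, RtoC_mult. ring.
        + rewrite cis_opp_l. ring.
      - unfold cis. now rewrite cos_PI, sin_PI. }
    rewrite E, <- RtoC_plus in Ew.
    apply Rmult_le_reg_l with (Cmod c0); [exact Hc0|].
    rewrite <- HF, Ew, Rmult_minus_distr_l, (Rmult_comm _ eta), Hetac.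
    eapply Rle_trans; [apply Cmod_triangle|].
    rewrite Cmod_R, Rabs_pos_eq by lra. simpl (_ ^ 2) in *. lra. }
  exists t, eta. split; [lra|]. split; [exact Heta|].
  intros r Hrr. apply Rabs_def2 in Hrr.
  assert (Hcont : continuity F).
  { apply circle_modulus_continuous with A rho; [exact Ha | exact Ht |].
    unfold d in *. lra. }
  destruct (IVT_gen F alp alm r Hcont) as [al [_ Hal]].
  { rewrite Rmin_right, Rmax_left by lra. lra. }
  exists (p al). split; [|exact Hal]. rewrite Hpz. apply Htc.
Qed.

(** * Two commuting backward shifts *)

Section DoubleShift.

Variables (X : NormedModule C_AbsRing) (HX : abs_complete X).
Variables (B1 B2 : bounded_op X X) (e : nat -> nat -> X).
Hypotheses (HB1 : op_norm B1 <= 1) (HB2 : op_norm B2 <= 1)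
  (He : forall i j, norm (e i j) <= 1)
  (H1S : forall i j, B1 (e (S i) j) = e i j) (H10 : forall j, B1 (e O j) = zero)
  (H2S : forall i j, B2 (e i (S j)) = e i j) (H20 : forall i, B2 (e i O) = zero).
Variables (a b : nat -> C) (A1 A2 rho : R) (Hrho : rho < 1).
Hypotheses (Ha : geom_bounded_C a A1 rho) (Hb : geom_bounded_C b A2 rho)
  (Hnc : nonconstant a).

Let T : bounded_op X X := op_comp (fcalc a B1) (fcalc b B2).

(** The tensor product of the [i]-th basis vector with the eigenvector of the
    backward shift for the eigenvalue [mu]. *)
Definition slice (mu : C) (i : nat) : X := ksum (e i) mu.

Lemma rho_small z : Cmod z < 1 -> rho * Cmod z < 1.
Proof.
  intros Hz. destruct Ha as [_ [Hr _]]. apply Rle_lt_trans with (rho * 1); [|lra].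
  apply Rmult_le_compat_l; lra.
Qed.

Lemma row_bounded i : geom_bounded (e i) 1 1.
Proof. repeat split; try lra. intros j. rewrite pow1, Rmult_1_r. apply He. Qed.

Lemma slice_bounded mu : Cmod mu < 1 -> geom_bounded (slice mu) (/ (1 - Cmod mu)) 1.
Proof.
  intros Hmu. repeat split; [left; apply Rinv_0_lt_compat; lra | lra |].
  intros i. rewrite pow1, Rmult_1_r.
  eapply Rle_trans; [apply (ksum_norm X HX _ _ 1 mu (row_bounded i)); lra|].
  right. field. lra.
Qed.

Lemma slice_shift1_S mu i : Cmod mu < 1 -> B1 (slice mu (S i)) = slice mu i.
Proof.
  intros Hmu. etransitivity; [exact (bop_ksum X HX B1 1 mu ltac:(lra) _ _ (row_bounded (S i)))|].
  unfold slice. f_equal. apply FunctionalExtensionality.functional_extensionality.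
  intros j. apply H1S.
Qed.

Lemma slice_shift1_0 mu : Cmod mu < 1 -> B1 (slice mu O) = zero.
Proof.
  intros Hmu. etransitivity; [exact (bop_ksum X HX B1 1 mu ltac:(lra) _ _ (row_bounded O))|].
  apply vsum_unique.
  refine (is_series_eq _ _ _ _ (is_series_finite X (fun _ => zero) O _) _ _).
  - reflexivity.
  - intros j. simpl. rewrite H10. module_eq.
  - reflexivity.
Qed.

Lemma slice_shift2 mu i : Cmod mu < 1 -> B2 (slice mu i) = mu *: slice mu i.
Proof.
  intros Hmu.
  assert (H := taylor_shift X HX B2 (e i) 1 1 (row_bounded i) mu ltac:(lra) (H2S i) 0).
  change (taylor (e i) mu 0) with (slice mu i) in H.
  change (quotn 0 (e i) mu O) with (e i O) in H.
  rewrite H, H20. module_eq.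
Qed.

Lemma eigenspace_closed (S' : bounded_op X X) (c : C) : closed_subspace (fun x => S' x = c *: x).
Proof.
  split.
  - rewrite bop_zero. module_eq.
  - intros x y Hx Hy. rewrite bop_plus, Hx, Hy. module_eq.
  - intros d x Hx. rewrite bop_scal, Hx. module_eq.
  - intros x H.
    set (S2 := minus S' (c *: op_id X) : bounded_op X X).
    assert (HS2 : forall x, S2 x = minus (S' x) (c *: x)).
    { intros y. unfold S2. rewrite bop_minus_apply. reflexivity. }
    assert (Hk : forall y, S' y = c *: y -> S2 y = zero).
    { intros y Hy. rewrite HS2, Hy. module_eq. }
    assert (E : S2 x = zero).
    { apply (norm_eq_zero (V := X)). apply Rle_antisym; [|apply norm_ge_0].
      apply le_epsilon. intros eps Heps. assert (H0 := op_norm_ge0 X X S2).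
      destruct (H (eps / (op_norm S2 + 1))) as [y [Hy Hxy]]; [apply Rdiv_lt_0_compat; lra|].
      rewrite Rplus_0_l.
      assert (E : S2 x = S2 (minus x y)) by (rewrite bop_minus, (Hk y Hy); module_eq).
      rewrite E. eapply Rle_trans; [apply op_norm_bound|].
      apply Rle_trans with ((op_norm S2 + 1) * (eps / (op_norm S2 + 1))).
      - apply Rmult_le_compat; try lra. apply norm_ge_0.
      - right. field. lra. }
    rewrite HS2 in E.
    replace (S' x) with (plus (minus (S' x) (c *: x)) (c *: x)) by module_eq.
    rewrite E. apply plus_zero_l.
Qed.

(** On the Taylor coefficients at [z] of the family [l -> ksum (slice mu) l] the operator
    acts by convolution with those of [psi(mu) phi], the first of which is unimodular. *)
Lemma eigenvector_start z mu : Cmod z < 1 -> Cmod mu < 1 ->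
  Cmod (Cmult (ksum_C a z) (ksum_C b mu)) = 1 -> orbit_starts T (ksum (slice mu) z).
Proof.
  intros Hz Hmu H1.
  assert (Hs := slice_bounded mu Hmu).
  set (g := taylor (slice mu) z). change (ksum (slice mu) z) with (g O).
  assert (Hz1 : 1 * Cmod z < 1) by lra.
  set (psi := ksum_C b mu) in *.
  assert (Hpsi : psi <> RtoC 0).
  { intros E. rewrite E, Cmult_0_r, Cmod_0 in H1. lra. }
  assert (HB2g : forall j, B2 (g j) = mu *: g j).
  { intros j. apply (taylor_in_subspace X HX (fun x => B2 x = mu *: x)
      (eigenspace_closed B2 mu) (slice mu) _ 1 z j Hs Hz1).
    intros i. now apply slice_shift2. }
  destruct (nonconstant_taylor a A1 rho z Ha (rho_small z Hz) Hnc) as [L [HL1 HL2]].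
  assert (Hd1 : 0 < 1 - 1 * Cmod z) by lra.
  assert (Hdr : 0 < 1 - rho * Cmod z) by (generalize (rho_small z Hz); lra).
  assert (Ha' := Ha). destruct Ha' as [HA1 [Hr _]].
  apply (eigen_expansion_start X HX T g (fun l => Cmult psi (taylor_C a z l))
    (/ (1 - Cmod mu) / (1 - 1 * Cmod z)) (1 / (1 - 1 * Cmod z))
    (Cmod psi * (A1 / (1 - rho * Cmod z))) (rho / (1 - rho * Cmod z))).
  - rewrite Cmult_comm. exact H1.
  - repeat split.
    + apply Rdiv_le_0_compat; [apply Hs | exact Hd1].
    + apply Rdiv_le_0_compat; lra.
    + intros j. apply (taylor_norm X HX _ _ 1 z j Hs Hz1).
  - apply Rmult_le_pos; [apply Cmod_ge_0 | apply Rdiv_le_0_compat; lra].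
  - apply Rdiv_le_0_compat; lra.
  - intros l. rewrite Cmod_mult, Rmult_assoc. apply Rmult_le_compat_l; [apply Cmod_ge_0|].
    exact (taylor_norm C_NormedModule C_abs_complete a A1 rho z l Ha (rho_small z Hz)).
  - exists L. split; [exact HL1|]. now apply Cmult_neq_0.
  - intros j.
    assert (E2 : fcalc b B2 (g j) = psi *: g j).
    { apply (fcalc_eigen X HX b A2 rho B2 (g j) mu Hb Hrho HB2); [lra | apply HB2g]. }
    change (T (g j)) with (fcalc a B1 (fcalc b B2 (g j))). rewrite E2, bop_scal.
    unfold g at 1.
    rewrite (fcalc_taylor X HX B1 (slice mu) _ 1 Hs z Hz1
      (fun i => slice_shift1_S mu i Hmu) (slice_shift1_0 mu Hmu) a A1 rho j HB1 Hz Ha Hrho).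
    unfold convol. etransitivity; [symmetry; apply psum_scal|]. apply psum_ext. intros k _.
    fold g. module_eq.
Qed.

(** The points [l] with [|phi(l)| = |phi(z)|] accumulate at [z], and the eigenvectors for
    these [l] recover the coefficients of the family by the identity theorem. *)
Lemma slices_in z mu : Cmod z < 1 -> Cmod mu < 1 ->
  Cmod (Cmult (ksum_C a z) (ksum_C b mu)) = 1 -> forall i, orbit_starts T (slice mu i).
Proof.
  intros Hz Hmu H1.
  apply (identity_theorem X HX _ (orbit_starts_subspace X T) (slice mu) _ 1 z
    (slice_bounded mu Hmu)); [lra|].
  intros eps Heps.
  assert (Hne : ksum_C a z <> RtoC 0).
  { intros E. rewrite E, Cmult_0_l, Cmod_0 in H1. lra. }
  destruct (modulus_values a A1 rho z Ha (rho_small z Hz) Hnc Hne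
    (Rmin eps (1 - Cmod z))) as [t [eta [[Ht Htm] [Heta H]]]]; [apply Rmin_case; lra|].
  assert (Ht1 := Rlt_le_trans _ _ _ Htm (Rmin_l _ _)).
  assert (Ht2 := Rlt_le_trans _ _ _ Htm (Rmin_r _ _)).
  destruct (H (Cmod (ksum_C a z))) as [l [Hl Hla]].
  { rewrite Rminus_diag, Rabs_R0. exact Heta. }
  exists l. split; [|split].
  - intros E. rewrite E in Hl. replace (Cminus z z) with (RtoC 0) in Hl by ring.
    rewrite Cmod_0 in Hl. lra.
  - lra.
  - apply eigenvector_start; [|exact Hmu|].
    + replace l with (Cplus z (Cminus l z)) by ring.
      eapply Rle_lt_trans; [apply Cmod_triangle|]. lra.
    + rewrite Cmod_mult, Hla, <- Cmod_mult. exact H1.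
Qed.

(** Near a point of the hypersurface [|phi(z) psi(mu)| = 1], every [mu] lies on it
    for a suitable [z]; so both variables can be freed one after the other. *)
Theorem double_shift_starts z0 mu0 : Cmod z0 < 1 -> Cmod mu0 < 1 ->
  Cmod (Cmult (ksum_C a z0) (ksum_C b mu0)) = 1 -> forall i j, orbit_starts T (e i j).
Proof.
  intros Hz0 Hmu0 H1 i.
  assert (Hne : ksum_C a z0 <> RtoC 0).
  { intros E. rewrite E, Cmult_0_l, Cmod_0 in H1. lra. }
  assert (Hne2 : ksum_C b mu0 <> RtoC 0).
  { intros E. rewrite E, Cmult_0_r, Cmod_0 in H1. lra. }
  assert (Hp : 0 < Cmod (ksum_C b mu0)) by now apply Cmod_gt_0.
  rewrite Cmod_mult in H1.
  assert (Hphi : Cmod (ksum_C a z0) = / Cmod (ksum_C b mu0)).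
  { apply Rmult_eq_reg_r with (Cmod (ksum_C b mu0)); [|lra]. rewrite Rinv_l; lra. }
  destruct (modulus_values a A1 rho z0 Ha (rho_small z0 Hz0) Hnc Hne
    (1 - Cmod z0)) as [t [eta [Ht [Heta H]]]]; [lra|].
  apply (identity_theorem X HX _ (orbit_starts_subspace X T) (e i) 1 1 mu0 (row_bounded i));
    [lra|].
  intros eps Heps.
  (* For [mu] close to [mu0] the number [1 / |psi(mu)|] is within [eta] of [|phi(z0)|], hence
     a value of [|phi|]. *)
  set (p := Cmod (ksum_C b mu0)) in *.
  set (k := Rmin (p / 2) (eta * (p * p) / 4)).
  assert (Hpp : 0 < p * p) by now apply Rmult_lt_0_compat.
  assert (Hk : 0 < k).
  { apply Rmin_case; [lra|]. apply Rdiv_lt_0_compat; [now apply Rmult_lt_0_compat | lra]. }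
  destruct (ksum_continuous C_NormedModule C_abs_complete b A2 rho mu0 Hb (rho_small mu0 Hmu0) k Hk)
    as [delta [Hdelta Hcont]].
  set (m := Rmin (Rmin eps delta) (1 - Cmod mu0)).
  assert (Hm : 0 < m) by (unfold m; repeat apply Rmin_case; lra).
  assert (Hm1 : m <= eps) by (eapply Rle_trans; [apply Rmin_l | apply Rmin_l]).
  assert (Hm2 : m <= delta) by (eapply Rle_trans; [apply Rmin_l | apply Rmin_r]).
  assert (Hm3 : m <= 1 - Cmod mu0) by apply Rmin_r.
  set (mu := Cplus mu0 (RtoC (m / 2))).
  assert (Emu : Cminus mu mu0 = RtoC (m / 2)) by (unfold mu; ring).
  assert (Hmm : Cmod (RtoC (m / 2)) = m / 2) by (rewrite Cmod_R, Rabs_pos_eq; lra).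
  assert (Hmu : Cmod mu < 1).
  { unfold mu. eapply Rle_lt_trans; [apply Cmod_triangle|]. lra. }
  exists mu. split; [|split].
  - intros E. rewrite E in Emu. replace (Cminus mu0 mu0) with (RtoC 0) in Emu by ring.
    apply RtoC_inj in Emu. lra.
  - rewrite Emu, Hmm. lra.
  - assert (Hq : Rabs (Cmod (ksum_C b mu) - p) < k).
    { eapply Rle_lt_trans; [exact (norm_triangle_inv (V := C_NormedModule) _ _)|].
      apply Hcont. rewrite Emu, Hmm. lra. }
    assert (Hk1 : k <= p / 2) by apply Rmin_l.
    assert (Hk2 : k <= eta * (p * p) / 4) by apply Rmin_r.
    set (q := Cmod (ksum_C b mu)) in *.
    apply Rabs_def2 in Hq. assert (Hq0 : p / 2 < q) by lra.
    destruct (H (/ q)) as [l [Hl Hla]].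
    { rewrite Hphi. replace (/ q - / p) with (- ((q - p) / (q * p))) by (field; lra).
      rewrite Rabs_Ropp. unfold Rdiv. rewrite Rabs_mult.
      rewrite (Rabs_pos_eq (/ (q * p))) by (left; apply Rinv_0_lt_compat, Rmult_lt_0_compat; lra).
      apply Rlt_le_trans with (k * / (q * p)).
      - apply Rmult_lt_compat_r; [apply Rinv_0_lt_compat, Rmult_lt_0_compat; lra|].
        apply Rabs_def1; lra.
      - apply Rmult_le_reg_r with (q * p); [apply Rmult_lt_0_compat; lra|].
        rewrite Rmult_assoc, Rinv_l, Rmult_1_r by (apply Rgt_not_eq, Rmult_lt_0_compat; lra).
        apply Rle_trans with (eta * (p * p) / 4); [exact Hk2|].
        replace (eta * (p * p) / 4) with (eta * (p / 4 * p)) by field.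
        apply Rmult_le_compat_l; [lra|]. apply Rmult_le_compat_r; lra. }
    apply (slices_in l mu); [|exact Hmu|].
    + replace l with (Cplus z0 (Cminus l z0)) by ring.
      eapply Rle_lt_trans; [apply Cmod_triangle|]. lra.
    + rewrite Cmod_mult, Hla. fold q. field. lra.
Qed.

End DoubleShift.

(** * Completeness from lower semicontinuity of the norm *)

(** The partial sums converge coordinatewise; lower semicontinuity of the norm provides
    the limit and, applied to the tails of the series, convergence in norm. *)
Lemma abs_complete_of_fatou (X : NormedModule C_AbsRing) (co : nat -> bounded_op X C_NormedModule) :
  (forall k x, Cmod (co k x) <= norm x) ->
  (forall x y, (forall k, co k x = co k y) -> x = y) ->
  (forall (x : nat -> X) M s, (forall m, norm (x m) <= M) ->
     (forall k eps, 0 < eps -> exists N, forall m, (N <= m)%nat ->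
        Cmod (Cminus (co k (x m)) (s k)) < eps) ->
     exists y, (forall k, co k y = s k) /\ norm y <= M) ->
  abs_complete X.
Proof.
  intros Hco Hext Hfatou u Hu. assert (Hu' := Hu). destruct Hu' as [M HM].
  assert (Hs : forall k, is_series (fun n => co k (u n)) (vsum (fun n => co k (u n)))).
  { intros k. apply (abs_summable_ex C_abs_complete). exists M. intros n.
    eapply Rle_trans; [|apply (HM n)]. apply psum_R_le. intros j _. apply Hco. }
  set (s := fun k => vsum (fun n => co k (u n)) : C).
  destruct (Hfatou (psum u) M s) as [y [Hy _]].
  { intros m. eapply Rle_trans; [apply psum_norm | apply HM]. }
  { intros k eps Heps. destruct (proj1 (is_series_psum _ _) (Hs k) eps Heps) as [N HN].
    exists N. intros m Hm. rewrite bop_psum. exact (HN m Hm). }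
  exists y. apply is_series_psum. intros eps Heps.
  destruct (abs_summable_tail X u Hu (eps / 2) ltac:(lra)) as [N HN].
  exists N. intros n Hn. apply Rle_lt_trans with (eps / 2); [|lra].
  destruct (Hfatou (psum (fun k => u (n + k)%nat)) (eps / 2)
     (fun k => Cminus (s k) (co k (psum u n)))) as [y' [Hy' Hn']].
  { intros m. eapply Rle_trans; [apply psum_norm | now apply HN]. }
  { intros k e He. destruct (proj1 (is_series_psum _ _) (Hs k) e He) as [N' HN'].
    exists N'. intros m Hm. specialize (HN' (n + m)%nat ltac:(lia)).
    rewrite <- bop_psum, psum_split, bop_plus in HN'.
    set (p := co k (psum u n) : C) in *.
    set (r := co k (psum (fun k0 => u (n + k0)%nat) m) : C) in *.
    change (Cmod (Cminus (Cplus p r) (s k)) < e) in HN'.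
    replace (Cminus r (Cminus (s k) p)) with (Cminus (Cplus p r) (s k)) by ring. exact HN'. }
  replace (minus (psum u n) y) with (opp y'); [rewrite norm_oppC; exact Hn'|].
  apply Hext. intros k. rewrite bop_opp, bop_minus, Hy, Hy'.
  change (Copp (Cminus (s k) (co k (psum u n))) = Cminus (co k (psum u n)) (s k)). ring.
Qed.

Lemma finitely_many_close (x : nat -> nat -> C) (s : nat -> C) :
  (forall k eps, 0 < eps -> exists N, forall m, (N <= m)%nat -> Cmod (Cminus (x m k) (s k)) < eps) ->
  forall n eps, 0 < eps -> exists N, forall m k, (N <= m)%nat -> (k < n)%nat ->
    Cmod (Cminus (x m k) (s k)) < eps.
Proof.
  intros H n eps Heps. induction n as [|n [N IH]]; [exists O; intros; lia|].
  destruct (H n eps Heps) as [N' HN']. exists (Nat.max N N'). intros m k Hm Hk.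
  destruct (Nat.eq_dec k n) as [->|Hne]; [apply HN'; lia | apply IH; lia].
Qed.

(** * The space of absolutely summable sequences *)

Definition abs_sum_le (c : nat -> C) (M : R) : Prop := forall n, psum (fun k => Cmod (c k)) n <= M.

Record l1 : Type := mk_l1 { l1_seq :> nat -> C; l1_summable : exists M, abs_sum_le l1_seq M }.

Lemma l1_ext (c d : l1) : (forall k, c k = d k) -> c = d.
Proof.
  destruct c as [c Hc], d as [d Hd]; simpl. intros H.
  assert (E : c = d) by (now apply FunctionalExtensionality.functional_extensionality).
  subst d. f_equal. apply ProofIrrelevance.proof_irrelevance.
Qed.

Lemma abs_sum_le_plus c d M N : abs_sum_le c M -> abs_sum_le d N ->
  abs_sum_le (fun k => Cplus (c k) (d k)) (M + N).
Proof.
  intros Hc Hd n. apply Rle_trans with (psum (fun k => Cmod (c k) + Cmod (d k)) n).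
  - apply psum_R_le. intros k _. apply Cmod_triangle.
  - rewrite psum_R_plus. apply Rplus_le_compat; [apply Hc | apply Hd].
Qed.

Lemma abs_sum_le_scal a c M : abs_sum_le c M ->
  abs_sum_le (fun k => Cmult a (c k)) (Cmod a * M).
Proof.
  intros Hc n. rewrite (psum_ext _ (fun k => Cmod a * Cmod (c k))).
  - rewrite psum_R_scal. apply Rmult_le_compat_l; [apply Cmod_ge_0 | apply Hc].
  - intros k _. apply Cmod_mult.
Qed.

Lemma abs_sum_le_zero : abs_sum_le (fun _ => RtoC 0) 0.
Proof.
  intros n. rewrite (psum_ext _ (fun _ => 0)) by (intros; apply Cmod_0).
  rewrite psum_R_const. lra.
Qed.

Definition l1_plus (c d : l1) : l1.
Proof.
  refine (mk_l1 (fun k => Cplus (c k) (d k)) _).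
  destruct (l1_summable c) as [M HM], (l1_summable d) as [N HN].
  exists (M + N). now apply abs_sum_le_plus.
Defined.
Definition l1_scal (a : C) (c : l1) : l1.
Proof.
  refine (mk_l1 (fun k => Cmult a (c k)) _).
  destruct (l1_summable c) as [M HM]. exists (Cmod a * M). now apply abs_sum_le_scal.
Defined.
Definition l1_zero : l1 := mk_l1 _ (ex_intro _ 0 abs_sum_le_zero).
Definition l1_opp (c : l1) : l1 := l1_scal (Copp (RtoC 1)) c.

Lemma l1_plus_comm c d : l1_plus c d = l1_plus d c.
Proof. apply l1_ext; intros k; apply Cplus_comm. Qed.
Lemma l1_plus_assoc c d f : l1_plus c (l1_plus d f) = l1_plus (l1_plus c d) f.
Proof. apply l1_ext; intros k; apply Cplus_assoc. Qed.
Lemma l1_plus_zero c : l1_plus c l1_zero = c.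
Proof. apply l1_ext; intros k; apply Cplus_0_r. Qed.
Lemma l1_plus_opp c : l1_plus c (l1_opp c) = l1_zero.
Proof. apply l1_ext; intros k; simpl; ring. Qed.
Lemma l1_scal_assoc a b c : l1_scal a (l1_scal b c) = l1_scal (Cmult a b) c.
Proof. apply l1_ext; intros k; apply Cmult_assoc. Qed.
Lemma l1_scal_one c : l1_scal (RtoC 1) c = c.
Proof. apply l1_ext; intros k; apply Cmult_1_l. Qed.
Lemma l1_scal_distr_l a c d : l1_scal a (l1_plus c d) = l1_plus (l1_scal a c) (l1_scal a d).
Proof. apply l1_ext; intros k; apply Cmult_plus_distr_l. Qed.
Lemma l1_scal_distr_r a b c : l1_scal (Cplus a b) c = l1_plus (l1_scal a c) (l1_scal b c).
Proof. apply l1_ext; intros k; apply Cmult_plus_distr_r. Qed.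

Definition l1_AbelianMonoid_mixin :=
  AbelianMonoid.Mixin l1 l1_plus l1_zero l1_plus_comm l1_plus_assoc l1_plus_zero.
Canonical l1_AbelianMonoid := AbelianMonoid.Pack l1 l1_AbelianMonoid_mixin l1.
Definition l1_AbelianGroup_mixin :=
  AbelianGroup.Mixin l1_AbelianMonoid l1_opp l1_plus_opp.
Canonical l1_AbelianGroup := AbelianGroup.Pack l1
  (AbelianGroup.Class l1 l1_AbelianMonoid_mixin l1_AbelianGroup_mixin) l1.
Definition l1_ModuleSpace_mixin :=
  ModuleSpace.Mixin C_AbsRing l1_AbelianGroup l1_scal
    l1_scal_assoc l1_scal_one l1_scal_distr_l l1_scal_distr_r.
Canonical l1_ModuleSpace := ModuleSpace.Pack C_AbsRing l1
  (ModuleSpace.Class C_AbsRing l1 (AbelianGroup.class l1_AbelianGroup)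
     l1_ModuleSpace_mixin) l1.

Definition l1_partial_sum (c : l1) (r : R) : Prop := exists n, r = psum (fun k => Cmod (c k)) n.

Definition l1_norm (c : l1) : R := real (Lub_Rbar (l1_partial_sum c)).

Lemma l1_norm_is_lub (c : l1) : is_lub_Rbar (l1_partial_sum c) (Finite (l1_norm c)).
Proof.
  unfold l1_norm.
  assert (HL := Lub_Rbar_correct (l1_partial_sum c)). destruct (l1_summable c) as [M HM].
  assert (H0 : Rbar_le 0 (Lub_Rbar (l1_partial_sum c))) by (apply HL; now exists O).
  assert (HM' : Rbar_le (Lub_Rbar (l1_partial_sum c)) M).
  { apply HL. intros r [n ->]. apply HM. }
  destruct (Lub_Rbar (l1_partial_sum c)); [exact HL | destruct HM' | destruct H0].
Qed.

Lemma l1_norm_sum (c : l1) : abs_sum_le c (l1_norm c).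
Proof. intros n. apply (l1_norm_is_lub c). now exists n. Qed.

Lemma l1_norm_le (c : l1) M : abs_sum_le c M -> l1_norm c <= M.
Proof.
  intros H. apply (proj2 (l1_norm_is_lub c) (Finite M)). intros r [n ->]. apply H.
Qed.

Lemma l1_norm_triangle (c d : l1) : l1_norm (plus c d) <= l1_norm c + l1_norm d.
Proof. apply l1_norm_le. apply abs_sum_le_plus; apply l1_norm_sum. Qed.
Lemma l1_norm_scal (a : C) (c : l1) : l1_norm (scal a c) <= Cmod a * l1_norm c.
Proof. apply l1_norm_le. apply abs_sum_le_scal, l1_norm_sum. Qed.

Lemma l1_norm_coord (c : l1) k : Cmod (c k) <= l1_norm c.
Proof.
  eapply Rle_trans; [|apply (l1_norm_sum c (S k))].
  apply (psum_R_term (fun k => Cmod (c k))); [intros; apply Cmod_ge_0 | lia].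
Qed.

Lemma l1_norm_eq_0 (c : l1) : l1_norm c = 0 -> c = zero.
Proof.
  intros H. apply l1_ext. intros k. apply Cmod_eq_0.
  generalize (l1_norm_coord c k) (Cmod_ge_0 (c k)). lra.
Qed.

Canonical l1_UniformSpace := UniformSpace.Pack l1
  (norm_UniformSpace_mixin l1_ModuleSpace l1_norm l1_norm_triangle l1_norm_scal) l1.
Canonical l1_NormedModuleAux := NormedModuleAux.Pack C_AbsRing l1
  (NormedModuleAux.Class C_AbsRing l1 (ModuleSpace.class C_AbsRing l1_ModuleSpace)
     (UniformSpace.class l1_UniformSpace)) l1.
Canonical l1_NormedModule := NormedModule.Pack C_AbsRing l1
  (NormedModule.Class C_AbsRing l1
     (NormedModuleAux.class C_AbsRing l1_NormedModuleAux)
     (norm_NormedModule_mixin l1_ModuleSpace l1_norm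
        l1_norm_triangle l1_norm_scal l1_norm_eq_0)) l1.

Lemma l1_coord_linear k : is_linear (U := l1_NormedModule) (V := C_NormedModule)
  (fun c : l1 => c k).
Proof.
  split; [reflexivity | reflexivity |].
  exists 1. split; [lra|]. intros c. rewrite Rmult_1_l. apply l1_norm_coord.
Qed.

Definition l1_coord (k : nat) : bounded_op l1_NormedModule C_NormedModule :=
  mk_op _ (l1_coord_linear k).

Lemma l1_abs_complete : abs_complete l1_NormedModule.
Proof.
  apply abs_complete_of_fatou with l1_coord.
  - intros k c. apply l1_norm_coord.
  - intros c d H. apply l1_ext. exact H.
  - intros x M s Hx Hs.
    assert (H : abs_sum_le s M).
    { intros n. apply le_epsilon. intros eps Heps.
      assert (Hn := pos_INR n).
      destruct (finitely_many_close (fun m k => x m k) s Hs n (eps / (INR n + 1))) as [N HN].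
      { apply Rdiv_lt_0_compat; lra. }
      apply Rle_trans with (psum (fun k => Cmod (x N k) + eps / (INR n + 1)) n).
      - apply psum_R_le. intros k Hk. specialize (HN N k (Nat.le_refl _) Hk).
        replace (s k) with (Cplus (x N k) (Copp (Cminus (x N k) (s k)))) by ring.
        eapply Rle_trans; [apply Cmod_triangle|]. rewrite Cmod_opp. lra.
      - rewrite psum_R_plus, psum_R_const. apply Rplus_le_compat.
        + eapply Rle_trans; [apply (l1_norm_sum (x N)) | apply Hx].
        + apply Rle_trans with ((INR n + 1) * (eps / (INR n + 1))).
          * apply Rmult_le_compat_r; [apply Rdiv_le_0_compat|]; lra.
          * right. field. lra. }
    exists (mk_l1 s (ex_intro _ M H)). split; [reflexivity|].
    apply l1_norm_le. exact H.
Qed.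

Definition l1_delta (i : nat) : l1.
Proof.
  refine (mk_l1 (fun k => if Nat.eqb k i then RtoC 1 else RtoC 0) (ex_intro _ 1 _)).
  intros n. destruct (Nat.lt_ge_cases i n) as [H|H].
  - rewrite (psum_single _ n i H).
    + rewrite Nat.eqb_refl, Cmod_1. apply Rle_refl.
    + intros k _ Hne. apply Nat.eqb_neq in Hne. rewrite Hne. apply Cmod_0.
  - rewrite psum_zero; [exact Rle_0_1|]. intros k Hk.
    assert (Hne : (k =? i)%nat = false) by (apply Nat.eqb_neq; lia).
    rewrite Hne. apply Cmod_0.
Defined.

Lemma l1_delta_norm i : norm (l1_delta i) <= 1.
Proof.
  apply l1_norm_le. intros n. simpl. destruct (Nat.lt_ge_cases i n) as [H|H].
  - rewrite (psum_single _ n i H).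
    + rewrite Nat.eqb_refl, Cmod_1. apply Rle_refl.
    + intros k _ Hne. apply Nat.eqb_neq in Hne. rewrite Hne. apply Cmod_0.
  - rewrite psum_zero; [exact Rle_0_1|]. intros k Hk.
    assert (Hne : (k =? i)%nat = false) by (apply Nat.eqb_neq; lia).
    rewrite Hne. apply Cmod_0.
Qed.

Lemma l1_psum_coord (u : nat -> l1) n k : (psum u n : l1) k = psum (fun j => u j k) n.
Proof. exact (bop_psum (l1_coord k) u n). Qed.

Lemma l1_expansion (c : l1) : is_series (fun i => c i *: l1_delta i) c.
Proof.
  apply is_series_psum. intros eps Heps.
  assert (Hc : abs_summable (X := C_NormedModule) (fun k => c k)).
  { exists (l1_norm c). apply l1_norm_sum. }
  destruct (abs_summable_tail C_NormedModule _ Hc (eps / 2) ltac:(lra)) as [N HN].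
  exists N. intros n Hn. apply Rle_lt_trans with (eps / 2); [|lra].
  rewrite norm_minus_sym. apply l1_norm_le.
  assert (Hk : forall k, (minus c (psum (fun i => c i *: l1_delta i) n) : l1) k =
     if (k <? n)%nat then RtoC 0 else c k).
  { intros k. change (Cplus (c k) (Cmult (Copp (RtoC 1)) ((psum (fun i => c i *: l1_delta i) n : l1) k))
      = if (k <? n)%nat then RtoC 0 else c k).
    rewrite l1_psum_coord.
    destruct (Nat.ltb_spec k n) as [H|H].
    - rewrite (psum_single _ n k H).
      + change ((c k *: l1_delta k : l1) k) with (Cmult (c k) (if Nat.eqb k k then RtoC 1 else RtoC 0)).
        rewrite Nat.eqb_refl. ring.
      + intros j _ Hne. change ((c j *: l1_delta j : l1) k)
          with (Cmult (c j) (if Nat.eqb k j then RtoC 1 else RtoC 0)).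
        destruct (Nat.eqb_spec k j); [congruence | apply Cmult_0_r].
    - rewrite psum_zero; [change (@zero C_AbelianMonoid) with (RtoC 0); Cring|].
      intros j Hj. change ((c j *: l1_delta j : l1) k)
          with (Cmult (c j) (if Nat.eqb k j then RtoC 1 else RtoC 0)).
      destruct (Nat.eqb_spec k j); [lia | apply Cmult_0_r]. }
  intros m.
  assert (Hw : forall k, 0 <= Cmod ((minus c (psum (fun i => c i *: l1_delta i) n) : l1) k))
    by (intros; apply Cmod_ge_0).
  eapply Rle_trans; [apply (psum_R_mono _ m (n + m) Hw); lia|].
  rewrite psum_R_split, (psum_ext _ (fun _ => 0)).
  - rewrite psum_R_const, Rmult_0_r, Rplus_0_l.
    eapply Rle_trans; [|apply (HN n m Hn)]. apply psum_R_le. intros k _. rewrite Hk.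
    destruct (Nat.ltb_spec (n + k) n); [lia | apply Rle_refl].
  - intros k H. rewrite Hk. destruct (Nat.ltb_spec k n); [apply Cmod_0 | lia].
Qed.

Lemma l1_closed_full (Z : l1 -> Prop) : closed_subspace (X := l1_NormedModule) Z ->
  (forall i, Z (l1_delta i)) -> forall c, Z c.
Proof.
  intros HZ H c. apply (cs_series l1_NormedModule Z HZ _ _ (l1_expansion c)).
  intros k. apply (cs_scal l1_NormedModule Z HZ), H.
Qed.

(** The bounded operators on [l1] are the bounded families of images of the basis. *)
Section L1Operators.

Variables (Y : NormedModule C_AbsRing) (HY : abs_complete Y).
Variables (f : nat -> Y) (Hf : forall i, norm (f i) <= 1).

Lemma l1_lift_bound (c : l1) n :
  psum (fun i => norm (c i *: f i)) n <= l1_norm c.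
Proof.
  eapply Rle_trans; [|apply (l1_norm_sum c n)]. apply psum_R_le. intros i _.
  rewrite norm_scalC. apply Rle_trans with (Cmod (c i) * 1); [|lra].
  apply Rmult_le_compat_l; [apply Cmod_ge_0 | apply Hf].
Qed.

Lemma l1_lift_series (c : l1) : is_series (fun i => c i *: f i) (vsum (fun i => c i *: f i)).
Proof. apply (abs_summable_ex HY). exists (l1_norm c). apply l1_lift_bound. Qed.

Lemma l1_lift_norm (c : l1) : norm (vsum (fun i => c i *: f i)) <= l1_norm c.
Proof. apply is_series_norm_le with (1 := l1_lift_series c). apply l1_lift_bound. Qed.

Lemma l1_lift_linear : is_linear (U := l1_NormedModule) (fun c : l1 => vsum (fun i => c i *: f i)).
Proof.
  split.
  - intros c d. apply vsum_unique.
    refine (is_series_eq _ _ _ _ (is_series_plus _ _ _ _ (l1_lift_series c) (l1_lift_series d)) _ _);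
      [|reflexivity].
    intros i. simpl. change ((plus c d : l1) i) with (Cplus (c i) (d i)). module_eq.
  - intros a c. apply vsum_unique.
    refine (is_series_eq _ _ _ _ (is_series_scal (a : C_AbsRing) _ _ (l1_lift_series c)) _ _);
      [|reflexivity].
    intros i. simpl. change ((scal a c : l1) i) with (Cmult a (c i)). module_eq.
  - exists 1. split; [lra|]. intros c. rewrite Rmult_1_l. apply l1_lift_norm.
Qed.

Definition l1_lift : bounded_op l1_NormedModule Y := mk_op _ l1_lift_linear.

Lemma l1_lift_delta i : l1_lift (l1_delta i) = f i.
Proof.
  apply vsum_unique.
  refine (is_series_eq _ _ _ _ (is_series_finite Y
    (fun k => if Nat.eqb k i then f i else zero) (S i) _) _ _).
  - intros k Hk. destruct (Nat.eqb_spec k i); [lia | reflexivity].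
  - intros k. simpl. destruct (Nat.eqb_spec k i) as [->|H]; module_eq.
  - rewrite (psum_single _ _ i); [now rewrite Nat.eqb_refl | lia |].
    intros k _ Hne. destruct (Nat.eqb_spec k i); [contradiction | reflexivity].
Qed.

Lemma l1_lift_op_norm : op_norm l1_lift <= 1.
Proof.
  apply op_norm_le_mult; [lra|]. intros c. rewrite Rmult_1_l. apply l1_lift_norm.
Qed.

End L1Operators.

Lemma l1_op_ext (Y : NormedModule C_AbsRing) (S T : bounded_op l1_NormedModule Y) :
  (forall i, S (l1_delta i) = T (l1_delta i)) -> forall c, S c = T c.
Proof.
  intros H c.
  refine (is_series_unique_C _ _ _ (bop_is_series S _ _ (l1_expansion c)) _).
  refine (is_series_eq _ _ _ _ (bop_is_series T _ _ (l1_expansion c)) _ _); [|reflexivity].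
  intros i. etransitivity; [apply (bop_scal T)|]. rewrite <- H. symmetry. apply (bop_scal S).
Qed.

(** * Countable dense sets *)

(** All rational numbers, in the form [(i - j) / (k + 1)]. *)
Definition dense_R (n : nat) : R :=
  let (s, k) := of_nat n in let (i, j) := of_nat s in (INR i - INR j) / (INR k + 1).

Lemma dense_R_spec x eps : 0 < eps -> exists n, Rabs (dense_R n - x) < eps.
Proof.
  intros Heps. destruct (archimed_cor1 eps Heps) as [k [Hk Hk0]].
  assert (HkR : 0 < INR k) by now apply lt_0_INR.
  set (w := x * (INR k + 1)). set (z := up w).
  destruct (archimed w) as [Hz1 Hz2]. fold z in Hz1, Hz2.
  exists (to_nat (to_nat (Z.to_nat z, Z.to_nat (- z)), k)).
  unfold dense_R. rewrite !cancel_of_to.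
  assert (E : INR (Z.to_nat z) - INR (Z.to_nat (- z)) = IZR z).
  { rewrite !INR_IZR_INZ, <- minus_IZR. f_equal. lia. }
  rewrite E.
  replace (IZR z / (INR k + 1) - x) with ((IZR z - w) * / (INR k + 1)) by (unfold w; field; lra).
  rewrite Rabs_mult, Rabs_pos_eq, Rabs_pos_eq by
    (try (left; apply Rinv_0_lt_compat); lra).
  apply Rle_lt_trans with (1 * / (INR k + 1)).
  - apply Rmult_le_compat_r; [left; apply Rinv_0_lt_compat|]; lra.
  - rewrite Rmult_1_l. eapply Rle_lt_trans; [|exact Hk]. apply Rinv_le_contravar; lra.
Qed.

Definition dense_C (n : nat) : C := let (i, j) := of_nat n in (dense_R i, dense_R j).

Lemma dense_C_spec z eps : 0 < eps -> exists n, Cmod (Cminus (dense_C n) z) < eps.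
Proof.
  intros Heps. destruct z as [x y].
  destruct (dense_R_spec x (eps / 2) ltac:(lra)) as [i Hi].
  destruct (dense_R_spec y (eps / 2) ltac:(lra)) as [j Hj].
  exists (to_nat (i, j)). unfold dense_C. rewrite cancel_of_to.
  eapply Rle_lt_trans; [apply (Cmod_le_Rabs (dense_R i - x) (dense_R j - y))|]. lra.
Qed.

Fixpoint dense_span (n k : nat) : l1 :=
  match n with
  | O => zero
  | S m => plus (dense_span m (fst (of_nat k))) (dense_C (snd (of_nat k)) *: l1_delta m)
  end.

Lemma dense_span_spec n (c : nat -> C) eps : 0 < eps ->
  exists k, norm (minus (dense_span n k) (psum (fun i => c i *: l1_delta i) n)) < eps.
Proof.
  revert eps. induction n as [|n IH]; intros eps Heps.
  - exists O. simpl.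
    eapply Rle_lt_trans; [|exact Heps]. right.
    rewrite minus_eq_zero. exact (norm_zero (V := l1_NormedModule)).
  - destruct (IH (eps / 2) ltac:(lra)) as [k Hk].
    destruct (dense_C_spec (c n) (eps / 2) ltac:(lra)) as [j Hj].
    exists (to_nat (k, j)). cbn [dense_span psum]. rewrite cancel_of_to. cbn [fst snd].
    set (p := psum (fun i => c i *: l1_delta i) n) in *.
    assert (E : minus (plus (dense_span n k) (dense_C j *: l1_delta n)) (plus p (c n *: l1_delta n))
      = plus (minus (dense_span n k) p) (Cminus (dense_C j) (c n) *: l1_delta n)) by module_eq.
    eapply Rle_lt_trans; [right; exact (f_equal norm E)|].
    eapply Rle_lt_trans; [apply (norm_triangle (V := l1_NormedModule))|].
    apply Rlt_le_trans with (eps / 2 + eps / 2); [|lra].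
    apply Rplus_lt_le_compat; [exact Hk|].
    eapply Rle_trans; [right; apply (norm_scalC (X := l1_NormedModule))|].
    rewrite <- (Rmult_1_r (eps / 2)).
    apply Rmult_le_compat; [apply Cmod_ge_0 | apply norm_ge_0 | lra | apply l1_delta_norm].
Qed.

Lemma l1_separable : exists D : nat -> l1,
  forall d eps, 0 < eps -> exists k, norm (minus (D k) d) < eps.
Proof.
  exists (fun k => dense_span (fst (of_nat k)) (snd (of_nat k))).
  intros d eps Heps.
  destruct (proj1 (is_series_psum _ _) (l1_expansion d) (eps / 2) ltac:(lra)) as [N HN].
  specialize (HN N (Nat.le_refl _)).
  destruct (dense_span_spec N d (eps / 2) ltac:(lra)) as [k Hk].
  exists (to_nat (N, k)). rewrite cancel_of_to. cbn [fst snd].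
  eapply Rle_lt_trans; [apply (norm_dist_triangle (X := l1_NormedModule) _
    (psum (fun i => d i *: l1_delta i) N))|].
  apply Rlt_le_trans with (eps / 2 + eps / 2); [|lra].
  now apply Rplus_lt_compat.
Qed.

(** * The core: frequent visits in the sequence space over pairs of indices *)

(** The basis vector [e_i (x) e_j], with Cantor's enumeration of the pairs of indices. *)
Definition pair_delta (i j : nat) : l1 := l1_delta (to_nat (i, j)).

Definition shift_image1 (k : nat) : l1 :=
  match of_nat k with (O, _) => zero | (S i, j) => pair_delta i j end.
Definition shift_image2 (k : nat) : l1 :=
  match of_nat k with (_, O) => zero | (i, S j) => pair_delta i j end.

Lemma l1_norm_zero_le : norm (zero : l1_NormedModule) <= 1.
Proof. rewrite norm_zero. exact Rle_0_1. Qed.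

Lemma shift_image1_norm k : norm (shift_image1 k : l1_NormedModule) <= 1.
Proof.
  unfold shift_image1. destruct (of_nat k) as [[|i] j]; [apply l1_norm_zero_le | apply l1_delta_norm].
Qed.
Lemma shift_image2_norm k : norm (shift_image2 k : l1_NormedModule) <= 1.
Proof.
  unfold shift_image2. destruct (of_nat k) as [i [|j]]; [apply l1_norm_zero_le | apply l1_delta_norm].
Qed.

Definition shift1 : bounded_op l1_NormedModule l1_NormedModule :=
  l1_lift _ l1_abs_complete shift_image1 shift_image1_norm.
Definition shift2 : bounded_op l1_NormedModule l1_NormedModule :=
  l1_lift _ l1_abs_complete shift_image2 shift_image2_norm.

Lemma shift1_delta i j : shift1 (pair_delta i j) =
  match i with O => zero | S i' => pair_delta i' j end.
Proof.
  unfold shift1, pair_delta at 1. rewrite l1_lift_delta. unfold shift_image1.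
  now rewrite cancel_of_to.
Qed.
Lemma shift2_delta i j : shift2 (pair_delta i j) =
  match j with O => zero | S j' => pair_delta i j' end.
Proof.
  unfold shift2, pair_delta at 1. rewrite l1_lift_delta. unfold shift_image2.
  now rewrite cancel_of_to.
Qed.

Lemma l1_pair_op_ext (Y : NormedModule C_AbsRing) (S T : bounded_op l1_NormedModule Y) :
  (forall i j, S (pair_delta i j) = T (pair_delta i j)) -> forall c, S c = T c.
Proof.
  intros H. apply l1_op_ext. intros k. generalize (H (fst (of_nat k)) (snd (of_nat k))).
  unfold pair_delta. rewrite <- surjective_pairing, cancel_to_of. exact (fun h => h).
Qed.

Lemma shifts_commute c : shift1 (shift2 c) = shift2 (shift1 c).
Proof.
  apply (l1_pair_op_ext _ (op_comp shift1 shift2) (op_comp shift2 shift1)).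
  intros i j.
  change (shift1 (shift2 (pair_delta i j)) = shift2 (shift1 (pair_delta i j))).
  rewrite shift1_delta, shift2_delta.
  destruct i as [|i], j as [|j]; rewrite ?shift1_delta, ?shift2_delta, ?bop_zero; try reflexivity;
    etransitivity; try apply (bop_zero (U := l1_NormedModule)); symmetry;
    try apply (bop_zero (U := l1_NormedModule)); reflexivity.
Qed.

(** For the coefficients [a] and [b] of [phi] and [psi] this is [phi(B) (x) psi(B)]. *)
Definition double_shift (a b : nat -> C) : bounded_op l1_NormedModule l1_NormedModule :=
  op_comp (fcalc a shift1) (fcalc b shift2).

Lemma shift1_op_norm : op_norm shift1 <= 1.
Proof. apply l1_lift_op_norm. Qed.
Lemma shift2_op_norm : op_norm shift2 <= 1.
Proof. apply l1_lift_op_norm. Qed.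

Lemma double_shift_commute a b A1 A2 rho c : rho < 1 ->
  geom_bounded_C a A1 rho -> geom_bounded_C b A2 rho ->
  fcalc a shift1 (fcalc b shift2 c) = fcalc b shift2 (fcalc a shift1 c).
Proof.
  intros Hr Ha Hb. symmetry.
  apply (fcalc_intertwine _ _ l1_abs_complete l1_abs_complete (fcalc b shift2) shift1 shift1
    a A1 rho c Ha Hr shift1_op_norm shift1_op_norm).
  intros x. symmetry.
  apply (fcalc_intertwine _ _ l1_abs_complete l1_abs_complete shift1 shift2 shift2
    b A2 rho x Hb Hr shift2_op_norm shift2_op_norm).
  apply shifts_commute.
Qed.

(** The two factors commute, so either of them can play the role of the non-constant one. *)
Theorem double_shift_visits a b A1 A2 rho z w : rho < 1 ->
  geom_bounded_C a A1 rho -> geom_bounded_C b A2 rho ->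
  Cmod z < 1 -> Cmod w < 1 -> Cmod (Cmult (ksum_C a z) (ksum_C b w)) = 1 ->
  nonconstant a \/ nonconstant b ->
  exists x : l1, forall d eps, 0 < eps ->
    linearly_recurrent (fun n => norm (minus (Nat.iter n (double_shift a b) x) d) < eps).
Proof.
  intros Hr Ha Hb Hz Hw H1 Hnc.
  destruct l1_separable as [D HD].
  apply (frequently_visiting_vector l1_NormedModule l1_abs_complete (double_shift a b) D HD).
  apply l1_closed_full; [apply orbit_starts_subspace|].
  assert (H : forall i j, orbit_starts (double_shift a b) (pair_delta i j)).
  { destruct Hnc as [Hnc|Hnc].
    - apply (double_shift_starts l1_NormedModule l1_abs_complete shift1 shift2 pair_delta
        shift1_op_norm shift2_op_norm (fun i j => l1_delta_norm _)
        (fun i j => shift1_delta (S i) j) (fun j => shift1_delta O j)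
        (fun i j => shift2_delta i (S j)) (fun i => shift2_delta i O)
        a b A1 A2 rho Hr Ha Hb Hnc z w Hz Hw H1).
    - intros i j.
      assert (E : double_shift a b = op_comp (fcalc b shift2) (fcalc a shift1)).
      { apply op_ext. intros c. exact (double_shift_commute a b A1 A2 rho c Hr Ha Hb). }
      rewrite E. rewrite Cmult_comm in H1.
      apply (double_shift_starts l1_NormedModule l1_abs_complete shift2 shift1
        (fun j i => pair_delta i j)
        shift2_op_norm shift1_op_norm (fun i j => l1_delta_norm _)
        (fun j i => shift2_delta i (S j)) (fun i => shift2_delta i O)
        (fun j i => shift1_delta (S i) j) (fun j => shift1_delta O j)
        b a A2 A1 rho Hr Hb Ha Hnc w z Hw Hz H1 j i). }
  intros k. generalize (H (fst (of_nat k)) (snd (of_nat k))).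
  unfold pair_delta. rewrite <- surjective_pairing, cancel_to_of. exact (fun h => h).
Qed.

(** * Sequence spaces: truncations *)

Lemma ex_series_bounded (a : nat -> R) M : (forall k, 0 <= a k) -> (forall n, psum a n <= M) ->
  ex_series a /\ Series a <= M.
Proof.
  intros Ha HM.
  destruct (Un_cv_crit (psum a)) as [l Hl].
  - intros n. rewrite psum_R_S. generalize (Ha n). lra.
  - exists M. intros r [n ->]. apply HM.
  - assert (H : is_series a l).
    { apply is_series_Reals. intros eps Heps. destruct (Hl eps Heps) as [N HN].
      exists N. intros n Hn. rewrite <- sum_n_Reals, <- psum_sum_n. apply HN. lia. }
    split; [now exists l|]. rewrite (is_series_unique _ _ H).
    apply le_epsilon. intros eps Heps. destruct (Hl eps Heps) as [N HN].
    specialize (HN N (Nat.le_refl _)). unfold Rdist in HN. apply Rabs_def2 in HN.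
    generalize (HM N). lra.
Qed.

Lemma psum_le_Series (a : nat -> R) n : (forall k, 0 <= a k) -> ex_series a ->
  psum a n <= Series a.
Proof.
  intros Ha Ea. destruct n as [|n]; [apply (Series_ge0 a Ha Ea)|].
  rewrite (Series_incr_n a (S n)) by (lia || assumption). simpl pred.
  rewrite psum_sum_n, sum_n_Reals.
  assert (0 <= Series (fun k => a (S n + k)%nat)); [|lra].
  apply Series_ge0; [intros; apply Ha|]. now apply (ex_series_incr_n a (S n)).
Qed.

Section SequenceSpace.

Variables (p : R) (Hp : 1 < p).

Notation U := (lp_NormedModule p Hp).
Notation lp := (lp p Hp).

Let Hp0 : 0 < p. Proof. lra. Qed.

Lemma lp_partial_sums (x : lp) n : psum (fun k => rpow (Cmod (x k)) p) n <= rpow (norm x) p.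
Proof.
  change (norm x) with (lp_norm p x). rewrite (lp_norm_pow p Hp x (lp_summable x)).
  apply psum_le_Series; [intros; apply rpow_ge0 | exact (lp_summable x)].
Qed.

Lemma p_summable_of_partial (s : nat -> C) M :
  (forall n, psum (fun k => rpow (Cmod (s k)) p) n <= M) -> p_summable p s.
Proof.
  intros H. apply (ex_series_bounded _ M); [intros; apply rpow_ge0 | exact H].
Qed.

Lemma lp_norm_le_partial (x : lp) M : 0 <= M ->
  (forall n, psum (fun k => rpow (Cmod (x k)) p) n <= rpow M p) -> norm x <= M.
Proof.
  intros HM H. apply (lp_norm_le_of p Hp); [exact HM | | exact (lp_summable x)].
  apply (ex_series_bounded _ (rpow M p)); [intros; apply rpow_ge0 | exact H].
Qed.

Lemma lp_norm_mono (x y : lp) : (forall k, Cmod (x k) <= Cmod (y k)) -> norm x <= norm y.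
Proof.
  intros H. apply lp_norm_le_partial; [apply norm_ge_0|]. intros n.
  eapply Rle_trans; [|apply (lp_partial_sums y n)]. apply psum_R_le. intros k _.
  apply rpow_le; [exact Hp0|]. split; [apply Cmod_ge_0 | apply H].
Qed.

Lemma lp_coord_linear k : is_linear (U := U) (V := C_NormedModule) (fun x : lp => x k).
Proof.
  split; [reflexivity | reflexivity |].
  exists 1. split; [lra|]. intros x. rewrite Rmult_1_l.
  apply (lp_norm_coord p Hp), lp_summable.
Qed.

Definition lp_coord (k : nat) : bounded_op U C_NormedModule := mk_op _ (lp_coord_linear k).

Lemma lp_coord_le (x : lp) k : Cmod (x k) <= norm x.
Proof. apply (lp_norm_coord p Hp), lp_summable. Qed.

Lemma lp_coord_op_norm k : op_norm (lp_coord k) <= 1.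
Proof.
  apply op_norm_le_mult; [lra|]. intros x. rewrite Rmult_1_l. apply lp_coord_le.
Qed.

Definition delta_seq (i k : nat) : C := if Nat.eqb k i then RtoC 1 else RtoC 0.

Lemma delta_seq_partial i n : psum (fun k => rpow (Cmod (delta_seq i k)) p) n <= rpow 1 p.
Proof.
  assert (H1 : rpow 1 p = 1) by (rewrite rpow_pos by lra; unfold Rpower; now rewrite ln_1, Rmult_0_r, exp_0).
  rewrite H1. unfold delta_seq. destruct (Nat.lt_ge_cases i n) as [H|H].
  - rewrite (psum_single _ n i H).
    + rewrite Nat.eqb_refl, Cmod_1, H1. apply Rle_refl.
    + intros k _ Hne. apply Nat.eqb_neq in Hne. rewrite Hne, Cmod_0. apply rpow_0.
  - rewrite psum_zero; [exact Rle_0_1|]. intros k Hk.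
    assert (Hne : (k =? i)%nat = false) by (apply Nat.eqb_neq; lia).
    rewrite Hne, Cmod_0. apply rpow_0.
Qed.

Definition lp_delta (i : nat) : lp :=
  mk_lp (delta_seq i) (p_summable_of_partial _ _ (delta_seq_partial i)).

Lemma lp_delta_norm i : norm (lp_delta i) <= 1.
Proof. apply lp_norm_le_partial; [lra | apply delta_seq_partial]. Qed.

Lemma lp_psum_coord (u : nat -> lp) n k : (psum u n : lp) k = psum (fun j => u j k) n.
Proof. exact (bop_psum (lp_coord k) u n). Qed.

Definition finite_seq (s : nat -> C) (n : nat) : lp := psum (fun i => s i *: lp_delta i) n.

Lemma finite_seq_coord s n k : finite_seq s n k = if (k <? n)%nat then s k else RtoC 0.
Proof.
  unfold finite_seq. rewrite lp_psum_coord.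
  destruct (Nat.ltb_spec k n) as [H|H].
  - rewrite (psum_single _ n k H).
    + change ((s k *: lp_delta k : lp) k) with (Cmult (s k) (delta_seq k k)).
      unfold delta_seq. rewrite Nat.eqb_refl. ring.
    + intros j _ Hne. change ((s j *: lp_delta j : lp) k) with (Cmult (s j) (delta_seq j k)).
      unfold delta_seq. destruct (Nat.eqb_spec k j); [congruence | apply Cmult_0_r].
  - apply (psum_zero (G := C_AbelianMonoid)). intros j Hj.
    change ((s j *: lp_delta j : lp) k) with (Cmult (s j) (delta_seq j k)).
    unfold delta_seq. destruct (Nat.eqb_spec k j); [lia | apply Cmult_0_r].
Qed.

Lemma finite_seq_norm s n : norm (finite_seq s n) <= psum (fun k => Cmod (s k)) n.
Proof.
  eapply Rle_trans; [apply (psum_norm (X := U))|]. apply psum_R_le. intros k _.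
  eapply Rle_trans; [right; apply (norm_scalC (X := U))|].
  rewrite <- (Rmult_1_r (Cmod (s k))) at 2.
  apply Rmult_le_compat_l; [apply Cmod_ge_0 | apply lp_delta_norm].
Qed.

Lemma finite_seq_partial s n :
  psum (fun k => rpow (Cmod (s k)) p) n <= rpow (norm (finite_seq s n)) p.
Proof.
  eapply Rle_trans; [|apply (lp_partial_sums (finite_seq s n) n)]. apply psum_R_le.
  intros k Hk. rewrite finite_seq_coord. destruct (Nat.ltb_spec k n); [apply Rle_refl | lia].
Qed.

Lemma lp_abs_complete : abs_complete U.
Proof.
  apply abs_complete_of_fatou with lp_coord.
  - intros k x. apply lp_coord_le.
  - intros x y H. apply lp_ext. exact H.
  - intros x M s Hx Hs.
    assert (HM : 0 <= M) by (eapply Rle_trans; [apply (norm_ge_0 (V := U)) | apply (Hx O)]).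
    assert (Hf : forall n, norm (finite_seq s n) <= M).
    { intros n. apply le_epsilon. intros eps Heps. assert (Hn := pos_INR n).
      destruct (finitely_many_close (fun m k => x m k) s Hs n (eps / (INR n + 1))) as [N HN].
      { apply Rdiv_lt_0_compat; lra. }
      assert (E : finite_seq s n =
         plus (finite_seq (x N) n) (finite_seq (fun k => Copp (Cminus (x N k) (s k))) n)).
      { apply lp_ext. intros k.
        change (finite_seq s n k = Cplus (finite_seq (x N) n k)
          (finite_seq (fun k => Copp (Cminus (x N k) (s k))) n k)).
        rewrite !finite_seq_coord. destruct (k <? n)%nat; ring. }
      rewrite E. eapply Rle_trans; [apply (norm_triangle (V := U))|]. apply Rplus_le_compat.
      - eapply Rle_trans; [|apply (Hx N)]. apply lp_norm_mono. intros k.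
        rewrite finite_seq_coord. destruct (k <? n)%nat; [apply Rle_refl|].
        rewrite Cmod_0. apply Cmod_ge_0.
      - eapply Rle_trans; [apply finite_seq_norm|].
        apply Rle_trans with (psum (fun _ => eps / (INR n + 1)) n).
        + apply psum_R_le. intros k Hk. rewrite Cmod_opp. left. now apply HN.
        + rewrite psum_R_const. apply Rle_trans with ((INR n + 1) * (eps / (INR n + 1))).
          * apply Rmult_le_compat_r; [apply Rdiv_le_0_compat|]; lra.
          * right. field. lra. }
    assert (H : forall n, psum (fun k => rpow (Cmod (s k)) p) n <= rpow M p).
    { intros n. eapply Rle_trans; [apply finite_seq_partial|].
      apply rpow_le; [exact Hp0|]. split; [apply norm_ge_0 | apply Hf]. }
    exists (mk_lp s (p_summable_of_partial _ _ H)). split; [reflexivity|].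
    now apply lp_norm_le_partial.
Qed.

Definition trunc (n : nat) (x : lp) : lp := finite_seq x n.

Lemma trunc_coord n x k : trunc n x k = if (k <? n)%nat then x k else RtoC 0.
Proof. apply finite_seq_coord. Qed.

Lemma trunc_linear n : is_linear (U := U) (V := U) (trunc n).
Proof.
  split.
  - intros x y. apply lp_ext. intros k.
    change (trunc n (plus x y) k = Cplus (trunc n x k) (trunc n y k)).
    rewrite !trunc_coord. change ((plus x y : lp) k) with (Cplus (x k) (y k)).
    destruct (k <? n)%nat; ring.
  - intros c x. apply lp_ext. intros k.
    change (trunc n (scal c x) k = Cmult c (trunc n x k)).
    rewrite !trunc_coord. change ((scal c x : lp) k) with (Cmult c (x k)).
    destruct (k <? n)%nat; ring.
  - exists 1. split; [lra|]. intros x. rewrite Rmult_1_l. apply lp_norm_mono. intros k.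
    rewrite trunc_coord. destruct (k <? n)%nat; [apply Rle_refl|].
    rewrite Cmod_0. apply Cmod_ge_0.
Qed.

Definition trunc_op (n : nat) : bounded_op U U := mk_op _ (trunc_linear n).

Lemma trunc_norm n (x : lp) : norm (trunc n x) <= norm x.
Proof.
  apply lp_norm_mono. intros k.
  rewrite trunc_coord. destruct (k <? n)%nat; [apply Rle_refl|].
  rewrite Cmod_0. apply Cmod_ge_0.
Qed.

Definition tail_op (n : nat) : bounded_op U U := minus (op_id U) (trunc_op n).

Lemma tail_op_apply n (x : lp) : tail_op n x = minus x (trunc n x).
Proof. exact (bop_minus_apply (op_id U) (trunc_op n) x). Qed.

Lemma tail_coord n (x : lp) k : (tail_op n x : lp) k = if (k <? n)%nat then RtoC 0 else x k.
Proof.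
  rewrite tail_op_apply. change (Cplus (x k) (Copp (trunc n x k))
    = if (k <? n)%nat then RtoC 0 else x k).
  rewrite trunc_coord. destruct (k <? n)%nat; ring.
Qed.

Lemma tail_norm_mono n m (x : lp) : (n <= m)%nat -> norm (tail_op m x) <= norm (tail_op n x).
Proof.
  intros H. apply lp_norm_mono. intros k. rewrite !tail_coord.
  destruct (Nat.ltb_spec k m), (Nat.ltb_spec k n); try lia; try apply Rle_refl.
  rewrite Cmod_0. apply Cmod_ge_0.
Qed.

Lemma tail_norm n (x : lp) : norm (tail_op n x) <= norm x.
Proof.
  apply lp_norm_mono. intros k. rewrite tail_coord. destruct (k <? n)%nat; [|apply Rle_refl].
  rewrite Cmod_0. apply Cmod_ge_0.
Qed.

Lemma trunc_plus_tail n (x : lp) : plus (trunc n x) (tail_op n x) = x.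
Proof. rewrite tail_op_apply. module_eq. Qed.

Lemma tail_small (x : lp) eps : 0 < eps -> exists N, forall n, (N <= n)%nat ->
  norm (tail_op n x) < eps.
Proof.
  intros Heps.
  assert (Hs : abs_summable (X := C_NormedModule) (fun k => RtoC (rpow (Cmod (x k)) p))).
  { exists (rpow (norm x) p). intros n. eapply Rle_trans; [|apply (lp_partial_sums x n)].
    apply psum_R_le. intros k _. change (Cmod (RtoC (rpow (Cmod (x k)) p)) <= rpow (Cmod (x k)) p).
    rewrite Cmod_R, Rabs_pos_eq by apply rpow_ge0. apply Rle_refl. }
  destruct (abs_summable_tail C_NormedModule _ Hs (rpow (eps / 2) p)) as [N HN].
  { apply rpow_gt0. lra. }
  exists N. intros n Hn. apply Rle_lt_trans with (eps / 2); [|lra].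
  apply lp_norm_le_partial; [lra|]. intros m.
  assert (Hw : forall k, 0 <= rpow (Cmod ((tail_op n x : lp) k)) p) by (intros; apply rpow_ge0).
  eapply Rle_trans; [apply (psum_R_mono _ m (n + m) Hw); lia|].
  rewrite psum_R_split, (psum_ext _ (fun _ => 0)).
  - rewrite psum_R_const, Rmult_0_r, Rplus_0_l.
    eapply Rle_trans; [|apply (HN n m Hn)]. apply psum_R_le. intros k _.
    rewrite tail_coord. destruct (Nat.ltb_spec (n + k) n); [lia|].
    change (rpow (Cmod (x (n + k)%nat)) p <= Cmod (RtoC (rpow (Cmod (x (n + k)%nat)) p))).
    rewrite Cmod_R, Rabs_pos_eq by apply rpow_ge0. apply Rle_refl.
  - intros k H. rewrite tail_coord. destruct (Nat.ltb_spec k n); [|lia].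
    rewrite Cmod_0. apply rpow_0.
Qed.

(** * Functionals on the sequence space have small tails *)

Lemma rpow_root n : 0 <= n -> rpow (rpow n (/ p)) p = n.
Proof. intros H. now apply rpow_inv_l. Qed.

Lemma root_growth c : exists n : nat, c * rpow (INR n) (/ p) < INR n.
Proof.
  set (q := 1 - / p). assert (Hq : 0 < q).
  { unfold q. assert (/ p < 1); [|lra]. rewrite <- Rinv_1. apply Rinv_lt_contravar; lra. }
  set (d := Rmax c 1). assert (Hd : 1 <= d) by apply Rmax_r.
  destruct (INR_unbounded (Rpower d (/ q))) as [n Hn].
  assert (Hn0 : 0 < INR n) by (eapply Rlt_trans; [apply exp_pos | exact Hn]).
  exists n. rewrite rpow_pos by exact Hn0.
  assert (E : INR n = Rpower (INR n) q * Rpower (INR n) (/ p)).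
  { rewrite <- Rpower_plus. unfold q. replace (1 - / p + / p) with 1 by ring.
    symmetry. now apply Rpower_1. }
  rewrite E at 2. apply Rmult_lt_compat_r; [apply exp_pos|].
  apply Rle_lt_trans with d; [apply Rmax_l|].
  replace d with (Rpower (Rpower d (/ q)) q).
  - apply Rlt_Rpower_l; [exact Hq|]. split; [apply exp_pos | exact Hn].
  - rewrite Rpower_mult, Rinv_l by lra. apply Rpower_1. lra.
Qed.

(** If the tails of [f] stayed large, there would be [n] disjointly supported vectors
    in the unit ball on which [f] is at least [eps / 2]. Their sum has norm at most
    [n^(1/p)], and [f] is at least [n eps / 2] on it; for large [n] this contradicts
    [1 < p]. *)
Lemma functional_tail (f : bounded_op U C_NormedModule) eps : 0 < eps ->
  exists M, forall m (x : lp), (M <= m)%nat -> Cmod (f (tail_op m x)) <= eps * norm x.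
Proof.
  intros Heps. apply NNPP. intros Hno.
  assert (Hbad : forall M, exists m (x : lp), (M <= m)%nat /\ eps * norm x < Cmod (f (tail_op m x))).
  { intros M. apply NNPP. intros Hn. apply Hno. exists M. intros m x Hm.
    apply Rnot_lt_le. intros Hlt. apply Hn. now exists m, x. }
  assert (Hblocks : forall n, exists (K : nat) (x : lp) (r : R), (forall k, (K <= k)%nat -> x k = RtoC 0) /\
    (forall m, psum (fun k => rpow (Cmod (x k)) p) m <= INR n) /\
    f x = RtoC r /\ INR n * (eps / 2) <= r).
  { induction n as [|n [K [x [r [Hx [Hxs [Hfx Hr]]]]]]].
    - exists O, zero, 0. repeat split.
      + intros m. simpl. rewrite psum_zero; [apply Rle_refl|]. intros k _.
        rewrite Cmod_0. apply rpow_0.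
      + exact (bop_zero f).
      + simpl. lra.
    - destruct (Hbad K) as [m [w [Hm Hw]]].
      assert (Hwn : 0 < norm w).
      { destruct (norm_ge_0 w) as [H|H]; [exact H|]. exfalso.
        assert (Hw0 : w = zero) by (apply (norm_eq_zero (V := U)); now symmetry).
        assert (E : f (tail_op m w) = RtoC 0).
        { rewrite Hw0. transitivity (f zero); [exact (f_equal f (bop_zero (tail_op m))) | exact (bop_zero f)]. }
        rewrite E, Cmod_0, <- H in Hw. lra. }
      set (v := RtoC (/ norm w) *: tail_op m w : lp).
      assert (Hin : 0 < / norm w) by now apply Rinv_0_lt_compat.
      assert (Hv1 : norm v <= 1).
      { unfold v. eapply Rle_trans; [right; apply (norm_scalC (X := U))|].
        rewrite Cmod_R, Rabs_pos_eq by lra.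
        apply Rle_trans with (/ norm w * norm w); [|rewrite Rinv_l; lra].
        apply Rmult_le_compat_l; [lra | apply tail_norm]. }
      assert (Hfv : eps < Cmod (f v)).
      { unfold v.
        assert (E : f (RtoC (/ norm w) *: tail_op m w) = Cmult (RtoC (/ norm w)) (f (tail_op m w)))
          by apply (bop_scal f).
        rewrite E, Cmod_mult, Cmod_R, Rabs_pos_eq by lra.
        apply Rmult_lt_reg_l with (norm w); [exact Hwn|].
        rewrite <- Rmult_assoc, Rinv_r, Rmult_1_l by lra. lra. }
      assert (Hvk : forall k, (k < m)%nat -> v k = RtoC 0).
      { intros k Hk. change (v k) with (Cmult (RtoC (/ norm w)) ((tail_op m w : lp) k)).
        rewrite tail_coord. destruct (Nat.ltb_spec k m); [apply Cmult_0_r | lia]. }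
      assert (Hf0 := op_norm_ge0 _ _ f).
      destruct (tail_small v (eps / (2 * (op_norm f + 1)))) as [L HL].
      { apply Rdiv_lt_0_compat; lra. }
      specialize (HL L (Nat.le_refl _)).
      set (y := trunc L v).
      assert (Hfy : eps / 2 < Cmod (f y)).
      { assert (E : f v = Cplus (f y) (f (tail_op L v))).
        { rewrite <- (trunc_plus_tail L v) at 1. apply (bop_plus f). }
        assert (Hft : Cmod (f (tail_op L v)) <= eps / 2).
        { eapply Rle_trans; [apply (op_norm_bound _ _ f)|].
          apply Rle_trans with ((op_norm f + 1) * (eps / (2 * (op_norm f + 1)))).
          - apply Rmult_le_compat; try lra. apply norm_ge_0.
          - right. field. lra. }
        rewrite E in Hfv. generalize (Cmod_triangle (f y) (f (tail_op L v))). lra. }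
      set (fy := f y : C) in *.
      assert (Hcy : 0 < Cmod fy) by lra.
      assert (Hnz : RtoC (Cmod fy) <> RtoC 0) by (intros E; apply RtoC_inj in E; lra).
      (* Rotated so that the value of [f] adds to the value on the earlier blocks. *)
      set (c := Cdiv (Cconj fy) (RtoC (Cmod fy))).
      assert (Hc : Cmod c = 1).
      { unfold c. rewrite Cmod_div by exact Hnz. rewrite Cmod_conj, Cmod_R, Rabs_pos_eq by lra.
        field. lra. }
      assert (Hcf : Cmult c fy = RtoC (Cmod fy)).
      { unfold c. assert (E : Cmult fy (Cconj fy) = Cmult (RtoC (Cmod fy)) (RtoC (Cmod fy))).
        { rewrite <- Cmod2_conj, <- RtoC_mult. f_equal. ring. }
        transitivity (Cdiv (Cmult fy (Cconj fy)) (RtoC (Cmod fy))); [field; exact Hnz|].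
        rewrite E. field. exact Hnz. }
      exists (Nat.max K L), (plus x (c *: y)), (r + Cmod fy). split; [|split; [|split]].
      + intros k Hk. change (Cplus (x k) (Cmult c (trunc L v k)) = RtoC 0).
        rewrite trunc_coord. destruct (Nat.ltb_spec k L); [lia|].
        rewrite Hx by lia. ring.
      + intros N. rewrite S_INR.
        apply Rle_trans with (psum (fun k => rpow (Cmod (x k)) p + rpow (Cmod (y k)) p) N).
        * apply psum_R_le. intros k _.
          change (rpow (Cmod (Cplus (x k) (Cmult c (y k)))) p
            <= rpow (Cmod (x k)) p + rpow (Cmod (y k)) p).
          destruct (Nat.lt_ge_cases k m) as [H|H].
          -- assert (Ey : y k = RtoC 0).
             { unfold y. rewrite trunc_coord, Hvk by exact H. now destruct (k <? L)%nat. }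
             rewrite Ey, Cmod_0, rpow_0. replace (Cplus (x k) (Cmult c (RtoC 0))) with (x k) by ring.
             lra.
          -- rewrite (Hx k) by lia. rewrite Cmod_0, rpow_0.
             replace (Cplus (RtoC 0) (Cmult c (y k))) with (Cmult c (y k)) by ring.
             rewrite Cmod_mult, Hc, Rmult_1_l. lra.
        * rewrite psum_R_plus. apply Rplus_le_compat; [apply Hxs|].
          eapply Rle_trans; [apply lp_partial_sums|].
          assert (E1 : rpow 1 p = 1).
          { rewrite rpow_pos by lra. unfold Rpower. now rewrite ln_1, Rmult_0_r, exp_0. }
          rewrite <- E1. apply rpow_le; [exact Hp0|]. split; [apply norm_ge_0|].
          eapply Rle_trans; [apply trunc_norm | exact Hv1].
      + rewrite RtoC_plus, <- Hfx, <- Hcf.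
        transitivity (Cplus (f x) (f (c *: y))); [apply (bop_plus f)|].
        f_equal. apply (bop_scal f).
      + rewrite S_INR. lra. }
  assert (Hf0 := op_norm_ge0 _ _ f).
  destruct (root_growth (2 * op_norm f / eps)) as [n Hn].
  destruct (Hblocks n) as [K [x [r [_ [Hxs [Hfx Hr]]]]]].
  assert (Hx : norm x <= rpow (INR n) (/ p)).
  { apply lp_norm_le_partial; [apply rpow_ge0|]. intros m.
    rewrite rpow_root by apply pos_INR. apply Hxs. }
  assert (H1 : r <= op_norm f * rpow (INR n) (/ p)).
  { apply Rle_trans with (Cmod (f x)).
    - rewrite Hfx, Cmod_R. apply Rle_abs.
    - eapply Rle_trans; [apply (op_norm_bound _ _ f)|]. now apply Rmult_le_compat_l. }
  apply (Rmult_lt_compat_r (eps / 2)) in Hn; [|lra].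
  replace (2 * op_norm f / eps * rpow (INR n) (/ p) * (eps / 2))
    with (op_norm f * rpow (INR n) (/ p)) in Hn by (field; lra).
  lra.
Qed.

(** * Matrix units *)

Lemma rank_one_linear (f : bounded_op U C_NormedModule) (y : lp) :
  is_linear (U := U) (V := U) (fun x => (f x : C) *: y).
Proof.
  split.
  - intros x x'. rewrite bop_plus. exact (scal_distr_r (V := U) _ _ y).
  - intros c x. rewrite bop_scal. symmetry. exact (scal_assoc (V := U) _ _ y).
  - assert (Hf := op_norm_ge0 _ _ f). assert (Hy := norm_ge_0 y).
    exists (op_norm f * norm y + 1). split; [generalize (Rmult_le_pos _ _ Hf Hy); lra|].
    intros x. eapply Rle_trans; [right; apply (norm_scalC (X := U))|].
    apply Rle_trans with (op_norm f * norm x * norm y).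
    + apply Rmult_le_compat_r; [exact Hy | apply (op_norm_bound _ _ f)].
    + generalize (norm_ge_0 x). intros Hx.
      replace (op_norm f * norm x * norm y) with (op_norm f * norm y * norm x) by ring.
      apply Rmult_le_compat_r; lra.
Qed.

Definition rank_one (f : bounded_op U C_NormedModule) (y : lp) : bounded_op U U :=
  mk_op _ (rank_one_linear f y).

Definition matrix_unit (i j : nat) : bounded_op U U := rank_one (lp_coord j) (lp_delta i).

Lemma matrix_unit_norm i j : op_norm (matrix_unit i j) <= 1.
Proof.
  apply op_norm_le_mult; [lra|]. intros x. rewrite Rmult_1_l.
  eapply Rle_trans; [right; apply (norm_scalC (X := U))|].
  rewrite <- (Rmult_1_r (norm x)).
  apply Rmult_le_compat; [apply Cmod_ge_0 | apply norm_ge_0 | apply lp_coord_le | apply lp_delta_norm].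
Qed.

Definition matrix_unit_of (k : nat) : bounded_op U U :=
  matrix_unit (fst (of_nat k)) (snd (of_nat k)).

(** The operator whose matrix is the given element of [l1], read as a double sequence. *)
Definition matrix_op : bounded_op l1_NormedModule (op_NormedModule U U) :=
  l1_lift (op_NormedModule U U) (bounded_op_abs_complete U U lp_abs_complete)
    matrix_unit_of (fun k => matrix_unit_norm _ _).

Lemma matrix_op_delta i j : matrix_op (pair_delta i j) = matrix_unit i j.
Proof.
  unfold matrix_op, pair_delta. rewrite l1_lift_delta. unfold matrix_unit_of.
  now rewrite cancel_of_to.
Qed.

Lemma matrix_op_norm (c : l1) : op_norm (matrix_op c) <= norm c.
Proof. exact (l1_lift_norm (op_NormedModule U U) (bounded_op_abs_complete U U lp_abs_complete)
    matrix_unit_of (fun k => matrix_unit_norm _ _) c). Qed.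

Lemma eval_linear (x : lp) : is_linear (U := op_NormedModule U U) (V := U)
  (fun T : bounded_op U U => T x).
Proof.
  split; [reflexivity | reflexivity |].
  exists (norm x + 1). split; [generalize (norm_ge_0 x); lra|]. intros T.
  eapply Rle_trans; [apply op_norm_bound|]. rewrite Rmult_comm.
  apply Rmult_le_compat_r; [apply op_norm_ge0 | lra].
Qed.

Definition eval_op (x : lp) : bounded_op (op_NormedModule U U) U := mk_op _ (eval_linear x).

Notation B := (backward_shift p Hp).
Notation F := (forward_shift p Hp).

Lemma backward_delta i : B (lp_delta i) = match i with O => zero | S i' => lp_delta i' end.
Proof. apply lp_ext. intros k. now destruct i. Qed.

Lemma backward_norm : op_norm B <= 1.
Proof.
  apply op_norm_le_mult; [lra|]. intros x. rewrite Rmult_1_l.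
  apply lp_norm_le_partial; [apply norm_ge_0|]. intros n.
  eapply Rle_trans; [|apply (lp_partial_sums x (S n))].
  rewrite psum_S_l. change (@plus R_AbelianMonoid) with Rplus.
  generalize (rpow_ge0 (Cmod (x O)) p). simpl. lra.
Qed.

Lemma forward_norm : op_norm F <= 1.
Proof.
  apply op_norm_le_mult; [lra|]. intros x. rewrite Rmult_1_l.
  apply lp_norm_le_partial; [apply norm_ge_0|]. intros [|n]; [apply rpow_ge0|].
  eapply Rle_trans; [|apply (lp_partial_sums x n)].
  rewrite psum_S_l. change (@plus R_AbelianMonoid) with Rplus.
  simpl. rewrite Cmod_0, rpow_0. lra.
Qed.

Lemma matrix_op_shift1 (c : l1) x : matrix_op (shift1 c) x = B (matrix_op c x).
Proof.
  apply (l1_pair_op_ext U (op_comp (eval_op x) (op_comp matrix_op shift1))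
    (op_comp B (op_comp (eval_op x) matrix_op))).
  intros i j. change (matrix_op (shift1 (pair_delta i j)) x = B (matrix_op (pair_delta i j) x)).
  rewrite shift1_delta, matrix_op_delta.
  change (matrix_unit i j x) with (x j *: lp_delta i).
  assert (E : B (x j *: lp_delta i) = x j *: B (lp_delta i)) by apply (bop_scal B).
  rewrite E, backward_delta. destruct i as [|i].
  - assert (E0 : matrix_op zero = zero) by apply bop_zero.
    rewrite E0. change ((zero : lp) = x j *: zero). symmetry. apply (scal_zero_r (V := U)).
  - now rewrite matrix_op_delta.
Qed.

Lemma matrix_op_shift2 (c : l1) x : matrix_op (shift2 c) x = matrix_op c (F x).
Proof.
  apply (l1_pair_op_ext U (op_comp (eval_op x) (op_comp matrix_op shift2))
    (op_comp (eval_op (F x)) matrix_op)).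
  intros i j. change (matrix_op (shift2 (pair_delta i j)) x = matrix_op (pair_delta i j) (F x)).
  rewrite shift2_delta, matrix_op_delta.
  change (matrix_unit i j (F x)) with ((F x : lp) j *: lp_delta i).
  destruct j as [|j].
  - assert (E0 : matrix_op zero = zero) by apply bop_zero.
    rewrite E0. change ((zero : lp) = RtoC 0 *: lp_delta i). symmetry.
    exact (scal_zero_l (V := U) (lp_delta i)).
  - now rewrite matrix_op_delta.
Qed.

Lemma matrix_op_fcalc1 a A rho (c : l1) x : geom_bounded_C a A rho -> rho < 1 ->
  matrix_op (fcalc a shift1 c) x = fcalc a B (matrix_op c x).
Proof.
  intros Ha Hr.
  apply (fcalc_intertwine l1_NormedModule U l1_abs_complete lp_abs_complete
    (op_comp (eval_op x) matrix_op) shift1 B a A rho c Ha Hr shift1_op_norm backward_norm).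
  intros d. change (matrix_op (shift1 d) x = B (matrix_op d x)). apply matrix_op_shift1.
Qed.

Lemma matrix_op_fcalc2 b A rho (c : l1) x : geom_bounded_C b A rho -> rho < 1 ->
  matrix_op (fcalc b shift2 c) x = matrix_op c (fcalc b F x).
Proof.
  intros Hb Hr.
  assert (H1 := bop_is_series (op_comp (eval_op x) matrix_op) _ _
    (fcalc_apply l1_NormedModule l1_abs_complete b A rho shift2 c Hb Hr shift2_op_norm)).
  assert (H2 := bop_is_series (matrix_op c) _ _
    (fcalc_apply U lp_abs_complete b A rho F x Hb Hr forward_norm)).
  refine (is_series_unique_C _ _ _ H1 _).
  refine (is_series_eq _ _ _ _ H2 _ _); [|reflexivity].
  intros n. simpl. etransitivity; [apply (bop_scal (matrix_op c))|].
  symmetry. etransitivity; [apply (bop_scal (op_comp (eval_op x) matrix_op))|]. f_equal.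
  change (matrix_op (op_pow shift2 n c) x = matrix_op c (op_pow F n x)).
  clear. revert c x. induction n as [|n IH]; intros c x; [reflexivity|].
  rewrite op_pow_S, matrix_op_shift2, IH, <- op_pow_S_r. reflexivity.
Qed.

(** Composition with [B] on the left and with [F] on the right shift the rows and the
    columns of a matrix backwards. *)
Lemma matrix_op_double_shift a b A1 A2 rho (c : l1) : rho < 1 ->
  geom_bounded_C a A1 rho -> geom_bounded_C b A2 rho ->
  matrix_op (double_shift a b c) = conj_op (fcalc a B) (fcalc b F) (matrix_op c).
Proof.
  intros Hr Ha Hb. apply op_ext. intros x.
  change (matrix_op (fcalc a shift1 (fcalc b shift2 c)) x
    = fcalc a B (matrix_op c (fcalc b F x))).
  rewrite (matrix_op_fcalc1 a A1 rho _ x Ha Hr). f_equal.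
  apply (matrix_op_fcalc2 b A2 rho c x Hb Hr).
Qed.

End SequenceSpace.

(** * The comparison principle *)

Section Comparison.

Variables (X : ModuleSpace C_AbsRing) (E : top_subspace X) (A : X -> X).
Variables (J : l1 -> X) (S : bounded_op l1_NormedModule l1_NormedModule) (x : l1).
Hypotheses (HA : continuous_linear_on E A) (HJ : forall c, E (J c))
  (HJS : forall c, J (S c) = A (J c)).
Hypothesis Hx : forall d eps, 0 < eps ->
  linearly_recurrent (fun n => norm (minus (Nat.iter n S x) d) < eps).
Hypothesis Hdense : forall y W, E y -> base0 E W ->
  exists (d : l1) eps, 0 < eps /\ forall c : l1, norm (minus c d) < eps -> W (minus (J c) y).

(** The orbit of [J x] is the image of the orbit of [x], and the preimage of a
    neighbourhood under [J] contains a ball. *)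
Lemma comparison_principle : frequently_hypercyclic E A.
Proof.
  split; [exact HA|]. exists (J x). split; [apply HJ|].
  intros V [HVE HV] [y Hy]. apply lower_density_pos.
  destruct (HV y Hy) as [W [HW HWV]].
  destruct (Hdense y W (HVE y Hy) HW) as [d [eps [Heps Hd]]].
  apply linearly_recurrent_incl with (2 := Hx d eps Heps).
  intros n Hn.
  assert (En : Nat.iter n A (J x) = J (Nat.iter n S x)).
  { clear Hn. induction n as [|n IH]; [reflexivity|]. simpl. now rewrite IH, HJS. }
  rewrite En. apply HWV; [apply HJ | now apply Hd].
Qed.

End Comparison.

(** For a linear map, continuity at zero is enough. *)
Lemma continuous_linear_on_of_base (X : ModuleSpace C_AbsRing) (E : top_subspace X) (A : X -> X) :
  (forall x, E x -> E (A x)) -> (forall x y, E x -> E y -> E (minus x y)) ->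
  (forall x y, A (plus x y) = plus (A x) (A y)) ->
  (forall (c : C) x, A (c *: x) = c *: A x) ->
  (forall W, base0 E W -> exists W', base0 E W' /\ forall x, E x -> W' x -> W (A x)) ->
  continuous_linear_on E A.
Proof.
  intros HE Hminus Hplus Hscal Hbase. split; auto.
  intros V [HVE HV]. split; [now intros x [Hx _]|].
  intros x [Hx HVx]. destruct (HV (A x) HVx) as [W [HW HWV]].
  destruct (Hbase W HW) as [W' [HW' HWW']].
  exists W'. split; [exact HW'|]. intros y Hy HyW. split; [exact Hy|].
  apply HWV; [now apply HE|].
  replace (minus (A y) (A x)) with (A (minus y x)).
  - apply HWW'; [now apply Hminus | exact HyW].
  - replace (minus y x) with (plus y (Copp (RtoC 1) *: x)) by module_eq.
    rewrite Hplus, Hscal. module_eq.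
Qed.

Lemma conj_op_plus {U : NormedModule C_AbsRing} (R Q S T : bounded_op U U) :
  conj_op R Q (plus S T) = plus (conj_op R Q S) (conj_op R Q T).
Proof. apply op_ext. intros x. exact (bop_plus R (S (Q x)) (T (Q x))). Qed.

Lemma conj_op_scal {U : NormedModule C_AbsRing} (R Q : bounded_op U U) (c : C) T :
  conj_op R Q (c *: T) = c *: conj_op R Q T.
Proof. apply op_ext. intros x. exact (bop_scal R c (T (Q x))). Qed.

Lemma conj_op_minus {U : NormedModule C_AbsRing} (R Q S T : bounded_op U U) :
  conj_op R Q (minus S T) = minus (conj_op R Q S) (conj_op R Q T).
Proof.
  apply op_ext. intros x.
  change (R ((minus S T : bounded_op U U) (Q x))
    = (minus (conj_op R Q S) (conj_op R Q T) : bounded_op U U) x).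
  rewrite !bop_minus_apply, bop_minus. reflexivity.
Qed.

Lemma conj_op_norm {U : NormedModule C_AbsRing} (R Q T : bounded_op U U) :
  op_norm (conj_op R Q T) <= op_norm R * op_norm T * op_norm Q.
Proof.
  assert (HR := op_norm_ge0 _ _ R). assert (HQ := op_norm_ge0 _ _ Q).
  assert (HT := op_norm_ge0 _ _ T).
  apply op_norm_le_mult; [repeat apply Rmult_le_pos; assumption|]. intros x.
  change (norm (R (T (Q x))) <= op_norm R * op_norm T * op_norm Q * norm x).
  eapply Rle_trans; [apply op_norm_bound|]. rewrite !Rmult_assoc.
  apply Rmult_le_compat_l; [exact HR|].
  eapply Rle_trans; [apply op_norm_bound|].
  apply Rmult_le_compat_l; [exact HT | apply op_norm_bound].
Qed.

(** * Compact sets *)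

Section CompactSets.

Variable U : NormedModule C_AbsRing.

Lemma open_of_norm (O : U -> Prop) :
  (forall x, O x -> exists eps, 0 < eps /\ forall y, norm (minus y x) < eps -> O y) -> open O.
Proof.
  intros H x Hx. destruct (H x Hx) as [eps [Heps HO]].
  generalize (locally_ball_norm x (mkposreal eps Heps)).
  apply filter_imp. intros y Hy. now apply HO.
Qed.

Lemma open_norm (O : U -> Prop) x : open O -> O x ->
  exists eps, 0 < eps /\ forall y, norm (minus y x) < eps -> O y.
Proof.
  intros HO Hx. destruct (HO x Hx) as [eps Heps].
  exists eps. split; [apply cond_pos|]. intros y Hy. apply Heps. now apply norm_compat1.
Qed.

Lemma closure_norm (A : U -> Prop) x :
  closure A x <-> forall eps, 0 < eps -> exists y, A y /\ norm (minus y x) < eps.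
Proof.
  split.
  - intros H eps Heps.
    exact (H (ball_norm x (mkposreal eps Heps)) (locally_ball_norm x (mkposreal eps Heps))).
  - intros H W [eps HW]. destruct (H eps (cond_pos eps)) as [y [Hy Hyx]].
    exists y. split; [exact Hy|]. apply HW. now apply norm_compat1.
Qed.

(** The largest index in a finite subcover will do. *)
Lemma compact_increasing_cover (K : U -> Prop) (O : nat -> U -> Prop) : compact_set K ->
  (forall n, open (O n)) -> (forall n m x, (n <= m)%nat -> O n x -> O m x) ->
  (forall x, K x -> exists n, O n x) -> exists n, forall m x, (n <= m)%nat -> K x -> O m x.
Proof.
  intros HK HO Hmono Hcov. destruct (HK nat O HO Hcov) as [l Hl].
  exists (list_max l). intros m x Hm Hx. destruct (Hl x Hx) as [i [Hi HOi]].
  apply Hmono with i; [|exact HOi].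
  assert (Hmax := proj1 (list_max_le l (list_max l)) (Nat.le_refl _)).
  rewrite Forall_forall in Hmax. specialize (Hmax i Hi). lia.
Qed.

Lemma compact_bounded (K : U -> Prop) : compact_set K ->
  exists M, 0 < M /\ forall x, K x -> norm x <= M.
Proof.
  intros HK.
  destruct (compact_increasing_cover K (fun n x => norm x < INR n) HK) as [n Hn].
  - intros n. apply open_of_norm. intros x Hx. exists (INR n - norm x). split; [lra|].
    intros y Hy. generalize (norm_plus_minus y x). lra.
  - intros n m x Hnm Hx. apply le_INR in Hnm. lra.
  - intros x _. apply INR_unbounded.
  - exists (INR n + 1). split; [generalize (pos_INR n); lra|].
    intros x Hx. generalize (Hn n x (Nat.le_refl _) Hx). lra.
Qed.

Lemma compact_image (T : bounded_op U U) (K : U -> Prop) : compact_set K ->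
  compact_set (fun y => exists x, K x /\ y = T x).
Proof.
  intros HK I O HO Hcov.
  destruct (HK I (fun i x => O i (T x))) as [l Hl].
  - intros i. apply open_of_norm. intros x Hx.
    destruct (open_norm (O i) (T x) (HO i) Hx) as [eps [Heps H]].
    assert (H0 := op_norm_ge0 _ _ T).
    exists (eps / (op_norm T + 1)). split; [apply Rdiv_lt_0_compat; lra|].
    intros y Hy. apply H. rewrite <- bop_minus.
    eapply Rle_lt_trans; [apply op_norm_bound|].
    apply Rle_lt_trans with ((op_norm T + 1) * norm (minus y x)).
    + apply Rmult_le_compat_r; [apply norm_ge_0 | lra].
    + apply Rlt_le_trans with ((op_norm T + 1) * (eps / (op_norm T + 1))).
      * apply Rmult_lt_compat_l; lra.
      * right. field. lra.
  - intros x Hx. apply Hcov. now exists x.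
  - exists l. intros y [x [Hx ->]]. now apply Hl.
Qed.

Definition totally_bounded (K : U -> Prop) : Prop := forall eps, 0 < eps ->
  exists l : list U, forall y, K y -> exists c, In c l /\ norm (minus y c) < eps.

(** A subset of [K] without finite subcover meets some small ball in such a set;
    nested choices of radius [2^-n] converge to a point of [K], and the member of
    the cover containing it gives a contradiction. *)
Lemma compact_of_totally_bounded (HU : abs_complete U) (K : U -> Prop) :
  (forall x, closure K x -> K x) -> totally_bounded K -> compact_set K.
Proof.
  intros Hclosed Htb I O HO Hcov.
  set (good := fun S : U -> Prop => exists l : list I, forall x, S x -> exists i, In i l /\ O i x).
  apply NNPP. intros HbadK. change (~ good K) in HbadK.
  assert (Hunion : forall (l : list U) r (S : U -> Prop),
    (forall c, In c l -> good (fun y => S y /\ norm (minus y c) < r)) ->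
    good (fun y => S y /\ exists c, In c l /\ norm (minus y c) < r)).
  { intros l r S. induction l as [|c l IH]; intros H.
    - exists nil. intros y [_ [c [[] _]]].
    - destruct IH as [l1 H1]; [intros; apply H; now right|].
      destruct (H c) as [l2 H2]; [now left|].
      exists (l1 ++ l2). intros y [Hy [c' [[<-|Hc'] Hyc]]].
      + destruct (H2 y (conj Hy Hyc)) as [i [Hi HOi]]. exists i.
        split; [apply in_or_app; now right | exact HOi].
      + destruct (H1 y) as [i [Hi HOi]]; [split; [exact Hy | now exists c']|].
        exists i. split; [apply in_or_app; now left | exact HOi]. }
  assert (Hsplit : forall (S : U -> Prop) r, 0 < r -> exists c : U,
    (forall y, S y -> K y) -> ~ good S -> ~ good (fun y => S y /\ norm (minus y c) < r)).
  { intros S r Hr. destruct (Htb r Hr) as [l Hl].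
    apply NNPP. intros Hno. apply Hno. exists zero. intros HSK HbS. exfalso.
    assert (Hall : forall c, good (fun y => S y /\ norm (minus y c) < r)).
    { intros c. apply NNPP. intros Hc. apply Hno. now exists c. }
    apply HbS. destruct (Hunion l r S (fun c _ => Hall c)) as [l' Hl'].
    exists l'. intros y Hy. apply Hl'. split; [exact Hy | now apply Hl, HSK]. }
  assert (Hpos : forall n, 0 < (/ 2) ^ n) by (intros; apply pow_lt; lra).
  set (center := fun (S : U -> Prop) n =>
    proj1_sig (constructive_indefinite_description _ (Hsplit S ((/ 2) ^ n) (Hpos n)))).
  set (nest := fix nest (n : nat) : U -> Prop :=
    match n with
    | 0%nat => K
    | S m => fun y => nest m y /\ norm (minus y (center (nest m) m)) < (/ 2) ^ m
    end).
  assert (HnK : forall n y, nest n y -> K y).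
  { induction n as [|n IH]; intros y Hy; [exact Hy|]. apply IH, Hy. }
  assert (Hbad : forall n, ~ good (nest n)).
  { induction n as [|n IH]; [exact HbadK|].
    exact (proj2_sig (constructive_indefinite_description _ (Hsplit (nest n) ((/ 2) ^ n) (Hpos n)))
      (HnK n) IH). }
  assert (Hne : forall n, exists y, nest n y).
  { intros n. apply NNPP. intros Hno. apply (Hbad n). exists nil.
    intros y Hy. exfalso. apply Hno. now exists y. }
  set (y := fun n => proj1_sig (constructive_indefinite_description _ (Hne n))).
  assert (Hy : forall n, nest n (y n)).
  { intros n. exact (proj2_sig (constructive_indefinite_description _ (Hne n))). }
  assert (Hmono : forall n m x, (n <= m)%nat -> nest m x -> nest n x).
  { intros n m x Hnm. induction Hnm as [|m Hnm IH]; [trivial|]. intros [H _]. now apply IH. }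
  set (cn := fun n => center (nest n) n).
  assert (Hball : forall n x, nest (S n) x -> norm (minus x (cn n)) < (/ 2) ^ n).
  { intros n x Hx. exact (proj2 Hx). }
  assert (Hstep : forall n, norm (minus (y (S (S n))) (y (S n))) <= 2 * (/ 2) ^ n).
  { intros n. assert (H1 := Hball n _ (Hmono (S n) (S (S n)) _ ltac:(lia) (Hy (S (S n))))).
    assert (H2 := Hball n _ (Hy (S n))). rewrite norm_minus_sym in H2.
    generalize (norm_dist_triangle (y (S (S n))) (cn n) (y (S n))). lra. }
  destruct (HU (fun n => minus (y (S (S n))) (y (S n)))) as [l Hl].
  { apply abs_summable_geom with 2 (/ 2); [lra | lra | exact Hstep]. }
  set (ylim := plus l (y 1%nat)).
  assert (Hpsum : forall n, psum (fun n => minus (y (S (S n))) (y (S n))) n = minus (y (S n)) (y 1%nat)).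
  { induction n as [|n IH]; [symmetry; apply (minus_eq_zero (G := U))|].
    etransitivity; [exact (f_equal (fun v => plus v (minus (y (S (S n))) (y (S n)))) IH)|].
    module_eq. }
  assert (Hconv : forall eps, 0 < eps -> exists N, forall n, (N <= n)%nat ->
     norm (minus (y (S n)) ylim) < eps).
  { intros eps Heps. destruct (proj1 (is_series_psum _ _) Hl eps Heps) as [N HN].
    exists N. intros n Hn. specialize (HN n Hn). rewrite Hpsum in HN.
    assert (Eq : minus (y (S n)) ylim = minus (minus (y (S n)) (y 1%nat)) l)
      by (unfold ylim; module_eq).
    rewrite Eq. exact HN. }
  assert (HKy : K ylim).
  { apply Hclosed, closure_norm. intros eps Heps. destruct (Hconv eps Heps) as [N HN].
    exists (y (S N)). split; [apply (HnK (S N)), Hy | apply HN; lia]. }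
  destruct (Hcov ylim HKy) as [i Hi].
  destruct (open_norm (O i) ylim (HO i) Hi) as [eps [Heps HOe]].
  destruct (Hconv (eps / 4)) as [N1 HN1]; [lra|].
  destruct (pow_lt_1_zero (/ 2)) with (y := eps / 4) as [N2 HN2]; [rewrite Rabs_pos_eq; lra | lra |].
  set (n := Nat.max N1 N2).
  specialize (HN1 n ltac:(unfold n; lia)). specialize (HN2 n ltac:(unfold n; lia)).
  rewrite Rabs_pos_eq in HN2 by (left; apply Hpos).
  apply (Hbad (S n)). exists (i :: nil)%list. intros x Hx. exists i. split; [now left|].
  apply HOe.
  assert (H1 := Hball n x Hx). assert (H2 := Hball n _ (Hy (S n))).
  rewrite norm_minus_sym in H2.
  assert (H3 := norm_dist_triangle x (cn n) (y (S n))).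
  generalize (norm_dist_triangle x (y (S n)) ylim). lra.
Qed.

Lemma compact_closure (HU : abs_complete U) (A : U -> Prop) :
  totally_bounded A -> compact_set (closure A).
Proof.
  intros HA. apply (compact_of_totally_bounded HU).
  - intros x Hx. apply closure_norm. intros eps Heps.
    destruct (proj1 (closure_norm _ _) Hx (eps / 2)) as [y [Hy Hyx]]; [lra|].
    destruct (proj1 (closure_norm _ _) Hy (eps / 2)) as [z [Hz Hzy]]; [lra|].
    exists z. split; [exact Hz|]. generalize (norm_dist_triangle z y x). lra.
  - intros eps Heps. destruct (HA (eps / 2)) as [l Hl]; [lra|]. exists l. intros x Hx.
    destruct (proj1 (closure_norm _ _) Hx (eps / 2)) as [y [Hy Hyx]]; [lra|].
    destruct (Hl y Hy) as [c [Hc Hyc]]. exists c. split; [exact Hc|].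
    rewrite norm_minus_sym in Hyx. generalize (norm_dist_triangle x y c). lra.
Qed.

End CompactSets.

(** * The nuclear norm *)

Section Nuclear.

Variable U : NormedModule C_AbsRing.

Implicit Types S T : bounded_op U U.

(** Nuclear of norm at most [s]; bounding the partial sums saves evaluating the sum. *)
Definition nuclear_le (T : bounded_op U U) (s : R) : Prop :=
  exists (f : nat -> bounded_op U C_NormedModule) (y : nat -> U),
    (forall n, psum (fun k => op_norm (f k) * norm (y k)) n <= s) /\
    forall x, is_series (fun k => (f k x : C) *: y k) (T x).

Lemma nuclear_term_ge0 (f : nat -> bounded_op U C_NormedModule) (y : nat -> U) k :
  0 <= op_norm (f k) * norm (y k).
Proof. apply Rmult_le_pos; [apply op_norm_ge0 | apply norm_ge_0]. Qed.

Lemma nuclear_le_repr T s : nuclear_le T s ->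
  exists f y s', nuclear_representation T f y s' /\ s' <= s.
Proof.
  intros [f [y [Hs HT]]].
  destruct (ex_series_bounded _ s (nuclear_term_ge0 f y) Hs) as [He Hle].
  exists f, y, (Series (fun k => op_norm (f k) * norm (y k))).
  split; [|exact Hle]. split; [now apply Series_correct | exact HT].
Qed.

Lemma repr_nuclear_le T f y s : nuclear_representation T f y s -> nuclear_le T s.
Proof.
  intros [Hs HT]. exists f, y. split; [|exact HT]. intros n.
  rewrite <- (is_series_unique _ _ Hs). apply psum_le_Series; [apply nuclear_term_ge0|].
  now exists s.
Qed.

Lemma nuclear_norm_glb T : is_nuclear T ->
  is_glb_Rbar (fun s => exists f y, nuclear_representation T f y s) (Finite (nuclear_norm T)).
Proof.
  intros [f [y [s H]]]. unfold nuclear_norm.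
  set (E := fun s : R => exists f y, nuclear_representation T f y s).
  assert (HG := Glb_Rbar_correct E).
  assert (H0 : Rbar_le 0 (Glb_Rbar E)).
  { apply HG. intros r [f' [y' Hr]]. destruct (repr_nuclear_le T f' y' r Hr) as [? [? [Hs _]]].
    exact (Hs O). }
  assert (H1 : Rbar_le (Glb_Rbar E) s) by (apply HG; now exists f, y).
  destruct (Glb_Rbar E); [exact HG | destruct H1 | destruct H0].
Qed.

Lemma nuclear_le_is_nuclear T s : nuclear_le T s -> is_nuclear T.
Proof. intros H. destruct (nuclear_le_repr T s H) as [f [y [s' [Hr _]]]]. now exists f, y, s'. Qed.

Lemma nuclear_norm_le T s : nuclear_le T s -> nuclear_norm T <= s.
Proof.
  intros H. destruct (nuclear_le_repr T s H) as [f [y [s' [Hr Hs']]]].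
  apply Rle_trans with s'; [|exact Hs'].
  apply (nuclear_norm_glb T (nuclear_le_is_nuclear T s H)). now exists f, y.
Qed.

Lemma nuclear_norm_lt T eps : is_nuclear T -> nuclear_norm T < eps ->
  exists s, s < eps /\ nuclear_le T s.
Proof.
  intros HT Hlt. apply NNPP. intros Hno.
  assert (Hge : eps <= nuclear_norm T); [|lra].
  apply (proj2 (nuclear_norm_glb T HT) (Finite eps)). intros s [f [y Hs]].
  apply Rnot_lt_le. intros Hs'. apply Hno. exists s. split; [exact Hs'|].
  now apply repr_nuclear_le with f y.
Qed.

Lemma nuclear_le_mono T s t : nuclear_le T s -> s <= t -> nuclear_le T t.
Proof.
  intros [f [y [Hs HT]]] Hst. exists f, y. split; [|exact HT].
  intros n. eapply Rle_trans; [apply Hs | exact Hst].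
Qed.

Lemma nuclear_le_conj R Q T s : nuclear_le T s ->
  nuclear_le (conj_op R Q T) (op_norm R * op_norm Q * s).
Proof.
  intros [f [y [Hs HT]]].
  assert (HR := op_norm_ge0 _ _ R). assert (HQ := op_norm_ge0 _ _ Q).
  exists (fun k => op_comp (f k) Q), (fun k => R (y k)). split.
  - intros n. apply Rle_trans with
      (psum (fun k => op_norm R * op_norm Q * (op_norm (f k) * norm (y k))) n).
    + apply psum_R_le. intros k _.
      assert (Hf := op_norm_ge0 _ _ (f k)).
      apply Rle_trans with ((op_norm (f k) * op_norm Q) * (op_norm R * norm (y k))).
      * apply Rmult_le_compat; [apply op_norm_ge0 | apply norm_ge_0 | | apply op_norm_bound].
        apply op_norm_le_mult; [now apply Rmult_le_pos|]. intros x.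
        eapply Rle_trans; [apply (op_norm_bound _ _ (f k))|].
        rewrite Rmult_assoc. apply Rmult_le_compat_l; [exact Hf | apply op_norm_bound].
      * right. ring.
    + rewrite psum_R_scal. apply Rmult_le_compat_l; [now apply Rmult_le_pos | apply Hs].
  - intros x. refine (is_series_eq _ _ _ _ (bop_is_series R _ _ (HT (Q x))) _ _); [|reflexivity].
    intros k. apply (bop_scal R).
Qed.

Lemma nuclear_le_scal (c : C) T s : nuclear_le T s -> nuclear_le (c *: T) (Cmod c * s).
Proof.
  intros [f [y [Hs HT]]]. exists f, (fun k => c *: y k). split.
  - intros n. rewrite (psum_ext _ (fun k => Cmod c * (op_norm (f k) * norm (y k)))).
    + rewrite psum_R_scal. apply Rmult_le_compat_l; [apply Cmod_ge_0 | apply Hs].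
    + intros k _. rewrite norm_scalC. Rring.
  - intros x. refine (is_series_eq _ _ _ _ (is_series_scal (c : C_AbsRing) _ _ (HT x)) _ _);
      [|reflexivity].
    intros k. simpl. module_eq.
Qed.

Definition interleave {G : Type} (u v : nat -> G) (n : nat) : G :=
  if Nat.even n then u (Nat.div2 n) else v (Nat.div2 n).

Lemma interleave_even {G : Type} (u v : nat -> G) n : interleave u v (2 * n) = u n.
Proof.
  unfold interleave. replace (Nat.even (2 * n)) with true.
  - now rewrite Nat.div2_double.
  - symmetry. apply Nat.even_spec. now exists n.
Qed.

Lemma interleave_odd {G : Type} (u v : nat -> G) n : interleave u v (S (2 * n)) = v n.
Proof.
  unfold interleave. rewrite Nat.div2_succ_double.
  replace (Nat.even (S (2 * n))) with false; [reflexivity|].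
  symmetry. rewrite Nat.even_succ. apply Bool.not_true_is_false. rewrite Nat.odd_spec.
  intros [m Hm]. lia.
Qed.

Lemma psum_interleave_R (u v : nat -> R) n :
  psum (interleave u v) (2 * n) = psum u n + psum v n.
Proof.
  induction n as [|n IH]; [symmetry; apply Rplus_0_l|].
  replace (2 * S n)%nat with (S (S (2 * n))) by lia.
  rewrite !psum_R_S, IH, interleave_even, interleave_odd. Rring.
Qed.

Lemma psum_interleave (u v : nat -> U) n :
  psum (interleave u v) (2 * n) = plus (psum u n) (psum v n).
Proof.
  induction n as [|n IH]; [symmetry; apply plus_zero_l|].
  replace (2 * S n)%nat with (S (S (2 * n))) by lia. simpl psum.
  replace (n + (n + 0))%nat with (2 * n)%nat by lia.
  rewrite IH, interleave_even, interleave_odd. module_eq.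
Qed.

Lemma is_series_interleave (u v : nat -> U) a b : is_series u a -> is_series v b ->
  is_series (interleave u v) (plus a b).
Proof.
  intros Ha Hb. apply is_series_psum. intros eps Heps.
  destruct (proj1 (is_series_psum _ _) Ha (eps / 3) ltac:(lra)) as [N1 H1].
  destruct (proj1 (is_series_psum _ _) Hb (eps / 3) ltac:(lra)) as [N2 H2].
  destruct (is_series_term_small U _ _ Ha (eps / 3) ltac:(lra)) as [N3 H3].
  exists (2 * (N1 + N2 + N3))%nat. intros n Hn.
  assert (He : forall k, (N1 + N2 + N3 <= k)%nat ->
    norm (minus (psum (interleave u v) (2 * k)) (plus a b)) < 2 * (eps / 3)).
  { intros k Hk. rewrite psum_interleave.
    assert (E : minus (plus (psum u k) (psum v k)) (plus a b)
      = plus (minus (psum u k) a) (minus (psum v k) b)) by module_eq.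
    rewrite E. eapply Rle_lt_trans; [apply (norm_triangle (V := U))|].
    specialize (H1 k ltac:(lia)). specialize (H2 k ltac:(lia)). lra. }
  destruct (Nat.Even_or_Odd n) as [[k Hk]|[k Hk]]; subst n.
  - specialize (He k ltac:(lia)). lra.
  - rewrite Nat.add_1_r. simpl psum. replace (k + (k + 0))%nat with (2 * k)%nat by lia.
    rewrite interleave_even. specialize (He k ltac:(lia)). specialize (H3 k ltac:(lia)).
    assert (E : minus (plus (psum (interleave u v) (2 * k)) (u k)) (plus a b)
      = plus (minus (psum (interleave u v) (2 * k)) (plus a b)) (u k)) by module_eq.
    rewrite E. eapply Rle_lt_trans; [apply (norm_triangle (V := U))|]. lra.
Qed.

(** The two representations are interleaved. *)
Lemma nuclear_le_plus S T s t : nuclear_le S s -> nuclear_le T t ->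
  nuclear_le (plus S T) (s + t).
Proof.
  intros [f [y [Hs HS]]] [g [z [Ht HT]]].
  exists (interleave f g), (interleave y z). split.
  - intros n.
    assert (E : forall k, op_norm (interleave f g k) * norm (interleave y z k)
      = interleave (fun k => op_norm (f k) * norm (y k)) (fun k => op_norm (g k) * norm (z k)) k).
    { intros k. unfold interleave. now destruct (Nat.even k). }
    rewrite (psum_ext _ _ n (fun k _ => E k)).
    eapply Rle_trans; [apply (psum_R_mono _ n (2 * n)); [|lia]|].
    + intros k. unfold interleave. destruct (Nat.even k); apply nuclear_term_ge0.
    + rewrite psum_interleave_R. apply Rplus_le_compat; [apply Hs | apply Ht].
  - intros x. refine (is_series_eq _ _ _ _ (is_series_interleave _ _ _ _ (HS x) (HT x)) _ _);
      [|reflexivity].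
    intros k. unfold interleave. now destruct (Nat.even k).
Qed.

Lemma nuclear_le_minus S T s t : nuclear_le S s -> nuclear_le T t ->
  nuclear_le (minus S T) (s + t).
Proof.
  intros HS HT. replace (minus S T) with (plus S (Copp (RtoC 1) *: T)) by module_eq.
  apply nuclear_le_plus; [exact HS|].
  assert (H := nuclear_le_scal (Copp (RtoC 1)) T t HT).
  rewrite Cmod_opp, Cmod_1, Rmult_1_l in H. exact H.
Qed.

Lemma nuclear_minus S T : is_nuclear S -> is_nuclear T -> is_nuclear (minus S T).
Proof.
  intros [f [y [s HS]]] [g [z [t HT]]].
  apply nuclear_le_is_nuclear with (s + t).
  apply nuclear_le_minus; eapply repr_nuclear_le; eassumption.
Qed.

End Nuclear.

(** * Operators with absolutely summable matrix are dense *)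

Section Density.

Variables (p : R) (Hp : 1 < p).

Notation U := (lp_NormedModule p Hp).
Notation lp := (lp p Hp).
Notation J := (matrix_op p Hp).

Lemma matrix_op_series (c : l1) (x : lp) :
  is_series (V := U) (fun k => c k *: matrix_unit_of p Hp k x) (J c x).
Proof.
  exact (bop_is_series (eval_op p Hp x) _ _ (l1_lift_series (op_NormedModule U U)
    (bounded_op_abs_complete U U (lp_abs_complete p Hp)) (matrix_unit_of p Hp)
    (fun k => matrix_unit_norm p Hp _ _) c)).
Qed.

Lemma matrix_op_nuclear (c : l1) : nuclear_le U (J c) (norm c).
Proof.
  exists (fun k => lp_coord p Hp (snd (of_nat k))),
    (fun k => c k *: lp_delta p Hp (fst (of_nat k))). split.
  - intros n. eapply Rle_trans; [|apply (l1_norm_sum c n)]. apply psum_R_le. intros k _.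
    rewrite <- (Rmult_1_l (Cmod (c k))).
    apply Rmult_le_compat; [apply op_norm_ge0 | apply norm_ge_0 | apply lp_coord_op_norm |].
    eapply Rle_trans; [right; apply (norm_scalC (X := U))|].
    rewrite <- (Rmult_1_r (Cmod (c k))) at 2.
    apply Rmult_le_compat_l; [apply Cmod_ge_0 | apply lp_delta_norm].
  - intros x. refine (is_series_eq _ _ _ _ (matrix_op_series c x) _ _); [|reflexivity].
    intros k. cbv beta. unfold matrix_unit_of.
    change (matrix_unit p Hp (fst (of_nat k)) (snd (of_nat k)) x)
      with ((x (snd (of_nat k)) : C) *: lp_delta p Hp (fst (of_nat k))).
    change (lp_coord p Hp (snd (of_nat k)) x) with (x (snd (of_nat k))).
    module_eq.
Qed.

Lemma matrix_op_scaled_unit (t : C) i j (x : lp) :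
  J (t *: pair_delta i j) x = Cmult (x j) t *: lp_delta p Hp i.
Proof.
  assert (E : J (t *: pair_delta i j) = t *: J (pair_delta i j)) by apply (bop_scal J).
  rewrite E, matrix_op_delta.
  change (t *: (x j *: lp_delta p Hp i) = Cmult (x j) t *: lp_delta p Hp i).
  etransitivity; [apply (scal_assoc (V := U))|].
  exact (f_equal (fun u : C => u *: lp_delta p Hp i) (Cmult_comm t (x j))).
Qed.

(** The compression of an operator to finitely many coordinates has a finite
    matrix, hence is the operator of an element of [l1]. *)
Lemma compression (T : bounded_op U U) N M :
  exists d : l1, forall x : lp, J d x = trunc p Hp N (T (trunc p Hp M x)).
Proof.
  exists (psum (fun i => psum (fun j =>
    ((T (lp_delta p Hp j) : lp) i : C) *: pair_delta i j) M) N).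
  intros x. unfold trunc at 1, finite_seq.
  etransitivity; [exact (bop_psum (op_comp (eval_op p Hp x) J) _ N)|].
  apply psum_ext. intros i _.
  etransitivity; [exact (bop_psum (op_comp (eval_op p Hp x) J) _ M)|].
  set (t := fun j => Cmult (x j) ((T (lp_delta p Hp j) : lp) i)).
  assert (E : (T (trunc p Hp M x) : lp) i = psum t M).
  { etransitivity; [exact (bop_psum (op_comp (lp_coord p Hp i) T) _ M)|].
    apply psum_ext. intros j _. apply (bop_scal (op_comp (lp_coord p Hp i) T)). }
  rewrite E. clear E.
  assert (E : forall j, op_comp (eval_op p Hp x) J
      (((T (lp_delta p Hp j) : lp) i : C) *: pair_delta i j) = t j *: lp_delta p Hp i)
    by (intros j; exact (matrix_op_scaled_unit ((T (lp_delta p Hp j) : lp) i) i j x)).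
  rewrite (psum_ext _ _ M (fun j _ => E j)). clear E. clearbody t.
  induction M as [|M IH]; [symmetry; apply (scal_zero_l (V := U))|].
  etransitivity; [|symmetry; apply (scal_distr_r (V := U))].
  exact (f_equal (fun v : U => plus v (t M *: lp_delta p Hp i)) IH).
Qed.

(** ** Approximation in the nuclear norm *)

Lemma nuclear_le_rank_one f (y : lp) : nuclear_le U (rank_one p Hp f y) (op_norm f * norm y).
Proof.
  exists (fun _ => f), (fun k => match k with O => y | S _ => zero end).
  assert (H0 := nuclear_term_ge0 U (fun _ => f) (fun _ => y) O).
  split.
  - intros [|n]; [exact H0|].
    rewrite psum_S_l, psum_zero; [right; apply Rplus_0_r|].
    intros k _. etransitivity; [exact (f_equal (Rmult _) (norm_zero (V := U)))|]. apply Rmult_0_r.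
  - intros x. refine (is_series_eq _ _ _ _ (is_series_finite U
      (fun k => (f x : C) *: match k with O => y | S _ => zero end) 1 _) _ _).
    + intros [|k] Hk; [lia | apply (scal_zero_r (V := U))].
    + reflexivity.
    + simpl. apply (plus_zero_l (G := U)).
Qed.

Definition nuclear_limit (T : bounded_op U U) : Prop :=
  forall eps, 0 < eps -> exists d : l1, nuclear_le U (minus (J d) T) eps.

(** The vector is truncated, and so is the functional by [functional_tail]. *)
Lemma nuclear_limit_rank_one f (y : lp) : nuclear_limit (rank_one p Hp f y).
Proof.
  intros eps Heps.
  assert (Hf := op_norm_ge0 _ _ f). assert (Hy := norm_ge_0 y).
  destruct (functional_tail p Hp f (eps / 2 / (norm y + 1))) as [M HM].
  { apply Rdiv_lt_0_compat; lra. }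
  destruct (tail_small p Hp y (eps / 2 / (op_norm f + 1))) as [N HN].
  { apply Rdiv_lt_0_compat; lra. }
  specialize (HN N (Nat.le_refl N)).
  destruct (compression (rank_one p Hp f y) N M) as [d Hd]. exists d.
  assert (E : minus (J d) (rank_one p Hp f y)
    = minus (Copp (RtoC 1) *: rank_one p Hp (op_comp f (tail_op p Hp M)) (trunc p Hp N y))
        (rank_one p Hp f (tail_op p Hp N y))).
  { apply op_ext. intros x.
    etransitivity; [apply (bop_minus_apply (J d))|]. rewrite Hd.
    etransitivity; [|symmetry; apply bop_minus_apply].
    change (minus (trunc p Hp N ((f (trunc p Hp M x) : C) *: y)) ((f x : C) *: y)
      = minus (Copp (RtoC 1) *: ((f (tail_op p Hp M x) : C) *: trunc p Hp N y))
          ((f x : C) *: tail_op p Hp N y)).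
    assert (E1 : f (tail_op p Hp M x) = Cminus (f x) (f (trunc p Hp M x))).
    { etransitivity; [exact (f_equal f (tail_op_apply p Hp M x))|]. apply (bop_minus f). }
    assert (E2 : trunc p Hp N ((f (trunc p Hp M x) : C) *: y)
      = (f (trunc p Hp M x) : C) *: trunc p Hp N y) by exact (bop_scal (trunc_op p Hp N) _ y).
    rewrite E1, E2, tail_op_apply.
    generalize (f x : C) (f (trunc p Hp M x) : C) (trunc p Hp N y). intros u v t.
    module_eq. }
  rewrite E. apply nuclear_le_mono with (eps / 2 + eps / 2); [|lra].
  assert (Hd1 : eps / 2 / (norm y + 1) * (norm y + 1) = eps / 2) by (field; lra).
  assert (Hd2 : eps / 2 / (op_norm f + 1) * (op_norm f + 1) = eps / 2) by (field; lra).
  assert (Hp1 : 0 < eps / 2 / (norm y + 1)) by (apply Rdiv_lt_0_compat; lra).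
  apply nuclear_le_minus.
  - apply nuclear_le_mono with (Cmod (Copp (RtoC 1)) *
      (op_norm (op_comp f (tail_op p Hp M)) * norm (trunc p Hp N y))).
    + apply nuclear_le_scal, nuclear_le_rank_one.
    + rewrite Cmod_opp, Cmod_1, Rmult_1_l.
      apply Rle_trans with (eps / 2 / (norm y + 1) * (norm y + 1)); [|lra].
      apply Rmult_le_compat; [apply op_norm_ge0 | apply norm_ge_0 | |].
      * apply op_norm_le_mult; [lra|]. intros x. apply (HM M x (Nat.le_refl M)).
      * generalize (trunc_norm p Hp N y). lra.
  - eapply nuclear_le_mono; [apply nuclear_le_rank_one|].
    apply Rle_trans with ((op_norm f + 1) * (eps / 2 / (op_norm f + 1))); [|lra].
    apply Rmult_le_compat; [exact Hf | apply norm_ge_0 | lra | lra].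
Qed.

Lemma nuclear_limit_plus S T : nuclear_limit S -> nuclear_limit T -> nuclear_limit (plus S T).
Proof.
  intros HS HT eps Heps.
  destruct (HS (eps / 2)) as [c Hc]; [lra|]. destruct (HT (eps / 2)) as [d Hd]; [lra|].
  exists (plus c d).
  assert (E : minus (J (plus c d)) (plus S T) = plus (minus (J c) S) (minus (J d) T)).
  { assert (E1 : J (plus c d) = plus (J c) (J d)) by apply (bop_plus J).
    rewrite E1. module_eq. }
  rewrite E. apply nuclear_le_mono with (eps / 2 + eps / 2); [|lra].
  now apply nuclear_le_plus.
Qed.

Lemma nuclear_limit_closed T :
  (forall eps, 0 < eps -> exists S, nuclear_limit S /\ nuclear_le U (minus S T) eps) ->
  nuclear_limit T.
Proof.
  intros H eps Heps. destruct (H (eps / 2)) as [S [HS HST]]; [lra|].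
  destruct (HS (eps / 2)) as [d Hd]; [lra|]. exists d.
  replace (minus (J d) T) with (plus (minus (J d) S) (minus S T)) by module_eq.
  apply nuclear_le_mono with (eps / 2 + eps / 2); [|lra]. now apply nuclear_le_plus.
Qed.

(** Finite parts of a nuclear representation are sums of operators of rank one. *)
Lemma nuclear_limit_all T : is_nuclear T -> nuclear_limit T.
Proof.
  intros [f [y [s [Hs HT]]]].
  set (S := fun n => psum (fun k => rank_one p Hp (f k) (y k)) n : bounded_op U U).
  assert (HS : forall n, nuclear_limit (S n)).
  { induction n as [|n IH].
    - intros eps Heps. exists zero.
      assert (E : minus (J zero) (S O) = zero).
      { assert (E1 : J zero = zero) by apply (bop_zero J). rewrite E1.
        change (S O) with (zero : bounded_op U U). module_eq. }
      refine (eq_ind_r (fun V => nuclear_le U V eps) _ E).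
      exists (fun _ => zero), (fun _ => zero). split.
      + intros n. rewrite psum_zero; [exact (Rlt_le _ _ Heps)|]. intros k _.
        etransitivity; [exact (f_equal (Rmult _) (norm_zero (V := U)))|]. apply Rmult_0_r.
      + intros x. refine (is_series_eq _ _ _ _ (is_series_finite U (fun _ => zero) O _) _ _);
          [reflexivity | | reflexivity].
        intros k. symmetry. apply (scal_zero_r (V := U)).
    - apply (nuclear_limit_plus (S n)); [exact IH | apply nuclear_limit_rank_one]. }
  assert (Ha : abs_summable (X := C_NormedModule) (fun k => RtoC (op_norm (f k) * norm (y k)))).
  { exists s. intros n. rewrite <- (is_series_unique _ _ Hs).
    eapply Rle_trans; [|apply psum_le_Series; [apply (nuclear_term_ge0 U f y) | now exists s]].
    apply psum_R_le. intros k _.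
    change (Cmod (RtoC (op_norm (f k) * norm (y k))) <= op_norm (f k) * norm (y k)).
    rewrite Cmod_R, Rabs_pos_eq; [apply Rle_refl | apply nuclear_term_ge0]. }
  apply nuclear_limit_closed. intros eps Heps.
  destruct (abs_summable_tail C_NormedModule _ Ha eps Heps) as [n Hn].
  exists (S n). split; [apply HS|].
  replace (minus (S n) T) with (Copp (RtoC 1) *: minus T (S n)) by module_eq.
  apply nuclear_le_mono with (Cmod (Copp (RtoC 1)) * eps);
    [|rewrite Cmod_opp, Cmod_1; lra].
  apply nuclear_le_scal. exists (fun k => f (n + k)%nat), (fun k => y (n + k)%nat). split.
  - intros m. eapply Rle_trans; [|apply (Hn n m (Nat.le_refl n))]. apply psum_R_le. intros k _.
    change (op_norm (f (n + k)%nat) * norm (y (n + k)%nat) <=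
      Cmod (RtoC (op_norm (f (n + k)%nat) * norm (y (n + k)%nat)))).
    rewrite Cmod_R, Rabs_pos_eq; [apply Rle_refl | apply nuclear_term_ge0].
  - intros x. assert (H1 := proj1 (is_series_shift _ n _) (HT x)).
    refine (is_series_eq _ _ _ _ H1 (fun _ => eq_refl) _).
    rewrite bop_minus_apply. f_equal. symmetry.
    exact (bop_psum (eval_op p Hp x) (fun k => rank_one p Hp (f k) (y k)) n).
Qed.

Lemma matrix_op_nuclear_dense T : is_nuclear T -> forall eps, 0 < eps ->
  exists (d : l1) eta, 0 < eta /\
    forall c : l1, norm (minus c d) < eta -> nuclear_norm (minus (J c) T) < eps.
Proof.
  intros HT eps Heps. destruct (nuclear_limit_all T HT (eps / 2)) as [d Hd]; [lra|].
  exists d, (eps / 2). split; [lra|]. intros c Hc.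
  apply Rle_lt_trans with (norm (minus c d) + eps / 2); [|lra].
  apply nuclear_norm_le.
  replace (minus (J c) T) with (plus (minus (J c) (J d)) (minus (J d) T)) by module_eq.
  apply nuclear_le_plus; [|exact Hd].
  assert (E : minus (J c) (J d) = J (minus c d)) by (symmetry; apply (bop_minus J)).
  rewrite E. apply matrix_op_nuclear.
Qed.

End Density.

(** * Compact operators *)

Section Compact.

Variables (p : R) (Hp : 1 < p).

Notation U := (lp_NormedModule p Hp).
Notation lp := (lp p Hp).
Notation J := (matrix_op p Hp).
Notation tail := (tail_op p Hp).

Lemma compact_tail (K : lp -> Prop) eps : compact_set (X := U) K -> 0 < eps ->
  exists N, forall n x, (N <= n)%nat -> K x -> norm (tail n x) < eps.
Proof.
  intros HK Heps.
  apply (compact_increasing_cover U K (fun n x => norm (tail n x) < eps) HK).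
  - intros n. apply open_of_norm. intros x Hx.
    exists (eps - norm (tail n x)). split; [lra|]. intros y Hy.
    assert (H1 := norm_plus_minus (tail n y) (tail n x)).
    assert (H2 := tail_norm p Hp n (minus y x)).
    assert (E : tail n (minus y x) = minus (tail n y) (tail n x)) by apply (bop_minus (tail n)).
    rewrite E in H2. lra.
  - intros n m x Hnm Hx. eapply Rle_lt_trans; [apply (tail_norm_mono p Hp n m x Hnm) | exact Hx].
  - intros x _. destruct (tail_small p Hp x eps Heps) as [N HN]. exists N. apply HN. lia.
Qed.

(** On [l^p] this characterizes the compact operators. *)
Definition vanishing_tails (T : bounded_op U U) : Prop :=
  forall eps, 0 < eps -> exists N, op_norm (op_comp (tail N) T) <= eps.

Lemma compact_vanishing_tails T : is_compact_op T -> vanishing_tails T.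
Proof.
  intros HT eps Heps. destruct (compact_tail _ eps HT Heps) as [N HN].
  exists N. apply op_norm_le_of. intros x Hx. left. apply (HN N (T x) (Nat.le_refl N)).
  apply closure_norm. intros e He. exists (T x). split; [now exists x|].
  rewrite (minus_eq_zero (G := U)). eapply Rle_lt_trans; [right; apply (norm_zero (V := U)) | exact He].
Qed.

Lemma interval_net M eps : 0 < eps ->
  exists l : list R, forall r, Rabs r <= M -> exists g, In g l /\ Rabs (r - g) < eps.
Proof.
  intros Heps. destruct (INR_unbounded ((M + M) / eps)) as [n Hn].
  exists (map (fun k => - M + INR k * eps) (seq 0 n)).
  intros r Hr. apply Rabs_le_between in Hr.
  assert (H0 : 0 <= (r + M) / eps) by (apply Rdiv_le_0_compat; lra).
  destruct (nfloor_ex _ H0) as [k [Hk1 Hk2]].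
  exists (- M + INR k * eps). split.
  - apply in_map_iff. exists k. split; [reflexivity|]. apply in_seq. split; [lia|]. apply INR_lt. eapply Rle_lt_trans; [exact Hk1|].
    eapply Rle_lt_trans; [|exact Hn].
    apply Rmult_le_compat_r; [left; now apply Rinv_0_lt_compat | lra].
  - assert (E : r + M = (r + M) / eps * eps) by (field; lra).
    apply (Rmult_le_compat_r eps) in Hk1; [|lra]. apply (Rmult_lt_compat_r eps) in Hk2; [|lra].
    rewrite <- E in Hk1, Hk2. apply Rabs_def1; lra.
Qed.

Lemma disc_net M eps : 0 < eps ->
  exists l : list C, forall z, Cmod z <= M -> exists g, In g l /\ Cmod (Cminus z g) < eps.
Proof.
  intros Heps. destruct (interval_net M (eps / 2)) as [l Hl]; [lra|].
  exists (list_prod l l). intros z Hz.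
  assert (Hmax := Rmax_Cmod z).
  assert (H1 := Rmax_l (Rabs (fst z)) (Rabs (snd z))).
  assert (H2 := Rmax_r (Rabs (fst z)) (Rabs (snd z))).
  destruct (Hl (fst z)) as [g [Hg Hzg]]; [lra|].
  destruct (Hl (snd z)) as [h [Hh Hzh]]; [lra|].
  exists (g, h). split; [now apply in_prod|].
  eapply Rle_lt_trans; [apply (Cmod_le_Rabs (fst z - g) (snd z - h))|]. lra.
Qed.

Lemma finite_seq_net M N eps : 0 < eps ->
  exists l : list U, forall s, (forall k, Cmod (s k) <= M) ->
    exists c, In c l /\ norm (minus (finite_seq p Hp s N : U) c) < eps.
Proof.
  revert eps. induction N as [|N IH]; intros eps Heps.
  - exists (zero :: nil)%list. intros s _. exists zero. split; [now left|].
    eapply Rle_lt_trans; [right | exact Heps].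
    exact (eq_trans (f_equal norm (minus_eq_zero (G := U) zero)) (norm_zero (V := U))).
  - destruct (IH (eps / 2)) as [l Hl]; [lra|].
    destruct (disc_net M (eps / 2)) as [m Hm]; [lra|].
    exists (map (fun cg => plus (fst cg) (snd cg *: lp_delta p Hp N)) (list_prod l m)).
    intros s Hs. destruct (Hl s Hs) as [c [Hc Hsc]]. destruct (Hm (s N) (Hs N)) as [g [Hg Hsg]].
    exists (plus c (g *: lp_delta p Hp N)). split.
    + apply (in_map (fun cg => plus (fst cg) (snd cg *: lp_delta p Hp N)) _ (c, g)).
      now apply in_prod.
    + change (finite_seq p Hp s (S N))
        with (plus (finite_seq p Hp s N : U) (s N *: lp_delta p Hp N)).
      assert (E : minus (plus (finite_seq p Hp s N : U) (s N *: lp_delta p Hp N))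
          (plus c (g *: lp_delta p Hp N))
        = plus (minus (finite_seq p Hp s N : U) c) (Cminus (s N) g *: lp_delta p Hp N)).
      { generalize (finite_seq p Hp s N : U) (lp_delta p Hp N : U) (s N). intros u v w.
        module_eq. }
      rewrite E. eapply Rle_lt_trans; [apply (norm_triangle (V := U))|].
      assert (H : norm (Cminus (s N) g *: lp_delta p Hp N) <= Cmod (Cminus (s N) g)).
      { eapply Rle_trans; [right; apply (norm_scalC (X := U))|].
        rewrite <- (Rmult_1_r (Cmod (Cminus (s N) g))) at 2.
        apply Rmult_le_compat_l; [apply Cmod_ge_0 | apply lp_delta_norm]. }
      lra.
Qed.

(** Up to small tails the image of the unit ball is a bounded set of finite sequences,
    which has finite nets. *)
Lemma vanishing_tails_compact T : vanishing_tails T -> is_compact_op T.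
Proof.
  intros HT. apply (compact_closure U (lp_abs_complete p Hp)). intros eps Heps.
  destruct (HT (eps / 2)) as [N HN]; [lra|].
  destruct (finite_seq_net (op_norm T) N (eps / 2)) as [l Hl]; [lra|].
  exists l. intros y [x [Hx ->]].
  assert (HTx : norm (T x) <= op_norm T) by now apply op_norm_bound1.
  destruct (Hl (T x)) as [c [Hc Hd]].
  { intros k. eapply Rle_trans; [apply lp_coord_le | exact HTx]. }
  exists c. split; [exact Hc|].
  assert (H1 : norm (tail N (T x)) <= eps / 2).
  { eapply Rle_trans; [apply (op_norm_bound1 _ _ (op_comp (tail N) T) x Hx) | exact HN]. }
  assert (E : minus (T x) c = plus (minus (finite_seq p Hp (T x) N : U) c) (tail N (T x))).
  { rewrite <- (trunc_plus_tail p Hp N (T x)) at 1. change (trunc p Hp N (T x))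
      with (finite_seq p Hp (T x) N).
    generalize (finite_seq p Hp (T x) N : U) (tail N (T x)). intros u v. module_eq. }
  rewrite E. eapply Rle_lt_trans; [apply (norm_triangle (V := U))|]. lra.
Qed.

Lemma vanishing_tails_limit T :
  (forall eps, 0 < eps -> exists S, vanishing_tails S /\ op_norm (minus S T) <= eps) ->
  vanishing_tails T.
Proof.
  intros H eps Heps. destruct (H (eps / 2)) as [S [HS HST]]; [lra|].
  destruct (HS (eps / 2)) as [N HN]; [lra|]. exists N. apply op_norm_le_of. intros x Hx.
  change (norm (tail N (T x)) <= eps).
  assert (E : tail N (T x) = minus (tail N (S x)) (tail N ((minus S T : bounded_op U U) x))).
  { rewrite bop_minus_apply, bop_minus. module_eq. }
  rewrite E. eapply Rle_trans; [apply (norm_minus_le (X := U))|].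
  assert (L1 : norm (tail N (S x)) <= eps / 2).
  { eapply Rle_trans; [apply (op_norm_bound1 _ _ (op_comp (tail N) S) x Hx) | exact HN]. }
  assert (L2 := tail_norm p Hp N ((minus S T : bounded_op U U) x)).
  assert (L3 := op_norm_bound1 _ _ (minus S T) x Hx). lra.
Qed.

Lemma vanishing_tails_subspace : closed_subspace (X := op_NormedModule U U) vanishing_tails.
Proof.
  split.
  - intros eps Heps. exists O. apply op_norm_le_of. intros x _. left.
    eapply Rle_lt_trans; [right | exact Heps].
    exact (eq_trans (f_equal norm (bop_zero (tail O))) (norm_zero (V := U))).
  - intros S T HS HT eps Heps.
    destruct (HS (eps / 2)) as [N1 H1]; [lra|]. destruct (HT (eps / 2)) as [N2 H2]; [lra|].
    exists (N1 + N2)%nat. apply op_norm_le_of. intros x Hx.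
    change (norm (tail (N1 + N2) (plus (S x) (T x))) <= eps).
    assert (K1 := tail_norm_mono p Hp N1 (N1 + N2) (S x) ltac:(lia)).
    assert (K2 := tail_norm_mono p Hp N2 (N1 + N2) (T x) ltac:(lia)).
    assert (L1 : norm (tail N1 (S x)) <= eps / 2).
    { eapply Rle_trans; [apply (op_norm_bound1 _ _ (op_comp (tail N1) S) x Hx) | exact H1]. }
    assert (L2 : norm (tail N2 (T x)) <= eps / 2).
    { eapply Rle_trans; [apply (op_norm_bound1 _ _ (op_comp (tail N2) T) x Hx) | exact H2]. }
    rewrite bop_plus. eapply Rle_trans; [apply (norm_triangle (V := U))|]. lra.
  - intros c T HT eps Heps. assert (Hc := Cmod_ge_0 c).
    destruct (HT (eps / (Cmod c + 1))) as [N HN]; [apply Rdiv_lt_0_compat; lra|].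
    exists N. apply op_norm_le_of. intros x Hx.
    change (norm (tail N (c *: T x)) <= eps).
    assert (L : norm (tail N (T x)) <= eps / (Cmod c + 1)).
    { eapply Rle_trans; [apply (op_norm_bound1 _ _ (op_comp (tail N) T) x Hx) | exact HN]. }
    rewrite bop_scal. eapply Rle_trans; [right; apply (norm_scalC (X := U))|].
    apply Rle_trans with ((Cmod c + 1) * (eps / (Cmod c + 1))); [|right; field; lra].
    apply Rmult_le_compat; [exact Hc | apply norm_ge_0 | lra | exact L].
  - intros T H. apply vanishing_tails_limit. intros eps Heps.
    destruct (H eps Heps) as [S [HS HST]]. exists S. split; [exact HS|].
    apply (Rle_trans _ (norm (minus (S : op_NormedModule U U) T))); [apply Rle_refl|].
    rewrite norm_minus_sym. now left.
Qed.

Lemma compact_minus (S T : bounded_op U U) : is_compact_op S -> is_compact_op T -> is_compact_op (minus S T).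
Proof.
  intros HS HT. apply compact_vanishing_tails in HS, HT. apply vanishing_tails_compact.
  assert (HV := vanishing_tails_subspace).
  replace (minus S T) with (plus S (Copp (RtoC 1) *: T)) by module_eq.
  apply (cs_plus _ _ HV); [exact HS|]. now apply (cs_scal _ _ HV).
Qed.

Lemma matrix_op_minus (c d : l1) : minus (J c) (J d) = J (minus c d).
Proof. symmetry. apply (bop_minus J). Qed.

Lemma matrix_op_compact (c : l1) : is_compact_op (J c).
Proof.
  apply vanishing_tails_compact. revert c.
  assert (HV := vanishing_tails_subspace).
  apply (l1_closed_full (fun c => vanishing_tails (J c))).
  - split.
    + exact (eq_ind_r vanishing_tails (cs_zero _ _ HV) (bop_zero J)).
    + intros c d Hc Hd.
      exact (eq_ind_r vanishing_tails (cs_plus _ _ HV _ _ Hc Hd) (bop_plus J c d)).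
    + intros a c Hc.
      exact (eq_ind_r vanishing_tails (cs_scal _ _ HV a _ Hc) (bop_scal J a c)).
    + intros c H. apply (cs_closed _ _ HV). intros eps Heps.
      destruct (H eps Heps) as [d [Hd Hcd]]. exists (J d). split; [exact Hd|].
      eapply Rle_lt_trans; [|exact Hcd].
      eapply Rle_trans; [|apply (matrix_op_norm p Hp (minus c d))].
      right. exact (f_equal op_norm (matrix_op_minus c d)).
  - intros k.
    assert (E : l1_delta k = pair_delta (fst (of_nat k)) (snd (of_nat k))).
    { unfold pair_delta. now rewrite <- surjective_pairing, cancel_to_of. }
    rewrite E, matrix_op_delta. generalize (fst (of_nat k)) (snd (of_nat k)). intros i j.
    intros eps Heps. exists (S i). apply op_norm_le_of. intros x _. left.
    eapply Rle_lt_trans; [right | exact Heps].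
    transitivity (norm (zero : U)); [|apply (norm_zero (V := U))]. apply (f_equal norm).
    apply lp_ext. intros n.
    change ((tail (S i) (matrix_unit p Hp i j x) : lp) n = RtoC 0). rewrite tail_coord.
    destruct (Nat.ltb_spec n (S i)) as [Hn|Hn]; [reflexivity|].
    change (Cmult (x j) (delta_seq i n) = RtoC 0). unfold delta_seq.
    destruct (Nat.eqb_spec n i); [lia | apply Cmult_0_r].
Qed.

(** ** Approximation by compressions *)

Lemma compression_error (T : bounded_op U U) N M : exists d : l1, forall x : lp,
  norm (minus (J d) T x) <= norm (trunc p Hp N (T (tail M x))) + norm (tail N (T x)).
Proof.
  destruct (compression p Hp T N M) as [d Hd]. exists d. intros x.
  assert (E : minus (J d) T x
    = minus (Copp (RtoC 1) *: trunc p Hp N (T (tail M x))) (tail N (T x))).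
  { etransitivity; [apply (bop_minus_apply (J d))|]. rewrite Hd, !tail_op_apply.
    assert (E1 : trunc p Hp N (T (minus x (trunc p Hp M x)))
      = minus (trunc p Hp N (T x)) (trunc p Hp N (T (trunc p Hp M x)))).
    { etransitivity; [exact (f_equal (trunc p Hp N) (bop_minus T x (trunc p Hp M x)))|].
      exact (bop_minus (trunc_op p Hp N) _ _). }
    rewrite E1.
    generalize (trunc p Hp N (T (trunc p Hp M x)) : U) (trunc p Hp N (T x) : U) (T x : U).
    intros u v w. module_eq. }
  rewrite E. eapply Rle_trans; [apply (norm_minus_le (X := U))|].
  apply Rplus_le_compat_r.
  eapply Rle_trans; [right; apply (norm_scalC (X := U))|].
  rewrite Cmod_opp, Cmod_1. lra.
Qed.

(** The rows of the matrix of [T] are functionals, so each of them has small tails. *)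
Lemma rows_tail (T : bounded_op U U) N eps : 0 < eps ->
  exists M, forall m x, (M <= m)%nat -> norm (trunc p Hp N (T (tail m x))) <= eps * norm x.
Proof.
  intros Heps.
  assert (H : exists M, forall m x, (M <= m)%nat ->
    psum (fun i => Cmod ((T (tail m x) : lp) i)) N <= eps * norm x).
  { revert eps Heps. induction N as [|N IH]; intros eps Heps.
    - exists O. intros m x _. apply Rmult_le_pos; [lra | apply norm_ge_0].
    - destruct (IH (eps / 2)) as [M1 H1]; [lra|].
      destruct (functional_tail p Hp (op_comp (lp_coord p Hp N) T) (eps / 2)) as [M2 H2]; [lra|].
      exists (M1 + M2)%nat. intros m x Hm. rewrite psum_R_S.
      specialize (H1 m x ltac:(lia)). specialize (H2 m x ltac:(lia)).
      change (Cmod ((T (tail m x) : lp) N) <= eps / 2 * norm x) in H2. lra. }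
  destruct H as [M HM]. exists M. intros m x Hm.
  eapply Rle_trans; [apply finite_seq_norm | now apply HM].
Qed.

Lemma matrix_op_compact_dense T : is_compact_op T -> forall eps, 0 < eps ->
  exists (d : l1) eta, 0 < eta /\
    forall c : l1, norm (minus c d) < eta -> op_norm (minus (J c) T) < eps.
Proof.
  intros HT eps Heps. apply compact_vanishing_tails in HT.
  destruct (HT (eps / 4)) as [N HN]; [lra|].
  destruct (rows_tail T N (eps / 4)) as [M HM]; [lra|].
  destruct (compression_error T N M) as [d Hd].
  exists d, (eps / 2). split; [lra|]. intros c Hc.
  replace (minus (J c) T) with (plus (minus (J c) (J d)) (minus (J d) T)) by module_eq.
  eapply Rle_lt_trans; [apply op_norm_triangle|].
  assert (H1 : op_norm (minus (J c) (J d)) <= norm (minus c d)).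
  { eapply Rle_trans; [right; exact (f_equal op_norm (matrix_op_minus c d))|].
    apply matrix_op_norm. }
  assert (H2 : op_norm (minus (J d) T) <= eps / 2); [|lra].
  apply op_norm_le_of. intros x Hx. eapply Rle_trans; [apply Hd|].
  specialize (HM M x (Nat.le_refl M)).
  assert (L : norm (tail N (T x)) <= eps / 4).
  { eapply Rle_trans; [apply (op_norm_bound1 _ _ (op_comp (tail N) T) x Hx) | exact HN]. }
  assert (eps / 4 * norm x <= eps / 4 * 1) by (apply Rmult_le_compat_l; lra). lra.
Qed.

(** On a compact set the tails of [x] and of [T x] are uniformly small. *)
Lemma matrix_op_COT_dense T (K : U -> Prop) eps : compact_set K -> 0 < eps ->
  exists (d : l1) eta, 0 < eta /\ forall c : l1, norm (minus c d) < eta ->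
    forall x, K x -> norm (minus (J c) T x) < eps.
Proof.
  intros HK Heps. assert (HT := op_norm_ge0 _ _ T).
  destruct (compact_bounded U K HK) as [b [Hb HKb]].
  destruct (compact_tail _ (eps / 4) (compact_image U T K HK)) as [N HN]; [lra|].
  destruct (compact_tail K (eps / 4 / (op_norm T + 1)) HK) as [M HM].
  { apply Rdiv_lt_0_compat; lra. }
  destruct (compression_error T N M) as [d Hd].
  exists d, (eps / 2 / b). split; [apply Rdiv_lt_0_compat; lra|]. intros c Hc x Hx.
  assert (E : minus (J c) T x = plus (J (minus c d) x) (minus (J d) T x)).
  { rewrite <- matrix_op_minus.
    rewrite (bop_minus_apply (J c) T), (bop_minus_apply (J c) (J d)), (bop_minus_apply (J d) T).
    generalize (J c x : U) (J d x : U) (T x : U). intros u v w. module_eq. }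
  rewrite E. eapply Rle_lt_trans; [apply (norm_triangle (V := U))|].
  assert (H1 : norm (J (minus c d) x) <= eps / 2).
  { eapply Rle_trans; [apply op_norm_bound|].
    apply Rle_trans with (eps / 2 / b * b); [|right; field; lra].
    apply Rmult_le_compat; [apply op_norm_ge0 | apply norm_ge_0 | | now apply HKb].
    eapply Rle_trans; [apply matrix_op_norm | now left]. }
  assert (H2 : norm (trunc p Hp N (T (tail M x))) <= eps / 4).
  { eapply Rle_trans; [apply trunc_norm|]. eapply Rle_trans; [apply op_norm_bound|].
    apply Rle_trans with ((op_norm T + 1) * (eps / 4 / (op_norm T + 1))); [|right; field; lra].
    apply Rmult_le_compat; [exact HT | apply norm_ge_0 | lra |].
    left. now apply HM. }
  assert (H3 : norm (tail N (T x)) < eps / 4).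
  { apply HN; [lia|]. now exists x. }
  specialize (Hd x). lra.
Qed.

End Compact.

(** * Transfer to the three operator spaces *)

Section Transfer.

Variables (p : R) (Hp : 1 < p).

Notation U := (lp_NormedModule p Hp).
Notation J := (matrix_op p Hp).

Variables (L Q : bounded_op U U) (S : bounded_op l1_NormedModule l1_NormedModule) (x0 : l1).
Hypothesis HJS : forall c : l1, J (S c) = conj_op L Q (J c).
Hypothesis Hx : forall d eps, 0 < eps ->
  linearly_recurrent (fun n => norm (minus (Nat.iter n S x0) d) < eps).

Lemma conj_op_factor : 0 < op_norm L * op_norm Q + 1.
Proof. generalize (Rmult_le_pos _ _ (op_norm_ge0 _ _ L) (op_norm_ge0 _ _ Q)). lra. Qed.

Lemma conj_op_fhc_nuclear : frequently_hypercyclic (nuclear_ops U) (conj_op L Q).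
Proof.
  assert (HA := conj_op_factor).
  apply (comparison_principle (op_ModuleSpace U U) (nuclear_ops U) (conj_op L Q) J S x0).
  - apply (continuous_linear_on_of_base (op_ModuleSpace U U)).
    + intros T [f [y [s HT]]]. apply repr_nuclear_le in HT.
      exact (nuclear_le_is_nuclear U _ _ (nuclear_le_conj U L Q T s HT)).
    + intros T T'. apply nuclear_minus.
    + apply conj_op_plus.
    + apply conj_op_scal.
    + intros W [eps ->].
      assert (Heps := cond_pos eps).
      assert (He : 0 < eps / (op_norm L * op_norm Q + 1)) by (apply Rdiv_lt_0_compat; lra).
      exists (fun T => nuclear_norm T < eps / (op_norm L * op_norm Q + 1)).
      split; [now exists (mkposreal _ He)|]. intros T HT HTn.
      destruct (nuclear_norm_lt U T _ HT HTn) as [s [Hs HTs]].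
      assert (H1 := nuclear_norm_le U _ _ (nuclear_le_conj U L Q T s HTs)).
      eapply Rle_lt_trans; [exact H1|].
      assert (Hs0 : 0 <= s) by (destruct HTs as [f [y [Hs0 _]]]; exact (Hs0 O)).
      apply Rle_lt_trans with ((op_norm L * op_norm Q + 1) * s).
      * apply Rmult_le_compat_r; lra.
      * apply Rlt_le_trans with ((op_norm L * op_norm Q + 1) * (eps / (op_norm L * op_norm Q + 1))).
        -- now apply Rmult_lt_compat_l.
        -- right. field. lra.
  - intros c. exact (nuclear_le_is_nuclear U _ _ (matrix_op_nuclear p Hp c)).
  - exact HJS.
  - exact Hx.
  - intros T W HT [eps ->]. exact (matrix_op_nuclear_dense p Hp T HT eps (cond_pos eps)).
Qed.

Lemma conj_op_small T e : op_norm T <= e / (op_norm L * op_norm Q + 1) -> 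
  op_norm (conj_op L Q T) <= e.
Proof.
  intros H. assert (HA := conj_op_factor).
  eapply Rle_trans; [apply conj_op_norm|].
  assert (HT := op_norm_ge0 _ _ T).
  apply Rle_trans with ((op_norm L * op_norm Q + 1) * (e / (op_norm L * op_norm Q + 1)));
    [|right; field; lra].
  replace (op_norm L * op_norm T * op_norm Q) with (op_norm L * op_norm Q * op_norm T) by ring.
  apply Rle_trans with ((op_norm L * op_norm Q + 1) * op_norm T).
  - apply Rmult_le_compat_r; lra.
  - apply Rmult_le_compat_l; lra.
Qed.

(** [T] is a limit of operators [J d], which [conj_op L Q] maps to the compact operators
    [J (S d)]. *)
Lemma conj_op_compact T : is_compact_op T -> is_compact_op (conj_op L Q T).
Proof.
  intros HT. assert (HA := conj_op_factor).
  apply vanishing_tails_compact, vanishing_tails_limit. intros eps Heps.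
  destruct (matrix_op_compact_dense p Hp T HT (eps / (op_norm L * op_norm Q + 1)))
    as [d [eta [Heta Hd]]]; [apply Rdiv_lt_0_compat; lra|].
  exists (conj_op L Q (J d)). split.
  - rewrite <- HJS. apply compact_vanishing_tails, matrix_op_compact.
  - rewrite <- conj_op_minus. apply conj_op_small. left. apply Hd.
    rewrite (minus_eq_zero (G := l1_NormedModule)).
    eapply Rle_lt_trans; [right; apply (norm_zero (V := l1_NormedModule)) | exact Heta].
Qed.

Lemma conj_op_fhc_compact : frequently_hypercyclic (compact_ops U) (conj_op L Q).
Proof.
  assert (HA := conj_op_factor).
  apply (comparison_principle (op_ModuleSpace U U) (compact_ops U) (conj_op L Q) J S x0).
  - apply (continuous_linear_on_of_base (op_ModuleSpace U U)).
    + apply conj_op_compact.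
    + apply compact_minus.
    + apply conj_op_plus.
    + apply conj_op_scal.
    + intros W [eps ->].
      assert (Heps := cond_pos eps).
      assert (He : 0 < eps / 2 / (op_norm L * op_norm Q + 1)) by (apply Rdiv_lt_0_compat; lra).
      exists (fun T => op_norm T < eps / 2 / (op_norm L * op_norm Q + 1)).
      split; [now exists (mkposreal _ He)|]. intros T _ HTn.
      apply Rle_lt_trans with (eps / 2); [|lra]. apply conj_op_small. now left.
  - apply matrix_op_compact.
  - exact HJS.
  - exact Hx.
  - intros T W HT [eps ->]. exact (matrix_op_compact_dense p Hp T HT eps (cond_pos eps)).
Qed.

Lemma conj_op_fhc_COT : frequently_hypercyclic (bounded_ops_COT U) (conj_op L Q).
Proof.
  apply (comparison_principle (op_ModuleSpace U U) (bounded_ops_COT U) (conj_op L Q) J S x0).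
  - apply (continuous_linear_on_of_base (op_ModuleSpace U U)).
    + intros T _. exact I.
    + intros T T' _ _. exact I.
    + apply conj_op_plus.
    + apply conj_op_scal.
    + intros W [K [eps [HK ->]]].
      assert (Heps := cond_pos eps). assert (HL := op_norm_ge0 _ _ L).
      assert (He : 0 < eps / (op_norm L + 1)) by (apply Rdiv_lt_0_compat; lra).
      exists (fun T : bounded_op U U =>
        forall y, (exists x, K x /\ y = Q x) -> norm (T y) < eps / (op_norm L + 1)).
      split.
      * exists (fun y => exists x, K x /\ y = Q x), (mkposreal _ He).
        split; [now apply compact_image | reflexivity].
      * intros T _ HT x HKx. change (norm (L (T (Q x))) < eps).
        eapply Rle_lt_trans; [apply op_norm_bound|].
        apply Rle_lt_trans with ((op_norm L + 1) * norm (T (Q x))).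
        -- apply Rmult_le_compat_r; [apply norm_ge_0 | lra].
        -- apply Rlt_le_trans with ((op_norm L + 1) * (eps / (op_norm L + 1))).
           ++ apply Rmult_lt_compat_l; [lra|]. apply HT. now exists x.
           ++ right. field. lra.
  - intros c. exact I.
  - exact HJS.
  - exact Hx.
  - intros T W _ [K [eps [HK ->]]]. exact (matrix_op_COT_dense p Hp T K eps HK (cond_pos eps)).
Qed.

End Transfer.

(** * The functional calculus of an analytic function *)

(** The coefficients of [f] are unique, so the sum that defines [fun_of_op] is the one
    that converges. *)
Lemma fun_of_op_fcalc (U : NormedModule C_AbsRing) (HU : abs_complete U) (f : C -> C)
    (a : nat -> C) A rho (T : bounded_op U U) :
  geom_bounded_C a A rho -> rho < 1 -> (forall z, Cmod z <= 1 -> f z = ksum_C a z) ->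
  op_norm T <= 1 -> fun_of_op f T = fcalc a T.
Proof.
  intros Ha Hr Hf HT.
  assert (Hfa : forall z, Cmod z < 1 ->
    is_series (V := C_NormedModule) (fun i => (z ^ i)%C *: a i) (f z)).
  { intros z Hz. rewrite Hf by lra. apply (ksum_C_correct a A rho z Ha).
    destruct (Rle_lt_dec 0 rho) as [H|H]; generalize (Cmod_ge_0 z); intros Hz0.
    - apply Rle_lt_trans with (1 * rho); [|lra].
      rewrite Rmult_comm. apply Rmult_le_compat_r; lra.
    - apply Rle_lt_trans with (0 * Cmod z); [|lra]. apply Rmult_le_compat_r; lra. }
  assert (Hcalc := fcalc_correct U HU a A rho T Ha Hr HT).
  unfold fun_of_op. set (P := fun S : bounded_op U U => exists b : nat -> C, _).
  destruct (epsilon_spec (inhabits zero) P) as [b [Hb HbS]].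
  { exists (fcalc a T), a. split; [|exact Hcalc].
    intros z Hz. apply is_pseries_C. now apply Hfa. }
  assert (Hbs : forall z, Cmod z < 1 ->
    is_series (V := C_NormedModule) (fun i => (z ^ i)%C *: b i) (f z)).
  { intros z Hz. now apply is_pseries_C, Hb. }
  destruct (geom_bounded_of_series b (/ 2) (f (RtoC (/ 2)))) as [B HB]; [lra | |].
  { apply Hbs. rewrite Cmod_R, Rabs_pos_eq; lra. }
  refine (is_series_unique_C _ _ _ HbS _).
  refine (is_series_eq _ _ _ _ Hcalc _ eq_refl). intros n.
  now rewrite (coefs_unique a b A B rho (/ / 2) 1 f Rlt_0_1 Ha HB Hfa Hbs n).
Qed.

Lemma nonconstant_coefs (f : C -> C) (a : nat -> C) A rho :
  geom_bounded_C a A rho -> rho < 1 -> (forall z, Cmod z <= 1 -> f z = ksum_C a z) ->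
  (exists z w, Cmod z <= 1 /\ Cmod w <= 1 /\ f z <> f w) -> nonconstant a.
Proof.
  intros Ha Hr Hf [z [w [Hz [Hw Hne]]]]. apply NNPP. intros Hno. apply Hne.
  assert (H0 : forall i, (1 <= i)%nat -> a i = RtoC 0).
  { intros i Hi. apply NNPP. intros Hai. apply Hno. now exists i. }
  assert (Hc : forall u, Cmod u <= 1 -> f u = a O).
  { intros u Hu. rewrite Hf by exact Hu. unfold ksum. apply vsum_unique.
    refine (is_series_eq _ _ _ _ (is_series_finite C_NormedModule
      (fun i => (u ^ i)%C *: a i) 1 _) (fun _ => eq_refl) _).
    - intros k Hk. rewrite (H0 k Hk). apply Cmult_0_r.
    - change (Cplus (RtoC 0) (Cmult (RtoC 1) (a O)) = a O). ring. }
  now rewrite (Hc z Hz), (Hc w Hw).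
Qed.

Theorem theorem5p9 (p : R) (Hp : 1 < p) (phi psi : C -> C)
  (phi_analytic : analytic_near_closed_disc phi)
  (psi_analytic : analytic_near_closed_disc psi)
  (phi_nonzero : exists z : C, Cmod z <= 1 /\ phi z <> RtoC 0)
  (psi_nonzero : exists z : C, Cmod z <= 1 /\ psi z <> RtoC 0)
  (Hunimodular : exists z w : C,
     Cmod z < 1 /\ Cmod w < 1 /\ Cmod (Cmult (phi z) (psi w)) = 1)
  (Hnonconstant :
     (exists z w : C, Cmod z <= 1 /\ Cmod w <= 1 /\ phi z <> phi w) \/
     (exists z w : C, Cmod z <= 1 /\ Cmod w <= 1 /\ psi z <> psi w)) :
  let A := conj_op (fun_of_op phi (backward_shift p Hp))
                   (fun_of_op psi (forward_shift p Hp)) in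
  frequently_hypercyclic (nuclear_ops (lp_NormedModule p Hp)) A /\
  frequently_hypercyclic (compact_ops (lp_NormedModule p Hp)) A /\
  frequently_hypercyclic (bounded_ops_COT (lp_NormedModule p Hp)) A.
Proof.
  destruct (analytic_near_closed_disc_series phi phi_analytic) as [a [A1 [r1 [Hr1 [Ha1 Hphi]]]]].
  destruct (analytic_near_closed_disc_series psi psi_analytic) as [b [A2 [r2 [Hr2 [Hb2 Hpsi]]]]].
  set (rho := Rmax r1 r2).
  assert (Hrho : rho < 1) by (apply Rmax_lub_lt; tauto).
  assert (Ha := geom_bounded_weaken a A1 A1 r1 rho Ha1 (Rle_refl _) (Rmax_l _ _)).
  assert (Hb := geom_bounded_weaken b A2 A2 r2 rho Hb2 (Rle_refl _) (Rmax_r _ _)).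
  rewrite (fun_of_op_fcalc _ (lp_abs_complete p Hp) phi a A1 rho _ Ha Hrho Hphi
    (backward_norm p Hp)).
  rewrite (fun_of_op_fcalc _ (lp_abs_complete p Hp) psi b A2 rho _ Hb Hrho Hpsi
    (forward_norm p Hp)).
  destruct Hunimodular as [z [w [Hz [Hw H1]]]].
  rewrite (Hphi z), (Hpsi w) in H1 by now left.
  assert (Hnc : nonconstant a \/ nonconstant b).
  { destruct Hnonconstant as [H|H]; [left | right].
    - exact (nonconstant_coefs phi a A1 rho Ha Hrho Hphi H).
    - exact (nonconstant_coefs psi b A2 rho Hb Hrho Hpsi H). }
  destruct (double_shift_visits a b A1 A2 rho z w Hrho Ha Hb Hz Hw H1 Hnc) as [x Hx].
  assert (HJ := fun c : l1 => matrix_op_double_shift p Hp a b A1 A2 rho c Hrho Ha Hb).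
  intros A. split; [|split].
  - exact (conj_op_fhc_nuclear p Hp _ _ _ x HJ Hx).
  - exact (conj_op_fhc_compact p Hp _ _ _ x HJ Hx).
  - exact (conj_op_fhc_COT p Hp _ _ _ x HJ Hx).
Qed.
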